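(* Let $d\in\mathbb{N}$ and let $\nu$ be the uniform distribution on $B^d$. Let $(X_n)_{n\in\mathbb{N}}$ be a Markov chain with transition kernel $\widetilde{H}$ and initial distribution $\nu$. The approximation of $S(f,A)$ is $$S_{n,n_0}^{\mathrm{har}}(f,A) = \frac{1}{n} \sum_{i=1}^n f(X_{i+n_0}).$$ For $r\geq1$ and $p\in(2,\infty]$ let $\mathcal{F}_p(r,d)=\{ (f,A)\mid \|f\|_{p}\leq 1,\ A\in \mathcal{S}_d(r)\}$. Let $n_0(p)$ be the smallest natural number (including zero) greater than or equal to $$4.51\cdot 10^{15}\, d^2\, r^2 \cdot \begin{cases} \frac{p}{2(p-2)} \left( d \log r +\log\frac{32p}{p-2}\right) , & p\in(2,4),\\ d \log r+ 4.16, & p\in[4,\infty]. \end{cases}$$ Then for all $n\in\mathbb{N}$ $$e(S_{n,n_0(p)}^{\mathrm{har}},\mathcal{F}_p(r,d)) \leq 9.5 \cdot 10^{7}\, \frac{ d r}{\sqrt{n}}+ 6.4 \cdot 10^{15} \,\frac{d^2\, r^2}{n}.$$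
   Context: $B^d$ is the closed Euclidean unit ball of $\mathbb{R}^d$, $rB^d$ the ball of radius $r$ around $0$, $\partial B^d$ the unit sphere, $\mathrm{vol}_d$ Lebesgue measure. $\mathcal{S}_d(r)=\{A\subset\mathbb{R}^d\text{ convex}\mid B^d\subset A\subset rB^d\}$. $\mu_A$ is the uniform distribution on $A$, $S(f,A)=\frac1{\mathrm{vol}_d(A)}\int_Af(x)\,dx$, and $\|f\|_p$ is the norm of $L_p(A,\mu_A)$. Hit-and-run kernel $H$ on $A$: from $x\in A$, choose a direction $\theta$ uniformly distributed on $\partial B^d$ and then choose the next state uniformly distributed on the chord $A\cap\{x+t\theta\mid t\in\mathbb{R}\}$; $H(x,\cdot)$ is the law of the next state. Its lazy version is $\widetilde H(x,C)=\frac12(\mathbf 1_C(x)+H(x,C))$. A Markov chain with kernel $\widetilde H$ and initial distribution $\nu$ has $X_1\sim\nu$ and $\Pr(X_{n+1}\in C\mid X_1,\dots,X_n)=\widetilde H(X_n,C)$. The error is $e(S^{\mathrm{har}}_{n,n_0},(f,A))=(\mathbf E|S^{\mathrm{har}}_{n,n_0}(f,A)-S(f,A)|^2)^{1/2}$ and $e(S^{\mathrm{har}}_{n,n_0},\mathcal F)=\sup_{(f,A)\in\mathcal F}e(S^{\mathrm{har}}_{n,n_0},(f,A))$, where for each $(f,A)$ the hit-and-run chain on $A$ is used. For $p=\infty$ read $\frac p{p-2}=1$. *)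

(* Defs.v *)
From HB Require Import structures.
From mathcomp Require Import all_boot all_order all_algebra.
From mathcomp Require Import all_classical all_reals all_analysis.
From mathcomp Require Import measurable_realfun.

Set Implicit Arguments.
Unset Strict Implicit.
Unset Printing Implicit Defensive.

Import Order.TTheory GRing.Theory Num.Theory.
Import numFieldNormedType.Exports.

Local Open Scope classical_set_scope.
Local Open Scope ring_scope.

(* Row vectors carry the sigma-algebra generated by the coordinates, i.e. the
   product sigma-algebra, which on R^n is the Borel one. *)
Section row_measurable.
Context {R : realType} (n : nat).

Definition row_coord (i : 'I_n) (x : 'rV[R]_n) : R := x 0 i.

Let row_measurable : set (set 'rV[R]_n) := g_sigma_preimage row_coord.

Let row_set0 : row_measurable set0.
Proof. exact: sigma_algebra0. Qed.

Let row_setC A : row_measurable A -> row_measurable (~` A).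
Proof. exact: sigma_algebraC. Qed.

Let row_bigcup (F : (set 'rV[R]_n)^nat) :
  (forall i, row_measurable (F i)) -> row_measurable (\bigcup_i (F i)).
Proof. exact: sigma_algebra_bigcup. Qed.

HB.instance Definition _ := @isMeasurable.Build default_measure_display
  'rV[R]_n row_measurable row_set0 row_setC row_bigcup.

Lemma measurable_row_coord (i : 'I_n) :
  measurable_fun [set: 'rV[R]_n] (fun x : 'rV[R]_n => x 0 i).
Proof.
move=> _ Y mY; rewrite setTI; apply: sub_sigma_algebra => /=.
rewrite -bigcup_seq/=; exists i => /=; first by rewrite mem_index_enum.
by exists Y => //; rewrite setTI.
Qed.

Lemma measurable_fun_row d (T : measurableType d) (f : T -> 'rV[R]_n) :
  (forall i, measurable_fun [set: T] (fun t => f t 0 i)) ->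
  measurable_fun [set: T] f.
Proof.
move=> mf; apply: (@measurability _ _ _ _ _ _
  (\big[setU/set0]_(i < n) preimage_set_system setT (row_coord i) measurable)).
  by [].
move=> _ [B + <-]; rewrite -bigcup_seq/= => -[i _ [C mC <-]].
by have := mf i measurableT C mC; rewrite !setTI.
Qed.

End row_measurable.

Section lebesgue_row.
Context {R : realType}.

Definition row_cons n (xv : R * 'rV[R]_n) : 'rV[R]_n.+1 :=
  \row_i if unlift ord0 i is Some j then xv.2 0 j else xv.1.

Lemma measurable_row_cons n : measurable_fun [set: R * 'rV[R]_n] (@row_cons n).
Proof.
apply: measurable_fun_row => i.
rewrite (_ : (fun _ => _) = fun xv : R * 'rV[R]_n =>
  if unlift ord0 i is Some j then xv.2 0 j else xv.1); last first.
  by apply/funext => xv; rewrite mxE.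
case: (unlift ord0 i) => [j|]; last exact: measurable_fst.
exact: (measurableT_comp (measurable_row_coord j) measurable_snd).
Qed.

Section step.
Variables (n : nat) (mu : {sigma_finite_measure set 'rV[R]_n -> \bar R}).

Definition lebesgue_row_step (A : set 'rV[R]_n.+1) : \bar R :=
  (@lebesgue_measure R \x mu)%E (@row_cons n @^-1` A).

Let step0 : lebesgue_row_step set0 = 0%E.
Proof. by rewrite /lebesgue_row_step preimage_set0 measure0. Qed.

Let step_ge0 A : (0 <= lebesgue_row_step A)%E.
Proof. exact: measure_ge0. Qed.

Let mpre A : measurable A -> measurable (@row_cons n @^-1` A).
Proof. by move=> mA; rewrite -[_ @^-1` _]setTI; exact: measurable_row_cons. Qed.

Let step_sigma_additive : semi_sigma_additive lebesgue_row_step.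
Proof.
move=> F mF tF mUF; rewrite /lebesgue_row_step preimage_bigcup.
apply: measure_semi_sigma_additive.
- by move=> i; exact: mpre.
- apply/trivIsetP => /= i j _ _ ij; rewrite -preimage_setI.
  by move/trivIsetP : tF => /(_ _ _ _ _ ij) ->//; rewrite preimage_set0.
- by rewrite -preimage_bigcup; exact: mpre.
Qed.

HB.instance Definition _ := isMeasure.Build _ _ _ lebesgue_row_step
  step0 step_ge0 step_sigma_additive.

Definition row_uncons (x : 'rV[R]_n.+1) : R * 'rV[R]_n :=
  (x 0 ord0, \row_j x 0 (lift ord0 j)).

Lemma measurable_row_uncons : measurable_fun [set: 'rV[R]_n.+1] row_uncons.
Proof.
apply: measurable_fun_pair; first exact: measurable_row_coord.
apply: measurable_fun_row => i.
rewrite (_ : (fun _ => _) = fun x : 'rV[R]_n.+1 => x 0 (lift ord0 i)).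
  exact: measurable_row_coord.
by apply/funext => x; rewrite mxE.
Qed.

Lemma row_consK : cancel (@row_cons n) row_uncons.
Proof.
case=> x v; rewrite /row_uncons !mxE unlift_none; congr pair.
by apply/rowP => j; rewrite !mxE liftK.
Qed.

Let step_sigma_finite : sigma_finite setT lebesgue_row_step.
Proof.
have /sigma_finiteP[F [TF ndF Foo]] := sigma_finiteT (@lebesgue_measure R).
have /sigma_finiteP[G [TG ndG Goo]] := sigma_finiteT mu.
exists (fun i => row_uncons @^-1` (F i `*` G i)).
  rewrite -preimage_bigcup (_ : \bigcup_i _ = setT) ?preimage_setT//.
  apply/seteqP; split => // -[x v] _.
  have [k _ Fx] : (\bigcup_k F k) x by rewrite -TF.
  have [l _ Gv] : (\bigcup_l G l) v by rewrite -TG.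
  exists (maxn k l) => //; split => /=.
  - by move: x Fx; exact/subsetPset/ndF/leq_maxl.
  - by move: v Gv; exact/subsetPset/ndG/leq_maxr.
move=> i; have [mF Fi] := Foo i; have [mG Gi] := Goo i; split.
  rewrite -[_ @^-1` _]setTI; apply: measurable_row_uncons => //.
  exact: measurableX.
rewrite /lebesgue_row_step -comp_preimage.
rewrite (_ : row_uncons \o _ = id); last by apply/funext => x; exact: row_consK.
by rewrite preimage_id product_measure1E// lte_mul_pinfty// ge0_fin_numE.
Qed.

HB.instance Definition _ := Measure_isSigmaFinite.Build _ _ _
  lebesgue_row_step step_sigma_finite.

End step.

(* Lebesgue measure on the Borel sets of R^n: the n-fold product of the
   one-dimensional Lebesgue measure (R^0 being a point of mass 1). *)
Fixpoint vol n : {sigma_finite_measure set 'rV[R]_n -> \bar R} :=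
  if n is m.+1 then lebesgue_row_step (vol m) else \d_(0 : 'rV[R]_0).

End lebesgue_row.

(* The restriction of mu to a set D that need not be measurable: on measurable
   sets C, C |-> mu^*(C `&` D) is a measure for every D. A convex set in R^n is
   Lebesgue measurable but not always Borel. *)
Section mtrace.
Local Open Scope measure_scope.
Context d (T : measurableType d) (R : realType).
Variables (mu : {measure set T -> \bar R}) (D : set T).

Definition mtrace (C : set T) : \bar R := mu^* (C `&` D).

Lemma mtraceE C : measurable C -> measurable D -> mtrace C = mu (C `&` D).
Proof. by move=> mC mD; rewrite /mtrace measurable_mu_extE//; exact: measurableI. Qed.

Let mtrace0 : mtrace set0 = 0%E.
Proof. by rewrite /mtrace set0I outer_measure0. Qed.

Let mtrace_ge0 C : (0 <= mtrace C)%E.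
Proof. exact: outer_measure_ge0. Qed.

Let mtrace_sigma_additive : semi_sigma_additive mtrace.
Proof.
move=> F mF tF mUF.
have cF i : (mu^*).-caratheodory (F i).
  by apply: sub_caratheodory; exact: sub_sigma_algebra.
suff -> : mtrace (\bigcup_n F n) = (\sum_(k <oo) mtrace (F k))%E.
  exact/is_cvg_nneseries.
apply/eqP; rewrite eq_le; apply/andP; split.
  rewrite /mtrace setI_bigcupl.
  exact: outer_measure_sigma_subadditive.
have := caratheodory_lime_le cF tF (\bigcup_n F n `&` D).
apply: le_trans; rewrite -[leLHS]adde0 leeD//.
apply: lee_nneseries => // i _; rewrite /mtrace le_outer_measure//.
by move=> x [Fx Dx]; split => //; split => //; exists i.
Qed.

HB.instance Definition _ := isMeasure.Build _ _ _ mtrace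
  mtrace0 mtrace_ge0 mtrace_sigma_additive.

End mtrace.

(* Normalization of mu restricted to D; by convention it is the point mass at
   x0 if mu D is 0 (or infinite). *)
Definition uniform d (T : measurableType d) (R : realType)
    (mu : {measure set T -> \bar R}) (x0 : T) (D : set T) : probability T R :=
  mnormalize (mtrace mu D) \d_x0.

Section hit_and_run.
Context {R : realType} (d : nat).

Definition enorm (x : 'rV[R]_d) : R := Num.sqrt (\sum_i x 0 i ^+ 2).

Definition eball (r : R) : set 'rV[R]_d := [set x | enorm x <= r].

Definition direction (x : 'rV[R]_d) : 'rV[R]_d := (enorm x)^-1 *: x.

Lemma measurable_enorm : measurable_fun [set: 'rV[R]_d] enorm.
Proof.
apply: (@measurableT_comp _ _ _ _ _ _ (@Num.sqrt R)).
  exact: (continuous_measurable_fun (@sqrt_continuous R)).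
apply: measurable_sum => i; apply: measurable_funX.
exact: measurable_row_coord.
Qed.

Lemma measurable_direction : measurable_fun [set: 'rV[R]_d] direction.
Proof.
apply: measurable_fun_row => i.
rewrite (_ : (fun _ => _) = (fun x => enorm x `^ (-1) * x 0 i)); last first.
  by apply/funext => x; rewrite mxE powR_inv1// sqrtr_ge0.
apply: measurable_funM; last exact: measurable_row_coord.
exact: (measurableT_comp (measurable_powR _) measurable_enorm).
Qed.

HB.instance Definition _ := isMeasurableFun.Build _ _ _ _ direction
  measurable_direction.

(* The uniform distribution (normalized surface measure) of the unit sphere as
   cone measure: the law of x / |x| for x uniform on the unit ball. *)
Definition sphere_uniform : probability 'rV[R]_d R :=
  distribution (uniform (vol d) 0 (eball 1)) direction.

(* The chord through x in direction th is parametrized by arc length t; if it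
   reduces to {x}, the next state is x. *)
Definition har_kernel (A : set 'rV[R]_d) (x : 'rV[R]_d) (C : set 'rV[R]_d) :
    \bar R :=
  (\int[sphere_uniform]_th
     uniform (@lebesgue_measure R) (0 : R)%R [set t : R | A (x + t *: th)%R]
       [set t : R | C (x + t *: th)%R])%E.

Definition lazy_har_kernel (A : set 'rV[R]_d) (x : 'rV[R]_d)
    (C : set 'rV[R]_d) : \bar R :=
  (2^-1%:E * ((\1_C x)%:E + har_kernel A x C))%E.

(* The chain is X 1, X 2, ... (X 0 plays no role) and its state space is A.
   The last clause is P(X_(n+1) \in C | X_1, ..., X_n) = lazy_har_kernel A X_n C
   written out on the events F of the sigma-algebra generated by X_1, ..., X_n. *)
Definition lazy_har_chain (A : set 'rV[R]_d) (nu : probability 'rV[R]_d R)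
    dO (Om : measurableType dO) (P : probability Om R)
    (X : nat -> {RV P >-> 'rV[R]_d}) : Prop :=
  [/\ forall n w, (0 < n)%N -> A (X n w),
      forall C, measurable C -> P (X 1%N @^-1` C) = nu C
    & forall n (F : set Om) (C : set 'rV[R]_d), (0 < n)%N ->
        g_sigma_preimage (fun (i : 'I_n) (w : Om) => X i.+1 w) F ->
        measurable C ->
        P (F `&` X n.+1 @^-1` C) =
        (\int[P]_(w in F) lazy_har_kernel A (X n w) C)%E].

Definition bodies (r : R) : set (set 'rV[R]_d) :=
  [set A | [/\ @convex_set R 'rV[R]_d A, eball 1 `<=` A & A `<=` eball r]].

Definition integrands (p : \bar R) (r : R) :
    set (('rV[R]_d -> R) * set 'rV[R]_d) :=
  [set fA | [/\ measurable_fun setT fA.1, bodies r fA.2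
    & ('N[uniform (vol d) 0%R fA.2]_p[EFin \o fA.1] <= 1)%E]].

Definition mean (f : 'rV[R]_d -> R) (A : set 'rV[R]_d) : R :=
  (fine (mu_ext (vol d) A))^-1 * Rintegral (mtrace (vol d) A) setT f.

Definition har_mean (n n0 : nat) (f : 'rV[R]_d -> R) (Om : Type)
    (X : nat -> Om -> 'rV[R]_d) (w : Om) : R :=
  n%:R^-1 * \sum_(1 <= i < n.+1) f (X (i + n0)%N w).

Definition har_error dO (Om : measurableType dO) (P : probability Om R)
    (X : nat -> Om -> 'rV[R]_d) (n n0 : nat) (f : 'rV[R]_d -> R)
    (A : set 'rV[R]_d) : \bar R :=
  ('E_P[(fun w => `|har_mean n n0 f X w - mean f A| ^+ 2)%R] `^ 2^-1)%E.

Definition burn_in_bound (p : \bar R) (r : R) : R :=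
  451 / 100 * 10 ^+ 15 * d%:R ^+ 2 * r ^+ 2 *
  if (p < 4%:E)%E then
    let q := fine p in
    q / (2 * (q - 2)) * (d%:R * ln r + ln (32 * q / (q - 2)))
  else d%:R * ln r + 416 / 100.

(* The smallest natural number that is at least burn_in_bound p r, which is
   nonnegative for 1 <= r and 2 < p. *)
Definition burn_in (p : \bar R) (r : R) : nat :=
  `|Num.ceil (burn_in_bound p r)|%N.

End hit_and_run.

(* Main.v *)
(** A body between the unit ball and the ball of radius [r] satisfies a
    Cheeger-type Poincare inequality for concave weights, by Brunn-Minkowski.
    Smoothing a function at the scale [s x] to which the body is still visible
    from most directions at [x] reduces the variance to the energy of averages
    along chords, which is the Dirichlet form of hit-and-run.  This yields a
    spectral gap of order [(d r)^-2] for the lazy reversible chain.  The error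
    splits into the stationary variance, bounded by summing the geometric decay
    of the covariances, and the cost of the warm start, whose density is at most
    [r^d]: Young's inequality trades this density against the [p]-th moment of
    [f], and the burn-in [n0] makes the trade cheap.  Unbounded [f] are
    truncated, and Fatou's lemma removes the truncation. *)
Require Import Defs.
From HB Require Import structures.
From mathcomp Require Import all_boot all_order all_algebra.
From mathcomp Require Import all_classical all_reals all_analysis.
From mathcomp Require Import measurable_realfun.
From mathcomp Require Import perm.
From mathcomp Require Import ring lra zify.

Set Implicit Arguments.
Unset Strict Implicit.
Unset Printing Implicit Defensive.

Import Order.TTheory GRing.Theory Num.Theory.
Import numFieldNormedType.Exports.

Local Open Scope classical_set_scope.
Local Open Scope ring_scope.

(** Averages at one fixed scale fail near corners and thin ends, while the gradient of an average at
    scale [s x] grows like 1 / [s x]. Both difficulties are met by using [s] itself as the concave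
    weight of the Poincare inequality: in the product of weight and gradient the scale cancels, and
    the local oscillation of f remains. The gap (n r)^-2 collects three losses: r^2 from the squared
    diameter, n from the mean of [s], which is bounded below by a multiple of n^(-1/2), and n from
    the squared Hellinger distance of neighbouring smoothing densities. In the constants, 14 * 10^12
    comes from smoothing, 14 from the passage to chords and 2 from the Dirichlet form, so G = 392 *
    10^12 (n r)^2; then 9 G / 2 is the square of 42 * 10^6 n r. A convex body need not be a Borel
    set, so the analysis takes place on its Euclidean interior, where the chain stays almost surely.
    Operators act on bounded measurable functions, on which expectations are positive normalized
    functionals. *)

Notation mfunT := (measurable_fun setT).

Lemma eqW d (T : porderType d) (x y : T) : x = y -> (x <= y)%O.
Proof. by move=> ->. Qed.

Lemma bernoulli_le (R : realFieldType) (x : R) n : 0 <= x <= 1 -> 1 - n%:R * x <= (1 - x) ^+ n.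
Proof.
move=> /andP[x0 x1]; elim: n => [|n IH]; first by rewrite mul0r subr0 expr0.
have y0 : 0 <= 1 - x by rewrite subr_ge0.
rewrite exprS; apply: le_trans (ler_wpM2l y0 IH); rewrite -(natr1 n).
have := mulr_ge0 (ler0n R n) (sqr_ge0 x); lra.
Qed.

(** * Measurability of row-valued maps *)

Section row_measurability.
Context {R : realType} (n : nat) d (T : measurableType d).
Implicit Types f g : T -> 'rV[R]_n.

Lemma measurable_rowD f g : mfunT f -> mfunT g ->
  mfunT (fun t => f t + g t).
Proof.
move=> mf mg; apply: measurable_fun_row => i.
rewrite (_ : (fun _ => _) = (fun t => f t 0 i + g t 0 i)); last first.
  by apply/funext => t; rewrite mxE.
by apply: measurable_funD; exact: (measurableT_comp (measurable_row_coord i)).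
Qed.

Lemma measurable_rowZ (h : T -> R) f : mfunT h ->
  mfunT f -> mfunT (fun t => h t *: f t).
Proof.
move=> mh mf; apply: measurable_fun_row => i.
rewrite (_ : (fun _ => _) = (fun t => h t * f t 0 i)); last first.
  by apply/funext => t; rewrite mxE.
apply: measurable_funM => //.
exact: (measurableT_comp (measurable_row_coord i)).
Qed.

Lemma measurable_rowN f : mfunT f -> mfunT (fun t => - f t).
Proof.
move=> mf; rewrite (_ : (fun _ => _) = (fun t => (-1) *: f t)).
  by apply: measurable_rowZ => //; exact: measurable_cst.
by apply/funext => t; rewrite scaleN1r.
Qed.

End row_measurability.

Lemma measurable_inv_ge0 d (T : measurableType d) (R : realType) (f : T -> R) :
  mfunT f -> (forall x, 0 <= f x) ->
  mfunT (fun x => (f x)^-1).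
Proof.
move=> mf f0; rewrite (_ : (fun _ => _) = (fun x => f x `^ (-1))); last first.
  by apply/funext => x; rewrite powR_inv1.
exact: (measurableT_comp (measurable_powR _) mf).
Qed.

(* Extended below by the measurable functions introduced later. *)
Ltac measurable_atom f := fail.

(** Syntactic recursion on the body of the function, with atoms looked up among the hypotheses.
    Repeated patterns rely on backtracking: the scalar rule is tried and, when it does not apply,
    the rule for row vectors. *)
Ltac meas :=
  lazymatch goal with
  | |- measurable_fun _ ?f =>
    first
    [ match goal with H : measurable_fun _ ?g |- _ => constr_eq f g; exact H end
    | match f with
      | fun z => z => exact: measurable_id
      | fun _ => ?c => exact: measurable_cst
      | fst => exact: measurable_fst
      | snd => exact: measurable_snd
      | \1_(_) => apply: measurable_indic; first [assumption | exact: measurable_itv]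
      | Num.norm => exact: normr_measurable
      | fun z => `|z| => exact: normr_measurable
      | fun z => fst z => exact: measurable_fst
      | fun z => snd z => exact: measurable_snd
      | fun _ => EFin _ => apply/measurable_EFinP; meas
      | fun _ => (_, _) => apply: measurable_fun_pair; meas
      | fun _ => (_ + _)%E => apply: emeasurable_funD; meas
      | fun _ => (EFin _ * _)%E => apply: measurable_funeM; meas
      | fun _ => - _ => apply: measurable_funN; meas
      | fun _ => - _ => apply: measurable_rowN; meas
      | fun _ => _ - _ => apply: measurable_funB; meas
      | fun _ => _ + _ => apply: measurable_funD; meas
      | fun _ => _ + _ => apply: measurable_rowD; meas
      | fun _ => _ *: _ => apply: measurable_rowZ; meas
      | fun _ => _ * _ => apply: measurable_funM; meas
      | fun _ => _ ^+ _ => apply: measurable_funX; meas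
      | fun _ => _^-1 => apply: measurable_inv_ge0; meas
      | fun _ => `|_| => apply: (measurableT_comp (@normr_measurable _ setT)); meas
      | fun z => fst (@?g z) => apply: (measurableT_comp measurable_fst); meas
      | fun z => snd (@?g z) => apply: (measurableT_comp measurable_snd); meas
      | fun z => \1_(?U) (@?g z) =>
          match goal with
          | H : measurable U |- _ => apply: (measurableT_comp (measurable_indic _ H)); meas
          | H : measurable_fun _ (\1_U) |- _ => apply: (measurableT_comp H); meas
          end
      | fun z => ?g z => 
          match goal with H : measurable_fun _ ?h |- _ => constr_eq g h; exact H end
      | fun z => ?h (@?g z) =>
          match goal with H : measurable_fun _ ?h' |- _ =>
            constr_eq h h'; apply: (measurableT_comp H); meas end
      | fun z => ?h (@?a z) (@?b z) =>
          match goal with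
          | H : measurable_fun _ (fun y => ?h' y.1 y.2) |- _ =>
            constr_eq h h'; refine (measurableT_comp H (measurable_fun_pair (f := a) (g := b) _ _)); meas
          end
      end
    | measurable_atom f
    | let use h :=
        match goal with H : context [h] |- _ =>
          lazymatch type of H with
          | measurable_fun _ _ => exact: H
          | context [measurable_fun _ _] => apply: H; meas
          end
        end in
      match f with
      | fun z => ?h _ => use h
      | fun z => ?h _ _ => use h
      | ?h _ => use h
      | ?h => use h
      end ]
  | |- measurable _ => assumption
  | |- _ => by []
  end.

(** * Lebesgue measure on boxes *)

Section boxes.
Context {R : realType}.
Local Notation leb := (@lebesgue_measure R).

Definition pbox n (I : 'I_n -> set R) : set 'rV[R]_n :=
  [set x | forall i, I i (x 0 i)].

Lemma measurable_pbox n (I : 'I_n -> set R) :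
  (forall i, measurable (I i)) -> measurable (pbox I).
Proof.
move=> mI; rewrite (_ : pbox I =
    \bigcap_(i in [set: 'I_n]) ((fun x : 'rV[R]_n => x 0 i) @^-1` I i)).
  apply: fin_bigcap_measurable => // i _.
  by rewrite -[_ @^-1` _]setTI; exact: measurable_row_coord.
by apply/seteqP; split => x /= h i; [move=> _; exact: h|exact: h].
Qed.

Lemma vol_pbox n (I : 'I_n -> set R) : (forall i, measurable (I i)) ->
  vol n (pbox I) = (\prod_(i < n) leb (I i))%E.
Proof.
elim: n I => [|n IHn] I mI /=.
  by rewrite big_ord0 /dirac indicE mem_set// => -[].
rewrite big_ord_recl /lebesgue_row_step.
rewrite (_ : @row_cons R n @^-1` pbox I =
  I ord0 `*` pbox (fun i => I (lift ord0 i))).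
  rewrite product_measure1E; [|exact: mI|exact: measurable_pbox].
  by rewrite IHn.
apply/seteqP; split => -[a v] /=.
  move=> h; split => [|i /=]; first by have := h ord0; rewrite mxE unlift_none.
  by have := h (lift ord0 i); rewrite mxE liftK.
by move=> [h1 h2] i; rewrite mxE; case: unliftP => [j ->|->].
Qed.

(** Boxes with measurable sides are stable under intersection and generate the sigma-algebra, and
    the cubes [-k, k]^n have finite volume and exhaust the space. Changes of variables on rows can
    therefore be checked on boxes. *)
Lemma vol_unique n (m : {measure set 'rV[R]_n -> \bar R}) :
  (forall I : 'I_n -> set R, (forall i, measurable (I i)) ->
    m (pbox I) = (\prod_(i < n) leb (I i))%E) ->
  forall A, measurable A -> vol n A = m A.
Proof.
move=> mE A mA.
pose G := [set B : set 'rV[R]_n | exists2 I, (forall i, measurable (I i)) & B = pbox I].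
pose g (k : nat) : set 'rV[R]_n := pbox (fun _ => `[- k%:R, k%:R]%classic).
have mG : @measurable _ 'rV[R]_n = <<s G >>.
  rewrite eqEsubset; split; last first.
    apply: smallest_sub; first exact: sigma_algebra_measurable.
    by move=> _ [I mI ->]; exact: measurable_pbox.
  apply: smallest_sub; first exact: smallest_sigma_algebra.
  move=> X; rewrite -bigcup_seq/= => -[i _ [C mC <-]].
  apply: sub_sigma_algebra.
  exists (fun j => if j == i then C else setT).
    by move=> j; case: ifP.
  apply/seteqP; split => x /=.
    by move=> [_ h] j; case: ifPn => // /eqP ->.
  by move=> /(_ i); rewrite eqxx.
apply: (measure_unique G g _ _ _ _ (vol n) m) => //.
- move=> _ _ [I mI ->] [J mJ ->].
  exists (fun i => I i `&` J i); first by move=> i; exact: measurableI.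
  apply/seteqP; split => x /=; last by move=> h; split => i; have [] := h i.
  by move=> [h1 h2] i; split.
- by move=> k; exists (fun _ => `[- k%:R, k%:R]%classic).
- apply/seteqP; split => // x _.
  (* The sum over all coordinates plays the role of a maximum. *)
  exists (\sum_(i < n) (Num.trunc `|x 0%R i|%R).+1)%N => // i /=.
  have : `|x 0 i| <= (\sum_(i < n) (Num.trunc `|x 0%R i|%R).+1)%N%:R.
    apply: (@le_trans _ _ (Num.trunc `|x 0 i|).+1%:R).
      by apply/ltW/truncnS_gt.
    by rewrite ler_nat (bigD1 i)//= leq_addr.
  by rewrite ler_norml in_itv/=.
- by move=> _ [I mI ->]; exact: etrans (vol_pbox mI) (esym (mE I mI)).
- move=> k; suff : (vol n (g k) < +oo)%E by [].
  rewrite vol_pbox//; under eq_bigr do rewrite lebesgue_measure_itv/=.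
  by case: ifP => _; rewrite -?EFinB prodEFin ltry.
Qed.

End boxes.

Lemma ge0_integral_comp d1 d2 (X : measurableType d1) (Y : measurableType d2)
    (R : realType) (mu : {measure set X -> \bar R})
    (nu : {measure set Y -> \bar R}) (phi : X -> Y) (k : R) :
  mfunT phi -> 0 <= k ->
  (forall A, measurable A -> mu (phi @^-1` A) = (k%:E * nu A)%E) ->
  forall F : Y -> \bar R, mfunT F -> (forall y, 0 <= F y)%E ->
  (\int[mu]_x F (phi x) = k%:E * \int[nu]_y F y)%E.
Proof.
move=> mphi k0 muE F mF F0.
pose phiM : {mfun X >-> Y} := HB.pack phi (isMeasurableFun.Build _ _ _ _ _ mphi).
pose kk : {nonneg R} := NngNum k0.
rewrite -[k]/(kk%:num) -ge0_integral_mscale//.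
transitivity (\int[pushforward mu phiM]_y F y)%E.
  by rewrite ge0_integral_pushforward//= preimage_setT.
by apply: eq_measure_integral => A mA _; exact: muE.
Qed.

(** * Affine changes of variables *)

Section affine.
Context {R : realType}.
Local Notation leb := (@lebesgue_measure R).

Lemma measurable_affine (c e : R) :
  measurable_fun [set: R] (fun t : R => c * t + e).
Proof. by apply: measurable_funD => //; exact: measurable_funM. Qed.

(** |c| times the pushforward agrees with Lebesgue measure on the intervals ]a, b], which
    characterize it. For c < 0 the preimage of such an interval is closed on the left, hence the two
    cases. *)
Lemma lebesgue_measure_affine (c e : R) (A : set R) : c != 0 -> measurable A ->
  leb ((fun t => c * t + e) @^-1` A) = ((`|c|^-1)%:E * leb A)%E.
Proof.
move=> c0 mA.
pose f : R -> measurableTypeR R := fun t => c * t + e.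
have mf : measurable_fun [set: R] f := measurable_affine c e.
pose fM : {mfun R >-> measurableTypeR R} :=
  HB.pack f (isMeasurableFun.Build _ _ _ _ f mf).
pose k : {nonneg R} := NngNum (normr_ge0 c).
have H := @lebesgue_measure_unique R (mscale k (pushforward leb fM)).
have -> : leb ((fun t => c * t + e) @^-1` A) =
   ((`|c|^-1)%:E * mscale k (pushforward leb fM) A)%E.
  by rewrite /mscale/= /pushforward/= muleA -EFinM mulVf ?normr_eq0// mul1e.
rewrite -H// => X [[a b] _ <-]/=.
rewrite /mscale/= /pushforward/=.
have [cp|cn|cc] := ltgtP 0 c; last by rewrite -cc eqxx in c0.
- rewrite (_ : fM @^-1` _ = `](a - e) / c, (b - e) / c]%classic); last first.
    apply/seteqP; split => t /=; rewrite /f !in_itv/= ler_pdivlMr// ltr_pdivrMr//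
      mulrC ltrBlDr lerBrDr; by [].
  rewrite !lebesgue_measure_itv/= !lte_fin ltr_pM2r ?invr_gt0// ltrD2r.
  case: ifPn => ab; last by rewrite mule0.
  by rewrite -!EFinD -EFinM; congr EFin; rewrite gtr0_norm//; field.
- rewrite (_ : fM @^-1` _ = `[(b - e) / c, (a - e) / c[%classic); last first.
    apply/seteqP; split => t /=; rewrite /f !in_itv/= ler_ndivrMr// ltr_ndivlMr//
      mulrC ltrBlDr lerBrDr andbC; by [].
  rewrite !lebesgue_measure_itv/= !lte_fin ltr_nM2r ?invr_lt0// ltrD2r.
  case: ifPn => ab; last by rewrite mule0.
  by rewrite -!EFinD -EFinM; congr EFin; rewrite ltr0_norm//; field.
Qed.

Variable n : nat.
Local Notation V := 'rV[R]_n.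

Lemma measurable_diag_affine (c e : 'I_n -> R) :
  measurable_fun [set: V] (fun x : V => \row_i (c i * x 0 i + e i)).
Proof.
apply: measurable_fun_row => i.
rewrite (_ : (fun _ => _) = (fun x : V => c i * x 0 i + e i)).
  exact: (measurableT_comp (measurable_affine (c i) (e i))
    (measurable_row_coord i)).
by apply/funext => x; rewrite mxE.
Qed.

Lemma vol_preimage (phi : V -> V) (k : R) : mfunT phi -> 0 < k ->
  (forall I : 'I_n -> set R, (forall i, measurable (I i)) ->
    vol n (phi @^-1` pbox I) = (k%:E * \prod_(i < n) leb (I i))%E) ->
  forall A, measurable A -> vol n (phi @^-1` A) = (k%:E * vol n A)%E.
Proof.
move=> mphi k0 H A mA.
pose phiM : {mfun V >-> V} := HB.pack phi (isMeasurableFun.Build _ _ _ _ _ mphi).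
have ki0 : 0 <= k^-1 by rewrite invr_ge0 ltW.
rewrite (@vol_unique R n (mscale (NngNum ki0) (pushforward (vol n) phiM)) _ A)//.
  by rewrite /mscale/= /pushforward/= muleA -EFinM mulfV ?gt_eqF// mul1e.
move=> I mI; transitivity ((k^-1)%:E * (k%:E * \prod_(i < n) leb (I i)))%E.
  by congr (_ * _)%E; exact: H.
by rewrite muleA -EFinM mulVf ?gt_eqF// mul1e.
Qed.

Lemma prode_scale (I : 'I_n -> \bar R) (c : 'I_n -> R) :
  (\prod_(i < n) ((c i)%:E * I i) = (\prod_(i < n) c i)%:E * \prod_(i < n) I i)%E.
Proof. by rewrite big_split/= prodEFin. Qed.

Lemma vol_diag_affine (c e : 'I_n -> R) : (forall i, c i != 0) ->
  forall A, measurable A ->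
  vol n ((fun x : V => \row_i (c i * x 0 i + e i)) @^-1` A) =
  ((\prod_(i < n) `|c i|%R^-1)%:E * vol n A)%E.
Proof.
move=> c0; apply: vol_preimage.
- exact: measurable_diag_affine.
- by apply: prodr_gt0 => i _; rewrite invr_gt0 normr_gt0.
- move=> I mI.
  rewrite (_ : _ @^-1` pbox I =
      pbox (fun i => (fun t => c i * t + e i) @^-1` I i)); last first.
    by apply/seteqP; split => x /= h i; have := h i; rewrite mxE.
  rewrite vol_pbox; last first.
    by move=> i; rewrite -[_ @^-1` _]setTI; exact: measurable_affine.
  by under eq_bigr do rewrite lebesgue_measure_affine//; rewrite prode_scale.
Qed.

Lemma ge0_integral_diag_affine (c e : 'I_n -> R) (F : V -> \bar R) :
  (forall i, c i != 0) -> mfunT F -> (forall x, 0 <= F x)%E ->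
  (\int[vol n]_x F (\row_i (c i * x 0 i + e i))%R =
   (\prod_(i < n) `|c i|%R^-1)%:E * \int[vol n]_x F x)%E.
Proof.
move=> c0 mF F0.
have k0 : 0 <= \prod_(i < n) `|c i|^-1.
  by apply: prodr_ge0 => i _; rewrite invr_ge0.
exact: (ge0_integral_comp (measurable_diag_affine c e) k0
  (vol_diag_affine e c0) mF F0).
Qed.

Lemma ge0_integral_translate (h : V) (F : V -> \bar R) :
  mfunT F -> (forall x, 0 <= F x)%E ->
  (\int[vol n]_x F (x + h)%R = \int[vol n]_x F x)%E.
Proof.
move=> mF F0.
have := @ge0_integral_diag_affine (fun=> 1) (fun i => h 0 i) F _ mF F0.
rewrite big1 => [|i _]; last by rewrite normr1 invr1.
rewrite mul1e => <-; last by move=> i; rewrite oner_neq0.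
by apply: eq_integral => x _; congr F; apply/rowP => i; rewrite !mxE mul1r.
Qed.

Lemma ge0_integral_scale (a : R) (F : V -> \bar R) : a != 0 ->
  mfunT F -> (forall x, 0 <= F x)%E ->
  (\int[vol n]_x F (a *: x)%R = (`|a|%R^-1 ^+ n)%:E * \int[vol n]_x F x)%E.
Proof.
move=> a0 mF F0.
have := @ge0_integral_diag_affine (fun=> a) (fun i => 0) F _ mF F0.
rewrite prodr_const card_ord => <- //.
by apply: eq_integral => x _; congr F; apply/rowP => i; rewrite !mxE addr0.
Qed.

Lemma ge0_integral_reindex (s : 'I_n -> 'I_n) (F : V -> \bar R) :
  involutive s -> mfunT F -> (forall x, 0 <= F x)%E ->
  (\int[vol n]_x F (\row_i x 0 (s i))%R = \int[vol n]_x F x)%E.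
Proof.
move=> sK mF F0.
have mp : measurable_fun [set: V] (fun x : V => \row_i x 0 (s i) : V).
  apply: measurable_fun_row => i.
  rewrite (_ : (fun _ => _) = (fun x : V => x 0 (s i))).
    exact: measurable_row_coord.
  by apply/funext => x; rewrite mxE.
rewrite -[RHS]mul1e; apply: (ge0_integral_comp mp ler01) => //.
apply: vol_preimage => // I mI.
rewrite (_ : _ @^-1` pbox I = pbox (fun i => I (s i))).
  rewrite vol_pbox// mul1e (reindex_inj (can_inj sK))/=.
  by apply: eq_bigr => i _; rewrite sK.
apply/seteqP; split => x /= h i.
  by have := h (s i); rewrite mxE sK.
by have := h (s i); rewrite sK mxE.
Qed.

End affine.

(** * Euclidean geometry and Borel sets of rows *)

Section euclid.
Context {R : realType} (n : nat).
Local Notation V := 'rV[R]_n.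
Implicit Types (x y z : V) (U : set V).

Definition dot x y : R := \sum_i x 0 i * y 0 i.

Lemma dotC x y : dot x y = dot y x.
Proof. by apply: eq_bigr => i _; rewrite mulrC. Qed.

Lemma dotDl x y z : dot (x + y) z = dot x z + dot y z.
Proof. by rewrite -big_split; apply: eq_bigr => i _; rewrite mxE mulrDl. Qed.

Lemma dotZl a x y : dot (a *: x) y = a * dot x y.
Proof. by rewrite mulr_sumr; apply: eq_bigr => i _; rewrite mxE mulrA. Qed.

Lemma dotDr x y z : dot z (x + y) = dot z x + dot z y.
Proof. by rewrite dotC dotDl !(dotC z). Qed.

Lemma dotZr a x y : dot y (a *: x) = a * dot y x.
Proof. by rewrite dotC dotZl dotC. Qed.

Lemma dotNl x y : dot (- x) y = - dot x y.
Proof. by rewrite -scaleN1r dotZl mulN1r. Qed.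

Lemma dotNr x y : dot x (- y) = - dot x y.
Proof. by rewrite dotC dotNl dotC. Qed.

Lemma dot_ge0 x : 0 <= dot x x.
Proof. by apply: sumr_ge0 => i _; rewrite -expr2 sqr_ge0. Qed.

Lemma sqr_enorm x : enorm x ^+ 2 = dot x x.
Proof.
rewrite sqr_sqrtr; last by apply: sumr_ge0 => i _; exact: sqr_ge0.
by [].
Qed.

Lemma enorm_ge0 x : 0 <= enorm x. Proof. exact: sqrtr_ge0. Qed.

Lemma le_sqr_coord x i : x 0 i ^+ 2 <= dot x x.
Proof.
by rewrite /dot (bigD1 i)//= -expr2 lerDl; apply: sumr_ge0 => j _;
  rewrite -expr2 sqr_ge0.
Qed.

Lemma ler_coord_enorm x i : `|x 0 i| <= enorm x.
Proof.
rewrite -(@ler_pXn2r _ 2)// ?nnegrE ?enorm_ge0//.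
by rewrite sqr_enorm real_normK ?num_real// le_sqr_coord.
Qed.

Lemma enorm_eq0 x : enorm x = 0 -> x = 0.
Proof.
move=> x0; apply/rowP => i; rewrite mxE; apply/eqP; rewrite -normr_eq0.
by rewrite eq_le normr_ge0 andbT -x0 ler_coord_enorm.
Qed.

Lemma cauchy_schwarz x y : dot x y ^+ 2 <= dot x x * dot y y.
Proof.
have [y0|yn0] := eqVneq (dot y y) 0.
  have -> : y = 0 by apply: enorm_eq0; apply/eqP; rewrite -sqrf_eq0 sqr_enorm y0.
  by rewrite -(scale0r (0 : V)) !dotZr !mul0r expr0n mulr0.
have yp : 0 < dot y y by rewrite lt0r yn0 dot_ge0.
have := dot_ge0 (x - (dot x y / dot y y) *: y).
rewrite dotDl !dotDr !dotNl !dotNr !dotZl !dotZr (dotC y x) => h.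
rewrite -subr_ge0.
have -> : dot x x * dot y y - dot x y ^+ 2 = dot y y *
  (dot x x - dot x y / dot y y * dot x y + (- (dot x y / dot y y * dot x y) -
   - (dot x y / dot y y * (dot x y / dot y y * dot y y)))) by field.
by rewrite mulr_ge0// ltW.
Qed.

Lemma ler_dot x y : `|dot x y| <= enorm x * enorm y.
Proof.
rewrite -(@ler_pXn2r _ 2)// ?nnegrE ?mulr_ge0 ?enorm_ge0//.
by rewrite exprMn !sqr_enorm real_normK ?num_real// cauchy_schwarz.
Qed.

Lemma enormZ a x : enorm (a *: x) = `|a| * enorm x.
Proof.
apply/eqP; rewrite -(@eqrXn2 _ 2)// ?mulr_ge0 ?enorm_ge0//.
by rewrite exprMn !sqr_enorm dotZl dotZr mulrA real_normK ?num_real// expr2.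
Qed.

Lemma enormN x : enorm (- x) = enorm x.
Proof. by rewrite -scaleN1r enormZ normrN1 mul1r. Qed.

Lemma enorm0 : enorm (0 : V) = 0.
Proof. by rewrite -(scale0r (0 : V)) enormZ normr0 mul0r. Qed.

Lemma enormBC x y : enorm (x - y) = enorm (y - x).
Proof. by rewrite -enormN opprB. Qed.

Lemma ler_enormD x y : enorm (x + y) <= enorm x + enorm y.
Proof.
rewrite -(@ler_pXn2r _ 2)// ?nnegrE ?addr_ge0 ?enorm_ge0//.
rewrite sqr_enorm dotDl !dotDr (dotC y x) sqrrD -!sqr_enorm.
have := ler_dot x y; have := ler_norm (dot x y); lra.
Qed.

Lemma ler_enormB x y : enorm (x - y) <= enorm x + enorm y.
Proof. by rewrite -[enorm y]enormN ler_enormD. Qed.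

Lemma ler_enorm_sum x : enorm x <= \sum_i `|x 0 i|.
Proof.
rewrite -(@ler_pXn2r _ 2)// ?nnegrE ?enorm_ge0 ?sumr_ge0//.
rewrite sqr_enorm expr2 mulr_suml; apply: ler_sum => i _.
rewrite -expr2 -real_normK ?num_real// expr2 ler_wpM2l//.
by rewrite (bigD1 i)//= lerDl sumr_ge0.
Qed.

(** Openness is tested with Euclidean balls, so that it can be used directly with [enorm];
    [measurable_eopen] links it to the sigma-algebra. *)
Definition eopen U := forall x, U x ->
  exists2 e : R, 0 < e & forall y, enorm (y - x) < e -> U y.

Definition econvex U := forall x y (t : R), U x -> U y -> 0 <= t <= 1 ->
  U ((1 - t) *: x + t *: y).

Definition oball (r : R) : set V := [set x | enorm x < r].

Lemma measurable_oball r : measurable (oball r).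
Proof.
rewrite (_ : oball r = (@enorm R n) @^-1` `]-oo, r[); last first.
  by [].
by rewrite -[_ @^-1` _]setTI; exact: measurable_enorm.
Qed.

Lemma measurable_eball r : measurable (@eball R n r).
Proof.
rewrite (_ : eball r = (@enorm R n) @^-1` `]-oo, r]); last first.
  by [].
by rewrite -[_ @^-1` _]setTI; exact: measurable_enorm.
Qed.

Definition cube x (e : R) : set V := pbox (fun i => `]x 0 i - e, x 0 i + e[%classic).

Lemma rat_approx (a : R) (e : R) : 0 < e -> exists q : rat, `|ratr q - a| < e.
Proof.
move=> e0; have ae : a - e < a + e by lra.
have [q] := rat_in_itvoo ae; rewrite in_itv/= => /andP[q1 q2]; exists q; rewrite ltr_norml; apply/andP; split; lra.
Qed.

Lemma rat_vec_approx x (e : R) : 0 < e ->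
  exists q : 'rV[rat]_n, forall i, `|ratr (q 0 i) - x 0 i| < e.
Proof.
move=> e0.
have /choice[q hq] : forall i, exists q : rat, `|ratr q - x 0 i| < e.
  by move=> i; exact: rat_approx.
by exists (\row_i q i) => i; rewrite mxE.
Qed.

Definition qvec (q : 'rV[rat]_n) : V := map_mx ratr q.

(* Euclidean balls are replaced by countably many rational cubes. *)
Lemma eopen_cubes U : eopen U ->
  U = \bigcup_(q in [set q : 'rV[rat]_n * rat | cube (qvec q.1) (ratr q.2) `<=` U])
        cube (qvec q.1) (ratr q.2).
Proof.
move=> oU; apply/seteqP; split => [x Ux|x [q hq]]; last exact: hq.
have [e e0 he] := oU x Ux.
(* A Euclidean distance is at most the sum of the n coordinate distances, so a cube of side below e
   / (n + 1) around a point near x fits into the ball; n + 1 also covers n = 0. *)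
have e10 : 0 < e / (2 * n.+1%:R) by rewrite divr_gt0// mulr_gt0// ltr0n.
have ee : e / (2 * n.+1%:R) / 2 < e / (2 * n.+1%:R).
  by move: e10; set e1 := e / _ => e10; lra.
have [p] := rat_in_itvoo ee; rewrite in_itv/= => /andP[p1 p2].
have p0 : 0 < ratr p :> R by apply: lt_trans p1; rewrite divr_gt0.
have [q hq] := rat_vec_approx x p0.
exists (q, p) => /=; last first.
  move=> i /=; rewrite in_itv/= mxE; have := hq i; rewrite ltr_norml => /andP[].
  move=> h1 h2; apply/andP; split; lra.
move=> y hy; apply: he; apply: le_lt_trans (ler_enorm_sum _) _.
apply: (@le_lt_trans _ _ (\sum_(i < n) (e / n.+1%:R))).
  apply: ler_sum => i _; have := hy i; rewrite /= in_itv/= !mxE => /andP[h1 h2].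
  have := hq i; rewrite ltr_norml => /andP[h3 h4].
  have p3 : 2 * ratr p < e / n.+1%:R.
    have -> : e / n.+1%:R = 2 * (e / (2 * n.+1%:R)).
      have : n.+1%:R != 0 :> R by [].
      by set N := n.+1%:R => N0; field.
    by rewrite ltr_pM2l.
  move: p3; set E := e / n.+1%:R => p3.
  by rewrite ler_norml; apply/andP; split; lra.
rewrite sumr_const card_ord -[_ *+ n]mulr_natr ?/e -mulrA gtr_pMr// mulrC ltr_pdivrMr ?ltr0n//.
by lra.
Qed.

Lemma measurable_eopen U : eopen U -> measurable U.
Proof.
move=> oU; rewrite (eopen_cubes oU).
rewrite bigcup_mkcond; apply: countable_bigcupT_measurable => // q.
by case: ifP => // _; exact: measurable_pbox.
Qed.

(** Lower semicontinuity is what a supremum such as [enlarge] provides. *)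
Lemma measurable_fun_lsc (f : V -> R) : (forall c, eopen [set x | c < f x]) ->
  mfunT f.
Proof.
move=> oF; apply: measurability (RGenOInfty.measurableE R) _.
move=> _ [_ [c ->] <-]; rewrite setTI; apply: measurable_eopen.
by rewrite (_ : _ @^-1` _ = [set x | c < f x])//; apply/seteqP; split => x /=;
  rewrite in_itv/= andbT.
Qed.

Lemma measurable_fun_lipschitz (f : V -> R) (L : R) :
  (forall x y, `|f x - f y| <= L * enorm (x - y)) -> mfunT f.
Proof.
move=> fL; apply: measurable_fun_lsc => c x /= cx.
exists ((f x - c) / (`|L| + 1)); first by rewrite divr_gt0 ?subr_gt0// ltr_wpDl.
move=> y /=; rewrite ltr_pdivlMr; last by [].
move=> h; have := fL y x; rewrite ler_norml => /andP[h1 _].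
have : L * enorm (y - x) <= `|L| * enorm (y - x).
  by rewrite ler_wpM2r ?enorm_ge0// ler_norm.
have := enorm_ge0 (y - x); lra.
Qed.

Lemma vol_eball_fin r : (vol n (@eball R n r) < +oo)%E.
Proof.
apply: (@le_lt_trans _ _ (vol n (pbox (fun=> `[- r, r]%classic)))).
  apply: le_measure; rewrite ?inE; [exact: measurable_eball|exact: measurable_pbox|].
  move=> x hx i /=; rewrite in_itv/= -ler_norml.
  exact: le_trans (ler_coord_enorm _ _) hx.
rewrite vol_pbox//; under eq_bigr do rewrite lebesgue_measure_itv/=.
by case: ifP => _; rewrite -?EFinB prodEFin ltry.
Qed.

Lemma vol_gt0 U x (r : R) : 0 < r -> measurable U ->
  (forall y, enorm (y - x) < r -> U y) -> (0 < vol n U)%E.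
Proof.
move=> r0 mU xU; set e := r / n.+1%:R.
have e0 : 0 < e by rewrite divr_gt0// ltr0n.
apply: (@lt_le_trans _ _ (vol n (pbox (fun i => `[x 0 i, x 0 i + e]%classic)))).
  rewrite vol_pbox// (eq_bigr (fun=> e%:E)) => [|i _].
    by rewrite prodEFin lte_fin; apply: prodr_gt0.
  by rewrite lebesgue_measure_itv/= lte_fin ltrDl e0 -EFinD addrAC subrr add0r.
apply: le_measure; rewrite ?inE//; first exact: measurable_pbox.
move=> y hy /=; apply: xU; apply: le_lt_trans (ler_enorm_sum _) _.
apply: (@le_lt_trans _ _ (\sum_(i < n) e)).
  apply: ler_sum => i _; have := hy i; rewrite /= in_itv/= !mxE => /andP[h1 h2].
  by rewrite ger0_norm ?subr_ge0// lerBlDl.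
rewrite sumr_const card_ord -[_ *+ n]mulr_natr ?/e -mulrA gtr_pMr// mulrC ltr_pdivrMr ?ltr0n//.
by lra.
Qed.

Lemma vol_eopen_gt0 U : eopen U -> U !=set0 -> (0 < vol n U)%E.
Proof.
move=> oU [x Ux]; have [e e0 he] := oU x Ux.
by apply: (vol_gt0 e0 _ he); exact: measurable_eopen.
Qed.

Lemma vol_scale (a : R) U : a != 0 -> measurable U ->
  vol n [set x | U (a *: x)] = ((`|a|^-1 ^+ n)%:E * vol n U)%E.
Proof.
move=> a0 mU.
rewrite (_ : [set x | U (a *: x)] =
    (fun x : V => \row_i (a * x 0 i + 0)) @^-1` U).
  by rewrite (vol_diag_affine (fun=> 0) (fun=> a0))// prodr_const card_ord.
apply/funext => x /=; congr U; apply/rowP => i.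
by rewrite !mxE addr0.
Qed.
End euclid.

Ltac nneg :=
  intros; rewrite ?lee_fin;
  solve [repeat first [done | exact: sqr_ge0 | exact: enorm_ge0 | exact: ltW
    | apply: mulr_ge0 | apply: addr_ge0 | apply: divr_ge0 | apply: exprn_ge0
    | rewrite invr_ge0 | apply: sumr_ge0; intros | apply: mule_ge0 | apply: adde_ge0
    | apply: integral_ge0; intros; rewrite ?lee_fin]].

(** * Proportional cuts by coordinate halfspaces *)

Section cutting.
Context {R : realType} (n : nat).
Local Notation V := 'rV[R]_n.
Local Notation leb := (@lebesgue_measure R).

Definition halfspace (i : 'I_n) (a : R) : set V := [set x | x 0 i < a].

Lemma measurable_halfspace i a : measurable (halfspace i a).
Proof.
rewrite (_ : halfspace i a = (fun x : V => x 0 i) @^-1` `]-oo, a[); last first.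
  by nneg.
by rewrite -[_ @^-1` _]setTI; exact: measurable_row_coord.
Qed.

Lemma vol_slab (B : set V) (M : R) i (a b : R) : measurable B -> 0 <= M ->
  B `<=` pbox (fun=> `[- M, M]%classic) -> a <= b ->
  (vol n (B `&` (halfspace i b `\` halfspace i a)) <=
   ((b - a) * (2 * M) ^+ n.-1)%:E)%E.
Proof.
move=> mB M0 BM ab.
pose I := fun j => if j == i then `[a, b]%classic else `[- M, M]%classic.
have mI j : measurable (I j) by rewrite /I; case: ifP.
apply: (@le_trans _ _ (vol n (pbox I))).
  apply: le_measure; rewrite ?inE.
  - by apply: measurableI => //; apply: measurableD; exact: measurable_halfspace.
  - exact: measurable_pbox.
  move=> x [Bx [/= xb xa]] j; rewrite /I; case: eqP => [->|_]; last exact: BM.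
  by rewrite /= in_itv/= (ltW xb) andbT leNgt; apply/negP.
rewrite vol_pbox// (eq_bigr (fun j => (if j == i then b - a else 2 * M)%:E)).
  rewrite prodEFin lee_fin (bigD1 i)//= eqxx ler_wpM2l ?subr_ge0//.
  rewrite (eq_bigr (fun=> 2 * M)); last by move=> j /negPf ->.
  by rewrite prodr_const cardC1 card_ord.
move=> j _; rewrite /I; case: ifP => _; rewrite lebesgue_measure_itv/= lte_fin.
  by rewrite lt_neqAle ab andbT; case: eqVneq => [->|_] //=; rewrite subrr.
case: ltP => [_|h]; first by rewrite -EFinB; congr EFin; lra.
by rewrite (_ : M = 0) ?mulr0//; apply/eqP; rewrite eq_le M0 andbT; lra.
Qed.

(** By [vol_slab] the volume below the cut is a Lipschitz function of its position, so the
    intermediate value theorem applies. *)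
Lemma proportional_cut (B : set V) (M : R) i (v : R) : measurable B -> 0 <= M ->
  B `<=` pbox (fun=> `[- M, M]%classic) -> 0 <= v -> (v%:E <= vol n B)%E ->
  exists a, vol n (B `&` halfspace i a) = v%:E.
Proof.
move=> mB M0 BM v0 vB.
have mBH a : measurable (B `&` halfspace i a).
  by apply: measurableI => //; exact: measurable_halfspace.
have mS a b : measurable (B `&` (halfspace i b `\` halfspace i a)).
  by apply: measurableI => //; apply: measurableD; exact: measurable_halfspace.
have Boo : (vol n B < +oo)%E.
  apply: (@le_lt_trans _ _ (vol n (pbox (fun=> `[- M, M]%classic)))).
    by apply: le_measure; rewrite ?inE//; exact: measurable_pbox.
  rewrite vol_pbox//; under eq_bigr do rewrite lebesgue_measure_itv/=.
  by case: ifP => _; rewrite -?EFinB prodEFin ltry.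
have BHfin a : vol n (B `&` halfspace i a) \is a fin_num.
  rewrite ge0_fin_numE//; apply: le_lt_trans Boo.
  by apply: le_measure; rewrite ?inE.
pose f a := fine (vol n (B `&` halfspace i a)).
pose C := (2 * M) ^+ n.-1.
have C0 : 0 <= C by nneg.
have fab a b : a <= b -> 0 <= f b - f a <= C * (b - a).
  move=> ab.
  have E : vol n (B `&` halfspace i b) = (vol n (B `&` halfspace i a) +
      vol n (B `&` (halfspace i b `\` halfspace i a)))%E.
    rewrite -measureU//; last by apply/seteqP; split => // x [[_ xa] [_ [_]]].
    congr (vol n _); apply/seteqP; split => x /=.
      move=> [Bx xb]; have [xa|xa] := ltP (x 0 i) a; first by left.
      by right; split => //; split => //; rewrite /halfspace/= ltNge xa.
    move=> [[Bx xa]|[Bx [xb _]]]; split => //.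
    exact: lt_le_trans ab.
  have := vol_slab i mB M0 BM ab.
  have Sfin : vol n (B `&` (halfspace i b `\` halfspace i a)) \is a fin_num.
    rewrite ge0_fin_numE//; apply: le_lt_trans Boo.
    by apply: le_measure; rewrite ?inE.
  rewrite /f E fineD// addrAC subrr add0r fine_ge0//=.
  by rewrite -[in X in (X <= _)%E](fineK Sfin) lee_fin mulrC.
have fL a b : `|f a - f b| <= C * `|a - b|.
  wlog ab : a b / a <= b.
    move=> h; have [/h//|/ltW/h] := leP a b.
    by rewrite distrC (distrC b).
  have /andP[h1 h2] := fab a b ab.
  by rewrite distrC (distrC a) ger0_norm// (ger0_norm (_ : 0 <= b - a)) ?subr_ge0.
have fc : continuous f.
  move=> a; apply/cvgrPdist_lt => e e0; near=> b.
  apply: le_lt_trans (fL _ _) _; rewrite distrC.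
  apply: (@le_lt_trans _ _ ((C + 1) * `|b - a|)).
    by rewrite ler_wpM2r// lerDl.
  rewrite mulrC -ltr_pdivlMr ?ltr_wpDl//; near: b.
  have d0 : 0 < e / (C + 1) by rewrite divr_gt0// ltr_wpDl.
  by apply/nbhs_ballP; exists (e / (C + 1)) => //= y; rewrite /ball/= distrC.
have f0 : f (- M) = 0.
  rewrite /f (_ : _ `&` _ = set0) ?measure0//; apply/seteqP; split => // x [Bx].
  by have := BM x Bx i; rewrite /halfspace/= in_itv/= => /andP[h _]; rewrite ltNge h.
(* [halfspace] is strict and [B] may touch the face at [M], so the right end of the search interval
   lies beyond [M]. *)
have f1 : f (M + 1) = fine (vol n B).
  congr (fine (vol n _)); apply/seteqP; split => x; first by case.
  move=> Bx; split => //; have := BM x Bx i; rewrite /halfspace/= in_itv/=; lra.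
have vf : v <= fine (vol n B) by rewrite -lee_fin fineK// ge0_fin_numE.
have [|||a _ fa] := @IVT R f (- M) (M + 1) v; first by lra.
- exact: continuous_subspaceT.
- by rewrite f0 f1 ge_min le_max v0 vf orbT.
by exists a; rewrite -fa fineK.
Unshelve. all: by end_near. Qed.

End cutting.

Lemma ge0_mule_distr_ACA (R : realDomainType) (k a b x1 x2 y1 y2 : \bar R) :
  (0 <= a -> 0 <= b -> 0 <= x1 -> 0 <= x2 -> 0 <= y1 -> 0 <= y2 ->
  k * (a * (x1 + x2) + b * (y1 + y2)) =
  k * (a * x1 + b * y1) + k * (a * x2 + b * y2))%E.
Proof.
move=> *; rewrite -ge0_muleDr ?adde_ge0 ?mule_ge0//; congr (_ * _)%E.
by rewrite !ge0_muleDr// addeACA.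
Qed.

(** Weighted arithmetic-geometric mean of 1 and r, obtained from 1 + x <= e^x at x = - t ln r and x
    = (1 - t) ln r. *)
Lemma powR_le_affine (R : realType) (t r : R) : 0 <= t <= 1 -> 0 < r ->
  r `^ t <= (1 - t) + t * r.
Proof.
move=> /andP[t0 t1] r0; rewrite /powR gt_eqF//.
set G := expR (t * ln r); have G0 : 0 < G by exact: expR_gt0.
have h1 := expR_ge1Dx (- (t * ln r)); rewrite expRN -/G in h1.
have h2 := expR_ge1Dx ((1 - t) * ln r).
have E : expR ((1 - t) * ln r) = r * G^-1.
  have -> : (1 - t) * ln r = ln r - t * ln r by ring.
  by rewrite expRD lnK ?posrE// expRN.
rewrite E in h2.
have h3 : 1 <= ((1 - t) + t * r) * G^-1.
  have := ler_wpM2l (_ : 0 <= 1 - t) h1; rewrite subr_ge0 => /(_ t1).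
  have := ler_wpM2l t0 h2; nra.
by rewrite -[G]mul1r -ler_pdivlMr.
Qed.

(** * Mixed Brunn-Minkowski inequality for concave weights *)

Section mixed_brunn_minkowski.
Context {R : realType} (n : nat).
Local Notation V := 'rV[R]_n.
Variables (U : set V) (s : V -> R) (t : R).
Hypotheses (ms : mfunT s) (s0 : forall x, 0 <= s x) (t01 : 0 <= t <= 1).
Hypothesis sconc : forall x y, U x -> U y ->
  (1 - t) * s x + t * s y <= s ((1 - t) *: x + t *: y).

Let nu (A : set V) : \bar R := (\int[vol n]_(x in A) (s x)%:E)%E.

Let mE : mfunT (EFin \o s). Proof. exact/measurable_EFinP. Qed.

(** [W] stands for (1 - t) A + t B and [c] for the ratio vol B / vol A. As [c] is a separate
    parameter, cutting A and B in the same proportion keeps the inequality additive over the pieces.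
    For constant [s] the left side is a multiple of (vol A)^(1 - t) (vol B)^t, the multiplicative
    Brunn-Minkowski bound. *)
Definition mixed_bm (c : R) (A B : set V) := forall W, measurable W ->
  (forall x y, A x -> B y -> W ((1 - t) *: x + t *: y)) ->
  ((c `^ t)%:E * ((1 - t)%:E * nu A + (t / c)%:E * nu B) <= nu W)%E.

Lemma nu_halfspace (A : set V) i a : measurable A ->
  nu A = (nu (A `&` halfspace i a) + nu (A `\` halfspace i a))%E.
Proof.
move=> mA; have mH := measurable_halfspace i a.
rewrite /nu -ge0_integral_setU//=.
- by rewrite setUIDK.
- exact: measurableI.
- exact: measurableD.
- exact: measurable_funTS.
- by nneg.
- by apply/disj_setPS => x [[_ ?] [_ ?]].
Qed.

Lemma nu_ge0 A : (0 <= nu A)%E.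
Proof. by apply: integral_ge0 => x _; rewrite lee_fin. Qed.

(** If A is cut at a and B at b, combinations of the lower parts lie below (1 - t) a + t b and those
    of the upper parts do not, so the two instances bound disjoint pieces of W. *)
Lemma mixed_bm_cut c A B i a b : 0 < c -> measurable A -> measurable B ->
  mixed_bm c (A `&` halfspace i a) (B `&` halfspace i b) ->
  mixed_bm c (A `\` halfspace i a) (B `\` halfspace i b) -> mixed_bm c A B.
Proof.
move=> c0 mA mB h1 h2 W mW AB.
pose g := (1 - t) * a + t * b.
have mH := measurable_halfspace i g.
rewrite (nu_halfspace i g mW) (nu_halfspace i a mA) (nu_halfspace i b mB).
have /andP[t0 t1] := t01.
have {}h1 := h1 (W `&` halfspace i g) (measurableI _ _ mW mH).
have {}h2 := h2 (W `\` halfspace i g) (measurableD mW mH).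
apply: le_trans (leeD (h1 _) (h2 _)).
- by rewrite ge0_mule_distr_ACA ?nu_ge0// lee_fin ?subr_ge0// divr_ge0// ltW.
- move=> x y [Ax xa] [By yb]; split; first exact: AB.
  rewrite /halfspace/= !mxE /g.
  have : (1 - t) * x 0 i <= (1 - t) * a by rewrite ler_wpM2l ?subr_ge0// ltW.
  have : t * y 0 i <= t * b by rewrite ler_wpM2l// ltW.
  have [t00|tn0] := eqVneq t 0; first by rewrite t00; move: xa; rewrite /halfspace/=; lra.
  have : t * y 0 i < t * b by rewrite ltr_pM2l// lt0r tn0.
  lra.
- move=> x y [Ax xa] [By yb]; split; first exact: AB.
  rewrite /halfspace/= !mxE /g; apply/negP; rewrite -leNgt.
  move/negP : xa; rewrite -leNgt => xa; move/negP : yb; rewrite -leNgt => yb.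
  by rewrite lerD// ler_wpM2l// subr_ge0.
Qed.

(** A box is given by its lower and upper corners. Boxes are half-open: they tile without overlap
    and remain half-open when cut. *)
Definition boxT := (V * V)%type.
Implicit Types (p q : boxT) (L : seq boxT).
Definition bset (p : boxT) : set V :=
  pbox (fun i => `[p.1 0 i, p.2 0 i[%classic).
Definition nondeg (p : boxT) := [forall i, p.1 0 i < p.2 0 i].
Definition sep (p q : boxT) := [exists i, (p.2 0 i <= q.1 0 i) || (q.2 0 i <= p.1 0 i)].
Definition uset (L : seq boxT) : set V := [set x | exists2 p, p \in L & bset p x].
Definition good_boxes (L : seq boxT) := all nondeg L && pairwise sep L.

Definition lo_cut i a (p : boxT) : boxT :=
  (p.1, \row_j if j == i then Num.min (p.2 0 j) a else p.2 0 j).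
Definition up_cut i a (p : boxT) : boxT :=
  (\row_j if j == i then Num.max (p.1 0 j) a else p.1 0 j, p.2).
Definition lo_cuts i a L := [seq lo_cut i a p | p : boxT <- L & p.1 0 i < a].
Definition up_cuts i a L := [seq up_cut i a p | p : boxT <- L & a < p.2 0 i].

Lemma bset_lo_cut i a p : bset (lo_cut i a p) = bset p `&` halfspace i a.
Proof.
apply/seteqP; split => x /=.
  move=> h; split => [j|].
    by have := h j; rewrite /= !in_itv/= mxE; case: eqP => // _ /andP[-> /=];
      rewrite lt_min => /andP[].
  by have := h i; rewrite /= in_itv/= mxE eqxx lt_min => /andP[_ /andP[]].
move=> [h xa] j; have := h j; rewrite /= !in_itv/= mxE => /andP[-> /=].
by case: eqP => // ->; rewrite lt_min => ->.
Qed.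

Lemma bset_up_cut i a p : bset (up_cut i a p) = bset p `\` halfspace i a.
Proof.
apply/seteqP; split => x /=.
  move=> h; split => [j|].
    by have := h j; rewrite /= !in_itv/= mxE; case: eqP => // _ /andP[+ ->];
      rewrite ge_max => /andP[->].
  have := h i; rewrite /= in_itv/= mxE eqxx ge_max => /andP[/andP[_ h1] _].
  by rewrite /halfspace/=; apply/negP; rewrite -leNgt.
move=> [h xa] j; have := h j; rewrite /= !in_itv/= mxE => /andP[h1 ->].
rewrite andbT; case: eqP => // ji; rewrite ge_max h1/= ji leNgt.
exact/negP.
Qed.

Lemma uset_lo_cuts i a L : uset (lo_cuts i a L) = uset L `&` halfspace i a.
Proof.
apply/seteqP; split => x /=.
  move=> [q /mapP[p]]; rewrite mem_filter => /andP[pa pL] ->.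
  by rewrite bset_lo_cut => -[px xa]; split => //; exists p.
move=> [[p pL px] xa]; exists (lo_cut i a p); last by rewrite bset_lo_cut.
apply/mapP; exists p => //; rewrite mem_filter pL andbT.
by have := px i; rewrite /= in_itv/= => /andP[h _]; exact: le_lt_trans xa.
Qed.

Lemma uset_up_cuts i a L : uset (up_cuts i a L) = uset L `\` halfspace i a.
Proof.
apply/seteqP; split => x /=.
  move=> [q /mapP[p]]; rewrite mem_filter => /andP[pa pL] ->.
  by rewrite bset_up_cut => -[px xa]; split => //; exists p.
move=> [[p pL px] xa]; exists (up_cut i a p); last by rewrite bset_up_cut.
apply/mapP; exists p => //; rewrite mem_filter pL andbT.
move/negP : xa; rewrite -leNgt => xa.
by have := px i; rewrite /= in_itv/= => /andP[_]; exact: le_lt_trans.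
Qed.

Lemma good_lo_cuts i a L : good_boxes L -> good_boxes (lo_cuts i a L).
Proof.
move=> /andP[/allP nL sL]; apply/andP; split.
  apply/allP => q /mapP[p]; rewrite mem_filter => /andP[pa pL] ->.
  apply/forallP => j; rewrite mxE; case: eqP => [->|_]; last exact: (forallP (nL p pL) _).
  by rewrite lt_min pa andbT; exact: (forallP (nL p pL) _).
rewrite pairwise_map; apply: sub_pairwise (pairwise_filter _ sL).
move=> p q /existsP[j h]; apply/existsP; exists j; rewrite !mxE.
by case: eqP => // _; case/orP : h => h; rewrite !ge_min h ?orbT.
Qed.

Lemma good_up_cuts i a L : good_boxes L -> good_boxes (up_cuts i a L).
Proof.
move=> /andP[/allP nL sL]; apply/andP; split.
  apply/allP => q /mapP[p]; rewrite mem_filter => /andP[pa pL] ->.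
  apply/forallP => j; rewrite mxE; case: eqP => [->|_]; last exact: (forallP (nL p pL) _).
  by rewrite gt_max pa andbT; exact: (forallP (nL p pL) _).
rewrite pairwise_map; apply: sub_pairwise (pairwise_filter _ sL).
move=> p q /existsP[j h]; apply/existsP; exists j; rewrite !mxE.
by case: eqP => // _; case/orP : h => h; rewrite !le_max h ?orbT.
Qed.

Lemma size_lo_cuts i a L : (size (lo_cuts i a L) <= size L)%N.
Proof. by rewrite size_map size_filter count_size. Qed.

Lemma size_up_cuts i a L : (size (up_cuts i a L) <= size L)%N.
Proof. by rewrite size_map size_filter count_size. Qed.

Lemma size_lo_cuts_lt i a L p : p \in L -> a <= p.1 0 i ->
  (size (lo_cuts i a L) < size L)%N.
Proof.
move=> pL pa; rewrite size_map size_filter ltn_neqAle count_size andbT.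
by rewrite -all_count; apply/negP => /allP/(_ p pL); rewrite ltNge pa.
Qed.

Lemma size_up_cuts_lt i a L p : p \in L -> p.2 0 i <= a ->
  (size (up_cuts i a L) < size L)%N.
Proof.
move=> pL pa; rewrite size_map size_filter ltn_neqAle count_size andbT.
by rewrite -all_count; apply/negP => /allP/(_ p pL); rewrite ltNge pa.
Qed.

Lemma measurable_bset p : measurable (bset p). Proof. exact: measurable_pbox. Qed.

Lemma measurable_uset L : measurable (uset L).
Proof.
elim: L => [|p L IHL].
  by rewrite (_ : uset [::] = set0)//; apply/seteqP; split => // x [q].
rewrite (_ : uset (p :: L) = bset p `|` uset L).
  by apply: measurableU => //; exact: measurable_bset.
apply/seteqP; split => x /=.
  move=> [q]; rewrite inE => /orP[/eqP ->|qL] qx; [by left|by right; exists q].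
move=> [px|[q qL qx]]; first by exists p => //; rewrite mem_head.
by exists q => //; rewrite inE qL orbT.
Qed.

Lemma vol_bset p : nondeg p -> vol n (bset p) = (\prod_i (p.2 0 i - p.1 0 i))%:E.
Proof.
move=> /forallP pn; rewrite vol_pbox// -prodEFin; apply: eq_bigr => i _.
by rewrite lebesgue_measure_itv/= lte_fin pn -EFinB.
Qed.

(* [z = (1 - t) x + t T x] for the coordinatewise affine map [T] of [bset p]
   onto [bset q]. *)
Lemma mixed_bm_box (c : R) p q : nondeg p -> nondeg q ->
  bset p `<=` U -> bset q `<=` U ->
  vol n (bset q) = (c%:E * vol n (bset p))%E -> 0 < c ->
  mixed_bm c (bset p) (bset q).
Proof.
move=> pn qn pU qU cE c0 W mW AB.
have /andP[t0 t1] := t01.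
pose lp i := p.2 0 i - p.1 0 i; pose lq i := q.2 0 i - q.1 0 i.
have lp0 i : 0 < lp i by rewrite subr_gt0; exact: (forallP pn).
have lq0 i : 0 < lq i by rewrite subr_gt0; exact: (forallP qn).
pose r i := lq i / lp i; have r0 i : 0 < r i by rewrite divr_gt0.
pose e i := q.1 0 i - r i * p.1 0 i.
pose T (x : V) : V := \row_i (r i * x 0 i + e i).
(* Diagonal of the linear part of x |-> (1 - t) x + t T x. The product of the entries is its
   Jacobian, and [powR_le_affine] on each side bounds it below by c^t. *)
pose m i := (1 - t) + t * r i.
have m0 i : 0 < m i.
  rewrite /m; have [->|tn0] := eqVneq t 0; first by lra.
  by rewrite ltr_wpDl ?subr_ge0// mulr_gt0// lt0r tn0.
pose M (x : V) : V := \row_i (m i * x 0 i + t * e i).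
have ME x : M x = (1 - t) *: x + t *: T x.
  by apply/rowP => i; rewrite !mxE /m; ring.
have Tpq x : bset q (T x) <-> bset p x.
  have key i : (q.1 0 i <= T x 0 i < q.2 0 i) = (p.1 0 i <= x 0 i < p.2 0 i).
    rewrite mxE /e.
    have -> : r i * x 0 i + (q.1 0 i - r i * p.1 0 i) =
      q.1 0 i + r i * (x 0 i - p.1 0 i) by ring.
    rewrite lerDl pmulr_rge0// subr_ge0; congr andb.
    rewrite -ltrBrDl -/(lq i) mulrC /r mulrA ltr_pdivrMr// mulrC ltr_pM2l//.
    by rewrite /lp ltrD2r.
  by split => h i; have := h i; rewrite /= !in_itv/= key.
have prodr : \prod_i r i = c.
  have Hc : \prod_i lq i = c * \prod_i lp i.
    by move: cE; rewrite !vol_bset// -EFinM => -[].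
  rewrite /r big_split/= prodfV Hc mulfK//.
  by apply/prodf_neq0 => i _; rewrite gt_eqF.
have mWE : mfunT (fun x : V => (\1_W x * s x)%:E).
  by meas.
have nuE A : measurable A -> nu A = (\int[vol n]_x (\1_A x * s x)%:E)%E.
  move=> mA; rewrite /nu integral_mkcond; apply: eq_integral => x _.
  by rewrite patchE indicE; case: ifP => _; rewrite ?mul1r ?mul0r.
have mn0 i : m i != 0 by rewrite gt_eqF.
have := @ge0_integral_diag_affine R n m (fun i => t * e i) _ mn0 mWE
  (fun x => _ : (0 <= (\1_W x * s x)%:E)%E).
rewrite -nuE// => HW.
have {}HW : (\int[vol n]_x (\1_W (M x) * s (M x))%:E =
    (\prod_(i < n) `|m i|%R^-1)%:E * nu W)%E.
  by apply: HW => x; rewrite lee_fin mulr_ge0.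
have pm0 : 0 < \prod_i m i by apply: prodr_gt0.
have {}HW : nu W = ((\prod_i m i)%:E * \int[vol n]_x (\1_W (M x) * s (M x))%:E)%E.
  rewrite HW muleA -EFinM -[LHS]mul1e; congr (_%:E * _)%E.
  rewrite -big_split/= big1// => i _.
  by rewrite gtr0_norm// mulfV.
have mp := measurable_bset p; have mq := measurable_bset q.
have mT : mfunT T by exact: measurable_diag_affine.
have Hq : (\int[vol n]_x (\1_(bset q) (T x) * s (T x))%:E = (c^-1)%:E * nu (bset q))%E.
  rewrite nuE// (@ge0_integral_diag_affine R n r e
      (fun x => (\1_(bset q) x * s x)%:E)).
  - congr (_%:E * _)%E; rewrite -prodr -prodfV; apply: eq_bigr => i _.
    by rewrite gtr0_norm.
  - by move=> i; rewrite gt_eqF.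
  - by meas.
  - by nneg.
have cm : c `^ t <= \prod_i m i.
  have -> : c `^ t = \prod_i (r i) `^ t.
    rewrite -prodr.
    suff [] : 0 <= \prod_i r i /\ (\prod_i r i) `^ t = \prod_i (r i) `^ t by [].
    elim/big_rec2 : _ => [|i y1 y2 _ [h1 h2]]; first by rewrite powR1.
    by rewrite mulr_ge0 ?(ltW (r0 i))// powRM ?(ltW (r0 i))// h2.
  apply: ler_prod => i _; rewrite powR_ge0/=; exact: powR_le_affine.
rewrite HW.
apply: (@le_trans _ _ ((\prod_i m i)%:E *
    ((1 - t)%:E * nu (bset p) + (t / c)%:E * nu (bset q)))%E).
  rewrite lee_wpmul2r// ?lee_fin//.
  by rewrite adde_ge0// mule_ge0 ?nu_ge0// lee_fin ?subr_ge0// divr_ge0// ltW.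
rewrite lee_wpmul2l ?lee_fin ?(ltW pm0)//.
have mp1 : mfunT (fun x : V => (\1_(bset p) x * s x)%:E).
  by meas.
have mq1 : mfunT (fun x : V => (\1_(bset q) x * s x)%:E).
  by meas.
have mqT : mfunT (fun x : V => (\1_(bset q) (T x) * s (T x))%:E).
  exact: (measurableT_comp mq1 mT).
have mWM : mfunT (fun x : V => (\1_W (M x) * s (M x))%:E).
  exact: (measurableT_comp mWE (measurable_diag_affine m (fun i => t * e i))).
have g0 A (x : V) : (0 <= (\1_A x * s x)%:E)%E by nneg.
rewrite EFinM -muleA -Hq nuE// -!ge0_integralZl_EFin//; [|by lra].
rewrite -ge0_integralD//; last 4 first.
- by move=> x _; rewrite mule_ge0// lee_fin subr_ge0.
- by meas.
- by nneg.
- by meas.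
apply: ge0_le_integral => //.
- move=> x _; rewrite -!EFinM -EFinD lee_fin.
  by rewrite addr_ge0// mulr_ge0 ?subr_ge0// mulr_ge0.
- by apply: emeasurable_funD; exact: measurable_funeM.
move=> x _; rewrite -!EFinM -EFinD lee_fin !indicE.
have [xp|xp] := boolP (x \in bset p).
  have px : bset p x by rewrite inE in xp.
  have qx : bset q (T x) by apply/Tpq.
  rewrite (mem_set qx) !mul1r mem_set ?mul1r.
    by rewrite ME; apply: sconc; [exact: pU|exact: qU].
  by rewrite ME; exact: AB.
rewrite (_ : (T x \in bset q) = false) ?mul0r ?mulr0 ?addr0 ?mulr_ge0//.
by apply/negbTE; apply: contra xp; rewrite !inE => /Tpq.
Qed.

(** Hadwiger-Ohmann induction on the total number of boxes. Two separated boxes of one family yield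
    a hyperplane with a whole box on each side; the other family is cut parallel to it in the same
    volume proportion. Both halves keep the ratio [c] and contain fewer boxes in total. Two single
    boxes are the case of [mixed_bm_box]. *)
Lemma mixed_bm_boxes (M : R) L K : 0 <= M -> good_boxes L -> good_boxes K ->
  L != [::] -> K != [::] ->
  uset L `<=` pbox (fun=> `[- M, M]%classic) -> uset L `<=` U ->
  uset K `<=` pbox (fun=> `[- M, M]%classic) -> uset K `<=` U ->
  forall c, 0 < c -> vol n (uset K) = (c%:E * vol n (uset L))%E ->
  mixed_bm c (uset L) (uset K).
Proof.
move=> M0.
have [N] := ubnP (size L + size K)%N.
elim: N L K => [//|N IHN] L K szN gL gK L0 K0 LM LU KM KU c c0 cE.
have mL := measurable_uset L; have mK := measurable_uset K.
have finM (B : set V) : measurable B -> B `<=` pbox (fun=> `[- M, M]%classic) ->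
    exists r, vol n B = r%:E.
  move=> mB BM; exists (fine (vol n B)); rewrite fineK// ge0_fin_numE//.
  apply: (@le_lt_trans _ _ (vol n (pbox (fun=> `[- M, M]%classic)))).
    by apply: le_measure; rewrite ?inE//; exact: measurable_pbox.
  rewrite vol_pbox//; under eq_bigr do rewrite lebesgue_measure_itv/=.
  by case: ifP => _; rewrite -?EFinB prodEFin ltry.
have cut i a b :
    ((size (lo_cuts i a L) + size (lo_cuts i b K)).+1 < N.+1)%N ->
    ((size (up_cuts i a L) + size (up_cuts i b K)).+1 < N.+1)%N ->
    lo_cuts i a L != [::] -> up_cuts i a L != [::] ->
    lo_cuts i b K != [::] -> up_cuts i b K != [::] ->
    vol n (uset K `&` halfspace i b) = (c%:E * vol n (uset L `&` halfspace i a))%E ->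
    mixed_bm c (uset L) (uset K).
  move=> s1 s2 L1 L2 K1 K2 E.
  have E2 : vol n (uset K `\` halfspace i b) = (c%:E * vol n (uset L `\` halfspace i a))%E.
    have mHa := measurable_halfspace i a; have mHb := measurable_halfspace i b.
    have D1 : vol n (uset K) = (vol n (uset K `\` halfspace i b) +
      vol n (uset K `&` halfspace i b))%E by exact: measureDI.
    have D2 : vol n (uset L) = (vol n (uset L `\` halfspace i a) +
      vol n (uset L `&` halfspace i a))%E by exact: measureDI.
    have := cE; rewrite D1 D2 E.
    have [x1 ->] := finM _ (measurableD mK mHb) (subset_trans (@subDsetl _ _ _) KM).
    have [x2 ->] := finM _ (measurableD mL mHa) (subset_trans (@subDsetl _ _ _) LM).
    have [x3 ->] := finM _ (measurableI _ _ mL mHa) (subset_trans (@subIsetl _ _ _) LM).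
    by rewrite -!EFinM -!EFinD => -[] h; congr EFin; lra.
  apply: (@mixed_bm_cut c _ _ i a b) => //.
    rewrite -uset_lo_cuts -uset_lo_cuts; apply: IHN => //; rewrite ?uset_lo_cuts//.
    - exact: good_lo_cuts.
    - exact: good_lo_cuts.
    - by move=> x [/LM].
    - by move=> x [/LU].
    - by move=> x [/KM].
    - by move=> x [/KU].
  rewrite -uset_up_cuts -uset_up_cuts; apply: IHN => //; rewrite ?uset_up_cuts//.
  - exact: good_up_cuts.
  - exact: good_up_cuts.
  - by move=> x [/LM].
  - by move=> x [/LU].
  - by move=> x [/KM].
  - by move=> x [/KU].
have cut_nil i a Q : good_boxes Q -> uset Q `<=` pbox (fun=> `[- M, M]%classic) ->
    (0 < vol n (uset Q `&` halfspace i a))%E ->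
    (vol n (uset Q `&` halfspace i a) < vol n (uset Q))%E ->
    lo_cuts i a Q != [::] /\ up_cuts i a Q != [::].
  move=> gQ QM Q1 Q2; split; apply/eqP => h.
    by move: Q1; rewrite -uset_lo_cuts h (_ : uset [::] = set0) ?measure0 ?ltxx//;
      apply/seteqP; split => // x [q].
  have D1 : vol n (uset Q) = (vol n (uset Q `\` halfspace i a) +
    vol n (uset Q `&` halfspace i a))%E.
    by apply: measureDI; [exact: measurable_uset|exact: measurable_halfspace].
  by move: Q2; rewrite D1 -uset_up_cuts h (_ : uset [::] = set0) ?measure0 ?add0e ?ltxx//;
      apply/seteqP; split => // x [q].
have strict (Q : seq boxT) i a : good_boxes Q ->
    uset Q `<=` pbox (fun=> `[- M, M]%classic) ->
    (exists2 p, p \in Q & p.2 0 i <= a) -> (exists2 q, q \in Q & a <= q.1 0 i) ->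
    (0 < vol n (uset Q `&` halfspace i a))%E /\
    (vol n (uset Q `&` halfspace i a) < vol n (uset Q))%E.
  move=> gQ QM [p pQ pa] [q qQ qa].
  have mQ := measurable_uset Q; have mH := measurable_halfspace i a.
  have pos (u : boxT) (B : set V) : u \in Q -> measurable B -> bset u `<=` B ->
      (0 < vol n B)%E.
    move=> uQ mB uB; apply: (@lt_le_trans _ _ (vol n (bset u))).
      have un : nondeg u by case/andP : gQ => /allP/(_ u uQ).
      rewrite vol_bset// lte_fin prodr_gt0// => j _; rewrite subr_gt0.
      exact: (forallP un).
    by apply: le_measure; rewrite ?inE//; exact: measurable_bset.
  have p1 : (0 < vol n (uset Q `&` halfspace i a))%E.
    apply: (pos p) => //; first exact: measurableI.
    move=> x px; split; first by exists p.
    by have := px i; rewrite /= in_itv/= => /andP[_ h]; exact: lt_le_trans pa.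
  have p2 : (0 < vol n (uset Q `\` halfspace i a))%E.
    apply: (pos q) => //; first exact: measurableD.
    move=> x qx; split; first by exists q.
    have := qx i; rewrite /= in_itv/= => /andP[h _].
    by apply/negP; rewrite -leNgt; exact: le_trans h.
  split => //.
  have D1 : vol n (uset Q) = (vol n (uset Q `\` halfspace i a) +
    vol n (uset Q `&` halfspace i a))%E by exact: measureDI.
  have [x1 E1] := finM _ (measurableD mQ mH) (subset_trans (@subDsetl _ _ _) QM).
  have [x2 E2] := finM _ (measurableI _ _ mQ mH) (subset_trans (@subIsetl _ _ _) QM).
  by move: p2; rewrite D1 E1 E2 -EFinD !lte_fin ltrDr.
have split (Q : seq boxT) : good_boxes Q -> (1 < size Q)%N -> exists i a,
    (exists2 p, p \in Q & p.2 0 i <= a) /\ (exists2 q, q \in Q & a <= q.1 0 i).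
  case: Q => [//|p [//|q Q]] /andP[_ /= /andP[/andP[/existsP[i /orP[h|h]] _] _]] _.
  - by exists i, (q.1 0 i); split; [exists p|exists q] => //; rewrite !inE eqxx ?orbT.
  - by exists i, (p.1 0 i); split; [exists q|exists p] => //; rewrite !inE eqxx ?orbT.
have [vL EL] := finM _ mL LM; have [vK EK] := finM _ mK KM.
have [L1|L1] := ltnP 1 (size L).
  have [i [a [pL qL]]] := split L gL L1.
  have [h1 h2] := strict L i a gL LM pL qL.
  have [v Ev] := finM _ (measurableI _ _ mL (measurable_halfspace i a))
    (subset_trans (@subIsetl _ _ _) LM).
  have [v0 vvL] : 0 < v /\ v < vL by move: h1 h2; rewrite Ev EL !lte_fin.
  have cv : ((c * v)%:E <= vol n (uset K))%E.
    by rewrite cE EL -EFinM lee_fin ler_wpM2l ?ltW.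
  (* K is cut so that the part below has c times the volume v of the lower part of L. *)
  have [b Eb] := proportional_cut i mK M0 KM (mulr_ge0 (ltW c0) (ltW v0)) cv.
  have [L2 L3] := cut_nil i a L gL LM h1 h2.
  have [K2 K3] : lo_cuts i b K != [::] /\ up_cuts i b K != [::].
    apply: (cut_nil i b) => //; rewrite Eb ?lte_fin ?mulr_gt0//.
    by rewrite cE EL -EFinM lte_fin ltr_pM2l.
  apply: (cut i a b) => //; last by rewrite Eb Ev EFinM.
    case: qL => q qL qa; have := size_lo_cuts_lt qL qa; have := size_lo_cuts i b K.
    by move: szN; clear; lia.
  case: pL => q qL' qa; have := size_up_cuts_lt qL' qa; have := size_up_cuts i b K.
  by move: szN; clear; lia.
have [K1|K1] := ltnP 1 (size K).
  have [i [b [pK qK]]] := split K gK K1.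
  have [h1 h2] := strict K i b gK KM pK qK.
  have [v Ev] := finM _ (measurableI _ _ mK (measurable_halfspace i b))
    (subset_trans (@subIsetl _ _ _) KM).
  have [v0 vvK] : 0 < v /\ v < c * vL.
    by move: h1 h2; rewrite Ev cE EL -EFinM !lte_fin.
  have cv : ((c^-1 * v)%:E <= vol n (uset L))%E.
    by rewrite EL lee_fin mulrC ler_pdivrMr// mulrC ltW.
  have iv0 : 0 <= c^-1 * v by nneg.
  have [a Ea] := proportional_cut i mL M0 LM iv0 cv.
  have [K2 K3] := cut_nil i b K gK KM h1 h2.
  have [L2 L3] : lo_cuts i a L != [::] /\ up_cuts i a L != [::].
    apply: (cut_nil i a) => //; rewrite Ea ?lte_fin ?mulr_gt0 ?invr_gt0//.
    by rewrite EL lte_fin mulrC ltr_pdivrMr// mulrC.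
  apply: (cut i a b) => //; last by rewrite Ev Ea -EFinM mulrA mulfV ?mul1r// gt_eqF.
    case: qK => q qK qa; have := size_lo_cuts_lt qK qa; have := size_lo_cuts i a L.
    by move: szN; clear; lia.
  case: pK => q qK' qa; have := size_up_cuts_lt qK' qa; have := size_up_cuts i a L.
  by move: szN; clear; lia.
move: L K L1 K1 gL gK L0 K0 LU KU cE {IHN szN LM KM mL mK finM cut cut_nil strict split EL EK}.
case=> [//|p [|//]] [//|q [|//]] _ _ /andP[/= /andP[pn _] _] /andP[/= /andP[qn _] _] _ _.
have us1 (u : boxT) : uset [:: u] = bset u.
  apply/seteqP; split => x; first by move=> [w]; rewrite inE => /eqP ->.
  by move=> ux; exists u => //; rewrite inE.
by rewrite !us1 => pU qU cE; exact: mixed_bm_box.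
Qed.

End mixed_brunn_minkowski.

Lemma ge0_dominated_cvg d (T : measurableType d) (R : realType)
    (mu : {measure set T -> \bar R}) (f_ : nat -> T -> R) (f g : T -> R) :
  (forall k, mfunT (f_ k)) -> mfunT f ->
  mfunT g -> (forall x, f_ ^~ x @ \oo --> f x) ->
  (forall k x, 0 <= f_ k x <= g x) -> (\int[mu]_x (g x)%:E < +oo)%E ->
  (\int[mu]_x (f_ k x)%:E)%E @[k --> \oo] --> (\int[mu]_x (f x)%:E)%E.
Proof.
move=> mf_ mf mg cf fg goo.
have g0 x : 0 <= g x by have /andP[h1 h2] := fg 0%N x; exact: le_trans h2.
have [] // := @dominated_convergence _ _ _ mu setT measurableT
  (fun k => EFin \o f_ k) (EFin \o f) (EFin \o g).
- by move=> k; exact/measurable_EFinP.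
- exact/measurable_EFinP.
- by apply: aeW => x _; apply: cvg_EFin; [exact: nearW|exact: cf].
- apply/integrableP; split; first exact/measurable_EFinP.
  by under eq_integral do rewrite /= ger0_norm//.
- by apply: aeW => x k _ /=; rewrite lee_fin ger0_norm; have /andP[] := fg k x.
Qed.

(** * Inner approximation of open sets by boxes *)

Section grid.
Context {R : realType} (n M : nat).
Local Notation V := 'rV[R]_n.

(** The cells of mesh 1 / (k + 1) tile the cube [-M, M[^n; [f i] is the number of the cell in
    direction i. *)
Definition gbox (k : nat) (f : {ffun 'I_n -> 'I_(2 * M * k.+1)}) : @boxT R n :=
  (\row_i ((f i)%:R / k.+1%:R - M%:R), \row_i ((f i).+1%:R / k.+1%:R - M%:R)).

Definition gboxes (k : nat) (A : set V) :=
  [seq gbox f | f <- enum {ffun 'I_n -> 'I_(2 * M * k.+1)} & `[< bset (gbox f) `<=` A >]].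

Lemma good_gboxes k A : good_boxes (gboxes k A).
Proof.
apply/andP; split.
  apply/allP => _ /mapP[f _ ->]; apply/forallP => i; rewrite !mxE.
  by rewrite ltrD2r ltr_pM2r ?invr_gt0 ?ltr0n// ltr_nat.
rewrite pairwise_map; apply: pairwise_filter.
apply: (@sub_pairwise _ [rel f g | f != g]); last by rewrite -uniq_pairwise enum_uniq.
move=> f g /= /eqP fg; apply/existsP.
have [i fgi] : exists i, f i != g i.
  apply/existsP; rewrite -negb_forall; apply/negP => /forallP h; apply: fg.
  by apply/ffunP => i; apply/eqP.
exists i; rewrite !mxE !lerD2r !ler_pM2r ?invr_gt0 ?ltr0n// !ler_nat.
by move: fgi; rewrite -val_eqE neq_ltn.
Qed.

Lemma sub_gboxes k A : uset (gboxes k A) `<=` A.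
Proof.
move=> x [p /mapP[f]]; rewrite mem_filter => /andP[/asboolP fA _] ->.
exact: fA.
Qed.

Lemma gboxes_cover k (A : set V) x (e : R) : (2 * n.+1)%:R / e < k.+1%:R -> 0 < e ->
  (forall y, enorm (y - x) < e -> A y) ->
  pbox (fun=> `[- M%:R, M%:R[%classic) x -> uset (gboxes k A) x.
Proof.
move=> ke e0 xA xM.
have k0 : 0 < k.+1%:R :> R by rewrite ltr0n.
have xi0 i : 0 <= (x 0 i + M%:R) * k.+1%:R.
  by rewrite mulr_ge0 ?(ltW k0)//; have := xM i; rewrite /= in_itv/=; lra.
have fi i : (Num.truncn ((x 0 i + M%:R) * k.+1%:R)%R < 2 * M * k.+1)%N.
  rewrite -(ltr_nat R); apply: (@le_lt_trans _ _ ((x 0 i + M%:R) * k.+1%:R)).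
    by rewrite truncn_le.
  rewrite natrM ltr_pM2r// natrM; have := xM i; rewrite /= in_itv/=; lra.
pose f := [ffun i => Ordinal (fi i)] : {ffun 'I_n -> 'I_(2 * M * k.+1)}.
have fx : bset (gbox f) x.
  move=> i /=; rewrite in_itv/= !mxE !ffunE/= lerBlDr ltrBrDr.
  rewrite ler_pdivrMr// ltr_pdivlMr//.
  by rewrite truncn_le xi0 truncnS_gt.
exists (gbox f) => //; apply/mapP; exists f => //; rewrite mem_filter mem_enum andbT.
apply/asboolP => y fy; apply: xA; apply: le_lt_trans (ler_enorm_sum _) _.
apply: (@le_lt_trans _ _ (\sum_(i < n) k.+1%:R^-1)).
  apply: ler_sum => i _.
  have := fy i; have := fx i; rewrite /= !in_itv/= !mxE.
  have -> : (f i).+1%:R / k.+1%:R = (f i)%:R / k.+1%:R + k.+1%:R^-1 :> R.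
    by rewrite -natr1 mulrDl mul1r.
  set a := (f i)%:R / _; set b := k.+1%:R^-1.
  move=> /andP[h1 h2] /andP[h3 h4]; rewrite ler_norml; apply/andP; split; lra.
rewrite sumr_const card_ord -[_ *+ n]mulr_natr mulrC ltr_pdivrMr// mulrC.
move: ke; rewrite ltr_pdivrMr// => ke.
apply: le_lt_trans ke; rewrite ler_nat; lia.
Qed.

End grid.

(** * Mixed Brunn-Minkowski inequality for open sets *)

Section open_bm.
Context {R : realType} (n M : nat).
Local Notation V := 'rV[R]_n.
Variables (U : set V) (s : V -> R) (t : R).
Hypotheses (UM : U `<=` pbox (fun=> `]- M%:R, M%:R[%classic)) (oU : eopen U) (ms : mfunT s)
  (s0 : forall x, 0 <= s x) (t01 : 0 <= t <= 1) (sconc : forall x y, U x -> U y ->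
  (1 - t) * s x + t * s y <= s ((1 - t) *: x + t *: y)).
Hypothesis nuUoo : (\int[vol n]_x (\1_U x * s x)%:E < +oo)%E.

Lemma gboxes_cvg (A : set V) (g : V -> R) : eopen A -> A `<=` U ->
  mfunT g -> (forall x, 0 <= g x) ->
  (\int[vol n]_x (\1_U x * g x)%:E < +oo)%E ->
  (\int[vol n]_x (\1_(uset (gboxes M k A)) x * g x)%:E)%E @[k --> \oo] -->
  (\int[vol n]_x (\1_A x * g x)%:E)%E.
Proof.
move=> oA AU mg g0 goo.
have mA := measurable_eopen oA; have mU := measurable_eopen oU.
apply: (@ge0_dominated_cvg _ _ _ _ _ _ (fun x => \1_U x * g x)) => //.
- by move=> k; apply: measurable_funM => //; apply: measurable_indic;
    exact: measurable_uset.
- by meas.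
- by meas.
- move=> x; apply: cvgM; last exact: cvg_cst.
  rewrite !indicE; have [/[!inE] Ax|xA] := boolP (x \in A); last first.
    rewrite (_ : (fun k => _) = cst 0); first exact: cvg_cst.
    apply/funext => k; rewrite indicE; apply/eqP; rewrite pnatr_eq0 eqb0.
    by apply: contra xA; rewrite !inE; exact: sub_gboxes.
  have [e e0 he] := oA x Ax.
  apply: cvg_near_cst; near=> k; rewrite indicE mem_set//.
  apply: (@gboxes_cover _ _ _ _ _ _ e) => //.
    near: k; exists (Num.truncn ((2 * n.+1)%:R / e)) => // k /= hk.
    by apply: lt_le_trans (truncnS_gt _) _; rewrite ler_nat.
  by move=> i; have := UM (AU x Ax) i; rewrite /= !in_itv/= => /andP[/ltW -> ->].
- move=> k x; rewrite mulr_ge0//= ler_wpM2r// !indicE ler_nat.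
  case: (boolP (x \in uset _)) => // /[!inE] /sub_gboxes/AU Ux.
  by rewrite mem_set.
Unshelve. all: by end_near. Qed.

(** Limit of [mixed_bm_boxes] along inner box approximations of A and K, whose volume ratios
    converge. The power c^t is first weakened to 1 + t (1 - 1/c), by c^t >= 1 + t ln c and ln c >= 1
    - 1/c, so that the bound is a rational expression in the volumes. The names [vU] and [nU] belong
    to K, because K = U in the Cheeger inequality. *)
Lemma mixed_bm_open (A K W : set V) : eopen A -> A `<=` U -> A !=set0 ->
  eopen K -> K `<=` U -> K !=set0 -> measurable W ->
  (forall x y, A x -> K y -> W ((1 - t) *: x + t *: y)) ->
  forall vU vA nU nA : R, vU = fine (vol n K) -> vA = fine (vol n A) ->
  nU = fine (\int[vol n]_x (\1_K x * s x)%:E)%E ->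
  nA = fine (\int[vol n]_x (\1_A x * s x)%:E)%E ->
  (((1 + t * (1 - vA / vU)) * ((1 - t) * nA + t * (vA / vU * nU)))%:E <=
   \int[vol n]_x (\1_W x * s x)%:E)%E.
Proof.
move=> oA AU A0 oK KU K0 mW AUW vU vA nU nA vUE vAE nUE nAE.
have mA := measurable_eopen oA; have mU := measurable_eopen oU.
have mK := measurable_eopen oK.
pose g B k := uset (@gboxes R n M k B).
pose nu (B : set V) : \bar R := (\int[vol n]_x (\1_B x * s x)%:E)%E.
have volE B : measurable B -> vol n B = (\int[vol n]_x (\1_B x * (fun=> 1) x)%:E)%E.
  move=> mB; rewrite -[LHS]mul1e -integral_cst// [LHS]integral_mkcond.
  by apply: eq_integral => x _; rewrite patchE indicE; case: ifP; rewrite ?mul1r ?mul0r.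
have nuE B : measurable B -> nu B = (\int[vol n]_(x in B) (s x)%:E)%E.
  move=> mB; rewrite [RHS]integral_mkcond; apply: eq_integral => x _.
  by rewrite patchE indicE; case: ifP; rewrite ?mul1r ?mul0r.
have mg B k : measurable (g B k) by exact: measurable_uset.
have M0 : 0 <= M%:R :> R by [].
have UM' : U `<=` pbox (fun=> `[- M%:R, M%:R]%classic).
  by move=> x /UM h i; have := h i; rewrite /= !in_itv/= => /andP[/ltW -> /ltW].
have volUoo : (vol n U < +oo)%E.
  apply: (@le_lt_trans _ _ (vol n (pbox (fun=> `[- M%:R, M%:R]%classic)))).
    by apply: le_measure; rewrite ?inE//; exact: measurable_pbox.
  rewrite vol_pbox//; under eq_bigr do rewrite lebesgue_measure_itv/=.
  by case: ifP => _; rewrite -?EFinB prodEFin ltry.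
have volUoo1 : (\int[vol n]_x (\1_U x * (fun=> 1) x)%:E < +oo)%E by rewrite -volE.
have cvgv B : eopen B -> B `<=` U ->
    fine (vol n (g B k)) @[k --> \oo] --> fine (vol n B).
  move=> oB BU; apply: fine_cvg; rewrite fineK; last first.
    rewrite ge0_fin_numE//; apply: le_lt_trans volUoo.
    by apply: le_measure; rewrite ?inE//; exact: measurable_eopen.
  rewrite volE; last exact: measurable_eopen.
  under eq_fun do rewrite volE//.
  exact: gboxes_cvg.
have lenu B C : measurable B -> measurable C -> B `<=` C -> (nu B <= nu C)%E.
  move=> mB mC BC; apply: ge0_le_integral => //.
  - by nneg.
  - by meas.
  - by meas.
  move=> x _; rewrite lee_fin ler_wpM2r// !indicE ler_nat.
  by case: (boolP (x \in B)) => // /[!inE] /BC Cx; rewrite mem_set.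
have nufin B : measurable B -> B `<=` U -> nu B \is a fin_num.
  move=> mB BU; rewrite ge0_fin_numE; last first.
    by apply: integral_ge0 => x _; rewrite lee_fin mulr_ge0.
  exact: le_lt_trans (lenu _ _ mB mU BU) nuUoo.
have volfin B : measurable B -> B `<=` U -> vol n B \is a fin_num.
  move=> mB BU; rewrite ge0_fin_numE//; apply: le_lt_trans volUoo.
  by apply: le_measure; rewrite ?inE.
have gU B k : B `<=` U -> g B k `<=` U by move=> BU; apply: subset_trans BU; exact: sub_gboxes.
have cvgn B : eopen B -> B `<=` U -> fine (nu (g B k)) @[k --> \oo] --> fine (nu B).
  move=> oB BU; apply: fine_cvg; rewrite fineK; last first.
    by apply: nufin => //; exact: measurable_eopen.
  exact: gboxes_cvg.
have vA0 : 0 < vA by rewrite vAE fine_gt0// (vol_eopen_gt0 oA A0)/= -ge0_fin_numE// volfin.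
have vU0 : 0 < vU.
  by rewrite vUE fine_gt0// (vol_eopen_gt0 oK K0)/= -ge0_fin_numE// volfin.
pose va k := fine (vol n (g A k)); pose vu k := fine (vol n (g K k)).
have cva : va k @[k --> \oo] --> vA by rewrite vAE; exact: cvgv.
have cvu : vu k @[k --> \oo] --> vU by rewrite vUE; exact: cvgv.
pose F k := (1 + t * (1 - va k / vu k)) *
   ((1 - t) * fine (nu (g A k)) + t * (va k / vu k * fine (nu (g K k)))).
have cF : F k @[k --> \oo] -->
    (1 + t * (1 - vA / vU)) * ((1 - t) * nA + t * (vA / vU * nU)).
  have cq : va k / vu k @[k --> \oo] --> vA / vU.
    by apply: cvgM => //; apply: cvgV => //; rewrite gt_eqF.
  apply: cvgM.
    apply: cvgD; first exact: cvg_cst.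
    by apply: (cvgM (cvg_cst _)); apply: cvgB => //; exact: cvg_cst.
  apply: cvgD; first by apply: (cvgM (cvg_cst _)); rewrite nAE; exact: cvgn.
  by apply: (cvgM (cvg_cst _)); apply: cvgM => //; rewrite nUE; exact: cvgn.
rewrite -/(nu W); have [->|Woo] := eqVneq (nu W) +oo%E; first by rewrite leey.
have Wfin : nu W \is a fin_num.
  rewrite ge0_fin_numE ?lt_neqAle ?Woo ?leey//.
  by apply: integral_ge0 => x _; rewrite lee_fin mulr_ge0.
rewrite -(fineK Wfin) lee_fin.
apply: (cvgr_to_le cF).
have va0 : \forall k \near \oo, 0 < va k by exact: (cvgr_gt vA).
near=> k.
have vak : 0 < va k by near: k.
have vuk : 0 < vu k by near: k; exact: (cvgr_gt vU).
have gn B : B `<=` U -> 0 < fine (vol n (g B k)) -> gboxes M k B != [::].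
  move=> BU; apply: contraTneq => h.
  by rewrite /g h (_ : uset [::] = set0) ?measure0 ?ltxx//; apply/seteqP; split => // x [].
have gM B : B `<=` U -> g B k `<=` pbox (fun=> `[- M%:R, M%:R]%classic).
  by move=> BU; exact: subset_trans (gU B k BU) UM'.
have AU' := gU A k AU; have UU' := gU K k KU.
set c := vu k / va k; have c0 : 0 < c by rewrite divr_gt0.
have cE : vol n (g K k) = (c%:E * vol n (g A k))%E.
  rewrite -[LHS]fineK ?volfin// -[in RHS](fineK (volfin _ (mg A k) AU')).
  by rewrite -EFinM; congr EFin; rewrite /c divfK// gt_eqF.
have := @mixed_bm_boxes R n U s t ms s0 t01 sconc M%:R _ _ M0 (good_gboxes M k A)
  (good_gboxes M k K) (gn A AU vak) (gn K KU vuk)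
  (gM A AU) AU' (gM K KU) UU' c c0 cE W mW.
have AUW' x y : g A k x -> g K k y -> W ((1 - t) *: x + t *: y).
  by move=> /sub_gboxes Ax /sub_gboxes Ky; exact: AUW.
move=> /(_ AUW').
rewrite -(nuE _ (mg A k)) -(nuE _ (mg K k)) -(nuE _ mW).
have Ea : nu (g A k) = (fine (nu (g A k)))%:E by rewrite fineK// nufin.
have Eu : nu (g K k) = (fine (nu (g K k)))%:E by rewrite fineK// nufin.
have Ew : nu W = (fine (nu W))%:E by rewrite fineK.
move=> h.
have : ((c `^ t * ((1 - t) * fine (nu (g A k)) + t / c * fine (nu (g K k))))%:E <=
    (fine (nu W))%:E)%E.
  by rewrite -Ew EFinM EFinD (EFinM (1 - t)) (EFinM (t / c)) -Ea -Eu.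
rewrite lee_fin.
apply: le_trans; rewrite /F.
have /andP[t0 t1] := t01.
have -> : t / c = t * (va k / vu k) by rewrite /c invf_div.
rewrite -[t * (va k / vu k) * _]mulrA ler_wpM2r//.
  by rewrite addr_ge0// !mulr_ge0 ?subr_ge0 ?fine_ge0 ?invr_ge0 ?(ltW vuk)//;
    apply: integral_ge0 => x _; rewrite lee_fin mulr_ge0.
have : 1 + t * ln c <= c `^ t by rewrite /powR gt_eqF//; exact: expR_ge1Dx.
apply: le_trans; rewrite lerD2l ler_wpM2l//.
have ci0 : 0 < c^-1 by rewrite invr_gt0.
have cm : -1 < c^-1 - 1 by lra.
have := le_ln1Dx cm; rewrite addrC subrK lnV ?posrE//.
by rewrite {2}/c invf_div; lra.
Unshelve. all: by end_near. Qed.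

End open_bm.

Lemma indic_itv_lt (R : realType) (l c : R) : c <= 1 ->
  \1_(`[0, 1[%classic : set R) l * (l < c)%R%:R = \1_(`[0, c[%classic : set R) l :> R.
Proof.
move=> c1; rewrite !indicE !mem_setE !in_itv/= -natrM mulnb.
by case: (0 <= l) => //=; case: (ltP l c) => [lc|]; rewrite ?andbF// (lt_le_trans lc).
Qed.

(** * Layer-cake formula *)

Section layer_cake.
Context d (T : measurableType d) (R : realType).
Variable mu : {sigma_finite_measure set T -> \bar R}.
Local Notation leb := (@lebesgue_measure R).

Lemma measurable_lt_graph (h : T -> R) : mfunT h ->
  measurable [set zl : T * R | zl.2 < h zl.1].
Proof.
move=> mh; rewrite (_ : [set _ | _] =
    (fun zl : T * R => h zl.1 - zl.2) @^-1` `]0, +oo[).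
  rewrite -[_ @^-1` _]setTI; apply: measurable_funB => //.
  by meas.
by apply/seteqP; split => zl /=; rewrite in_itv/= andbT subr_gt0.
Qed.

Lemma layer_cake (h f : T -> R) : mfunT h -> mfunT f ->
  (forall z, 0 <= h z <= 1) -> (forall z, 0 <= f z) ->
  (\int[leb]_(l in `[0%R, 1%R[) \int[mu]_z (\1_[set z | (l < h z)%R] z * f z)%:E =
   \int[mu]_z (h z * f z)%:E)%E.
Proof.
move=> mh mf h01 f0.
pose F (zl : T * R) : \bar R :=
  (\1_`[0%R, 1%R[%classic zl.2 * (\1_[set zl : T * R | zl.2 < h zl.1] zl * f zl.1))%:E.
have mF : mfunT F.
  apply/measurable_EFinP; apply: measurable_funM.
    have m1 : mfunT (\1_(`[0%R, 1%R[%classic : set R) : R -> R).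
      by meas.
    by meas.
  apply: measurable_funM; first by apply: measurable_indic; exact: measurable_lt_graph.
  by meas.
have F0 zl : (0 <= F zl)%E by nneg.
have := @fubini_tonelli _ _ _ _ R mu leb F mF F0.
rewrite (eq_integral (fun z => (h z * f z)%:E)); last first.
  move=> z _; rewrite /F/=.
  transitivity (\int[leb]_l ((f z)%:E * (\1_(`[0%R, h z[%classic) l)%:E))%E.
    apply: eq_integral => l _; rewrite -EFinM; congr EFin.
    rewrite mulrCA [RHS]mulrC [LHS]mulrA [LHS]mulrC mulrC; congr (_ * _).
    have /andP[_ h1] := h01 z.
    rewrite -(indic_itv_lt l h1) mulrC; congr (_ * _).
    by rewrite indicE; congr (_%:R); congr nat_of_bool; apply/idP/idP; rewrite inE.
  rewrite ge0_integralZl_EFin//; last exact/measurable_EFinP.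
  have /andP[h0 _] := h01 z.
  rewrite integral_indic// setIT [RHS]EFinM muleC; congr (_ * _)%E.
  apply: etrans (lebesgue_measure_itv `[0, h z[) _ => /=.
  rewrite lte_fin; case: ltP => [_|hz]; first by rewrite oppr0 addr0.
  by congr EFin; apply/eqP; rewrite eq_le h0.
move=> ->; rewrite integral_mkcond; apply: eq_integral => l _.
rewrite patchE; case: ifPn => [l01|l01].
  by apply: eq_integral => z _; rewrite /F/= !indicE l01 mul1r.
by rewrite integral0_eq// => z _; rewrite /F/= indicE (negPf l01) mul0r.
Qed.

Lemma measurable_level (h f : T -> R) : mfunT h ->
  mfunT f -> (forall z, 0 <= f z) ->
  mfunT
    (fun l : R => \int[mu]_z (\1_[set z | (l < h z)%R] z * f z)%:E)%E.
Proof.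
move=> mh mf f0.
pose F (zl : T * R) : \bar R := (\1_[set zl : T * R | zl.2 < h zl.1] zl * f zl.1)%:E.
have mF : mfunT F.
  apply/measurable_EFinP; apply: measurable_funM.
    by apply: measurable_indic; exact: measurable_lt_graph.
  by meas.
have F0 zl : (0 <= F zl)%E by nneg.
have := @measurable_fun_fubini_tonelli_G _ _ _ _ R mu F mF F0.
by meas.
Qed.

End layer_cake.

Lemma integral01_affine (R : realType) (X Y : R -> \bar R) (a c : R) :
  let I := (`[0%R, 1%R[%classic : set R) in
  let leb := @lebesgue_measure R in
  measurable_fun I X -> measurable_fun I Y -> (forall l, 0 <= X l)%E ->
  (forall l, 0 <= Y l)%E -> 0 <= a -> 0 <= c ->
  (\int[leb]_(l in I) (X l + a%:E * Y l + c%:E) =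
   \int[leb]_(l in I) X l + a%:E * \int[leb]_(l in I) Y l + c%:E)%E.
Proof.
move=> I leb mX mY X0 Y0 a0 c0.
have mI : measurable I by exact: measurable_itv.
have aY0 l : (0 <= a%:E * Y l)%E by nneg.
rewrite ge0_integralD//; last 2 first.
- by nneg.
- by apply: emeasurable_funD => //; exact: measurable_funeM.
rewrite ge0_integralD//; last exact: measurable_funeM.
rewrite ge0_integralZl_EFin//; congr (_ + _)%E.
rewrite integral_cst// -[RHS]mule1; congr (_ * _)%E.
apply: etrans (lebesgue_measure_itv `[0, 1[) _ => /=.
by rewrite lte_fin ltr01 oppr0 addr0.
Qed.

Lemma integral01_le (R : realType) (X Y : R -> \bar R) :
  let I := (`[0%R, 1%R[%classic : set R) in
  let leb := @lebesgue_measure R in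
  measurable_fun I X -> measurable_fun I Y -> (forall l, 0 <= X l)%E ->
  (forall l, (0 <= l < 1)%R -> X l <= Y l)%E ->
  (\int[leb]_(l in I) X l <= \int[leb]_(l in I) Y l)%E.
Proof.
move=> I leb mX mY X0 XY; have mI : measurable I by exact: measurable_itv.
by apply: ge0_le_integral => // l; rewrite /I/= in_itv/=; exact: XY.
Qed.

(** Here y = vA / vU, and the hypothesis is [mixed_bm_open] with K = U. To first order in t its left
    side is nA + t y (nU - nA); for y <= 1/2 the loss t y nA is at most t nA / 2. The complementary
    levels make up for this loss. *)
Lemma level_small_ineq (R : realFieldType) (t y nA nU nW : R) :
  0 <= t <= 1 -> 0 <= y <= 1 / 2 -> 0 <= nA <= nU ->
  (1 + t * (1 - y)) * ((1 - t) * nA + t * (y * nU)) <= nW ->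
  nA + t * y * nU <= nW + (t / 2 * nA + t ^+ 2 * nU).
Proof.
move=> /andP[t0 t1] /andP[y0 y1] /andP[n0 n1] h.
have p1 : 0 <= t * nA * (1 / 2 - y) by rewrite !mulr_ge0 ?subr_ge0.
have p2 : 0 <= t ^+ 2 * (nU - (1 - y) * nA).
  by rewrite mulr_ge0 ?sqr_ge0// subr_ge0; have := mulr_ge0 y0 n0; lra.
have p3 : 0 <= t ^+ 2 * (y * (1 - y) * nU).
  by rewrite mulr_ge0 ?sqr_ge0// !mulr_ge0//; lra.
lra.
Qed.

(** For y >= 1/2 the first-order gain t y (nU - nA) is at least t (nU - nA) / 2. *)
Lemma level_large_ineq (R : realFieldType) (t y nA nU nW : R) :
  0 <= t <= 1 -> 1 / 2 <= y <= 1 -> 0 <= nA <= nU ->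
  (1 + t * (1 - y)) * ((1 - t) * nA + t * (y * nU)) <= nW ->
  nA + t / 2 * nU <= nW + (t / 2 * nA + t ^+ 2 * nU).
Proof.
move=> /andP[t0 t1] /andP[y0 y1] /andP[n0 n1] h.
have y00 : 0 <= y by lra.
have p1 : 0 <= t * (y - 1 / 2) * (nU - nA) by rewrite !mulr_ge0 ?subr_ge0.
have p2 : 0 <= t ^+ 2 * (nU - (1 - y) * nA).
  by rewrite mulr_ge0 ?sqr_ge0// subr_ge0; have := mulr_ge0 y00 n0; lra.
have p3 : 0 <= t ^+ 2 * (y * (1 - y) * nU).
  by rewrite mulr_ge0 ?sqr_ge0// !mulr_ge0//; lra.
lra.
Qed.

(** * Cheeger inequality for a concave weight *)

Section weighted_cheeger.
Context {R : realType} (n M : nat).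
Local Notation V := 'rV[R]_n.
Local Notation leb := (@lebesgue_measure R).
Variables (U : set V) (s : V -> R) (D : R).
Hypotheses (UM : U `<=` pbox (fun=> `]- M%:R, M%:R[%classic)) (oU : eopen U) (cU : econvex U)
  (U0 : U !=set0) (ms : mfunT s) (s0 : forall x, 0 <= s x) (spos : forall x, U x -> 0 < s x)
  (sconc : forall x y t, U x -> U y -> 0 <= t <= 1 ->
  (1 - t) * s x + t * s y <= s ((1 - t) *: x + t *: y))
  (nuUoo : (\int[vol n]_x (\1_U x * s x)%:E < +oo)%E).
Hypothesis UD : forall x y, U x -> U y -> enorm (x - y) <= D.

Let vU := fine (vol n U).
Let nU := fine (\int[vol n]_x (\1_U x * s x)%:E)%E.

Let mU : measurable U. Proof. exact: measurable_eopen. Qed.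

Let volUoo : (vol n U < +oo)%E.
Proof.
apply: (@le_lt_trans _ _ (vol n (pbox (fun=> `]- M%:R, M%:R[%classic)))).
  by apply: le_measure; rewrite ?inE//; exact: measurable_pbox.
rewrite vol_pbox//; under eq_bigr do rewrite lebesgue_measure_itv/=.
by case: ifP => _; rewrite -?EFinB prodEFin ltry.
Qed.

Let volUE : vol n U = vU%:E.
Proof. by rewrite fineK// ge0_fin_numE. Qed.

Let vU0 : 0 < vU.
Proof. by have := vol_eopen_gt0 oU U0; rewrite volUE lte_fin. Qed.

Let nuUE : (\int[vol n]_x (\1_U x * s x)%:E)%E = nU%:E.
Proof.
rewrite fineK// ge0_fin_numE//; apply: integral_ge0 => x _.
by nneg.
Qed.

Let D0 : 0 <= D.
Proof. by case: U0 => x Ux; apply: le_trans (UD Ux Ux); exact: enorm_ge0. Qed.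

(** Functional form of a Minkowski combination: for l >= 0 the set where [enlarge t G] exceeds l is
    (1 - t) {x in U | G x > l} + t U. Where no decomposition of z exists, the supremum of the empty
    set gives 0. *)
Definition enlarge (t : R) (G : V -> R) (z : V) : R :=
  sup [set G x | x in [set x | U x /\ exists2 y, U y & z = (1 - t) *: x + t *: y]].

Section enlarge.
Variables (G : V -> R) (t : R).
Hypothesis G01 : forall x, 0 <= G x <= 1.
Hypothesis t01 : 0 < t <= 1.

Let t01' : 0 <= t <= 1. Proof. by move: t01 => /andP[/ltW -> ->]. Qed.

Let E z := [set G x | x in [set x | U x /\ exists2 y, U y & z = (1 - t) *: x + t *: y]].

Let ubE z : ubound (E z) 1.
Proof. by move=> _ [x _ <-]; have /andP[] := G01 x. Qed.

Lemma enlarge_ge x y : U x -> U y -> G x <= enlarge t G ((1 - t) *: x + t *: y).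
Proof.
move=> Ux Uy; apply: ub_le_sup; first by exists 1; exact: ubE.
by exists x => //; split => //; exists y.
Qed.

Lemma enlarge01 z : 0 <= enlarge t G z <= 1.
Proof.
have [E0|/set0P Ez] := eqVneq (E z) set0.
  by rewrite /enlarge -/(E z) E0 sup0 lexx ler01.
apply/andP; split; last exact: (ge_sup Ez (@ubE z)).
have [_ [x xE _]] := Ez.
have /andP[h _] := G01 x; apply: le_trans h _.
by apply: ub_le_sup; [exists 1; exact: ubE|exists x].
Qed.

Lemma enlarge_notin z : ~ U z -> enlarge t G z = 0.
Proof.
move=> Uz; rewrite /enlarge -/(E z) (_ : E z = set0) ?sup0//.
apply/seteqP; split => // v [x [Ux [y Uy zE]] _]; apply: Uz.
by rewrite zE; exact: cU.
Qed.

Lemma enlarge_le z c : U z ->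
  (forall x, U x -> enorm (x - z) <= t * D -> G x <= c) -> enlarge t G z <= c.
Proof.
move=> Uz Gc; apply: ge_sup.
  exists (G z), z => //; split => //; exists z => //.
  by rewrite -scalerDl subrK scale1r.
move=> _ [x [Ux [y Uy zE]] <-]; apply: Gc => //.
have -> : x - z = t *: (x - y).
  by rewrite zE scalerBl scale1r opprD opprB addrA subrKC scalerBr.
have /andP[t0 _] := t01.
by rewrite enormZ gtr0_norm// ler_wpM2l ?(ltW t0)//; exact: UD.
Qed.

(** With x fixed, moving y by (z' - z) / t moves z to z', so openness comes from U alone and no
    continuity of G enters. *)
Lemma eopen_enlarge c : eopen [set z | c < enlarge t G z].
Proof.
move=> z /= cz; have [c0|c0] := ltP c 0.
  exists 1 => // y _; apply: lt_le_trans c0 _; by have /andP[] := enlarge01 y.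
have [E0|/set0P Ez] := eqVneq (E z) set0.
  by move: cz; rewrite /enlarge -/(E z) E0 sup0 ltNge c0.
have [_ [x [Ux [y Uy zE]] <-] cx] := sup_gt Ez cz.
have [e e0 he] := oU Uy; have /andP[t0 t1] := t01.
exists (t * e); first exact: mulr_gt0.
move=> z' zz'.
pose y' := y + t^-1 *: (z' - z).
have Uy' : U y'.
  apply: he; rewrite /y' addrC addKr enormZ gtr0_norm ?invr_gt0//.
  by rewrite mulrC ltr_pdivrMr// mulrC.
apply: lt_le_trans cx _.
have -> : z' = (1 - t) *: x + t *: y'.
  rewrite /y' scalerDr scalerA mulfV ?gt_eqF// scale1r addrA -zE.
  by rewrite addrC subrK.
exact: enlarge_ge.
Qed.

Lemma measurable_enlarge : mfunT (enlarge t G).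
Proof. exact: measurable_fun_lsc eopen_enlarge. Qed.

Let nu (A : set V) : \bar R := (\int[vol n]_x (\1_A x * s x)%:E)%E.

Let measurable_nu A : measurable A -> mfunT (fun x => (\1_A x * s x)%:E).
Proof.
by move=> mA; apply/measurable_EFinP/measurable_funM => //; exact: measurable_indic.
Qed.

Let nu_mono A B : measurable A -> measurable B -> A `<=` B -> (nu A <= nu B)%E.
Proof.
move=> mA mB AB; apply: ge0_le_integral => //; [|exact: measurable_nu..|].
  by nneg.
move=> x _; rewrite lee_fin ler_wpM2r// !indicE ler_nat.
by case: (boolP (x \in A)) => // /[!inE] /AB Bx; rewrite mem_set.
Qed.

Hypothesis oG : forall l, 0 <= l -> eopen (U `&` [set x | l < G x]).

Lemma level_bm l : 0 <= l -> exists vA nA nW : R,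
  [/\ vol n (U `&` [set x | l < G x]) = vA%:E,
      nu (U `&` [set x | l < G x]) = nA%:E,
      nu [set z | l < enlarge t G z] = nW%:E,
      [&& 0 <= vA <= vU & 0 <= nA <= nU] &
      (1 + t * (1 - vA / vU)) * ((1 - t) * nA + t * (vA / vU * nU)) <= nW].
Proof.
move=> l0; set A := U `&` _; set W := [set z | _].
have mA : measurable A by apply: measurable_eopen; exact: oG.
have mW : measurable W by apply: measurable_eopen; exact: eopen_enlarge.
have AU : A `<=` U by exact: subIsetl.
have WU : W `<=` U.
  move=> z; apply: contraPP => Uz; rewrite /W/= enlarge_notin//.
  by lra.
have fin B : measurable B -> B `<=` U -> nu B = (fine (nu B))%:E.
  move=> mB BU; rewrite fineK// ge0_fin_numE.
    exact: le_lt_trans (nu_mono mB mU BU) nuUoo.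
  by apply: integral_ge0 => x _; rewrite lee_fin mulr_ge0.
have volA : vol n A = (fine (vol n A))%:E.
  rewrite fineK// ge0_fin_numE//; apply: le_lt_trans volUoo.
  by apply: le_measure; rewrite ?inE.
exists (fine (vol n A)), (fine (nu A)), (fine (nu W)); split => //.
- exact: fin.
- exact: fin.
- rewrite !fine_ge0//=; last by apply: integral_ge0 => x _; rewrite lee_fin mulr_ge0.
  rewrite -!lee_fin -volA -fin// -volUE -nuUE; apply/andP; split.
    by apply: le_measure; rewrite ?inE.
  exact: nu_mono.
have [A0|/set0P A0] := eqVneq A set0.
  rewrite A0 measure0 /nu integral0_eq; last by move=> x _; rewrite indic0 mul0r.
  by rewrite !(mul0r, mulr0, addr0) fine_ge0//; apply: integral_ge0 => x _;
    rewrite lee_fin mulr_ge0.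
have sc x y : U x -> U y -> (1 - t) * s x + t * s y <= s ((1 - t) *: x + t *: y).
  by move=> Ux Uy; exact: sconc.
have AUW x y : A x -> U y -> W ((1 - t) *: x + t *: y).
  by move=> [Ux lx] Uy; apply: lt_le_trans lx _; exact: enlarge_ge.
have := @mixed_bm_open R n M U s t UM oU ms s0 t01' sc nuUoo A U W (oG l0) AU A0 oU (@subset_refl _ U) U0 mW AUW
  vU (fine (vol n A)) nU (fine (nu A)) erefl erefl erefl erefl.
by rewrite -/(nu W) (fin _ mW WU) lee_fin.
Qed.

Hypothesis mG : mfunT G.

Let UG z := \1_U z * G z.

Let mUG : mfunT UG.
Proof. by apply: measurable_funM => //; exact: measurable_indic. Qed.

Let UG01 z : 0 <= UG z <= 1.
Proof.
have /andP[g0 g1] := G01 z.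
by rewrite /UG indicE; case: (z \in U); rewrite ?mul1r ?mul0r ?g0 ?lexx ?ler01.
Qed.

Let UGE l : 0 <= l -> [set z | l < UG z] = U `&` [set x | l < G x].
Proof.
move=> l0; apply/seteqP; split => x; rewrite /= /UG indicE.
  case: (boolP (x \in U)) => [/[!inE] Ux|_]; first by rewrite mul1r.
  by rewrite mul0r ltNge l0.
by move=> [Ux lx]; rewrite mem_set// mul1r.
Qed.

(** Integration of a level inequality over l in [0, 1[. All terms are layer-cake integrals, since G
    and its enlargement take values in [0, 1]. *)
Lemma enlarge_integral (a c : R) : 0 <= a -> 0 <= c ->
  (forall l (vA nA nW : R), 0 <= l < 1 ->
    vol n (U `&` [set x | l < G x]) = vA%:E ->
    0 <= vA <= vU -> 0 <= nA <= nU ->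
    (1 + t * (1 - vA / vU)) * ((1 - t) * nA + t * (vA / vU * nU)) <= nW ->
    nA + a * vA + c <= nW + (t / 2 * nA + t ^+ 2 * nU)) ->
  (\int[vol n]_x (UG x * s x)%:E + a%:E * \int[vol n]_x (UG x)%:E + c%:E <=
   \int[vol n]_x (enlarge t G x * s x)%:E +
   ((t / 2)%:E * \int[vol n]_x (UG x * s x)%:E + (t ^+ 2 * nU)%:E))%E.
Proof.
move=> a0 c0 H.
have /andP[t0 t1] := t01'.
have nU0 : 0 <= nU.
  by apply: fine_ge0; apply: integral_ge0 => x _; rewrite lee_fin mulr_ge0.
pose K (h f : V -> R) l := (\int[vol n]_z (\1_[set z | (l < h z)%R] z * f z)%:E)%E.
have m1 : measurable_fun [set: V] (fun=> 1 : R) by meas.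
have mK (h f : V -> R) : mfunT h -> mfunT f ->
    (forall z, 0 <= f z) -> measurable_fun (`[0%R, 1%R[%classic : set R) (K h f).
  by move=> mh mf f0; apply: measurable_funTS; exact: measurable_level.
have K0 (h f : V -> R) l : (forall z, 0 <= f z) -> (0 <= K h f l)%E.
  by move=> f0; apply: integral_ge0 => z _; rewrite lee_fin mulr_ge0.
have -> : (\int[vol n]_x (UG x)%:E = \int[vol n]_x (UG x * (fun=> 1) x)%:E)%E.
  by apply: eq_integral => x _; rewrite mulr1.
have me := measurable_enlarge.
rewrite -(layer_cake (vol n) mUG ms UG01 s0) -(layer_cake (vol n) mUG m1 UG01)//.
rewrite -(layer_cake (vol n) me ms enlarge01 s0).
have m01 : measurable (`[0%R, 1%R[%classic : set R) by [].
have mKs := mK _ _ mUG ms s0.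
have mK1 := mK _ _ mUG m1 (fun=> ler01).
have mKe := mK _ _ me ms s0.
have t20 : 0 <= t / 2 by nneg.
have tn0 : 0 <= t ^+ 2 * nU by nneg.
have HL := integral01_affine mKs mK1 (fun l => K0 _ _ l s0) (fun l => K0 _ _ l (fun=> ler01)) a0 c0.
have HR := integral01_affine mKe mKs (fun l => K0 _ _ l s0) (fun l => K0 _ _ l s0) t20 tn0.
rewrite addeA -[X in (X <= _)%E]HL -[X in (_ <= X)%E]HR; apply: integral01_le.
- by do 2?[apply: emeasurable_funD => //]; exact: measurable_funeM.
- by do 2?[apply: emeasurable_funD => //]; exact: measurable_funeM.
- move=> l; apply: adde_ge0; last by rewrite lee_fin.
  apply: adde_ge0; first exact: K0.
  by apply: mule_ge0; [rewrite lee_fin|apply: K0 => z; exact: ler01].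
move=> l /andP[l0 l1].
have [vA [nA [nW [vAE nAE nWE /andP[vA01 nA01] ineq]]]] := level_bm l0.
have -> : K UG s l = nA%:E by rewrite /K UGE.
have -> : K (enlarge t G) s l = nW%:E by [].
have -> : K UG (fun=> 1) l = vA%:E.
  rewrite /K UGE// -vAE -[RHS]mul1e -integral_cst//; last first.
    by apply: measurable_eopen; exact: oG.
  rewrite [RHS]integral_mkcond; apply: eq_integral => x _.
  by rewrite patchE indicE; case: ifP => _; rewrite ?mul1r ?mul0r.
rewrite -!EFinM -!EFinD lee_fin.
have lE : 0 <= l < 1 by rewrite l0.
by have := H l vA nA nW lE vAE vA01 nA01 ineq; rewrite addrA.
Qed.

End enlarge.

Section cheeger.
Variables (G l : V -> R) (L : R).
Hypotheses (Dpos : 0 < D) (G01 : forall x, 0 <= G x <= 1) (mG : mfunT G) (ml : mfunT l)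
  (l0 : forall x, 0 <= l x)
  (GL : forall x z, U x -> U z -> s z * `|G x - G z| <= L * enorm (x - z))
  (Gl : forall z e, U z -> 0 < e -> exists2 dl : R, 0 < dl &
  forall x, U x -> enorm (x - z) < dl -> `|G x - G z| <= (l z + e) * enorm (x - z)).
Hypothesis Gsmall : (vol n (U `&` [set x | (0 < G x)%R]) <= (vU / 2)%:E)%E.

Let G' x := 1 - G x.

Let G'01 x : 0 <= G' x <= 1.
Proof. by have /andP[? ?] := G01 x; rewrite /G' subr_ge0 gerBl; apply/andP; split. Qed.

Let mG' : mfunT G'. Proof. exact: measurable_funB. Qed.

Let nU0 : 0 <= nU.
Proof. by apply: fine_ge0; apply: integral_ge0 => x _; rewrite lee_fin mulr_ge0. Qed.

Let contG (H : V -> R) c : (forall x z, `|H x - H z| = `|G x - G z|) ->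
  eopen (U `&` [set x | c < H x]).
Proof.
move=> HG z [Uz /= cz]; have [e1 e10 he1] := Gl Uz (ltr01).
have [e2 e20 he2] := oU Uz.
have l1 : 0 < l z + 1 by rewrite ltr_wpDl.
have q0 : 0 < (H z - c) / (l z + 1) by rewrite divr_gt0 ?subr_gt0.
exists (Num.min (Num.min e1 e2) ((H z - c) / (l z + 1))).
  by rewrite !lt_min e10 e20.
move=> x; rewrite !lt_min => /andP[/andP[h1 h2] h3]; split; first exact: he2.
have := he1 x (he2 x h2) h1; rewrite -HG ler_norml => /andP[h4 _].
move: h3; rewrite ltr_pdivlMr// mulrC => h3 /=; lra.
Qed.

Let oG c : 0 <= c -> eopen (U `&` [set x | c < G x]).
Proof. by move=> _; exact: contG. Qed.

Let oG' c : 0 <= c -> eopen (U `&` [set x | c < G' x]).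
Proof.
by move=> _; apply: contG => x z; rewrite /G' opprB addrC addrA subrK distrC.
Qed.

Let II (f : V -> R) := (\int[vol n]_x (f x)%:E)%E.

Let finI (f : V -> R) : mfunT f -> (forall x, 0 <= f x <= \1_U x * s x) ->
  II f = (fine (II f))%:E.
Proof.
move=> mf f0; rewrite fineK// ge0_fin_numE; last first.
  by apply: integral_ge0 => x _; rewrite lee_fin; have /andP[] := f0 x.
apply: le_lt_trans nuUoo; apply: ge0_le_integral => //.
- by move=> x _; rewrite lee_fin; have /andP[] := f0 x.
- by meas.
- by meas.
- by move=> x _; rewrite lee_fin; have /andP[] := f0 x.
Qed.

(** Levels of G occupy at most half of the volume and levels of 1 - G at least half, so
    [level_small_ineq] applies to the former and [level_large_ineq] to the latter. In the sum the
    losses t nA / 2 integrate to t nU / 2 and cancel against the gain from 1 - G. *)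
Let cheeger_step t : 0 < t <= 1 ->
  ((nU + t * (nU / vU * fine (II (fun x => \1_U x * G x))))%:E <=
   II (fun x => (enlarge t G x + enlarge t G' x) * s x)%R + (2 * t ^+ 2 * nU)%:E)%E.
Proof.
move=> t01; have /andP[t0 t1] := t01.
have vUn0 : vU != 0 by rewrite gt_eqF.
have mInd : mfunT (\1_U : V -> R) by meas.
have e01 (H : V -> R) : (forall x, 0 <= H x <= 1) ->
    forall x, 0 <= enlarge t H x * s x <= \1_U x * s x.
  move=> H01 x; have /andP[h0 h1] := enlarge01 t H01 x.
  rewrite mulr_ge0//= ler_wpM2r// indicE.
  case: (boolP (x \in U)) => //; rewrite notin_setE => Ux.
  by rewrite enlarge_notin.
have f01 (H : V -> R) : (forall x, 0 <= H x <= 1) ->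
    forall x, 0 <= \1_U x * H x * s x <= \1_U x * s x.
  move=> H01 x; have /andP[h0 h1] := H01 x.
  by rewrite !mulr_ge0//= ler_wpM2r// ler_piMr.
have me (H : V -> R) : (forall x, 0 <= H x <= 1) ->
    mfunT (fun x => enlarge t H x * s x).
  by move=> H01; apply: measurable_funM => //; exact: measurable_enlarge.
have mf (H : V -> R) : mfunT H ->
    mfunT (fun x => \1_U x * H x * s x).
  by move=> mH; do 2!apply: measurable_funM => //.
have E1 := finI (me _ G01) (e01 _ G01).
have E2 := finI (me _ G'01) (e01 _ G'01).
have F1 := finI (mf _ mG) (f01 _ G01).
have F2 := finI (mf _ mG') (f01 _ G'01).
have IGE : II (fun x => \1_U x * G x) = (fine (II (fun x => \1_U x * G x)))%:E.
  rewrite fineK// ge0_fin_numE; last first.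
    by apply: integral_ge0 => x _; rewrite lee_fin mulr_ge0//; have /andP[] := G01 x.
  apply: le_lt_trans volUoo; rewrite -[leRHS]mul1e -integral_cst// [leRHS]integral_mkcond.
  apply: ge0_le_integral => //.
  - by move=> x _; rewrite lee_fin mulr_ge0//; have /andP[] := G01 x.
  - by meas.
  - by apply/(measurable_restrictT _ _).1 => //; exact: measurable_cst.
  - move=> x _; rewrite patchE indicE; case: ifP => _; rewrite ?mul1r ?mul0r// lee_fin.
    by have /andP[] := G01 x.
have F12 : fine (II (fun x => \1_U x * G x * s x)) +
    fine (II (fun x => \1_U x * G' x * s x)) = nU.
  apply: EFin_inj; rewrite EFinD -F1 -F2 -nuUE /II -ge0_integralD//.
  - by apply: eq_integral => x _; rewrite -EFinD -mulrDl -mulrDr /G' addrCA subrr addr0 mulr1.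
  - by move=> x _; rewrite lee_fin; have /andP[] := f01 _ G01 x.
  - by meas.
  - by move=> x _; rewrite lee_fin; have /andP[] := f01 _ G'01 x.
  - by meas.
have a0 : 0 <= t * (nU / vU) by nneg.
have c0 : 0 <= t / 2 * nU by nneg.
have S1 := enlarge_integral G01 t01 oG mG a0 (lexx 0).
have S2 := enlarge_integral G'01 t01 oG' mG' (lexx 0) c0.
have {}S1 := S1 _.
have {}S2 := S2 _.
have H1 : forall (u vA nA nW : R), 0 <= u < 1 ->
    vol n (U `&` [set x | u < G x]) = vA%:E -> 0 <= vA <= vU -> 0 <= nA <= nU ->
    (1 + t * (1 - vA / vU)) * ((1 - t) * nA + t * (vA / vU * nU)) <= nW ->
    nA + t * (nU / vU) * vA + 0 <= nW + (t / 2 * nA + t ^+ 2 * nU).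
  move=> u vA nA nW /andP[u0 u1] vAE /andP[vA0 vA1] nA01 ineq.
  have -> : nA + t * (nU / vU) * vA + 0 = nA + t * (vA / vU) * nU by field.
  apply: level_small_ineq => //; first by rewrite (ltW t0).
  rewrite divr_ge0// ?(ltW vU0)//= ler_pdivrMr// mul1r mulrC -lee_fin -vAE.
  apply: le_trans Gsmall; apply: le_measure; rewrite ?inE//.
  - by apply: measurable_eopen; exact: oG.
  - by apply: measurable_eopen; exact: oG.
  - by move=> x [Ux ux]; split => //; exact: le_lt_trans ux.
have H2 : forall (u vA nA nW : R), 0 <= u < 1 ->
    vol n (U `&` [set x | u < G' x]) = vA%:E -> 0 <= vA <= vU -> 0 <= nA <= nU ->
    (1 + t * (1 - vA / vU)) * ((1 - t) * nA + t * (vA / vU * nU)) <= nW ->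
    nA + 0 * vA + t / 2 * nU <= nW + (t / 2 * nA + t ^+ 2 * nU).
  move=> u vA nA nW /andP[u0 u1] vAE /andP[vA0 vA1] nA01 ineq.
  rewrite mul0r addr0; apply: (@level_large_ineq _ _ (vA / vU)) => //.
    by rewrite (ltW t0).
  apply/andP; split; last by rewrite ler_pdivrMr// mul1r.
  rewrite ler_pdivlMr//.
  have mP : measurable (U `&` [set x | 0 < G x]).
    by apply: measurable_eopen; exact: oG.
  have mQ : measurable (U `&` [set x | u < G' x]).
    by apply: measurable_eopen; exact: oG'.
  have : (vU%:E <= vA%:E + (vU / 2)%:E)%E.
    rewrite -volUE -vAE; apply: le_trans (leeD (lexx _) Gsmall).
    apply: le_trans (measureU2 _ mQ mP).
    apply: le_measure; rewrite ?inE//; first exact: measurableU.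
    move=> x Ux; have [Gx|Gx] := ltP 0 (G x); first by right.
    by left; split => //; rewrite /G' /=; have /andP[] := G01 x; lra.
  by rewrite -EFinD lee_fin; lra.
have {}S1 := S1 H1; have {}S2 := S2 H2.
have E12 : II (fun x => (enlarge t G x + enlarge t G' x) * s x) =
    (fine (II (fun x => enlarge t G x * s x)) + fine (II (fun x => enlarge t G' x * s x)))%:E.
  rewrite EFinD -E1 -E2 /II -ge0_integralD//.
  - by apply: eq_integral => x _; rewrite -EFinD mulrDl.
  - by move=> x _; rewrite lee_fin; have /andP[] := e01 _ G01 x.
  - by meas.
  - by move=> x _; rewrite lee_fin; have /andP[] := e01 _ G'01 x.
  - by meas.
move: S1 S2; rewrite -!/(II _) E12 mul0e adde0.
set x1 := fine (II (fun x => \1_U x * G x * s x)) in F1 F12 *.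
set x2 := fine (II (fun x => \1_U x * G' x * s x)) in F2 F12 *.
set y1 := fine (II (fun x => enlarge t G x * s x)) in E1 *.
set y2 := fine (II (fun x => enlarge t G' x * s x)) in E2 *.
set z1 := fine (II (fun x => \1_U x * G x)) in IGE *.
rewrite F1 F2 E1 E2 IGE -!EFinM -!EFinD !lee_fin.
have F3 : t / 2 * x1 + t / 2 * x2 = t / 2 * nU by rewrite -mulrDr F12.
by move=> S1 S2; lra.
Qed.

(* Bound on the difference quotients of the enlargements. *)
Let enlarge_slope t z c : 0 < t <= 1 -> U z -> 
  (forall x, U x -> enorm (x - z) <= t * D -> `|G x - G z| <= c) ->
  enlarge t G z + enlarge t G' z - 1 <= 2 * c.
Proof.
move=> t01 Uz Gc.
have h1 : enlarge t G z <= G z + c.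
  by apply: enlarge_le => // x Ux xz; have := Gc x Ux xz; rewrite ler_norml; lra.
have h2 : enlarge t G' z <= G' z + c.
  by apply: enlarge_le => // x Ux xz; have := Gc x Ux xz; rewrite ler_norml /G'; lra.
by move: h1 h2; rewrite /G'; lra.
Qed.

(** Derivative of [cheeger_step] at t = 0, along t = 1 / (k + 1). A point x with z = (1 - t) x + t y
    lies within t D of z, so the difference quotient of the two enlargements is asymptotically at
    most 2 D l. The sets are measured by plain volume and their boundary by [s]; this asymmetry
    later produces an unweighted variance on the left and (s l)^2 on the right. *)
Theorem weighted_cheeger :
  ((nU / vU * fine (\int[vol n]_x (\1_U x * G x)%:E)%E)%:E <=
   (2 * D)%:E * \int[vol n]_x (\1_U x * (s x * l x))%:E)%E.
Proof.
have mInd : mfunT (\1_U : V -> R) by meas.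
set IG := fine _; set J := (\int[vol n]_x _)%E.
have J0 : (0 <= J)%E by apply: integral_ge0 => x _; rewrite lee_fin !mulr_ge0.
have [->|Joo] := eqVneq J +oo%E.
  by rewrite gt0_muley ?lee_fin ?leey// lte_fin mulr_gt0.
have JE : J = (fine J)%:E by rewrite fineK// ge0_fin_numE// lt_neqAle Joo leey.
rewrite JE -EFinM lee_fin.
pose t k : R := k.+1%:R^-1.
have t01 k : 0 < t k <= 1.
  by rewrite /t invr_gt0 ltr0n/= invf_le1 ?ltr0n// ler1n.
have tgt k : 0 < t k by have /andP[] := t01 k.
pose e k x := enlarge (t k) G x + enlarge (t k) G' x.
(* Positive part of the excess of the weighted difference quotient over its limit bound. It tends to
   0 pointwise and [GL] bounds it uniformly in k. *)
pose u k x := \1_U x * Num.max 0 (s x * (e k x - 1) / t k - 2 * D * (s x * l x)).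
have me k : mfunT (e k).
  by apply: measurable_funD; exact: measurable_enlarge.
have mu k : mfunT (u k).
  apply: measurable_funM => //; apply: measurable_maxr => //.
  by meas.
have L0 : 0 <= 2 * `|L| * D by nneg.
have ub k x : 0 <= u k x <= \1_U x * (2 * `|L| * D).
  rewrite /u indicE; case: (boolP (x \in U)) => [/[!inE] Ux|_]; last by rewrite !mul0r lexx.
  rewrite !mul1r le_max lexx/= ge_max L0/= lerBlDr.
  apply: (@le_trans _ _ (2 * `|L| * D)); last first.
    by rewrite lerDl !mulr_ge0// ltW.
  rewrite ler_pdivrMr//.
  have sx := spos Ux.
  have := @enlarge_slope (t k) x (`|L| * (t k * D) / s x) (t01 k) Ux.
  rewrite -(ler_pM2l sx) => h.
  apply: le_trans (h _) _; last first.
    by apply: eqW; field; rewrite gt_eqF.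
  move=> y Uy yx; rewrite ler_pdivlMr// mulrC; apply: le_trans (GL Uy Ux) _.
  apply: le_trans (ler_wpM2r (enorm_ge0 _) (ler_norm _)) _.
  by rewrite ler_wpM2l.
have cu x : u ^~ x @ \oo --> 0.
  have [Ux|Ux] := pselect (U x); last first.
    rewrite (_ : u ^~ x = cst 0); first exact: cvg_cst.
    by apply/funext => k; rewrite /u indicE memNset// mul0r.
  apply/cvgrPdist_le => eps eps0.
  have q0 : 0 < eps / (2 * D * s x) by rewrite divr_gt0// !mulr_gt0// spos.
  have [dl dl0 hdl] := Gl Ux q0.
  near=> k; rewrite sub0r normrN /u indicE mem_set// mul1r ger0_norm ?le_max ?lexx// ge_max (ltW eps0)/=.
  have tD : t k * D < dl.
    rewrite /t mulrC ltr_pdivrMr ?ltr0n// mulrC -ltr_pdivrMr//; near: k.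
    exists (Num.truncn (D / dl)) => // k /= hk.
    by apply: lt_le_trans (truncnS_gt _) _; rewrite ler_nat.
  have := @enlarge_slope (t k) x ((l x + eps / (2 * D * s x)) * (t k * D)) (t01 k) Ux.
  have sx := spos Ux.
  rewrite -(ler_pM2l sx) => h.
  rewrite lerBlDr ler_pdivrMr//; apply: le_trans (h _) _; last first.
    by apply: eqW; field; rewrite !gt_eqF.
  move=> y Uy yx; apply: le_trans (hdl y Uy (le_lt_trans yx tD)) _.
  by rewrite ler_wpM2l// addr_ge0// ltW.
have dom : (\int[vol n]_x (\1_U x * (2 * `|L| * D))%:E < +oo)%E.
  under eq_integral do rewrite mulrC EFinM.
  rewrite ge0_integralZl_EFin//; last first.
    by meas.
  by rewrite lte_mul_pinfty ?lee_fin// integral_indic// setIT.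
have mdom : mfunT (fun x => \1_U x * (2 * `|L| * D)).
  exact: measurable_funM.
have cI := ge0_dominated_cvg mu (measurable_cst _) mdom cu ub dom.
rewrite [X in _ --> X]integral0 in cI.
have finu k : II (u k) = (fine (II (u k)))%:E.
  rewrite fineK// ge0_fin_numE; last first.
    by apply: integral_ge0 => x _; rewrite lee_fin; have /andP[] := ub k x.
  apply: le_lt_trans dom; apply: ge0_le_integral => //.
  - by move=> x _; rewrite lee_fin; have /andP[] := ub k x.
  - exact/measurable_EFinP.
  - exact/measurable_EFinP.
  - by move=> x _; rewrite lee_fin; have /andP[] := ub k x.
(* The error 2 t^2 nU of [cheeger_step], divided by t, vanishes in the limit. *)
have cu0 : fine (II (u k)) + (2 * D * fine J + 2 * t k * nU) @[k --> \oo] -->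
    0 + (2 * D * fine J + 2 * 0 * nU).
  apply: cvgD; first by apply: fine_cvg; exact: cI.
  apply: cvgD; first exact: cvg_cst.
  apply: cvgM; last exact: cvg_cst.
  apply: cvgM; first exact: cvg_cst.
  exact: cvg_harmonic.
rewrite add0r mulr0 mul0r addr0 in cu0.
apply: (cvgr_to_ge cu0); near=> k.
have := cheeger_step (t01 k); rewrite -/IG -/(e k).
have : (II (fun x => e k x * s x)%R <=
    (nU + t k * (fine (II (u k)) + 2 * D * fine J))%:E)%E.
  have -> : (nU + t k * (fine (II (u k)) + 2 * D * fine J))%:E =
      (\int[vol n]_x (\1_U x * s x)%:E + ((t k)%:E * \int[vol n]_x (u k x)%:E +
       (t k * (2 * D))%:E * \int[vol n]_x (\1_U x * (s x * l x))%:E))%E.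
    rewrite nuUE -/(II (u k)) finu -/J JE -!EFinM -!EFinD; congr EFin.
    by lra.
  have D20 : 0 <= t k * (2 * D) by nneg.
  have mJ : mfunT (fun x => (\1_U x * (s x * l x))%:E).
    by meas.
  have mS : mfunT (fun x => (\1_U x * s x)%:E).
    by meas.
  have mue : mfunT (fun x => (u k x)%:E) by meas.
  have u0 x : (0 <= (u k x)%:E)%E by rewrite lee_fin; have /andP[] := ub k x.
  have j0 x : (0 <= (\1_U x * (s x * l x))%:E)%E by nneg.
  rewrite -!ge0_integralZl_EFin ?(ltW (tgt k))//.
  rewrite -ge0_integralD//; last 4 first.
  - by move=> x _; rewrite mule_ge0// lee_fin ltW.
  - exact: measurable_funeM.
  - by nneg.
  - exact: measurable_funeM.
  rewrite -ge0_integralD//; last 3 first.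
  - by nneg.
  - by move=> x _; rewrite adde_ge0// mule_ge0// lee_fin ltW.
  - by apply: emeasurable_funD; exact: measurable_funeM.
  have ex0 x : 0 <= e k x.
    by rewrite addr_ge0//; [have /andP[] := enlarge01 (t k) G01 x|
      have /andP[] := enlarge01 (t k) G'01 x].
  apply: ge0_le_integral => //.
  - by nneg.
  - by meas.
  - apply: emeasurable_funD => //.
    by apply: emeasurable_funD; exact: measurable_funeM.
  move=> x _; rewrite -!EFinM -!EFinD lee_fin.
  have [Ux|Ux] := pselect (U x); last first.
    by rewrite /e !enlarge_notin// /u !indicE !memNset// !(mul0r, mulr0, addr0).
  rewrite /u !indicE !mem_set// !mul1r.
  set a := s x * (e k x - 1) / t k.
  have : a - 2 * D * (s x * l x) <= Num.max 0 (a - 2 * D * (s x * l x)).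
    by rewrite le_max lexx orbT.
  have Ha : t k * a = s x * (e k x - 1) by rewrite /a; field; rewrite gt_eqF.
  move=> /(ler_wpM2l (ltW (tgt k))); rewrite mulrBr Ha.
  lra.
move=> h1 h2; have := le_trans h2 (leeD h1 (lexx _)); rewrite -EFinD lee_fin => h.
rewrite -(ler_pM2l (tgt k)); move: h; rewrite expr2; lra.
Unshelve. all: by end_near. Qed.

End cheeger.

End weighted_cheeger.

(** * Poincare inequality with a concave weight *)

Section weighted_poincare.
Context {R : realType} (n M : nat).
Local Notation V := 'rV[R]_n.
Local Notation leb := (@lebesgue_measure R).
Variables (U : set V) (s : V -> R) (D : R).
Hypotheses (UM : U `<=` pbox (fun=> `]- M%:R, M%:R[%classic)) (oU : eopen U) (cU : econvex U)
  (U0 : U !=set0) (ms : mfunT s) (s0 : forall x, 0 <= s x) (spos : forall x, U x -> 0 < s x)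
  (sconc : forall x y t, U x -> U y -> 0 <= t <= 1 ->
  (1 - t) * s x + t * s y <= s ((1 - t) *: x + t *: y))
  (nuUoo : (\int[vol n]_x (\1_U x * s x)%:E < +oo)%E).
Hypothesis UD : forall x y, U x -> U y -> enorm (x - y) <= D.

Let vU := fine (vol n U).
Let nU := fine (\int[vol n]_x (\1_U x * s x)%:E)%E.

Let mU : measurable U. Proof. exact: measurable_eopen. Qed.

Let volUoo : (vol n U < +oo)%E.
Proof.
apply: (@le_lt_trans _ _ (vol n (pbox (fun=> `]- M%:R, M%:R[%classic)))).
  by apply: le_measure; rewrite ?inE//; exact: measurable_pbox.
rewrite vol_pbox//; under eq_bigr do rewrite lebesgue_measure_itv/=.
by case: ifP => _; rewrite -?EFinB prodEFin ltry.
Qed.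

Let volUE : vol n U = vU%:E.
Proof. by rewrite fineK// ge0_fin_numE. Qed.

Let vU0 : 0 < vU.
Proof. by have := vol_eopen_gt0 oU U0; rewrite volUE lte_fin. Qed.

Let nuUE : (\int[vol n]_x (\1_U x * s x)%:E)%E = nU%:E.
Proof.
rewrite fineK// ge0_fin_numE//; apply: integral_ge0 => x _.
by nneg.
Qed.

Let D0 : 0 <= D.
Proof. by case: U0 => x Ux; apply: le_trans (UD Ux Ux); exact: enorm_ge0. Qed.

Section poincare.
Variables (g l : V -> R) (L : R).
Hypotheses (Dpos : 0 < D) (nUpos : 0 < nU) (g01 : forall x, 0 <= g x <= 1) (mg : mfunT g)
  (ml : mfunT l) (l0 : forall x, 0 <= l x)
  (gL : forall x z, U x -> U z -> s z * `|g x - g z| <= L * enorm (x - z)).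
Hypothesis gl : forall z e, U z -> 0 < e -> exists2 dl : R, 0 < dl &
  forall x, U x -> enorm (x - z) < dl -> `|g x - g z| <= (l z + e) * enorm (x - z).

(** The Cheeger inequality is applied to the square of h = max (0, g - m), whose local slope is 2 h
    l. Young's inequality splits h (s l) and half of the left side is absorbed. *)
Lemma half_poincare m : 0 <= m <= 1 ->
  (vol n (U `&` [set x | (m < g x)%R]) <= (vU / 2)%:E)%E ->
  (\int[vol n]_x (\1_U x * Num.max 0 (g x - m) ^+ 2)%:E <=
   (16 * D ^+ 2 * (vU / nU) ^+ 2)%:E *
   \int[vol n]_x (\1_U x * (\1_[set x | m < g x] x * (s x * l x) ^+ 2))%:E)%E.
Proof.
move=> /andP[m0 m1] hm.
pose h x := Num.max 0 (g x - m).
have h0 x : 0 <= h x by rewrite /h le_max lexx.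
have h1 x : h x <= 1.
  by rewrite /h ge_max ler01/=; have /andP[] := g01 x; lra.
have hL x z : `|h x - h z| <= `|g x - g z|.
  have d1 := ler_norm (g x - g z); have := ler_norm (- (g x - g z)).
  rewrite normrN => d2.
  rewrite /h; case: (lerP 0 (g x - m)) => hx; case: (lerP 0 (g z - m)) => hz.
  - by rewrite opprB addrA subrK.
  - by rewrite subr0 ger0_norm//; apply: le_trans d1; lra.
  - by rewrite sub0r normrN ger0_norm//; apply: le_trans d2; lra.
  - by rewrite subrr normr0.
have mh : mfunT h.
  by apply: measurable_maxr; [exact: measurable_cst|exact: measurable_funB].
have sq x z : `|h x ^+ 2 - h z ^+ 2| = `|h x - h z| * (h x + h z).
  by rewrite subr_sqr normrM (ger0_norm (addr_ge0 (h0 x) (h0 z))).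
have mInd : mfunT (\1_U : V -> R) by meas.
have G01 x : 0 <= h x ^+ 2 <= 1 by rewrite sqr_ge0 expr_le1// (h1, h0).
have mG : mfunT (fun x => h x ^+ 2) by meas.
have mH : mfunT (fun x => 2 * h x * l x).
  by meas.
have HH0 x : 0 <= 2 * h x * l x by nneg.
have GL x z : U x -> U z -> s z * `|h x ^+ 2 - h z ^+ 2| <= 2 * L * enorm (x - z).
  move=> Ux Uz; rewrite sq.
  have : s z * (`|h x - h z| * (h x + h z)) <= 2 * (s z * `|g x - g z|).
    rewrite [leRHS]mulrCA ler_wpM2l// [leRHS]mulrC; apply: ler_pM; rewrite ?addr_ge0 ?hL//.
    by have := h1 x; have := h1 z; lra.
  by have := gL Ux Uz; lra.
have Gl z e : U z -> 0 < e -> exists2 dl : R, 0 < dl &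
  forall x, U x -> enorm (x - z) < dl ->
    `|h x ^+ 2 - h z ^+ 2| <= (2 * h z * l z + e) * enorm (x - z).
  move=> Uz e0; have e40 : 0 < e / 4 by lra.
  have [d1 d10 hd1] := gl Uz e40.
  set q := l z + e / 4; have q0 : 0 < q by rewrite ltr_wpDl.
  (* The second radius keeps the quadratic remainder q^2 |x - z| below e / 2. *)
  exists (Num.min d1 (e / 2 / q ^+ 2)).
    by rewrite lt_min d10/= !divr_gt0// exprn_gt0.
  move=> x Ux; rewrite lt_min => /andP[x1 x2].
  have gq := hd1 x Ux x1; rewrite -/q in gq.
  have hq : `|h x - h z| <= q * enorm (x - z) by exact: le_trans (hL x z) gq.
  have n0 := enorm_ge0 (x - z).
  have x3 : q ^+ 2 * enorm (x - z) <= e / 2.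
    by move: x2; rewrite ltr_pdivlMr ?exprn_gt0// mulrC => /ltW.
  have x4 : h x + h z <= 2 * h z + q * enorm (x - z).
    by have := le_trans (ler_norm _) hq; lra.
  rewrite sq; apply: le_trans (ler_pM _ _ hq x4) _; rewrite ?addr_ge0//.
  rewrite mulrAC ler_wpM2r//.
  have : 0 <= (e / 2) * (1 - h z) by rewrite mulr_ge0 ?subr_ge0// ltW// divr_gt0.
  by move: x3; rewrite /q; lra.
have Gsmall : (vol n (U `&` [set x | (0 < h x ^+ 2)%R]) <= (vU / 2)%:E)%E.
  rewrite (_ : _ `&` _ = U `&` [set x | m < g x])//; congr (_ `&` _).
  apply/seteqP; split => x /=; rewrite /h.
    by case: (lerP 0 (g x - m)) => hx; rewrite ?expr0n/= ?ltxx//; move: hx; rewrite le_eqVlt subr_gt0 => /orP[/eqP <-|//]; rewrite expr0n/= ltxx.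
  by move=> mx; rewrite exprn_gt0// lt_max subr_gt0 mx orbT.
have := weighted_cheeger UM oU cU U0 ms s0 spos sconc nuUoo UD Dpos G01 mG mH HH0 GL Gl Gsmall.
rewrite -/nU -/vU; set IG := fine (\int[vol n]_x (\1_U x * h x ^+ 2)%:E)%E => HC.
set K := (\int[vol n]_x (\1_U x * (\1_[set x | m < g x] x * (s x * l x) ^+ 2))%:E)%E.
have C0 : 0 < 16 * D ^+ 2 * (vU / nU) ^+ 2 by rewrite mulr_gt0 ?exprn_gt0 ?divr_gt0// mulr_gt0 ?exprn_gt0.
have K0 : (0 <= K)%E.
  by apply: integral_ge0 => x _; rewrite lee_fin !mulr_ge0// sqr_ge0.
have [->|Koo] := eqVneq K +oo%E; first by rewrite gt0_muley ?lte_fin// leey.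
have KE : K = (fine K)%:E by rewrite fineK// ge0_fin_numE// lt_neqAle Koo leey.
have IGE : (\int[vol n]_x (\1_U x * h x ^+ 2)%:E)%E = IG%:E.
  rewrite fineK// ge0_fin_numE; last first.
    by apply: integral_ge0 => x _; rewrite lee_fin mulr_ge0 ?sqr_ge0.
  apply: le_lt_trans volUoo; rewrite -[leRHS]mul1e -integral_cst// [leRHS]integral_mkcond.
  apply: ge0_le_integral => //.
  - by nneg.
  - by meas.
  - by apply/(measurable_restrictT _ _).1 => //; exact: measurable_cst.
  - move=> x _; rewrite patchE indicE; case: ifP => _; rewrite ?mul1r ?mul0r// lee_fin.
    by have /andP[] := G01 x.
rewrite -/(h _) IGE KE -EFinM lee_fin.
(* Weight in Young's inequality, chosen so that 2 D a is one half of nU / vU. *)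
pose a := nU / (4 * D * vU); have a0 : 0 < a by rewrite divr_gt0// !mulr_gt0.
have mset : measurable [set x | m < g x].
  rewrite (_ : [set x | _] = g @^-1` `]m, +oo[).
    by rewrite -[_ @^-1` _]setTI; exact: mg.
  by apply/seteqP; split => x /=; rewrite in_itv/= andbT.
have mindm : mfunT (\1_[set x | m < g x] : V -> R).
  by meas.
have mK : mfunT
    (fun x => (\1_U x * (\1_[set x | m < g x] x * (s x * l x) ^+ 2))%:E).
  by meas.
have mUG : mfunT (fun x => (\1_U x * h x ^+ 2)%:E).
  by meas.
have CS : (\int[vol n]_x (\1_U x * (s x * (2 * h x * l x)))%:E <=
    a%:E * IG%:E + (a^-1)%:E * (fine K)%:E)%E.
  have ai0 : 0 < a^-1 by rewrite invr_gt0.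
  rewrite -KE -IGE -!ge0_integralZl_EFin ?(ltW a0) ?(ltW ai0)//; last 2 first.
  - by nneg.
  - by nneg.
  rewrite -ge0_integralD//; last 4 first.
  - by nneg.
  - by meas.
  - by nneg.
  - by meas.
  apply: ge0_le_integral => //.
  - by nneg.
  - by meas.
  - by apply: emeasurable_funD; exact: measurable_funeM.
  move=> x _; rewrite -!EFinM -EFinD lee_fin.
  rewrite [a * _]mulrCA [a^-1 * _]mulrCA -mulrDr ler_wpM2l//.
  have [gx|gx] := ltP m (g x); last first.
    have -> : h x = 0 by rewrite /h max_l// subr_le0.
    rewrite !(mulr0, mul0r) expr0n/= mulr0 add0r.
    by nneg.
  rewrite indicE mem_set// mul1r.
  have -> : s x * (2 * h x * l x) = 2 * h x * (s x * l x) by ring.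
  set w := s x * l x.
  have : 0 <= a^-1 * (a * h x - w) ^+ 2 by nneg.
  have -> : a^-1 * (a * h x - w) ^+ 2 = a * h x ^+ 2 - 2 * h x * w + a^-1 * w ^+ 2.
    by field; rewrite gt_eqF.
  lra.
have HH : nU / vU * IG <= 2 * D * (a * IG + a^-1 * fine K).
  rewrite -lee_fin; apply: (le_trans HC); rewrite [leRHS]EFinM lee_wpmul2l//.
  by nneg.
have vn : nU / vU > 0 by rewrite divr_gt0.
rewrite -(ler_pM2l vn).
have E1 : 2 * D * (a * IG) = nU / vU * IG / 2.
  by rewrite /a; field; rewrite !gt_eqF.
have E2 : nU / vU * (16 * D ^+ 2 * (vU / nU) ^+ 2 * fine K) = 2 * (2 * D * (a^-1 * fine K)).
  by rewrite /a; field; rewrite !gt_eqF.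
by rewrite E2; move: HH; rewrite mulrDr E1; lra.
Qed.

End poincare.

Let measurable_gtT (g : V -> R) c : mfunT g ->
  measurable [set x | (c < g x)%R].
Proof.
move=> mg; rewrite (_ : [set x | _] = g @^-1` `]c, +oo[).
  by rewrite -[_ @^-1` _]setTI; exact: mg.
by apply/seteqP; split => x /=; rewrite in_itv/= andbT.
Qed.

Let measurable_gt (g : V -> R) c : mfunT g ->
  measurable (U `&` [set x | (c < g x)%R]).
Proof.
by move=> mg; apply: measurableI => //; exact: measurable_gtT.
Qed.

Let vol_bigcup_le (F : (set V)^nat) (c : R) : (forall k, measurable (F k)) ->
  nondecreasing_seq F -> (forall k, (vol n (F k) <= c%:E)%E) ->
  (vol n (\bigcup_k F k) <= c%:E)%E.
Proof.
move=> mF ndF Fc.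
have cF := nondecreasing_cvg_mu (mu := vol n) mF (bigcup_measurable (fun k _ => mF k)) ndF.
rewrite -(cvg_lim _ cF)//; apply: lime_le; first by apply/cvg_ex; eexists; exact: cF.
by apply: nearW => k; exact: Fc.
Qed.

(** The median is the infimum of the levels exceeded on at most half of the volume; continuity of
    the measure along increasing sequences of sets gives both bounds. *)
Lemma median_exists (g : V -> R) : mfunT g ->
  (forall x, 0 <= g x <= 1) ->
  exists m, [/\ 0 <= m <= 1,
    (vol n (U `&` [set x | (m < g x)%R]) <= (vU / 2)%:E)%E &
    (vol n (U `&` [set x | (g x < m)%R]) <= (vU / 2)%:E)%E].
Proof.
move=> mg g01.
pose E := [set c | 0 <= c /\ (vol n (U `&` [set x | (c < g x)%R]) <= (vU / 2)%:E)%E].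
have E1 : E 1.
  split => //; rewrite (_ : _ `&` _ = set0) ?measure0 ?lee_fin ?divr_ge0 ?(ltW vU0)//.
  by apply/seteqP; split => // x [_ /=] h; have /andP[_] := g01 x; rewrite leNgt h.
have lbE : lbound E 0 by move=> c [].
have hasE : has_inf E by split; [exists 1|exists 0].
pose m := inf E.
have m0 : 0 <= m by apply: lb_le_inf => //; exists 1.
have m1 : m <= 1 by apply: ge_inf => //; exists 0.
exists m; split; first by rewrite m0.
  rewrite (_ : _ `&` _ = \bigcup_k (U `&` [set x | (m + k.+1%:R^-1 < g x)%R])).
    apply: vol_bigcup_le.
    - by move=> k; exact: measurable_gt.
    - move=> i j ij; apply/subsetPset => x [Ux /=] h; split => //=.
      by apply: le_lt_trans h; rewrite lerD2l lef_pV2 ?posrE// ler_nat.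
    - move=> k; have ki : 0 < k.+1%:R^-1 :> R by nneg.
      have [c Ec cm] := inf_adherent ki hasE.
      case: Ec => c0; apply: le_trans; apply: le_measure; rewrite ?inE.
      + exact: measurable_gt.
      + exact: measurable_gt.
      + by move=> x [Ux /= h]; split => //=; apply: lt_trans h.
  apply/seteqP; split => x.
    move=> [Ux /= h]; have [k hk] := ltr_add_invr h.
    by exists k => //; split.
  by move=> [k _ [Ux /= h]]; split => //=; apply: le_lt_trans h; rewrite lerDl.
have [mle0|mgt0] := leP m 0.
  rewrite (_ : _ `&` _ = set0) ?measure0 ?lee_fin ?divr_ge0 ?(ltW vU0)//.
  apply/seteqP; split => // x [_ /= h]; have /andP[+ _] := g01 x.
  by lra.
rewrite (_ : _ `&` _ = \bigcup_k (U `\` [set x | (m - k.+1%:R^-1 < g x)%R])).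
  have mD c : measurable (U `\` [set x | (c < g x)%R]).
    by apply: measurableD => //; exact: measurable_gtT.
  apply: vol_bigcup_le => //.
  - move=> i j ij; apply/subsetPset => x [Ux /= h]; split => //= h'.
    apply: h; apply: le_lt_trans h'; rewrite lerD2l lerN2 lef_pV2 ?posrE//.
    by rewrite ler_nat.
  - move=> k; have [c0|c0] := ltP (m - k.+1%:R^-1) 0.
      rewrite (_ : _ `\` _ = set0) ?measure0 ?lee_fin ?divr_ge0 ?(ltW vU0)//.
      apply/seteqP; split => // x [_ /=]; apply.
      by apply: lt_le_trans c0 _; have /andP[] := g01 x.
    have nE : ~ E (m - k.+1%:R^-1).
      by move=> /(ge_inf (ex_intro _ 0 lbE)); rewrite -/m leNgt ltrBlDr ltrDl invr_gt0 ltr0n.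
    have := measurable_gt (m - k.+1%:R^-1) mg.
    set W := U `&` _ => mW.
    have WU : (vol n W <= vol n U)%E by apply: le_measure; rewrite ?inE// => x [].
    have eW : vol n W = (fine (vol n W))%:E.
      by rewrite fineK// ge0_fin_numE// (le_lt_trans WU).
    have eD : vol n (U `\` [set x | (m - k.+1%:R^-1 < g x)%R]) = (vol n U - vol n W)%E.
      by apply: measureD => //; exact: measurable_gtT.
    rewrite eD volUE eW -EFinB lee_fin.
    have : ~~ (vol n W <= (vU / 2)%:E)%E by apply/negP => h; apply: nE.
    by rewrite -ltNge eW lte_fin; lra.
apply/seteqP; split => x.
  move=> [Ux /= h]; have [k hk] := ltr_add_invr h.
  by exists k => //; split => //=; apply/negP; rewrite -leNgt lerBrDr ltW.
move=> [k _ [Ux /= /negP]]; rewrite -leNgt => h; split => //=.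
by apply: le_lt_trans h _; rewrite ltrBlDr ltrDl invr_gt0 ltr0n.
Qed.

(** [half_poincare] at a median, for g and for 1 - g. The two energies live on the disjoint sets {m
    < g} and {g < m}, so their sum carries no factor 2. *)
Theorem weighted_poincare (g l : V -> R) (L : R) : 0 < D -> 0 < nU ->
  mfunT g -> mfunT l ->
  (forall x, 0 <= g x <= 1) -> (forall x, 0 <= l x) ->
  (forall x z, U x -> U z -> s z * `|g x - g z| <= L * enorm (x - z)) ->
  (forall z e, U z -> 0 < e -> exists2 dl : R, 0 < dl &
    forall x, U x -> enorm (x - z) < dl -> `|g x - g z| <= (l z + e) * enorm (x - z)) ->
  exists2 m, 0 <= m <= 1 &
  (\int[vol n]_x (\1_U x * (g x - m) ^+ 2)%:E <=
   (16 * D ^+ 2 * (vU / nU) ^+ 2)%:E * \int[vol n]_x (\1_U x * (s x * l x) ^+ 2)%:E)%E.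
Proof.
move=> Dpos nUpos mg ml g01 l0 gL gl.
have [m [m01 hm1 hm2]] := median_exists mg g01; exists m => //.
have g01' x : 0 <= 1 - g x <= 1 by have := g01 x; lra.
have m01' : 0 <= 1 - m <= 1 by move: m01; lra.
have mg' : mfunT (fun x => 1 - g x) by meas.
have dg x z : 1 - g x - (1 - g z) = - (g x - g z) by ring.
have gL' x z : U x -> U z -> s z * `|1 - g x - (1 - g z)| <= L * enorm (x - z).
  by rewrite dg normrN; exact: gL.
have gl' z e : U z -> 0 < e -> exists2 dl : R, 0 < dl &
    forall x, U x -> enorm (x - z) < dl ->
    `|1 - g x - (1 - g z)| <= (l z + e) * enorm (x - z).
  move=> Uz e0; have [dl dl0 h] := gl z e Uz e0; exists dl => // x Ux xz.
  by rewrite dg normrN; exact: h.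
have hm2' : (vol n (U `&` [set x | (1 - m < 1 - g x)%R]) <= (vU / 2)%:E)%E.
  rewrite (_ : [set x | (1 - m < 1 - g x)%R] = [set x | (g x < m)%R])//.
  by apply/seteqP; split => x /=; rewrite ltrD2l ltrN2.
have P1 := half_poincare Dpos nUpos g01 mg ml l0 gL gl m01 hm1.
have P2 := half_poincare Dpos nUpos g01' mg' ml l0 gL' gl' m01' hm2'.
have mInd : mfunT (\1_U : V -> R) by meas.
have msl : mfunT (fun x => (s x * l x) ^+ 2).
  by meas.
have mset (h : V -> R) c : mfunT h ->
    mfunT (\1_[set x | c < h x] : V -> R).
  by move=> mh; apply: measurable_indic; exact: measurable_gtT.
have mmax (h : V -> R) c : mfunT h ->
    mfunT (fun x => (\1_U x * Num.max 0 (h x - c) ^+ 2)%:E).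
  move=> mh; apply/measurable_EFinP; apply: measurable_funM => //.
  apply: measurable_funX; apply: measurable_maxr; first exact: measurable_cst.
  by meas.
have mK (h : V -> R) c : mfunT h -> mfunT
    (fun x => (\1_U x * (\1_[set x | c < h x] x * (s x * l x) ^+ 2))%:E).
  move=> mh; apply/measurable_EFinP; apply: measurable_funM => //.
  by meas.
have -> : (\int[vol n]_x (\1_U x * (g x - m) ^+ 2)%:E =
    \int[vol n]_x (\1_U x * Num.max 0 (g x - m) ^+ 2)%:E +
    \int[vol n]_x (\1_U x * Num.max 0 (1 - g x - (1 - m)) ^+ 2)%:E)%E.
  rewrite -ge0_integralD//; last 4 first.
  - by nneg.
  - exact: mmax.
  - by nneg.
  - by meas.
  apply: eq_integral => x _; rewrite -EFinD -mulrDr; congr (_ * _)%:E.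
  have -> : 1 - g x - (1 - m) = - (g x - m) by ring.
  case: (lerP 0 (g x - m)) => hx.
    by rewrite max_l ?oppr_le0// expr0n/= addr0.
  by rewrite max_r ?oppr_ge0 ?(ltW hx)// sqrrN expr0n/= add0r.
apply: le_trans (leeD P1 P2) _; rewrite -ge0_muleDr; last 2 first.
- by apply: integral_ge0 => x _; rewrite lee_fin !mulr_ge0// sqr_ge0.
- by apply: integral_ge0 => x _; rewrite lee_fin !mulr_ge0// sqr_ge0.
apply: lee_wpmul2l.
  by nneg.
rewrite -ge0_integralD//; last 4 first.
- by nneg.
- exact: mK.
- by nneg.
- by meas.
apply: ge0_le_integral => //.
- by nneg.
- by apply: emeasurable_funD; [exact: mK|exact: (mK (fun x => 1 - g x))].
- by meas.
move=> x _; rewrite -EFinD lee_fin -mulrDr ler_wpM2l// -mulrDl.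
rewrite ler_piMl ?sqr_ge0// !indicE (_ : (x \in [set y | 1 - m < 1 - g y]) = (g x < m)); last first.
  by apply/idP/idP; rewrite inE/= ltrD2l ltrN2.
rewrite (_ : (x \in [set y | m < g y]) = (m < g x)); last by apply/idP/idP; rewrite inE.
by case: (ltgtP m (g x)); rewrite ?addr0 ?add0r ?lexx.
Qed.

End weighted_poincare.

Lemma ge0_integral_linear d (T : measurableType d) (R : realType)
    (mu : {measure set T -> \bar R}) (c1 c2 : R) (f g : T -> \bar R) :
  0 <= c1 -> 0 <= c2 -> mfunT f -> mfunT g ->
  (forall x, 0 <= f x)%E -> (forall x, 0 <= g x)%E ->
  (\int[mu]_x (c1%:E * f x + c2%:E * g x) =
   c1%:E * \int[mu]_x f x + c2%:E * \int[mu]_x g x)%E.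
Proof.
move=> c10 c20 mf mg f0 g0; rewrite ge0_integralD//.
- by rewrite !ge0_integralZl_EFin.
- by nneg.
- by meas.
- by nneg.
- by meas.
Qed.

(** * A quadratic bump and second moments of the ball *)

Section bump.
Context {R : realType} (n : nat).
Local Notation V := 'rV[R]_n.
Local Notation leb := (@lebesgue_measure R).

Definition ballvol : R := fine (vol n (@oball R n 1)).

Lemma oball_fin r : (vol n (@oball R n r) < +oo)%E.
Proof.
apply: le_lt_trans (vol_eball_fin n r).
apply: le_measure; rewrite ?inE; [exact: measurable_oball|exact: measurable_eball|].
by move=> x /= /ltW.
Qed.

Lemma vol_oball1 : vol n (@oball R n 1) = ballvol%:E.
Proof. by rewrite /ballvol fineK// ge0_fin_numE// oball_fin. Qed.

Lemma ballvol_gt0 : 0 < ballvol.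
Proof.
rewrite -lte_fin -vol_oball1; apply: (@vol_gt0 _ _ _ 0 1) => //.
  exact: measurable_oball.
by move=> y; rewrite subr0.
Qed.

Lemma vol_oball r : 0 < r -> vol n (@oball R n r) = (r ^+ n * ballvol)%:E.
Proof.
move=> r0; rewrite EFinM -vol_oball1.
have ri : r^-1 != 0 by rewrite invr_eq0 gt_eqF.
have := vol_scale ri (measurable_oball 1).
rewrite ger0_norm ?invr_ge0 ?(ltW r0)// invrK => <-; congr (vol n _).
apply/seteqP; split => x /=; rewrite /oball/= enormZ ger0_norm ?invr_ge0 ?(ltW r0)//.
  by rewrite mulrC ltr_pdivrMr// mul1r.
by rewrite mulrC ltr_pdivrMr// mul1r.
Qed.

Lemma measurable_dot (v : V) : mfunT (dot v).
Proof.
apply: measurable_sum => i; apply: measurable_funM; first exact: measurable_cst.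
exact: measurable_row_coord.
Qed.

Lemma measurable_oball_indic r : mfunT (\1_(@oball R n r) : V -> R).
Proof. by apply: measurable_indic; exact: measurable_oball. Qed.

Let flip (k : 'I_n) (x : V) : V := \row_i ((if i == k then -1 else 1) * x 0 i + 0).

Let dot_flip k x : dot (flip k x) (flip k x) = dot x x.
Proof.
apply: eq_bigr => i _; rewrite mxE addr0.
by case: (i == k); rewrite ?mulN1r ?mulrNN ?mul1r.
Qed.

Let oball_flip k x : \1_(@oball R n 1) (flip k x) = \1_(@oball R n 1) x :> R.
Proof.
rewrite !indicE (_ : (flip k x \in oball 1) = (x \in oball 1))//.
by apply/idP/idP; rewrite !inE /oball/= /enorm;
  under eq_bigr do rewrite expr2; rewrite -/(dot _ _) ?dot_flip => h;
  under eq_bigr do rewrite expr2; rewrite -/(dot _ _) ?dot_flip.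
Qed.

Let integral_flip k (F : V -> \bar R) : mfunT F ->
  (forall x, 0 <= F x)%E -> (\int[vol n]_x F (flip k x) = \int[vol n]_x F x)%E.
Proof.
move=> mF F0; have := @ge0_integral_diag_affine R n
  (fun i => if i == k then -1 else 1) (fun=> 0) F.
rewrite /flip => ->//; last by move=> i; case: ifP; rewrite ?oppr_eq0 oner_eq0.
rewrite big1 ?mul1e// => i _; by case: ifP; rewrite ?normrN normr1 invr1.
Qed.

(** Interpolates between <v, x>^2 at k = 0 and the sum of the (v_i x_i)^2 at k = n. Averaging over
    the reflection of one coordinate removes its cross terms and preserves the ball. *)
Let part (v : V) (k : nat) (x : V) : R :=
  \sum_(i < n | (i < k)%N) (v 0 i * x 0 i) ^+ 2 +
  (\sum_(i < n | (k <= i)%N) v 0 i * x 0 i) ^+ 2.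

Let measurable_part v k : mfunT (part v k).
Proof.
have mc i : mfunT (fun x : V => v 0 i * x 0 i).
  by apply: measurable_funM; [exact: measurable_cst|exact: measurable_row_coord].
have ms (Q : pred 'I_n) (F : 'I_n -> V -> R) : (forall i, mfunT (F i)) ->
    mfunT (fun x => \sum_(i < n | Q i) F i x).
  move=> mF; under eq_fun do rewrite big_mkcond/=.
  by apply: measurable_sum => i; case: (Q i).
apply: measurable_funD; first by apply: ms => i; exact: measurable_funX.
by apply: measurable_funX; exact: ms.
Qed.

Let part_ge0 v k x : 0 <= part v k x.
Proof. by nneg. Qed.

Let part_flip v (k : 'I_n) x : part v k x + part v k (flip k x) = 2 * part v k.+1 x.
Proof.
have E1 : \sum_(i < n | (i < k.+1)%N) (v 0 i * x 0 i) ^+ 2 =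
    (v 0 k * x 0 k) ^+ 2 + \sum_(i < n | (i < k)%N) (v 0 i * x 0 i) ^+ 2.
  rewrite (bigD1 k)//=; congr (_ + _); apply: eq_bigl => i.
  by rewrite ltnS andbC -val_eqE/= -ltn_neqAle.
have E2 y : \sum_(i < n | (k <= i)%N) v 0 i * y 0 i =
    v 0 k * y 0 k + \sum_(i < n | (k < i)%N) v 0 i * y 0 i.
  rewrite (bigD1 k)//=; congr (_ + _); apply: eq_bigl => i.
  by rewrite andbC -val_eqE/= eq_sym -ltn_neqAle.
have E3 : \sum_(i < n | (i < k)%N) (v 0 i * (flip k x) 0 i) ^+ 2 =
    \sum_(i < n | (i < k)%N) (v 0 i * x 0 i) ^+ 2.
  apply: eq_bigr => i ik; rewrite mxE addr0 ifN ?mul1r//.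
  by rewrite -val_eqE/= ltn_eqF.
have E4 : \sum_(i < n | (k < i)%N) v 0 i * (flip k x) 0 i =
    \sum_(i < n | (k < i)%N) v 0 i * x 0 i.
  apply: eq_bigr => i ik; rewrite mxE addr0 ifN ?mul1r//.
  by rewrite -val_eqE/= gtn_eqF.
have E5 : (flip k x) 0 k = - x 0 k by rewrite mxE eqxx mulN1r addr0.
by rewrite /part E1 !E2 E3 E4 E5; ring.
Qed.

Let B1 := \1_(@oball R n 1) : V -> R.

Let integral_part v (k : 'I_n) :
  (\int[vol n]_x (B1 x * part v k x)%:E = \int[vol n]_x (B1 x * part v k.+1 x)%:E)%E.
Proof.
have mP j : mfunT (fun x => (B1 x * part v j x)%:E).
  apply/measurable_EFinP/measurable_funM; first exact: measurable_oball_indic.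
  exact: measurable_part.
have P0 j x : (0 <= (B1 x * part v j x)%:E)%E by nneg.
have : (\int[vol n]_x (B1 x * part v k x)%:E + \int[vol n]_x (B1 x * part v k x)%:E =
    \int[vol n]_x (B1 x * part v k.+1 x)%:E + \int[vol n]_x (B1 x * part v k.+1 x)%:E)%E.
  rewrite -{2}(integral_flip k (mP k))// -!ge0_integralD//.
    apply: eq_integral => x _; rewrite /B1 oball_flip -!EFinD -!mulrDr part_flip.
    by rewrite mulr_natl mulr2n.
  rewrite (_ : (fun _ => _) = (fun x => (B1 x * part v k (flip k x))%:E)).
    apply/measurable_EFinP/measurable_funM => //; first exact: measurable_oball_indic.
    by apply: (measurableT_comp (measurable_part v k)); exact: measurable_diag_affine.
  by apply/funext => x; rewrite /B1 oball_flip.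
set a := (\int[vol n]_x _)%E; set b := (\int[vol n]_x (B1 x * part v k.+1 x)%:E)%E.
have a0 : (0 <= a)%E by apply: integral_ge0.
have b0 : (0 <= b)%E by apply: integral_ge0.
move: a b a0 b0 => [a| |] [b| |]//= a0 b0; rewrite -?EFinD => -[h]//.
by congr EFin; move: h; lra.
Qed.

(** Cross terms vanish by reflections, the n coordinate moments agree by transpositions, and their
    sum is the integral of |x|^2 <= 1 over the ball. *)
Lemma ball_second_moment (v : V) :
  (\int[vol n]_x (\1_(@oball R n 1) x * dot v x ^+ 2)%:E <=
   (dot v v * ballvol / n%:R)%:E)%E.
Proof.
rewrite -/B1.
have I0 k : (k <= n)%N -> (\int[vol n]_x (B1 x * part v 0 x)%:E =
    \int[vol n]_x (B1 x * part v k x)%:E)%E.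
  elim: k => // k IH kn; rewrite (IH (ltnW kn)).
  exact: (integral_part v (Ordinal kn)).
pose m i : \bar R := (\int[vol n]_x (B1 x * x 0 i ^+ 2)%:E)%E.
have mm i : mfunT (fun x : V => (B1 x * x 0 i ^+ 2)%:E).
  apply/measurable_EFinP/measurable_funM; first exact: measurable_oball_indic.
  by apply: measurable_funX; exact: measurable_row_coord.
have m0 i x : (0 <= (B1 x * x 0 i ^+ 2)%:E)%E by nneg.
have msym i j : m i = m j.
  have := @ge0_integral_reindex R n (tperm i j) _ (tpermK i j) (mm i) (m0 i).
  rewrite -/(m i) => <-; apply: eq_integral => x _; rewrite mxE tpermL.
  congr (_ * _)%:E; rewrite /B1 !indicE; congr (_%:R).
  set y := \row_i _; rewrite (_ : (y \in oball 1) = (x \in oball 1))//.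
  suff E : enorm y = enorm x by apply/idP/idP; rewrite !inE /oball/= E.
  rewrite /enorm; congr Num.sqrt.
  rewrite [RHS](reindex_inj (@perm_inj _ (tperm i j)))/=.
  by apply: eq_bigr => k _; rewrite mxE.
have sumE (c : 'I_n -> R) : (forall i, 0 <= c i) ->
    (\int[vol n]_x (B1 x * \sum_i (c i * x 0 i ^+ 2))%:E = \sum_(i < n) ((c i)%:E * m i))%E.
  move=> c0; rewrite /m.
  under [in RHS]eq_bigr => i _ do rewrite -ge0_integralZl_EFin//.
  rewrite -ge0_integral_sum//; last 2 first.
  - by move=> i; exact: measurable_funeM.
  - by nneg.
  apply: eq_integral => x _; rewrite mulr_sumr -sumEFin.
  by apply: eq_bigr => i _; rewrite -EFinM mulrCA.
have msum : (\sum_(i < n) m i <= ballvol%:E)%E.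
  rewrite -vol_oball1 -[leRHS]mul1e -integral_cst//; last exact: measurable_oball.
  rewrite [leRHS]integral_mkcond/=.
  under eq_bigr do rewrite -[m _]mul1e; rewrite -(sumE (fun=> 1))//.
  apply: ge0_le_integral => //.
  - move=> x _; rewrite lee_fin mulr_ge0// sumr_ge0// => i _.
    by nneg.
  - apply/measurable_EFinP/measurable_funM; first exact: measurable_oball_indic.
    apply: measurable_sum => i; apply: measurable_funM => //.
    by apply: measurable_funX; exact: measurable_row_coord.
  - apply/(measurable_restrictT _ _).1; [exact: measurable_oball|exact: measurable_cst].
  move=> x _; rewrite patchE /B1 indicE; case: ifPn => xB; last by rewrite mul0r.
  rewrite mul1r lee_fin; under eq_bigr do rewrite mul1r expr2.
  rewrite -/(dot x x) -sqr_enorm; move: xB; rewrite inE /oball/= => /ltW h.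
  by rewrite expr_le1// enorm_ge0.
have -> : (\int[vol n]_x (B1 x * dot v x ^+ 2)%:E =
    \sum_(i < n) ((v 0 i ^+ 2)%:E * m i))%E.
  rewrite -sumE; last by move=> i; exact: sqr_ge0.
  transitivity (\int[vol n]_x (B1 x * part v 0 x)%:E)%E.
    apply: eq_integral => x _; congr (_ * _)%:E; rewrite /part big1 ?add0r//.
  rewrite (I0 n)//; apply: eq_integral => x _; congr (_ * _)%:E.
  rewrite /part [X in _ + X ^+ 2]big1 ?expr0n/= ?addr0.
    by apply: eq_big => [i|i _]; rewrite ?ltn_ord// exprMn.
  by move=> i; rewrite leqNgt ltn_ord.
have [n0|n0] := posnP n.
  rewrite big1 ?lee_fin ?mulr_ge0 ?invr_ge0 ?dot_ge0 ?(ltW ballvol_gt0)// => i.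
  by have := ltn_ord i; rewrite {2}n0.
pose i0 := Ordinal n0.
have mE : (n%:R%:E * m i0 <= ballvol%:E)%E.
  apply: le_trans msum; rewrite (eq_bigr (fun=> m i0))//.
  by rewrite big_const card_ord iter_addr addr0 mule_natl.
rewrite (eq_bigr (fun i => (v 0 i ^+ 2)%:E * m i0)%E); last first.
  by move=> i _; rewrite (msym i i0).
have m00 : (0 <= m i0)%E by apply: integral_ge0.
rewrite -ge0_sume_distrl; last by move=> i _; rewrite lee_fin sqr_ge0.
rewrite sumEFin (_ : \sum_i _ = dot v v); last by nneg; rewrite expr2.
move: m00 mE; case: (m i0) => [y| |]//= y0.
  rewrite -!EFinM !lee_fin => h; rewrite -[leRHS]mulrA ler_wpM2l ?dot_ge0//.
  by rewrite ler_pdivlMr ?ltr0n// mulrC.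
by rewrite gt0_muley ?lte_fin ?ltr0n// leye_eq.
Qed.

(** Square root of the smoothing density. Distances between shifted densities are measured in
    Hellinger form by L^2 increments of [bump]; since [bump] is quadratic on the ball, these
    increments reduce to second moments of the ball. *)
Definition bump (w : V) : R := Num.max 0 (1 - dot w w).

Lemma bump_ge0 w : 0 <= bump w. Proof. by rewrite /bump le_max lexx. Qed.

Lemma bump_le1 w : bump w <= 1.
Proof. by rewrite /bump ge_max ler01/= gerBl dot_ge0. Qed.

Lemma oballE r (w : V) : 0 <= r -> oball r w = (dot w w < r ^+ 2) :> Prop.
Proof.
move=> r0; rewrite -sqr_enorm ltr_pXn2r// ?nnegrE ?enorm_ge0//.
Qed.

Lemma bump_in w : oball 1 w -> bump w = 1 - dot w w.
Proof.
by rewrite oballE// expr1n /bump => h; rewrite max_r// subr_ge0 ltW.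
Qed.

Lemma bump_out w : ~ oball 1 w -> bump w = 0.
Proof.
rewrite oballE// expr1n /bump => /negP; rewrite -leNgt => h.
by rewrite max_l// subr_le0.
Qed.

Lemma measurable_bump : mfunT bump.
Proof.
apply: measurable_maxr; first exact: measurable_cst.
apply: measurable_funB; first exact: measurable_cst.
apply: measurable_sum => i; apply: measurable_funM; exact: measurable_row_coord.
Qed.

Lemma measurable_bump_sqr : mfunT (fun w => bump w ^+ 2).
Proof. by apply: measurable_funX; exact: measurable_bump. Qed.

Lemma bump_sqr01 w : 0 <= bump w ^+ 2 <= 1.
Proof. by rewrite sqr_ge0 expr_le1 ?bump_ge0 ?bump_le1. Qed.

Definition bumpvol : R := fine (\int[vol n]_w (bump w ^+ 2)%:E)%E.

Lemma integral_bump : (\int[vol n]_w (bump w ^+ 2)%:E = bumpvol%:E)%E.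
Proof.
rewrite fineK// ge0_fin_numE; last first.
  by apply: integral_ge0 => w _; rewrite lee_fin sqr_ge0.
apply: (@le_lt_trans _ _ (\int[vol n]_w (B1 w)%:E)%E).
  apply: ge0_le_integral => //.
  - by nneg.
  - by apply/measurable_EFinP; exact: measurable_bump_sqr.
  - by apply/measurable_EFinP; exact: measurable_oball_indic.
  move=> w _; rewrite lee_fin /B1 indicE; case: (pselect (oball 1 w)) => h.
    by rewrite mem_set//; have /andP[] := bump_sqr01 w.
  by rewrite bump_out// expr0n memNset.
rewrite integral_indic ?setIT; last 2 first.
- by [].
- exact: measurable_oball.
exact: oball_fin.
Qed.

(** For x = 1 / (2 n) the bump is at least 3 x / 2 on the ball of radius 1 - x, which by Bernoulli's
    inequality keeps half of the volume. *)
Lemma bumpvol_ge : (0 < n)%N -> 9 / 32 * ballvol <= n%:R ^+ 2 * bumpvol.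
Proof.
move=> n0; have nR : 1 <= n%:R :> R by rewrite ler1n.
pose x : R := (2 * n%:R)^-1.
have nx : n%:R * x = 1 / 2 by rewrite /x; field; rewrite gt_eqF// (lt_le_trans ltr01).
have x0 : 0 < x by rewrite invr_gt0 mulr_gt0// (lt_le_trans ltr01).
have x2 : x <= 1 / 2 by rewrite -nx ler_peMl// ltW.
have r0 : 0 < 1 - x by lra.
have Hv : (vol n (oball (1 - x)) <= ((16 / 9) * n%:R ^+ 2 * bumpvol)%:E)%E.
  rewrite EFinM -integral_bump -ge0_integralZl_EFin//; last 2 first.
  - by nneg.
  - by apply/measurable_EFinP; exact: measurable_bump_sqr.
  rewrite -[leLHS]mul1e -integral_cst//; last exact: measurable_oball.
  rewrite [leLHS]integral_mkcond/=; apply: ge0_le_integral => //.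
  - by move=> w _; rewrite patchE; case: ifP.
  - by apply/(measurable_restrictT _ _).1; [exact: measurable_oball|exact: measurable_cst].
  - by apply: measurable_funeM; apply/measurable_EFinP; exact: measurable_bump_sqr.
  move=> w _; rewrite patchE; case: ifPn => h; last first.
    by nneg.
  rewrite -EFinM lee_fin; move: h; rewrite inE oballE ?(ltW r0)// => h.
  have hb : 3 / 2 * x <= bump w.
    by rewrite /bump le_max; apply/orP; right; nra.
  have hb0 : 0 <= 3 / 2 * x by nneg.
  have : (3 / 2 * x) ^+ 2 <= bump w ^+ 2 by rewrite ler_pXn2r// nnegrE// bump_ge0.
  have K0 : 0 <= 16 / 9 * n%:R ^+ 2 :> R by nneg.
  move=> /(ler_wpM2l K0); apply: le_trans.
  have -> : 16 / 9 * n%:R ^+ 2 * (3 / 2 * x) ^+ 2 = 4 * (n%:R * x) ^+ 2 by field.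
  by rewrite nx; lra.
have := @bernoulli_le _ x n; rewrite nx => /(_ ltac:(lra)) hb.
move: Hv; rewrite vol_oball// lee_fin => Hv.
have := ballvol_gt0; have : (1 - 1 / 2) * ballvol <= (1 - x) ^+ n * ballvol.
  by rewrite ler_wpM2r// ltW// ballvol_gt0.
by lra.
Qed.

Lemma bumpvol_gt0 : (0 < n)%N -> 0 < bumpvol.
Proof.
move=> n0; have := bumpvol_ge n0.
have n2 : 0 < n%:R ^+ 2 :> R by rewrite exprn_gt0// ltr0n.
by rewrite -(pmulr_rgt0 bumpvol n2); have := ballvol_gt0; lra.
Qed.

(** If |h|^2 > 1 / n the two squares are bounded separately. Otherwise the increment is bounded by
    |2 <h, w> + |h|^2| on each of the two unit balls; [ball_second_moment] gives 10 |h|^2 ballvol /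
    n per ball, and [bumpvol_ge] converts the total with 20 * 32 / 9 < 72. *)
Lemma bump_shift_sq (h : V) : (0 < n)%N ->
  (\int[vol n]_w ((bump (w + h)%R - bump w) ^+ 2)%:E <=
   (72 * n%:R * dot h h * bumpvol)%:E)%E.
Proof.
move=> n0; have nR : 1 <= n%:R :> R by rewrite ler1n.
have n0R : 0 < n%:R :> R by rewrite ltr0n.
have mb := measurable_bump.
have mtr : mfunT (fun w : V => w + h).
  by meas.
have mbh : mfunT (fun w : V => bump (w + h)).
  by meas.
have mL : mfunT (fun w : V => ((bump (w + h) - bump w) ^+ 2)%:E).
  by meas.
have hh0 := dot_ge0 h; have c0 := bumpvol_gt0 n0.
have [hn|hn] := leP (dot h h) n%:R^-1; last first.
  apply: (@le_trans _ _ (\int[vol n]_w ((bump (w + h)%R ^+ 2)%:E + (bump w ^+ 2)%:E))%E).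
    apply: ge0_le_integral => //.
    - by nneg.
    - by apply: emeasurable_funD; apply/measurable_EFinP; apply: measurable_funX.
    move=> w _; rewrite -EFinD lee_fin.
    have := mulr_ge0 (bump_ge0 (w + h)) (bump_ge0 w).
    by lra.
  rewrite ge0_integralD//; last 4 first.
  - by nneg.
  - by meas.
  - by nneg.
  - by meas.
  rewrite (ge0_integral_translate h (F := fun w => (bump w ^+ 2)%:E)); last 2 first.
  - by meas.
  - by nneg.
  rewrite integral_bump -EFinD lee_fin.
  have : 1 * bumpvol <= n%:R * dot h h * bumpvol.
    rewrite ler_wpM2r ?(ltW c0)//.
    by move: hn; rewrite -(ltr_pM2l n0R) divff ?gt_eqF// => /ltW.
  have -> : 72 * n%:R * dot h h * bumpvol = 72 * (n%:R * dot h h * bumpvol) by ring.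
  by lra.
pose F (w : V) := (B1 w * (8 * dot h w ^+ 2 + 2 * dot h h ^+ 2))%:E.
have mF : mfunT F.
  apply/measurable_EFinP/measurable_funM; first exact: measurable_oball_indic.
  apply: measurable_funD; last exact: measurable_cst.
  apply: measurable_funM; first exact: measurable_cst.
  by apply: measurable_funX; exact: measurable_dot.
have F0 w : (0 <= F w)%E.
  by rewrite lee_fin mulr_ge0// addr_ge0// mulr_ge0// sqr_ge0.
have mFh : mfunT (fun w : V => F (w + h)) by meas.
have key (w k : V) : dot k k = dot h h -> dot k w ^+ 2 = dot h w ^+ 2 -> oball 1 w ->
    (((bump (w + k) - bump w) ^+ 2)%:E <= F w)%E.
  move=> kk kw wB; rewrite lee_fin /B1 indicE mem_set// mul1r -kk -kw.
  have hb : `|bump (w + k) - bump w| <= `|2 * dot k w + dot k k|.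
    have e : 1 - dot (w + k) (w + k) = 1 - dot w w - (2 * dot k w + dot k k).
      by rewrite dotDl !dotDr (dotC w k); ring.
    rewrite (bump_in wB) /bump e; set q := 2 * _ + _.
    have : 0 <= 1 - dot w w by rewrite -bump_in// bump_ge0.
    set p := 1 - _ => p0; have := ler_norm q.
    case: (lerP 0 (p - q)) => pq h1; first by rewrite addrAC subrr add0r normrN.
    by rewrite sub0r normrN ger0_norm//; lra.
  apply: (@le_trans _ _ ((2 * dot k w + dot k k) ^+ 2)).
    by rewrite -[leLHS]real_normK ?num_real// -[leRHS]real_normK ?num_real// ler_pXn2r ?nnegrE.
  have := sqr_ge0 (2 * dot k w - dot k k); rewrite sqrrB sqrrD; lra.
apply: (@le_trans _ _ (\int[vol n]_w (F w + F (w + h)%R))%E).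
  apply: ge0_le_integral => //.
  - by nneg.
  - exact: emeasurable_funD.
  move=> w _; case: (pselect (oball 1 w)) => wB.
    by apply: le_trans (key w h _ _ wB) _; rewrite ?leeDl//.
  case: (pselect (oball 1 (w + h))) => whB; last first.
    by rewrite !bump_out// subrr expr0n/= adde_ge0.
  have := key (w + h) (- h); rewrite dotNl dotNr opprK dotNl sqrrN addrK.
  have -> : (bump w - bump (w + h)) ^+ 2 = (bump (w + h) - bump w) ^+ 2 by ring.
  move=> /(_ erefl erefl whB) H.
  by apply: le_trans H _; rewrite leeDr.
rewrite ge0_integralD// (ge0_integral_translate h)//.
have EF : (\int[vol n]_w F w <= (10 * dot h h * (ballvol / n%:R))%:E)%E.
  rewrite (_ : F = fun w => (8%:E * (B1 w * dot h w ^+ 2)%:E + (2 * dot h h ^+ 2)%:E * (B1 w)%:E)%E); last first.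
    by apply/funext => w; rewrite /F -!EFinM -EFinD; congr EFin; ring.
  have mBd : mfunT (fun w => (B1 w * dot h w ^+ 2)%:E).
    apply/measurable_EFinP/measurable_funM; first exact: measurable_oball_indic.
    by apply: measurable_funX; exact: measurable_dot.
  have mB : mfunT (fun w => (B1 w)%:E).
    by apply/measurable_EFinP; exact: measurable_oball_indic.
  have Bd0 w : (0 <= (B1 w * dot h w ^+ 2)%:E)%E by nneg.
  have hh2 : 0 <= 2 * dot h h ^+ 2 by nneg.
  rewrite ge0_integralD//; last 4 first.
  - by nneg.
  - by meas.
  - by nneg.
  - by meas.
  rewrite !ge0_integralZl_EFin//; last by move=> w _; rewrite lee_fin.
  rewrite integral_indic ?setIT//; last exact: measurable_oball.
  rewrite [X in (_ + _ * X <= _)%E](_ : _ = ballvol%:E); last exact: vol_oball1.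
  have := ball_second_moment h; rewrite -/B1 => H.
  apply: (@le_trans _ _ (8%:E * (dot h h * ballvol / n%:R)%:E + (2 * dot h h ^+ 2)%:E * ballvol%:E)%E).
    by rewrite leeD2r// lee_wpmul2l.
  rewrite -!EFinM -EFinD lee_fin.
  have : dot h h * ballvol * dot h h <= dot h h * ballvol * n%:R^-1.
    by rewrite ler_wpM2l// mulr_ge0// ltW// ballvol_gt0.
  by lra.
apply: (le_trans (leeD EF EF)); rewrite -EFinD lee_fin.
have : (dot h h / n%:R) * (9 / 32 * ballvol) <= (dot h h / n%:R) * (n%:R ^+ 2 * bumpvol).
  by rewrite ler_wpM2l ?bumpvol_ge// divr_ge0// ltW.
have -> : dot h h / n%:R * (n%:R ^+ 2 * bumpvol) = n%:R * dot h h * bumpvol.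
  by field; rewrite gt_eqF.
have -> : dot h h / n%:R * (9 / 32 * ballvol) = 9 / 32 * (dot h h * (ballvol / n%:R)).
  by field; rewrite gt_eqF.
have : 0 <= n%:R * dot h h * bumpvol by nneg.
set X := n%:R * dot h h * bumpvol; set Y := dot h h * (ballvol / n%:R).
rewrite -![10 * _ * _]mulrA -/Y.
have -> : 72 * n%:R * dot h h * bumpvol = 72 * X by rewrite /X; ring.
lra.
Qed.

(** Total variation is controlled by Hellinger distance through a pointwise Young inequality. The
    threshold 34 makes both errors, [bumpvol] / 8 and (2 * 72 / 34^2) [bumpvol], at most one
    eighth. *)
Lemma bump_shift_set (h : V) (S : set V) : (0 < n)%N -> measurable S ->
  34 ^+ 2 * (n%:R * dot h h) <= 1 ->
  (\int[vol n]_w (\1_S w * bump w ^+ 2)%:E <=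
   \int[vol n]_w (\1_S w * bump (w + h)%R ^+ 2)%:E + (bumpvol / 4)%:E)%E.
Proof.
move=> n0 mS hn; have c0 := bumpvol_gt0 n0.
have mb := measurable_bump.
have mS1 : mfunT (\1_S : V -> R) by meas.
have mtr : mfunT (fun w : V => w + h).
  by meas.
have mbh : mfunT (fun w : V => bump (w + h)).
  by meas.
have mb2 : mfunT (fun w : V => (bump w ^+ 2)%:E).
  by meas.
have mbh2 : mfunT (fun w : V => (bump (w + h) ^+ 2)%:E).
  by meas.
have mL : mfunT (fun w : V => ((bump (w + h) - bump w) ^+ 2)%:E).
  by meas.
have mX : mfunT (fun w : V => (\1_S w * bump w ^+ 2)%:E).
  by meas.
have mY : mfunT (fun w : V => (\1_S w * bump (w + h) ^+ 2)%:E).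
  by meas.
have b20 w : (0 <= (bump w ^+ 2)%:E)%E by nneg.
have Eh : (\int[vol n]_w (bump (w + h)%R ^+ 2)%:E = bumpvol%:E)%E.
  by rewrite (ge0_integral_translate h (F := fun w => (bump w ^+ 2)%:E))// integral_bump.
have X0 (w : V) : (0 <= (\1_S w * bump w ^+ 2)%:E)%E by nneg.
have Y0 (w : V) : (0 <= (\1_S w * bump (w + h) ^+ 2)%:E)%E by nneg.
have L0 (w : V) : (0 <= ((bump (w + h) - bump w) ^+ 2)%:E)%E by nneg.
have q0 : (0 : R) <= 2^-1 by nneg.
have q8 : (0 : R) <= 8^-1 by nneg.
have H : (\int[vol n]_w (1%:E * (\1_S w * bump w ^+ 2)%:E +
      (7 / 16)%:E * (bump (w + h)%R ^+ 2)%:E) <=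
    \int[vol n]_w (1%:E * (1%:E * (\1_S w * bump (w + h)%R ^+ 2)%:E +
      (9 / 16)%:E * (bump w ^+ 2)%:E) + 2%:E * ((bump (w + h)%R - bump w) ^+ 2)%:E))%E.
  apply: ge0_le_integral => //.
  - by move=> w _; rewrite adde_ge0// mule_ge0// lee_fin ?divr_ge0// sqr_ge0.
  - by apply: emeasurable_funD => //; exact: measurable_funeM.
  - apply: emeasurable_funD; last exact: measurable_funeM.
    by apply: measurable_funeM; apply: emeasurable_funD; exact: measurable_funeM.
  move=> w _; rewrite -?EFinM -?EFinD -?EFinM -?EFinD lee_fin.
  set a := bump w; set b := bump (w + h).
  have h1 := sqr_ge0 ((a - b) - (a + b) / 8).
  have h2 := sqr_ge0 ((b - a) - (a + b) / 8).
  have h3 := sqr_ge0 (a - b).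
  by rewrite indicE; case: (w \in S) => /=; nra.
have b2h0 (w : V) : (0 <= (bump (w + h) ^+ 2)%:E)%E by nneg.
have q9 : (0 : R) <= 9 / 16 by nneg.
have q7 : (0 : R) <= 7 / 16 by nneg.
move: H; rewrite !ge0_integral_linear//; last 2 first.
- by apply: emeasurable_funD; exact: measurable_funeM.
- by move=> w; rewrite adde_ge0// mule_ge0// lee_fin.
rewrite Eh integral_bump !mul1e => H.
have HL := bump_shift_sq h n0.
set I1 := (\int[vol n]_w (\1_S w * bump w ^+ 2)%:E)%E in H *.
set I2 := (\int[vol n]_w (\1_S w * bump (w + h)%R ^+ 2)%:E)%E in H *.
set I3 := (\int[vol n]_w ((bump (w + h)%R - bump w) ^+ 2)%:E)%E in H HL.
have I10 : (0 <= I1)%E by apply: integral_ge0.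
have I20 : (0 <= I2)%E by apply: integral_ge0.
have I30 : (0 <= I3)%E by apply: integral_ge0.
have hc : 34 ^+ 2 * (n%:R * dot h h) * bumpvol <= 1 * bumpvol by rewrite ler_wpM2r// ltW.
move: I1 I2 I3 I10 I20 I30 H HL => [x1| |] [x2| |] [x3| |]//= _ _ _; rewrite ?leey// ?leye_eq//.
rewrite -!EFinM -!EFinD !lee_fin => H.
have -> : 72 * n%:R * dot h h * bumpvol = 72 * (n%:R * dot h h * bumpvol) by ring.
move: hc; rewrite -mulrA => hc HL; lra.
Qed.

Let level_radius (l : R) := Num.sqrt (1 - Num.sqrt l).

Let level_radiusP l : 0 <= l < 1 -> 0 < level_radius l <= 1 /\
  [set w : V | l < bump w ^+ 2] = oball (level_radius l).
Proof.
move=> /andP[l0 l1].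
have s0 := sqrtr_ge0 l; have ss : Num.sqrt l ^+ 2 = l by rewrite sqr_sqrtr.
have s1 : Num.sqrt l < 1 by rewrite -(@ltr_pXn2r _ 2)// ?nnegrE// ss expr1n.
split; first by rewrite sqrtr_gt0 subr_gt0 s1 -[leRHS]sqrtr1 ler_sqrt// gerBl.
apply/seteqP; split => w; rewrite oballE ?sqrtr_ge0// sqr_sqrtr ?subr_ge0 ?(ltW s1)//=.
  move=> h; have : Num.sqrt l < bump w.
    by rewrite -(@ltr_pXn2r _ 2)// ?nnegrE ?bump_ge0// ss.
  by rewrite /bump lt_max ltNge s0/=; lra.
move=> h; rewrite -[ltLHS]ss ltr_pXn2r// ?nnegrE ?bump_ge0//.
by rewrite /bump lt_max; apply/orP; right; lra.
Qed.

Let ball_integral (f : V -> R) : mfunT f -> (forall w, 0 <= f w) ->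
  forall r, 0 < r -> (\int[vol n]_w (\1_(@oball R n r) w * f w)%:E =
    (r ^+ n)%:E * \int[vol n]_w (\1_(@oball R n 1) w * f (r *: w)%R)%:E)%E.
Proof.
move=> mf f0 r r0.
pose F (w : V) := (\1_(@oball R n r) w * f w)%:E.
have mF : mfunT F.
  by apply/measurable_EFinP/measurable_funM => //; exact: measurable_oball_indic.
have F0 w : (0 <= F w)%E by nneg.
have rn0 : r != 0 by rewrite gt_eqF.
have := ge0_integral_scale rn0 mF F0; rewrite ger0_norm ?(ltW r0)// => E.
rewrite (_ : (\int[vol n]_w (\1_(@oball R n 1) w * f (r *: w)%R)%:E)%E =
  (\int[vol n]_w F (r *: w)%R)%E).
  by rewrite E muleA -EFinM -exprMn divff// expr1n mul1e.
apply: eq_integral => w _; rewrite /F !indicE.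
rewrite (_ : (r *: w \in oball r) = (w \in oball 1))//.
by apply/idP/idP; rewrite !inE /oball/= enormZ (ger0_norm (ltW r0)) gtr_pMr.
Qed.

Let level_cmp (f : V -> R) (I : R) : mfunT f -> (forall w, 0 <= f w) ->
  (\int[vol n]_w (\1_(@oball R n 1) w * f w)%:E = I%:E)%E ->
  let N g l := (\int[vol n]_w (\1_[set w : V | (l < bump w ^+ 2)%R] w * g w)%:E)%E in
  let cl := (\int[leb]_(l in `[0%R, 1%R[) N f l)%E in
  [/\ mfunT (N f),
      forall l, 0 <= l < 1 -> N (fun=> 1) l = (level_radius l ^+ n * ballvol)%:E,
      (cl = \int[vol n]_w (bump w ^+ 2 * f w)%:E)%E &
      (\int[leb]_(l in `[0%R, 1%R[) N (fun=> 1%R) l = bumpvol%:E)%E].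
Proof.
move=> mf f0 EI N cl; split.
- exact: (measurable_level (vol n) measurable_bump_sqr mf f0).
- move=> l l01; have [/andP[r0 r1] E] := level_radiusP l01.
  rewrite /N E -(vol_oball r0).
  under eq_integral do rewrite mulr1.
  by rewrite integral_indic ?setIT//; exact: measurable_oball.
- by have := layer_cake (vol n) measurable_bump_sqr mf bump_sqr01 f0.
have := layer_cake (vol n) measurable_bump_sqr (measurable_cst (1 : R)) bump_sqr01 (fun=> ler01).
rewrite -integral_bump => ->; apply: eq_integral => w _; by rewrite mulr1.
Qed.

(** Superlevel sets of the squared bump are balls of radius at most 1, on which a radially
    nonincreasing f has a mean at least that on the unit ball; the layer-cake formula averages over
    the levels. *)
Lemma bump_avg_ge (f : V -> R) (I : R) : mfunT f -> (forall w, 0 <= f w) ->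
  (forall r w, 0 < r <= 1 -> oball 1 w -> f w <= f (r *: w)) ->
  (\int[vol n]_w (\1_(@oball R n 1) w * f w)%:E = I%:E)%E ->
  (I%:E * bumpvol%:E <= ballvol%:E * \int[vol n]_w (bump w ^+ 2 * f w)%:E)%E.
Proof.
move=> mf f0 fr EI; have [mN N1 Nf NT] := level_cmp mf f0 EI.
have I0 : 0 <= I.
  by rewrite -lee_fin -EI; apply: integral_ge0 => w _; rewrite lee_fin mulr_ge0.
have mN1 := measurable_level (vol n) measurable_bump_sqr (measurable_cst (1 : R)) (fun=> ler01).
rewrite -Nf -NT -!ge0_integralZl_EFin ?(ltW ballvol_gt0)//; first last.
- exact: measurable_funTS.
- by move=> l _; apply: integral_ge0 => w _; rewrite lee_fin mulr1.
- exact: measurable_funTS.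
- by move=> l _; apply: integral_ge0 => w _; rewrite lee_fin mulr_ge0.
apply: integral01_le.
- by apply: measurable_funTS; exact: measurable_funeM.
- by apply: measurable_funTS; exact: measurable_funeM.
- by move=> l; rewrite mule_ge0//; apply: integral_ge0 => w _; rewrite lee_fin mulr1.
move=> l l01; rewrite N1//; have [/andP[r0 r1] ->] := level_radiusP l01.
rewrite ball_integral// EFinM muleCA; rewrite [leRHS]muleCA lee_wpmul2l//.
  by nneg.
rewrite muleC lee_wpmul2l ?lee_fin ?(ltW ballvol_gt0)// -EI.
apply: ge0_le_integral => //.
- by nneg.
- by apply/measurable_EFinP/measurable_funM => //; exact: measurable_oball_indic.
- apply/measurable_EFinP/measurable_funM; first exact: measurable_oball_indic.
  apply: (measurableT_comp mf).
  by apply: measurable_rowZ; [exact: measurable_cst|exact: measurable_id].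
move=> w _; rewrite lee_fin indicE; case: (boolP (w \in oball 1)); rewrite ?mul0r// inE => wB.
by rewrite !mul1r fr ?r0.
Qed.

Lemma bump_avg_le (f : V -> R) (I : R) : mfunT f -> (forall w, 0 <= f w) ->
  (forall r w, 0 < r <= 1 -> oball 1 w -> f (r *: w) <= f w) ->
  (\int[vol n]_w (\1_(@oball R n 1) w * f w)%:E = I%:E)%E ->
  (ballvol%:E * \int[vol n]_w (bump w ^+ 2 * f w)%:E <= I%:E * bumpvol%:E)%E.
Proof.
move=> mf f0 fr EI; have [mN N1 Nf NT] := level_cmp mf f0 EI.
have I0 : 0 <= I.
  by rewrite -lee_fin -EI; apply: integral_ge0 => w _; rewrite lee_fin mulr_ge0.
have mN1 := measurable_level (vol n) measurable_bump_sqr (measurable_cst (1 : R)) (fun=> ler01).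
rewrite -Nf -NT -!ge0_integralZl_EFin ?(ltW ballvol_gt0)//; first last.
- exact: measurable_funTS.
- by move=> l _; apply: integral_ge0 => w _; rewrite lee_fin mulr_ge0.
- exact: measurable_funTS.
- by move=> l _; apply: integral_ge0 => w _; rewrite lee_fin mulr1.
apply: integral01_le.
- by apply: measurable_funTS; exact: measurable_funeM.
- by apply: measurable_funTS; exact: measurable_funeM.
- move=> l; rewrite mule_ge0 ?lee_fin ?(ltW ballvol_gt0)//.
  by apply: integral_ge0 => w _; rewrite lee_fin mulr_ge0.
move=> l l01; rewrite N1//; have [/andP[r0 r1] ->] := level_radiusP l01.
rewrite ball_integral// EFinM muleCA; rewrite [leRHS]muleCA lee_wpmul2l//.
  by nneg.
rewrite [leRHS]muleC lee_wpmul2l ?lee_fin ?(ltW ballvol_gt0)// -EI.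
apply: ge0_le_integral => //.
- by nneg.
- apply/measurable_EFinP/measurable_funM; first exact: measurable_oball_indic.
  apply: (measurableT_comp mf).
  by apply: measurable_rowZ; [exact: measurable_cst|exact: measurable_id].
- by apply/measurable_EFinP/measurable_funM => //; exact: measurable_oball_indic.
move=> w _; rewrite lee_fin indicE; case: (boolP (w \in oball 1)); rewrite ?mul0r// inE => wB.
by rewrite !mul1r fr ?r0.
Qed.

End bump.

Ltac measurable_atom f ::=
  match f with
  | \1_(oball _) => exact: measurable_oball_indic
  | fun z => \1_(oball _) (@?g z) =>
      apply: (measurableT_comp (measurable_oball_indic _)); meas
  | fun z => bump (@?g z) => apply: (measurableT_comp (@measurable_bump _ _)); meas
  end.

Section tonelli.
Context d1 d2 (T1 : measurableType d1) (T2 : measurableType d2) (R : realType).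
Variables (m1 : {sigma_finite_measure set T1 -> \bar R}).
Variables (m2 : {sigma_finite_measure set T2 -> \bar R}).
Variable f : T1 -> T2 -> \bar R.
Hypothesis mf : mfunT (fun z : T1 * T2 => f z.1 z.2).
Hypothesis f0 : forall x y, (0 <= f x y)%E.

Lemma tonelli_swap :
  (\int[m1]_x \int[m2]_y f x y = \int[m2]_y \int[m1]_x f x y)%E.
Proof. by apply: (fubini_tonelli (fun z => f z.1 z.2)) => // z; exact: f0. Qed.

Lemma measurable_partial_integral :
  mfunT (fun x => \int[m2]_y f x y)%E.
Proof.
by apply: (measurable_fun_fubini_tonelli_F (fun z => f z.1 z.2)) => // z; exact: f0.
Qed.

Lemma measurable_section x : mfunT (f x).
Proof. exact: (measurableT_comp mf (measurable_pair1 x)). Qed.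

End tonelli.

(** * Volume lost by a random displacement *)

Section exit.
Context {R : realType} (n : nat).
Local Notation V := 'rV[R]_n.
Variables (U : set V) (r : R).
Hypotheses (n0 : (0 < n)%N) (oU : eopen U) (cU : econvex U) (BU : oball 1 `<=` U).
Hypothesis Ur : U `<=` eball r.

Let mU : measurable U. Proof. exact: measurable_eopen. Qed.

Lemma dot_sub_scale (v d : V) s :
  dot (v - s *: d) (v - s *: d) = dot v v - 2 * (s * dot v d) + s * (s * dot d d).
Proof.
by rewrite dotDl !dotDr !dotNl !dotNr !dotZl !dotZr (dotC d v); ring.
Qed.

Lemma measurable_row_affine (y : V) e : mfunT (fun w : V => y + e *: w).
Proof.
apply: measurable_rowD; first exact: measurable_cst.
by apply: measurable_rowZ; [exact: measurable_cst|exact: measurable_id].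
Qed.

Let measurable_reach y e : measurable [set w : V | U (y - e *: w)].
Proof.
have := measurable_row_affine y (- e) measurableT mU; rewrite setTI.
congr (measurable _); apply/funext => w /=; by rewrite scaleNr.
Qed.

Let n0R : 0 < n%:R :> R. Proof. by rewrite ltr0n. Qed.

Let U_0 : U 0. Proof. by apply: BU; rewrite /oball/= enorm0. Qed.

Lemma convex_vol_fin : (vol n U < +oo)%E.
Proof.
apply: le_lt_trans (vol_eball_fin n r); apply: le_measure; rewrite ?inE//.
exact: measurable_eball.
Qed.

Lemma star_convex x w a b : U x -> U (x + b *: w) -> 0 <= a <= b -> U (x + a *: w).
Proof.
move=> Ux Uxb /andP[a0 ab]; have [b0|b0] := eqVneq b 0.
  by move: ab Uxb; rewrite b0 => a0'; rewrite (_ : a = 0)//; apply/eqP; rewrite eq_le a0 a0'.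
have bp : 0 < b by lra.
have h : 0 <= a / b <= 1 by rewrite divr_ge0 ?(ltW bp)//= ler_pdivrMr// mul1r.
have := cU Ux Uxb h; congr (U _).
rewrite scalerDr scalerA divfK// addrA -scalerDl.
by rewrite subrK scale1r.
Qed.

(** As U is convex and contains the unit ball, its dilate by 1 + u contains the u-neighbourhood of
    U. *)
Lemma near_dilate u y a : 0 < u -> U a -> enorm (y - a) < u -> U ((1 + u)^-1 *: y).
Proof.
move=> u0 Ua ya; have u1 : 0 < 1 + u by lra.
have Uq : U (u^-1 *: (y - a)).
  apply: BU; rewrite /oball/= enormZ ger0_norm ?invr_ge0 ?(ltW u0)//.
  by rewrite mulrC ltr_pdivrMr// mul1r.
have h : 0 <= u / (1 + u) <= 1.
  by rewrite divr_ge0 ?(ltW u0) ?(ltW u1)//= ler_pdivrMr// mul1r lerDr.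
have := cU Ua Uq h; congr (U _).
rewrite (_ : 1 - u / (1 + u) = (1 + u)^-1); last by field; rewrite gt_eqF.
rewrite scalerA (_ : u / (1 + u) / u = (1 + u)^-1).
  by rewrite -scalerDr [a + _]addrC subrK.
by field; rewrite !gt_eqF.
Qed.

(* The almost nearest point a of U to y separates U from y up to an error that
   is quadratically small, so that y - e w in U forces <y - a, w> to be large. *)
Lemma far_point_chebyshev u e y : 0 < u -> 0 < e -> ~ U ((1 + u)^-1 *: y) ->
  (vol n (oball 1 `&` [set w : V | U (y - e *: w)%R]) <=
   (2 * e ^+ 2 / (n%:R * u ^+ 2) * ballvol n)%:E)%E.
Proof.
move=> u0 e0 yU.
have r0 : 0 <= r by apply: le_trans (Ur U_0); exact: enorm_ge0.
have dist a : U a -> u ^+ 2 <= dot (y - a) (y - a).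
  move=> Ua; rewrite -sqr_enorm ler_pXn2r// ?nnegrE ?(ltW u0) ?enorm_ge0//.
  by rewrite leNgt; apply/negP => /(near_dilate u0 Ua).
pose Q := [set q | exists2 a, U a & q = dot (y - a) (y - a)].
have hasQ : has_inf Q.
  split; first by exists (dot (y - 0) (y - 0)); exists 0.
  by exists (u ^+ 2) => _ [a Ua ->]; exact: dist.
pose m := inf Q.
have um : u ^+ 2 <= m.
  by apply: lb_le_inf; [case: hasQ|move=> _ [a Ua ->]; exact: dist].
have u20 : 0 < u ^+ 2 by rewrite exprn_gt0.
have m0 : 0 < m by lra.
pose D2 := (2 * r + 1) ^+ 2.
have D20 : 0 < D2 by rewrite exprn_gt0// ltr_wpDl// mulr_ge0.
(* Moving from a towards b by the fraction s changes the squared distance to y by a linear and a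
   quadratic term; this s keeps the quadratic one, s^2 |b - a|^2, below s m / 8. *)
pose s := Num.min 1 (m / (8 * D2)).
have s0 : 0 < s by rewrite lt_min ltr01/= divr_gt0// mulr_gt0.
have s1 : s <= 1 by rewrite ge_min lexx.
have sD : s * D2 <= m / 8.
  have : s <= m / (8 * D2) by rewrite ge_min lexx orbT.
  rewrite -(ler_pM2r D20) => /le_trans; apply.
  by rewrite (_ : m / (8 * D2) * D2 = m / 8)//; field; rewrite gt_eqF.
have eta0 : 0 < s * m / 8 by rewrite divr_gt0// mulr_gt0.
have [q [a Ua ->] qa] := inf_adherent eta0 hasQ.
rewrite -/m in qa.
set v := y - a in qa; set N := dot v v in qa.
have mN : m <= N by apply: ge_inf; [case: hasQ|exists a].
have N0 : 0 < N by lra.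
have key w : U (y - e *: w) -> 7 / 8 * N <= e * dot v w.
  move=> Ub; set b := y - e *: w in Ub.
  have s01 : 0 <= s <= 1 by lra.
  have Uc := cU Ua Ub s01.
  have mc : m <= dot (v - s *: (b - a)) (v - s *: (b - a)).
    apply: ge_inf; first by case: hasQ.
    exists ((1 - s) *: a + s *: b) => //.
    suff -> : v - s *: (b - a) = y - ((1 - s) *: a + s *: b) by [].
    rewrite /v scalerBr scalerBl scale1r opprB opprD !opprD !opprK.
    by rewrite -!addrA; congr (_ + _); congr (_ + _); rewrite addrC.
  have bD : dot (b - a) (b - a) <= D2.
    rewrite -sqr_enorm ler_pXn2r// ?nnegrE ?enorm_ge0 ?addr_ge0 ?mulr_ge0//.
    apply: le_trans (ler_enormB _ _) _; have := Ur Ua; have := Ur Ub.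
    by rewrite /eball/=; lra.
  rewrite dot_sub_scale -/N in mc.
  have ba : dot v (b - a) = N - e * dot v w.
    have -> : b - a = v - e *: w by rewrite /b /v addrAC.
    by rewrite dotDr dotNr dotZr.
  rewrite ba in mc.
  have sb : s * (s * dot (b - a) (b - a)) <= s * (m / 8).
    by rewrite ler_pM2l//; apply: le_trans sD; rewrite ler_pM2l.
  have h : s * (2 * (N - e * dot v w)) <= s * (m / 4) by lra.
  by move: h; rewrite ler_pM2l//; lra.
set S := _ `&` _.
have mS : measurable S.
  apply: measurableI; first exact: measurable_oball.
  exact: measurable_reach.
(* Chebyshev's inequality at the level <v, w> >= 7 N / (8 e) supplied by [key]. *)
pose k := (49 / 64) * N ^+ 2 / e ^+ 2.
have k0 : 0 < k by rewrite divr_gt0 ?exprn_gt0// mulr_gt0 ?divr_gt0// exprn_gt0.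
have C : (k%:E * vol n S <= (N * ballvol n / n%:R)%:E)%E.
  apply: le_trans (ball_second_moment v).
  rewrite -(integral_cst (vol n) mS) [leLHS]integral_mkcond/=.
  apply: ge0_le_integral => //.
  - by move=> w _; rewrite patchE; case: ifP => // _; rewrite lee_fin ltW.
  - by apply/(measurable_restrictT _ _).1 => //; exact: measurable_cst.
  - apply/measurable_EFinP/measurable_funM; first exact: measurable_oball_indic.
    by apply: measurable_funX; exact: measurable_dot.
  move=> w _; rewrite patchE; case: ifPn => [|_]; last first.
    by nneg.
  rewrite inE => -[Bw /key h]; rewrite indicE mem_set// mul1r lee_fin.
  rewrite /k ler_pdivrMr ?exprn_gt0// -exprMn mulrC [_ * e]mulrC.
  have : (7 / 8 * N) ^+ 2 <= (e * dot v w) ^+ 2.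
    by rewrite ler_pXn2r// nnegrE ?(le_trans _ h)// mulr_ge0 ?divr_ge0// ltW.
  by apply: le_trans; rewrite exprMn; lra.
have Soo : vol n S \is a fin_num.
  rewrite ge0_fin_numE//; apply: le_lt_trans (oball_fin n 1).
  by apply: le_measure; rewrite ?inE//; [exact: measurable_oball|move=> w []].
rewrite -(fineK Soo) lee_fin; move: C; rewrite -[in X in X -> _](fineK Soo) -EFinM lee_fin.
set z := fine _ => C.
have z0 : 0 <= z by exact: fine_ge0.
have b0 := @ballvol_gt0 R n.
have h1 : N * z <= (64 / 49) * (e ^+ 2 * ballvol n / n%:R).
  have K1 : 0 <= 64 / 49 * e ^+ 2 / N.
    by rewrite divr_ge0 ?(ltW N0)// mulr_ge0 ?sqr_ge0// divr_ge0.
  have := ler_wpM2l K1 C.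
  have -> : 64 / 49 * e ^+ 2 / N * (k * z) = N * z.
    by rewrite /k; field; rewrite !gt_eqF.
  have -> // : 64 / 49 * e ^+ 2 / N * (N * ballvol n / n%:R) = (64 / 49) * (e ^+ 2 * ballvol n / n%:R).
  by field; rewrite !gt_eqF.
have h2 : u ^+ 2 * z <= 2 * (e ^+ 2 * ballvol n / n%:R).
  apply: (@le_trans _ _ (N * z)); first by rewrite ler_wpM2r// (le_trans um).
  apply: (le_trans h1); rewrite ler_wpM2r ?divr_ge0 ?mulr_ge0 ?sqr_ge0 ?(ltW b0) ?(ltW n0R) ?(ltW e0)//.
  by lra.
rewrite -(ler_pM2l u20); apply: (le_trans h2).
by apply: eqW; field; rewrite !gt_eqF.
Qed.

Let gap (e : R) (x w : V) : R := \1_(@oball R n 1) w * (\1_U x * (1 - \1_U (x + e *: w))).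

Definition exit_volume (e : R) : \bar R := (\int[vol n]_w \int[vol n]_x (gap e x w)%:E)%E.

Lemma gap_ge0 e x w : 0 <= gap e x w.
Proof.
by nneg.
Qed.

Let mI : mfunT (\1_U : V -> R). Proof. by meas. Qed.

Let mgap e : mfunT (fun z : V * V => (gap e z.2 z.1)%:E).
Proof.
apply/measurable_EFinP; apply: measurable_funM.
  by meas.
by meas.
Qed.

(** A displacement by N e w leaves U only if one of N successive displacements by e w does, and
    translation invariance gives each of them the same bound. Estimates for small e thereby extend
    to all e. *)
Lemma exit_volume_scale (e : R) N : (exit_volume (N%:R * e) <= N%:R%:E * exit_volume e)%E.
Proof.
rewrite /exit_volume -ge0_integralZl_EFin//; last 2 first.
- by move=> w _; apply: integral_ge0 => x _; rewrite lee_fin gap_ge0.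
- by apply: (measurable_partial_integral (vol n) (f := fun w x => (gap e x w)%:E) (mgap e)) => w x; rewrite lee_fin gap_ge0.
apply: ge0_le_integral => //.
- by move=> w _; apply: integral_ge0 => x _; rewrite lee_fin gap_ge0.
- by apply: (measurable_partial_integral (vol n) (f := fun w x => (gap (N%:R * e) x w)%:E) (mgap _)) => w x; rewrite lee_fin gap_ge0.
- by apply: measurable_funeM; apply: (measurable_partial_integral (vol n) (f := fun w x => (gap e x w)%:E) (mgap e)) => w x; rewrite lee_fin gap_ge0.
move=> w _; elim: N => [|N IH].
  rewrite mul0e integral0_eq// => x _; congr EFin.
  by rewrite /gap mul0r scale0r addr0 !indicE; case: (x \in U); rewrite /= ?subrr ?mul0r ?mulr0.
have ms k : mfunT (fun x => (gap k x w)%:E).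
  by have := measurable_section (f := fun w x => (gap k x w)%:E) (mgap k) w.
have mtr : mfunT (fun x : V => x + (N%:R * e) *: w).
  by meas.
have g0 k x : (0 <= (gap k x w)%:E)%E by nneg.
apply: (@le_trans _ _ (\int[vol n]_x ((gap (N%:R * e) x w)%:E + (gap e (x + (N%:R * e) *: w)%R w)%:E))%E).
  apply: ge0_le_integral => //.
  - by apply: emeasurable_funD => //; exact: (measurableT_comp (ms e) mtr).
  move=> x _; rewrite -EFinD lee_fin /gap -mulrDr ler_wpM2l//.
  have -> : x + (N.+1%:R * e) *: w = x + (N%:R * e) *: w + e *: w.
    by rewrite -addrA -scalerDl -natr1 mulrDl mul1r.
  rewrite !indicE; set c1 := x \in U; set c2 := x + (N%:R * e) *: w \in U.
  by set c3 := _ \in U; case: c1; case: c2; case: c3; rewrite /=; lra.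
rewrite ge0_integralD//; last exact: (measurableT_comp (ms e) mtr).
rewrite (ge0_integral_translate ((N%:R * e) *: w) (F := fun x => (gap e x w)%:E))//.
apply: le_trans (leeD IH (lexx _)) _.
rewrite -natr1 EFinD ge0_muleDl ?mul1e// lee_fin//.
Qed.

Let dil (u : R) : set V := [set y | U ((1 + u)^-1 *: y)].

Let mdil u : measurable (dil u).
Proof.
rewrite (_ : dil u = (fun y => (1 + u)^-1 *: y) @^-1` U)//.
rewrite -[_ @^-1` _]setTI; apply: measurable_rowZ => //; exact: measurable_id.
Qed.

Let vU := fine (vol n U).

Let volUE : vol n U = vU%:E.
Proof. by rewrite fineK// ge0_fin_numE// convex_vol_fin. Qed.

Let vU0 : 0 < vU.
Proof. by have := vol_eopen_gt0 oU (ex_intro _ 0 U_0); rewrite volUE lte_fin. Qed.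

Let vol_dil u : 0 <= u -> vol n (dil u) = ((1 + u) ^+ n * vU)%:E.
Proof.
move=> u0; have u1 : 0 < 1 + u by lra.
rewrite vol_scale ?invr_eq0 ?gt_eqF//.
by rewrite ger0_norm ?invr_ge0 ?(ltW u1)// invrK EFinM -volUE.
Qed.

Let dilS u v : 0 <= u <= v -> dil u `<=` dil v.
Proof.
move=> /andP[u0 uv] y Uy; have u1 : 0 < 1 + u by lra.
have v1 : 0 < 1 + v by lra.
have h : 0 <= (1 + u) / (1 + v) <= 1.
  by rewrite divr_ge0 ?(ltW u1) ?(ltW v1)//= ler_pdivrMr// mul1r lerD2l.
rewrite /dil/=; have := cU U_0 Uy h; rewrite scaler0 add0r scalerA; congr (U _).
by congr (_ *: _); field; rewrite !gt_eqF.
Qed.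

Let layer_vol u v : 0 <= u <= v -> (1 + v) ^+ n <= 5 / 4 ->
  (vol n (dil v `\` dil u) <= ((5 / 4) * n%:R * (v - u) * vU)%:E)%E.
Proof.
move=> uv hv; have /andP[u0 uv'] := uv.
have D1 : vol n (dil v `\` dil u) = (vol n (dil v) - vol n (dil v `&` dil u))%E.
  have Dv : (vol n (dil v) < +oo)%E by rewrite vol_dil ?ltry// (le_trans u0).
  by apply: measureD.
have D2 : dil v `&` dil u = dil u by apply: setIidr; exact: dilS.
rewrite D1 D2 !vol_dil ?(le_trans u0)// -EFinB lee_fin -mulrBl ler_wpM2r ?(ltW vU0)//.
rewrite subrXX (_ : 1 + v - (1 + u) = v - u); last by ring.
rewrite mulrC ler_wpM2r ?subr_ge0//.
have v1 : 1 <= 1 + v by lra.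
have u1 : 1 <= 1 + u by rewrite lerDl.
apply: (@le_trans _ _ (\sum_(i < n) (5 / 4 : R))); last first.
  by rewrite sumr_const card_ord -[leLHS]mulr_natr.
apply: ler_sum => i _; apply: le_trans hv.
have -> : (1 + v) ^+ n = (1 + v) * ((1 + v) ^+ (n.-1 - i) * (1 + v) ^+ i).
  rewrite -exprD subnK -?exprS ?prednK// -ltnS prednK//.
apply: (@le_trans _ _ (1 * ((1 + v) ^+ (n.-1 - i) * (1 + v) ^+ i))).
  rewrite mul1r ler_wpM2l ?exprn_ge0 ?(le_trans ler01)//.
  by apply: lerXn2r; rewrite ?nnegrE ?(le_trans ler01)// lerD2l.
by rewrite ler_wpM2r// mulr_ge0// exprn_ge0// (le_trans ler01).
Qed.

Let prob_from (e : R) (y : V) : R := fine (vol n (oball 1 `&` [set w : V | U (y - e *: w)])).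

Let mset_from e y : measurable (oball 1 `&` [set w : V | U (y - e *: w)]).
Proof.
apply: measurableI; first exact: measurable_oball.
exact: measurable_reach.
Qed.

Let prob_fromE e y : vol n (oball 1 `&` [set w : V | U (y - e *: w)]) = (prob_from e y)%:E.
Proof.
rewrite fineK// ge0_fin_numE//; apply: le_lt_trans (oball_fin n 1).
by apply: le_measure; rewrite ?inE; [exact: mset_from|exact: measurable_oball|move=> w []].
Qed.

Let exit_volumeE (e : R) : 0 < e ->
  exit_volume e = (\int[vol n]_y (\1_(~` U) y * prob_from e y)%:E)%E.
Proof.
move=> e0; pose f (w y : V) : \bar R :=
  (\1_(@oball R n 1) w * (\1_U (y - e *: w) * (1 - \1_U y)))%:E.
have f0 w y : (0 <= f w y)%E.
  by nneg.
have mf : mfunT (fun z : V * V => f z.1 z.2).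
  apply/measurable_EFinP; apply: measurable_funM.
    by meas.
  by meas.
transitivity (\int[vol n]_w \int[vol n]_y f w y)%E.
  apply: eq_integral => w _.
  have ms : mfunT (f w) by exact: measurable_section mf w.
  rewrite -(ge0_integral_translate (e *: w) (F := f w))//.
  by apply: eq_integral => y _; rewrite /f /gap addrK.
rewrite (tonelli_swap (vol n) (vol n) mf)//; apply: eq_integral => y _.
have mB : mfunT (fun w : V => (\1_(oball 1 `&` [set w : V | U (y - e *: w)]) w)%:E : \bar R).
  by apply/measurable_EFinP; apply: measurable_indic.
have EP : (prob_from e y)%:E =
    (\int[vol n]_w (\1_(oball 1 `&` [set w : V | U (y - e *: w)]) w)%:E)%E.
  by rewrite -prob_fromE integral_indic ?setIT//; exact: mset_from.
rewrite EFinM EP -ge0_integralZl_EFin//.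
apply: eq_integral => w _; rewrite -EFinM; congr EFin.
rewrite indicI /= !indicE in_setC.
rewrite (_ : (w \in [set w0 : V | U (y - e *: w0)]) = (y - e *: w \in U)); last first.
  by nneg.
case: (y \in U) => /=; first by lra.
by lra.
Qed.

Let exit_integrand_measurable e :
  mfunT (fun y => (\1_(~` U) y * prob_from e y)%:E).
Proof.
apply/measurable_EFinP; apply: measurable_funM.
  by apply: measurable_indic; exact: measurableC.
pose f (y w : V) : \bar R := (\1_(@oball R n 1) w * \1_U (y - e *: w))%:E.
have mf : mfunT (fun z : V * V => f z.1 z.2).
  apply/measurable_EFinP; apply: measurable_funM.
    by meas.
  by meas.
have f0 y w : (0 <= f y w)%E by nneg.
rewrite (_ : prob_from e = fun y => fine (\int[vol n]_w f y w)%E).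
  have m1 := measurable_partial_integral (vol n) mf f0.
  have m2 : measurable_fun [set: \bar R] (@fine R) by [].
  exact: (measurableT_comp m2 m1).
apply/funext => y; rewrite /prob_from; congr fine.
have EP : vol n (oball 1 `&` [set w : V | U (y - e *: w)]) =
    (\int[vol n]_w (\1_(oball 1 `&` [set w : V | U (y - e *: w)]) w)%:E)%E.
  by rewrite integral_indic ?setIT//; exact: mset_from.
rewrite EP; apply: eq_integral => w _; rewrite /f indicI /= !indicE.
by nneg.
Qed.

(** Points outside U are sorted by dilates of relative size u j = 2^(j + 1) e / sqrt n. The layer
    between u j and 2 u j has volume of order n (u j) vU and, by [far_point_chebyshev], a proportion
    of at most 4^-j / 2 of the displacements reaches it from U, so the sum is geometric. Beyond u n
    >= e nothing arrives. The smallness hypothesis keeps the volumes of the dilates linear in u. *)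
Let exit_small (e : R) : 0 < e -> (1 + 2 * (e * 2 ^+ n)) ^+ n <= 5 / 4 ->
  (exit_volume e <= (5 * Num.sqrt n%:R * e * vU * ballvol n)%:E)%E.
Proof.
move=> e0 he; rewrite exit_volumeE//.
pose q := Num.sqrt n%:R : R.
have q0 : 0 < q by rewrite sqrtr_gt0.
have qq : q ^+ 2 = n%:R by rewrite sqr_sqrtr// ltW.
have q1 : 1 <= q by rewrite -[leLHS]sqrtr1 ler_sqrt// ler1n.
pose dl := e / q; have dl0 : 0 < dl by rewrite divr_gt0.
have dle : dl <= e by rewrite ler_pdivrMr// ler_peMr// ltW.
pose u j := 2 * (dl * 2 ^+ j).
have u0 j : 0 < u j by rewrite mulr_gt0// mulr_gt0// exprn_gt0.
have uS j : u j.+1 = 2 * u j by rewrite /u exprS; ring.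
have un : e <= u n.
  have : n%:R <= 2 ^+ n :> R by rewrite -natrX ler_nat ltnW// ltn_expl.
  have qn : q <= n%:R by rewrite -qq expr2 ler_peMr// ltW.
  move=> /(le_trans qn); rewrite -(ler_pM2l dl0) {1}/dl divfK ?gt_eqF//.
  rewrite /u; have : 0 < dl * 2 ^+ n by rewrite mulr_gt0// exprn_gt0.
  lra.
have uj j : (j <= n)%N -> (1 + u j) ^+ n <= 5 / 4.
  move=> jn; apply: le_trans he.
  have A : 1 + u j <= 1 + 2 * (e * 2 ^+ n).
    rewrite lerD2l /u ler_wpM2l//; apply: ler_pM; rewrite ?(ltW dl0) ?exprn_ge0//.
    by rewrite ler_weXn2l// ler1n.
  have A0 : 0 <= 1 + u j by nneg.
  by apply: lerXn2r; rewrite ?nnegrE// (le_trans A0).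
have b0 := @ballvol_gt0 R n.
have pb y : 0 <= prob_from e y <= ballvol n.
  rewrite fine_ge0//= -lee_fin -prob_fromE -vol_oball1.
  by apply: le_measure; rewrite ?inE; [exact: mset_from|exact: measurable_oball|move=> w []].
pose c j : R := 2^-1 * 4^-1 ^+ j * ballvol n.
have c0 j : 0 <= c j by nneg.
have cheb j y : ~ dil (u j) y -> prob_from e y <= c j.
  move=> yd; rewrite -lee_fin -prob_fromE.
  apply: le_trans (far_point_chebyshev (u0 j) e0 yd) _; rewrite lee_fin ler_wpM2r ?(ltW b0)//.
  rewrite -qq /u /dl (_ : 2 * _ / _ = 2^-1 * (4 ^+ j)^-1) ?exprVn//.
  have -> : 4 ^+ j = (2 ^+ j) ^+ 2 :> R by rewrite (_ : 4 = 2 ^+ 2 :> R) -?exprM 1?mulnC//; ring.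
  by field; rewrite !gt_eqF ?exprn_gt0.
have far y : ~ dil (u n) y -> prob_from e y = 0.
  move=> yd; rewrite /prob_from (_ : _ `&` _ = set0) ?measure0//.
  apply/seteqP; split => // w [Bw /= Uw]; apply: yd; apply: (near_dilate (u0 n) Uw).
  rewrite opprB addrCA subrr addr0 enormZ gtr0_norm//.
  apply: lt_le_trans un; by rewrite -[ltRHS]mulr1 ltr_pM2l.
pose L j := dil (u j.+1) `\` dil (u j).
have mL j : measurable (L j) by exact: measurableD.
have ptw y : \1_(~` U) y * prob_from e y <=
    ballvol n * \1_(dil (u 0) `\` dil 0) y + \sum_(j < n) c j * \1_(L j) y.
  have [p0 p1] := andP (pb y).
  have S0 : 0 <= \sum_(j < n) c j * \1_(L j) y by nneg.
  have [yU|yU] := pselect (U y).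
    rewrite (@indicE _ _ (~` U)) memNset ?mul0r; last by move=> h; apply: h.
    by nneg.
  rewrite (@indicE _ _ (~` U)) mem_set// mul1r.
  have [yn|yn] := pselect (dil (u n) y); last first.
    by rewrite far// addr_ge0// mulr_ge0// ltW.
  have [y0|y0] := pselect (dil (u 0) y).
    rewrite indicE mem_set ?mulr1; last first.
      by split => //; rewrite /dil/= addr0 invr1 scale1r.
    by lra.
  have [j [jn yj yj1]] : exists j, [/\ (j < n)%N, ~ dil (u j) y & dil (u j.+1) y].
    have : exists j, `[< dil (u j) y >] by exists n; apply/asboolP.
    move=> /ex_minnP[[|j] /asboolP yj jmin] //.
    exists j; split=> //; first by apply: jmin; apply/asboolP.
    by move=> /asboolP /jmin; rewrite ltnn.
  rewrite (bigD1 (Ordinal jn))//= (@indicE _ _ (L j)) mem_set// mulr1.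
  apply: (le_trans (cheb j y yj)); rewrite addrCA lerDl addr_ge0// ?mulr_ge0 ?(ltW b0)//.
  by nneg.
have mD0 : measurable (dil (u 0) `\` dil 0) by exact: measurableD.
apply: (@le_trans _ _ (\int[vol n]_y ((ballvol n)%:E * (\1_(dil (u 0%N) `\` dil 0) y)%:E +
    \sum_(j < n) (c j)%:E * (\1_(L j) y)%:E))%E).
  apply: ge0_le_integral => //.
  - by move=> y _; rewrite lee_fin mulr_ge0//; have /andP[] := pb y.
  - apply: emeasurable_funD; first by meas; apply/measurable_EFinP; exact: measurable_indic.
    by apply: emeasurable_sum => j; apply: measurable_funeM; apply/measurable_EFinP; exact: measurable_indic.
  move=> y _; under eq_bigr do rewrite -EFinM.
  by rewrite sumEFin -EFinM -EFinD lee_fin.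
have mi (S : set V) : measurable S -> mfunT (fun y => (\1_S y)%:E : \bar R).
  by move=> mS; apply/measurable_EFinP; exact: measurable_indic.
rewrite ge0_integralD//; last 4 first.
- by nneg.
- by meas.
- by move=> y _; apply: sume_ge0 => j _; rewrite mule_ge0// lee_fin.
- by apply: emeasurable_sum => j; apply: measurable_funeM; exact: mi.
rewrite ge0_integral_sum//; last 2 first.
- by move=> j; apply: measurable_funeM; exact: mi.
- by nneg.
have E1 (a : R) (S : set V) : 0 <= a -> measurable S ->
    (\int[vol n]_y (a%:E * (\1_S y)%:E) = a%:E * vol n S)%E.
  move=> a0 mS; have m1 := mi _ mS.
  rewrite ge0_integralZl_EFin//.
  by rewrite integral_indic// setIT.
rewrite E1 ?(ltW b0)//; under eq_bigr do rewrite E1//.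
apply: (@le_trans _ _ ((ballvol n)%:E * (5 / 4 * n%:R * (u 0%N - 0) * vU)%:E +
    \sum_(j < n) (c j)%:E * (5 / 4 * n%:R * (u j.+1 - u j) * vU)%:E)%E).
  apply: leeD.
    apply: lee_wpmul2l; first by nneg.
    by apply: layer_vol; rewrite ?uj// lexx (ltW (u0 _)).
  apply: lee_sum => j _; apply: lee_wpmul2l; first by rewrite lee_fin.
  apply: layer_vol; last by apply: uj.
  by have := u0 j; rewrite uS; lra.
under eq_bigr do rewrite -EFinM.
rewrite sumEFin -EFinM -EFinD lee_fin.
have geo m : \sum_(j < m) 2^-1 ^+ j <= (2 : R).
  suff -> : \sum_(j < m) 2^-1 ^+ j = 2 - 2 * 2^-1 ^+ m :> R.
    by rewrite gerBl mulr_ge0// exprn_ge0.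
  elim: m => [|m IH]; first by rewrite big_ord0 expr0; ring.
  by rewrite big_ord_recr/= IH exprS; field.
have K0 : 0 <= 5 / 4 * n%:R * vU * ballvol n * dl.
  by nneg.
have -> : \sum_(j < n) c j * (5 / 4 * n%:R * (u j.+1 - u j) * vU) =
    (5 / 4 * n%:R * vU * ballvol n * dl) * \sum_(j < n) 2^-1 ^+ j.
  rewrite mulr_sumr; apply: eq_bigr => j _; rewrite uS /c /u.
  have -> : 4^-1 ^+ j = 2^-1 ^+ j * 2^-1 ^+ j :> R.
    by rewrite -exprMn; congr (_ ^+ _); field.
  have h2 : 2^-1 ^+ j * 2 ^+ j = 1 :> R by rewrite -exprMn mulVf// expr1n.
  transitivity (5 / 4 * n%:R * vU * ballvol n * dl * 2^-1 ^+ j * (2^-1 ^+ j * 2 ^+ j)); first by field.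
  by rewrite h2 mulr1.
have := ler_wpM2l K0 (geo n).
have -> : ballvol n * (5 / 4 * n%:R * (u 0%N - 0) * vU) = 5 / 4 * n%:R * vU * ballvol n * dl * 2.
  by rewrite /u expr0; ring.
have nd : n%:R * dl = q * e by rewrite -qq /dl; field; rewrite gt_eqF.
have -> : 5 / 4 * n%:R * vU * ballvol n * dl = 5 / 4 * (q * e) * vU * ballvol n.
  by rewrite -nd; ring.
have -> : 5 * Num.sqrt n%:R * e * vU * ballvol n = 5 / 4 * (q * e) * vU * ballvol n * 4.
  by rewrite -/q; field.
lra.
Qed.

Lemma exit_volume_le (e : R) : 0 < e ->
  (exit_volume e <= (5 * Num.sqrt n%:R * e * vU * ballvol n)%:E)%E.
Proof.
(* With N > K the step e / N satisfies n x <= 1/5 for the x below; (1 + x)^n (1 - x)^n <= 1 and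
   Bernoulli's inequality then give (1 + x)^n <= 5/4. *)
move=> e0; pose K := 10 * n%:R * (e * 2 ^+ n) : R.
have p0 : 0 < e * 2 ^+ n by rewrite mulr_gt0// exprn_gt0.
have K0 : 0 < K by rewrite mulr_gt0// mulr_gt0.
pose N := (Num.truncn K).+1.
have KN : K < N%:R by exact: truncnS_gt.
have N0 : 0 < N%:R :> R by rewrite ltr0n.
have eE : e = N%:R * (e / N%:R) by rewrite mulrCA divff ?mulr1// gt_eqF.
rewrite {1}eE; apply: le_trans (exit_volume_scale _ _) _.
have eN0 : 0 < e / N%:R by rewrite divr_gt0.
pose x := 2 * (e / N%:R * 2 ^+ n).
have x0 : 0 < x by rewrite mulr_gt0// mulr_gt0// exprn_gt0.
have nx : n%:R * x <= 1 / 5.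
  have -> : n%:R * x = K / N%:R / 5 by rewrite /x /K; field; rewrite gt_eqF.
  by rewrite ler_pM2r ?invr_gt0// ler_pdivrMr// mul1r ltW.
have x1 : x <= 1 / 5 by apply: le_trans nx; rewrite ler_peMl ?(ltW x0)// ler1n.
have hx : (1 + x) ^+ n <= 5 / 4.
  have pr : (1 + x) ^+ n * (1 - x) ^+ n <= 1.
    rewrite -exprMn expr_le1//; first by nra.
    by rewrite mulr_ge0; lra.
  have := @bernoulli_le _ x n ltac:(lra); have : 0 <= (1 + x) ^+ n by nneg.
  move: pr nx; set A := (1 + x) ^+ n; set B := (1 - x) ^+ n; set C := n%:R * x.
  move=> pr nx A0 BC.
  have : A * (4 / 5) <= A * B by rewrite ler_wpM2l//; lra.
  lra.
have := exit_small eN0 hx.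
have N0' : (0 <= N%:R%:E :> \bar R)%E by nneg.
move=> /(lee_wpmul2l N0') /le_trans; apply; rewrite -EFinM lee_fin.
by apply: eqW; field; rewrite gt_eqF.
Qed.

End exit.

(** Brunn-Minkowski in minimum form, from [mixed_bm_open] with constant weight. The sets are
    exchanged so that vol A <= vol K, where the factor 1 + t (1 - vol A / vol K) is at least 1. *)
Lemma bm_ball (R : realType) (n : nat) (t : R) (A K W : set 'rV[R]_n) (c : R) :
  0 <= t <= 1 -> eopen A -> A `<=` oball 1 -> A !=set0 ->
  eopen K -> K `<=` oball 1 -> K !=set0 -> measurable W ->
  (forall x y, A x -> K y -> W ((1 - t) *: x + t *: y)) ->
  (c%:E <= vol n A)%E -> (c%:E <= vol n K)%E -> (c%:E <= vol n W)%E.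
Proof.
move=> t01 oA AB A0 oK KB K0 mW.
wlog AK : t A K t01 oA AB A0 oK KB K0 / (vol n A <= vol n K)%E.
  move=> H HW cA cK; have [h|/ltW h] := leP (vol n A) (vol n K).
    exact: (H t A K).
  apply: (H (1 - t) K A) => //; first by move: t01; lra.
  by move=> x y Kx Ay; have := HW y x Ay Kx; rewrite opprB addrCA subrr addr0 addrC.
move=> HW cA _.
have BM : oball 1 `<=` @pbox R n (fun=> `]- 1%:R, 1%:R[%classic).
  move=> x; rewrite /oball/= => h i; rewrite /= in_itv/= -ltr_norml.
  exact: le_lt_trans (ler_coord_enorm x i) h.
have oB : eopen (@oball R n 1).
  move=> x /= hx; exists (1 - enorm x); first by rewrite subr_gt0.
  move=> y h; rewrite /oball/= -(subrK x y).
  by apply: le_lt_trans (ler_enormD _ _) _; move: h; lra.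
have one (S : set 'rV[R]_n) : measurable S ->
    (\int[vol n]_x (\1_S x * (fun=> 1%R) x)%:E = vol n S)%E.
  move=> mS; under eq_integral do rewrite mulr1.
  by rewrite integral_indic ?setIT.
have mA := measurable_eopen oA; have mK := measurable_eopen oK.
have Afin : (vol n A < +oo)%E.
  apply: le_lt_trans (oball_fin n 1).
  by apply: le_measure; rewrite ?inE//; exact: measurable_oball.
have Kfin : (vol n K < +oo)%E.
  apply: le_lt_trans (oball_fin n 1).
  by apply: le_measure; rewrite ?inE//; exact: measurable_oball.
have AE : vol n A = (fine (vol n A))%:E by rewrite fineK// ge0_fin_numE.
have KE : vol n K = (fine (vol n K))%:E by rewrite fineK// ge0_fin_numE.
have oneoo : (\int[vol n]_x (\1_(@oball R n 1) x * (fun=> 1%R) x)%:E < +oo)%E.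
  by rewrite one ?oball_fin//; exact: measurable_oball.
have sc (x y : 'rV[R]_n) : oball 1 x -> oball 1 y ->
    (1 - t) * (fun _ : 'rV[R]_n => 1 : R) x + t * (fun=> 1) y <= (fun=> 1) ((1 - t) *: x + t *: y).
  by lra.
have := @mixed_bm_open R n 1%N (oball 1) (fun=> 1) t BM oB (measurable_cst _)
  (fun=> ler01) t01 sc oneoo A K W oA AB A0 oK KB K0 mW HW _ _ _ _ erefl erefl
  erefl erefl.
rewrite !one//; apply: le_trans.
have a0 : 0 < fine (vol n A) by rewrite -lte_fin -AE; exact: vol_eopen_gt0.
have k0 : 0 < fine (vol n K) by rewrite -lte_fin -KE; exact: vol_eopen_gt0.
have ak : fine (vol n A) <= fine (vol n K) by rewrite -lee_fin -AE -KE.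
move: cA; rewrite AE /= !lee_fin => /le_trans; apply.
set a := fine (vol n A) in a0 ak *; set k := fine (vol n K) in k0 ak *.
rewrite divfK ?gt_eqF// -mulrDl subrK mul1r.
have /andP[t0 t1] := t01.
rewrite ler_peMl ?(ltW a0)// lerDl mulr_ge0// subr_ge0.
by rewrite ler_pdivrMr// mul1r.
Qed.

(** * The visibility scale *)

Section reach.
Context {R : realType} (n : nat).
Local Notation V := 'rV[R]_n.
Variables (U : set V) (r : R).
Hypotheses (n0 : (0 < n)%N) (oU : eopen U) (cU : econvex U) (BU : oball 1 `<=` U).
Hypothesis Ur : U `<=` eball r.

Let mU : measurable U. Proof. exact: measurable_eopen. Qed.

Let U_0 : U 0. Proof. by apply: BU; rewrite /oball/= enorm0. Qed.

Let n0R : 0 < n%:R :> R. Proof. by rewrite ltr0n. Qed.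

Let r0 : 0 <= r. Proof. by apply: le_trans (Ur U_0); exact: enorm_ge0. Qed.

Definition seen z (a : R) : set V := oball 1 `&` [set w : V | U (z + a *: w)].

Definition reach z (a : R) : Prop :=
  [/\ U z, 0 <= a & ((ballvol n / 2)%:E <= vol n (seen z a))%E].

Let open_seen z a : 0 <= a -> eopen (seen z a).
Proof.
move=> a0 w [Bw Uw]; have [e e0 He] := oU Uw.
have k0 : 0 < 1 - enorm w by rewrite subr_gt0.
exists (Num.min (1 - enorm w) (e / (a + 1))).
  by rewrite lt_min k0 divr_gt0// ltr_wpDl.
move=> y; rewrite lt_min => /andP[h1 h2]; split.
  rewrite /oball/= -(subrK w y).
  by apply: le_lt_trans (ler_enormD _ _) _; move: h1; lra.
apply: He; rewrite opprD addrACA subrr add0r -scalerBr enormZ ger0_norm//.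
move: h2; rewrite ltr_pdivlMr ?ltr_wpDl// => h2.
apply: le_lt_trans h2; rewrite mulrC ler_wpM2l ?enorm_ge0// lerDl//.
Qed.

Let measurable_seen z a : measurable (seen z a).
Proof.
apply: measurableI; first exact: measurable_oball.
by have := @measurable_row_affine R n z a measurableT _ mU; rewrite setTI.
Qed.

Let b0 := @ballvol_gt0 R n.

Let reach0 z : U z -> reach z 0.
Proof.
move=> Uz; split => //; rewrite (_ : seen z 0 = oball 1).
  by rewrite vol_oball1 lee_fin; have := b0; lra.
by apply/seteqP; split => w => [[]//|Bw]; split => //=; rewrite scale0r addr0.
Qed.

(** If x + a w and y + b v lie in U, so does their combination, which is the combined point plus q
    ((1 - u) w + u v) with u = t b / q. The sets of visible directions thus combine inside the unit
    ball, and [bm_ball] keeps half of it. *)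
Lemma reach_convex x y a b t : 0 <= t <= 1 -> reach x a -> reach y b ->
  reach ((1 - t) *: x + t *: y) ((1 - t) * a + t * b).
Proof.
move=> t01 [Ux a0 hx] [Uy b0' hy]; have /andP[t0 t1] := t01.
have t1' : 0 <= 1 - t by lra.
set z := _ + _; set q := _ + _.
have Uz : U z by exact: cU.
have q0 : 0 <= q by nneg.
have [->|qn0] := eqVneq q 0; first exact: reach0.
have qp : 0 < q by lra.
split=> //; pose u := t * b / q.
have uE : 1 - u = (1 - t) * a / q by rewrite /u /q; field; rewrite -/q.
have u01 : 0 <= u <= 1.
  rewrite divr_ge0 ?mulr_ge0//= -subr_ge0 uE divr_ge0// mulr_ge0//.
apply: (@bm_ball R n u (seen x a) (seen y b)) => //.
- exact: open_seen.
- by move=> w [].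
- by exists 0; split; rewrite /= ?scaler0 ?addr0// /oball/= enorm0.
- exact: open_seen.
- by move=> w [].
- by exists 0; split; rewrite /= ?scaler0 ?addr0// /oball/= enorm0.
move=> w v [Bw Uw] [Bv Uv]; split.
  rewrite /oball/=; apply: le_lt_trans (ler_enormD _ _) _.
  have /andP[u0 u1] := u01; have u1' : 0 <= 1 - u by lra.
  rewrite !enormZ !ger0_norm//; move: Bw Bv; rewrite /oball/= => Bw Bv.
  have [->|un0] := eqVneq u 0; first by rewrite subr0 mul1r mul0r addr0.
  have up : 0 < u by lra.
  have h1 : (1 - u) * enorm w <= 1 - u by rewrite ler_piMr// ltW.
  have h2 : u * enorm v < u by rewrite gtr_pMr.
  by lra.
have := cU Uw Uv t01; rewrite /=; congr (U _).
have -> : q *: ((1 - u) *: w + u *: v) = ((1 - t) * a) *: w + (t * b) *: v.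
  rewrite scalerDr !scalerA uE /u; congr (_ *: _ + _ *: _); by field; rewrite gt_eqF.
by rewrite !scalerDr !scalerA addrACA.
Qed.

(** Beyond range 8 r only w with |w| < 1/4 can stay in U, and these fill at most a quarter of the
    ball. *)
Lemma reach_le z a : reach z a -> a <= 8 * r.
Proof.
move=> [Uz a0 hz]; rewrite leNgt; apply/negP => ar.
have ap : 0 < a by apply: le_lt_trans ar; rewrite mulr_ge0.
have q4 : (0 : R) < 4^-1 by nneg.
have : (vol n (seen z a) <= vol n (@oball R n 4^-1))%E.
  apply: le_measure; rewrite ?inE//; first exact: measurable_oball.
  move=> w [_ /= Uw]; rewrite /oball/=.
  have h : enorm (a *: w) <= 2 * r.
    rewrite -[a *: w](addrK z); apply: le_trans (ler_enormB _ _) _.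
    by rewrite [a *: w + z]addrC; have := Ur Uw; have := Ur Uz; rewrite /eball/=; lra.
  rewrite enormZ gtr0_norm// in h.
  rewrite -(ltr_pM2l ap); apply: (le_lt_trans h); lra.
move=> /(le_trans hz); rewrite vol_oball// lee_fin.
have : 4^-1 ^+ n <= 4^-1 :> R.
  case: (n) n0 => // m _; rewrite exprS ler_piMr ?(ltW q4)//.
  by rewrite exprn_ile1 ?(ltW q4)// invf_le1// ler1n.
move=> /(ler_wpM2r (ltW b0)) h h'; have := b0; lra.
Qed.

Let kp : R := 34 * Num.sqrt n%:R.

Let kp0 : 0 < kp. Proof. by rewrite mulr_gt0// sqrtr_gt0. Qed.

Let cand x := [set q | exists z, exists2 a, reach z a & q = a - kp * enorm (x - z)].

(** Supremal convolution of the largest reach with the cone of slope [kp]. It is [kp]-Lipschitz by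
    construction and stays concave by [reach_convex]. The slope 34 sqrt n is tuned to
    [bump_shift_set]: moving the base point within the cone changes the visible bump mass by at most
    a quarter. *)
Definition scale x : R := Num.max 0 (sup (cand x)).

Let has_sup_cand x : has_sup (cand x).
Proof.
split; first by exists (0 - kp * enorm (x - 0)); exists 0, 0 => //; exact: reach0.
exists (8 * r) => _ [z [a /reach_le h ->]].
by apply: le_trans h; rewrite gerBl mulr_ge0 ?enorm_ge0// ltW.
Qed.

Lemma scale_ge0 x : 0 <= scale x. Proof. by rewrite /scale le_max lexx. Qed.

Lemma scale_ge x z a : reach z a -> a - kp * enorm (x - z) <= scale x.
Proof.
move=> h; rewrite /scale le_max; apply/orP; right.
by apply: (ub_le_sup (proj2 (has_sup_cand x))); exists z, a.
Qed.

Lemma scale_reach x a : 0 <= a < scale x ->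
  exists z b, reach z b /\ a < b - kp * enorm (x - z).
Proof.
move=> /andP[a0]; rewrite /scale lt_max ltNge a0/= => h.
have [_ [z [b hb ->]] hlt] := sup_gt (proj1 (has_sup_cand x)) h.
by exists z, b.
Qed.

Lemma scale_lipschitz x y : `|scale x - scale y| <= kp * enorm (x - y).
Proof.
suff H u v : scale u <= scale v + kp * enorm (u - v).
  have := H x y; have := H y x; rewrite enormBC => h1 h2.
  by rewrite ler_norml; apply/andP; split; lra.
rewrite {1}/scale ge_max addr_ge0 ?scale_ge0 ?mulr_ge0 ?enorm_ge0 ?(ltW kp0)//=.
apply: ge_sup; first by have [] := has_sup_cand u.
move=> _ [z [a ha ->]]; have := scale_ge v ha.
have : kp * enorm (v - z) <= kp * (enorm (u - v) + enorm (u - z)).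
  rewrite ler_pM2l// [enorm (u - v)]enormBC.
  apply: le_trans (ler_enormD _ _); by rewrite addrA subrK.
lra.
Qed.

Lemma measurable_scale : mfunT scale.
Proof. exact: (measurable_fun_lipschitz scale_lipschitz). Qed.

Lemma scale_gt0 x : U x -> 0 < scale x.
Proof.
move=> Ux; have [e e0 He] := oU Ux.
have : reach x e.
  split=> //; first exact: ltW.
  rewrite (_ : seen x e = oball 1); first by rewrite vol_oball1 lee_fin; have := b0; lra.
  apply/seteqP; split => w => [[]//|Bw]; split => //=; apply: He.
  by rewrite addrAC subrr add0r enormZ gtr0_norm// gtr_pMr.
by move/(scale_ge x); rewrite subrr enorm0 mulr0 subr0; exact: lt_le_trans.
Qed.

Lemma scale_concave x y t : U x -> U y -> 0 <= t <= 1 ->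
  (1 - t) * scale x + t * scale y <= scale ((1 - t) *: x + t *: y).
Proof.
move=> Ux Uy t01; have /andP[t0 t1] := t01.
have t1' : 0 <= 1 - t by lra.
apply/ler_addgt0Pr => e e0.
have pick v : U v -> exists z b, reach z b /\ scale v - e < b - kp * enorm (v - z).
  move=> Uv; have sv := scale_gt0 Uv.
  have [h|h] := leP 0 (scale v - e).
    by apply: scale_reach; rewrite h/= ltrBlDr ltrDl.
  by exists v, 0; split; [exact: reach0|rewrite subrr enorm0 mulr0 subr0].
have [z1 [a1 [h1 l1]]] := pick x Ux; have [z2 [a2 [h2 l2]]] := pick y Uy.
have := scale_ge ((1 - t) *: x + t *: y) (reach_convex t01 h1 h2).
have : kp * enorm ((1 - t) *: x + t *: y - ((1 - t) *: z1 + t *: z2)) <=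
    (1 - t) * (kp * enorm (x - z1)) + t * (kp * enorm (y - z2)).
  rewrite opprD addrACA -!scalerBr ![_ * (kp * _)]mulrCA -mulrDr ler_pM2l//.
  by apply: le_trans (ler_enormD _ _) _; rewrite !enormZ !ger0_norm.
have := ler_wpM2l t1' (ltW l1); have := ler_wpM2l t0 (ltW l2).
lra.
Qed.

(** Some z has reach b with kp |x - z| < b - a. From z at range b at least half of the bump mass is
    visible, passing to x shifts the bump by h = (z - x) / b and costs a quarter, and reducing the
    range from b to a can only help since U is star-shaped about x. *)
Lemma scale_inside x a : U x -> 0 <= a < scale x ->
  ((bumpvol n / 4)%:E <= \int[vol n]_w (\1_U (x + a *: w)%R * bump w ^+ 2)%:E)%E.
Proof.
move=> Ux a01; have [z [b [[Uz bb0 hz] hb]]] := scale_reach a01.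
have /andP[a0 _] := a01; have xz := enorm_ge0 (x - z).
have ab : a < b by apply: lt_le_trans hb _; rewrite gerBl mulr_ge0// ltW.
have bp : 0 < b by lra.
have mUz c v : measurable [set w : V | U (v + c *: w)].
  by have := @measurable_row_affine R n v c measurableT _ mU; rewrite setTI.
have mi c v : mfunT (fun w : V => \1_U (v + c *: w) : R).
  exact: (measurableT_comp (measurable_indic mU) (@measurable_row_affine R n v c)).
have mb := @measurable_bump_sqr R n.
have mI c v : mfunT (fun w : V => (\1_U (v + c *: w) * bump w ^+ 2)%:E).
  by meas.
have I0 c v (w : V) : (0 <= (\1_U (v + c *: w) * bump w ^+ 2)%:E)%E.
  by nneg.
have A1 : (\int[vol n]_w (\1_(@oball R n 1) w * \1_U (z + b *: w)%R)%:E = vol n (seen z b))%E.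
  have -> : vol n (seen z b) = (\int[vol n]_w (\1_(seen z b) w)%:E)%E.
    by rewrite integral_indic ?setIT.
  by apply: eq_integral => w _; rewrite /seen indicI.
have sfin : vol n (seen z b) = (fine (vol n (seen z b)))%:E.
  rewrite fineK// ge0_fin_numE//; apply: le_lt_trans (oball_fin n 1).
  by apply: le_measure; rewrite ?inE//; [exact: measurable_oball|move=> w []].
rewrite sfin in A1.
have star (rho : R) (w : V) : 0 < rho <= 1 -> oball 1 w ->
    \1_U (z + b *: w) <= \1_U (z + b *: (rho *: w)) :> R.
  move=> /andP[rho0 rho1] _; rewrite !indicE ler_nat scalerA.
  case: (boolP (z + b *: w \in U)) => //; rewrite inE => Uw.
  rewrite mem_set//; apply: (star_convex cU Uz Uw).
  by rewrite mulr_ge0 ?(ltW rho0)//= ler_piMr.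
have mS : mfunT (fun w : V => \1_U (z + b *: w) : R) by exact: mi.
have H1 := bump_avg_ge mS (fun w => ler0n R _) star A1.
have H2 : ((bumpvol n / 2)%:E <= \int[vol n]_w (bump w ^+ 2 * \1_U (z + b *: w)%R)%:E)%E.
  move: hz; rewrite sfin lee_fin => hz.
  have := H1; set J := (\int[vol n]_w _)%E => {}H1.
  have J0 : (0 <= J)%E by apply: integral_ge0 => w _; rewrite lee_fin mulr_ge0// sqr_ge0.
  have c0 := @bumpvol_gt0 R n n0.
  move: J J0 H1 => [j| |]//= _; rewrite ?leey// -!EFinM !lee_fin => H1.
  have hz' := ler_wpM2r (ltW c0) hz.
  by rewrite -(ler_pM2l b0); lra.
pose h := b^-1 *: (z - x).
have hh : 34 ^+ 2 * (n%:R * dot h h) <= 1.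
  rewrite -sqr_enorm /h enormZ ger0_norm ?invr_ge0 ?(ltW bp)// [enorm (z - x)]enormBC.
  have -> : 34 ^+ 2 * (n%:R * (b^-1 * enorm (x - z)) ^+ 2) = (kp * enorm (x - z) / b) ^+ 2.
    have qq : Num.sqrt n%:R ^+ 2 = n%:R :> R by rewrite sqr_sqrtr// ltW.
    by rewrite -{1}qq /kp; field; rewrite gt_eqF.
  have k0 : 0 <= kp * enorm (x - z) by nneg.
  rewrite expr_le1 ?divr_ge0 ?(ltW bp)// ler_pdivrMr// mul1r.
  by move: hb; lra.
have mset : measurable [set w : V | U (z + b *: w)] by exact: mUz.
have E1 (w : V) : \1_[set w : V | U (z + b *: w)] w = \1_U (z + b *: w) :> R.
  by nneg.
have := bump_shift_set n0 mset hh.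
under eq_integral do rewrite E1 mulrC.
move=> /(le_trans H2).
have -> : (\int[vol n]_w (\1_[set w : V | U (z + b *: w)%R] w * bump (w + h)%R ^+ 2)%:E =
    \int[vol n]_w (\1_U (x + b *: w)%R * bump w ^+ 2)%:E)%E.
  have := ge0_integral_translate h (mI b x) (I0 b x); move=> <-.
  apply: eq_integral => w _; rewrite E1; congr (\1_U _ * _)%:E.
  by rewrite scalerDr /h scalerA divff ?gt_eqF// scale1r addrCA [x + _]addrC subrK addrC.
have : (\int[vol n]_w (\1_U (x + b *: w)%R * bump w ^+ 2)%:E <=
    \int[vol n]_w (\1_U (x + a *: w)%R * bump w ^+ 2)%:E)%E.
  apply: ge0_le_integral => //.
  move=> w _; rewrite lee_fin ler_wpM2r ?sqr_ge0// !indicE ler_nat.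
  case: (boolP (x + b *: w \in U)) => //; rewrite inE => Uw.
  by rewrite mem_set//; apply: (star_convex cU Ux Uw); rewrite a0 ltW.
set J1 := (\int[vol n]_w _)%E; set J2 := (\int[vol n]_w _)%E => J12 H.
apply: le_trans J12; move: H; have : (0 <= J1)%E by apply: integral_ge0.
case: J1 => [j| |]//= _; rewrite ?leey// -EFinD !lee_fin; lra.
Qed.

(** At range 1 / (20 sqrt n) the bound of [exit_volume_le] makes the mean exit probability at most
    1/4. By Markov's inequality at least half of the volume of U then has this reach. *)
Lemma scale_mean : ((fine (vol n U) / (40 * Num.sqrt n%:R))%:E <=
  \int[vol n]_x (\1_U x * scale x)%:E)%E.
Proof.
pose q := Num.sqrt n%:R : R; have q0 : 0 < q by rewrite sqrtr_gt0.
pose a := (20 * q)^-1; have a0 : 0 < a by rewrite invr_gt0 mulr_gt0.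
have Uoo := convex_vol_fin oU Ur.
have UE : vol n U = (fine (vol n U))%:E by rewrite fineK// ge0_fin_numE.
set vU := fine (vol n U) in UE *.
have vU0 : 0 <= vU by exact: fine_ge0.
have mI : mfunT (\1_U : V -> R) by meas.
pose f (x w : V) : \bar R := (\1_(@oball R n 1) w * \1_U (x + a *: w))%:E.
have mshift : mfunT (fun z : V * V => z.1 + a *: z.2).
  by meas.
have mBs : mfunT (fun z : V * V => \1_(@oball R n 1) z.2 : R).
  by meas.
have mUs : mfunT (fun z : V * V => \1_U (z.1 + a *: z.2) : R).
  by meas.
have mf : mfunT (fun z : V * V => f z.1 z.2).
  by apply/measurable_EFinP; apply: measurable_funM.
have f0 x w : (0 <= f x w)%E by nneg.
pose g (x w : V) : \bar R :=
  (\1_(@oball R n 1) w * (\1_U x * (1 - \1_U (x + a *: w))))%:E.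
have mg : mfunT (fun z : V * V => g z.1 z.2).
  apply/measurable_EFinP; apply: measurable_funM => //.
  by meas.
have g0 x w : (0 <= g x w)%E.
  by nneg.
have mF := measurable_partial_integral (vol n) mf f0.
have mG := measurable_partial_integral (vol n) mg g0.
have fE x : (\int[vol n]_w f x w = vol n (seen x a))%E.
  have -> : vol n (seen x a) = (\int[vol n]_w (\1_(seen x a) w)%:E)%E.
    by rewrite integral_indic ?setIT.
  by apply: eq_integral => w _; rewrite /f /seen indicI.
have exitE : (\int[vol n]_x \int[vol n]_w g x w <= (vU * ballvol n / 4)%:E)%E.
  rewrite (tonelli_swap (vol n) (vol n) mg)//.
  apply: le_trans (exit_volume_le n0 oU cU BU Ur a0) _; rewrite lee_fin -/vU -/q.
  by apply: eqW; rewrite /a; field; rewrite gt_eqF.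
pose G := U `&` [set x | ((ballvol n / 2)%:E <= \int[vol n]_w f x w)%E].
have mGs : measurable G.
  apply: measurableI => //.
  rewrite (_ : [set x | _] = (fun x => \int[vol n]_w f x w)%E @^-1` `[(ballvol n / 2)%:E, +oo[).
    by rewrite -[_ @^-1` _]setTI; apply: mF => //; exact: emeasurable_itv.
  by apply/seteqP; split => x /=; rewrite in_itv/= andbT.
have ptw x : ((\1_U x * (ballvol n / 2))%:E <=
    (\1_G x * (ballvol n / 2))%:E + \int[vol n]_w g x w)%E.
  have G0 : (0 <= \int[vol n]_w g x w)%E by apply: integral_ge0.
  have bb : 0 <= ballvol n / 2 :> R by nneg.
  have [Ux|Ux] := pselect (U x); last first.
    by rewrite indicE memNset// mul0r adde_ge0// lee_fin mulr_ge0.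
  have [Gx|Gx] := pselect (G x).
    by rewrite !indicE !mem_set// mul1r leeDl.
  have mfx := measurable_section mf x; have mgx := measurable_section mg x.
  have tot : (\int[vol n]_w f x w + \int[vol n]_w g x w = (ballvol n)%:E)%E.
    rewrite -ge0_integralD//.
    have -> : (ballvol n)%:E = (\int[vol n]_w (\1_(@oball R n 1) w)%:E)%E.
      by rewrite -vol_oball1 integral_indic ?setIT//; exact: measurable_oball.
    apply: eq_integral => w _; rewrite /f /g -EFinD; congr EFin.
    by rewrite (@indicE _ _ U x) mem_set// mul1r; ring.
  have lt1 : (\int[vol n]_w f x w < (ballvol n / 2)%:E)%E.
    by rewrite ltNge; apply/negP => h; apply: Gx; split.
  rewrite (@indicE _ _ U x) mem_set// mul1r (@indicE _ _ G x) memNset// mul0r add0e.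
  have : (0 <= \int[vol n]_w f x w)%E by apply: integral_ge0.
  move: tot lt1 G0; case: (\int[vol n]_w f x w)%E => [y| |]//.
  case: (\int[vol n]_w g x w)%E => [y'| |]//=; rewrite -?EFinD => -[e].
  by rewrite lte_fin !lee_fin => h1 _ h2; lra.
have mh (S : set V) : measurable S ->
    mfunT (fun x : V => (\1_S x * (ballvol n / 2))%:E).
  move=> mS; apply/measurable_EFinP; apply: measurable_funM; last exact: measurable_cst.
  by meas.
have hb : 0 <= ballvol n / 2 :> R by nneg.
have Ih (S : set V) : measurable S ->
    (\int[vol n]_x (\1_S x * (ballvol n / 2))%:E = (ballvol n / 2)%:E * vol n S)%E.
  move=> mS; have m1 : mfunT (fun x : V => (\1_S x)%:E : \bar R).
    by meas.
  transitivity (\int[vol n]_x ((ballvol n / 2)%:E * (\1_S x)%:E))%E.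
    by apply: eq_integral => x _; rewrite -EFinM mulrC.
  by rewrite ge0_integralZl_EFin// integral_indic// setIT.
have vG : ((vU / 2)%:E <= vol n G)%E.
  have : ((ballvol n / 2)%:E * vol n U <= (ballvol n / 2)%:E * vol n G + (vU * ballvol n / 4)%:E)%E.
    apply: (@le_trans _ _ ((ballvol n / 2)%:E * vol n G + \int[vol n]_x \int[vol n]_w g x w)%E).
      rewrite -!Ih// -ge0_integralD//; last 3 first.
      - by nneg.
      - exact: mh.
      - by move=> x _; apply: integral_ge0.
      apply: ge0_le_integral => //.
      - by nneg.
      - exact: mh.
      - by apply: emeasurable_funD => //; exact: mh.
    by rewrite leeD2l.
  have Gfin : vol n G = (fine (vol n G))%:E.
    rewrite fineK// ge0_fin_numE//; apply: le_lt_trans Uoo.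
    by apply: le_measure; rewrite ?inE// => x [].
  rewrite UE Gfin -!EFinM -EFinD !lee_fin => H.
  by rewrite -(ler_pM2l b0); lra.
apply: (@le_trans _ _ (a%:E * vol n G)%E).
  apply: (@le_trans _ _ (a%:E * (vU / 2)%:E)%E); last by rewrite lee_wpmul2l// lee_fin ltW.
  rewrite -EFinM lee_fin le_eqVlt; apply/orP; left; apply/eqP.
  by rewrite /a -/q; field; rewrite gt_eqF.
have m1 : mfunT (fun x : V => (\1_G x)%:E : \bar R).
  by meas.
have -> : vol n G = (\int[vol n]_x (\1_G x)%:E)%E by rewrite integral_indic// setIT.
rewrite -ge0_integralZl_EFin ?(ltW a0)//; apply: ge0_le_integral => //.
- by nneg.
- by meas.
- by apply/measurable_EFinP; apply: measurable_funM => //; exact: measurable_scale.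
move=> x _; rewrite -EFinM lee_fin; have [Gx|Gx] := pselect (G x).
  have [Ux /= hx] := Gx; rewrite !indicE !mem_set// mulr1 mul1r.
  have Rx : reach x a by split => //; [exact: ltW|rewrite -fE].
  by have := scale_ge x Rx; rewrite subrr enorm0 mulr0 subr0.
by rewrite (@indicE _ _ G x) memNset// mulr0 mulr_ge0// scale_ge0.
Qed.

End reach.

(** * Logarithmic integrals *)

(** The integral is ln (b / a); the exponential in the hypothesis reduces numerical cases to
    [expR_ge_pow]. *)
Lemma integral_inv_le (R : realType) (a b c : R) : 0 < a -> 0 <= c ->
  b <= a * expR c ->
  (\int[@lebesgue_measure R]_t (\1_(`[a, b]%classic : set R) t * `|t|^-1)%:E <= c%:E)%E.
Proof.
move=> a0 c0 bc.
have E (t : R) : (\1_(`[a, b]%classic : set R) t * `|t|^-1)%:E =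
    ((fun t : R => (t^-1)%:E) \_ (`[a, b]%classic : set R)) t.
  rewrite patchE indicE; case: ifPn => [|]; rewrite ?mul0r// inE/= in_itv/= => /andP[ta _].
  by rewrite mul1r ger0_norm// (le_trans _ ta)// ltW.
under eq_integral do rewrite E.
rewrite -integral_mkcond.
have [ab|ab] := ltP a b; last first.
  have [->|nab] := eqVneq a b; last first.
    rewrite set_itv_ge ?integral_set0 ?lee_fin// bnd_simp.
    by lra.
  by rewrite set_itv1 integral_set1.
have pos x : a <= x -> 0 < x by lra.
rewrite (@continuous_FTC2 _ (fun t => t^-1) (@ln R))//; last 3 first.
- apply: derivable_within_continuous => x; rewrite in_itv/= => /andP[xa _].
  by apply: derivableV; rewrite ?gt_eqF ?pos//; exact: derivable_id.
- split.
  + move=> x; rewrite in_itv/= => /andP[xa _].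
    by have [] := is_derive1_ln (pos x (ltW xa)).
  + apply: cvg_at_right_filter; exact: (continuous_ln a0).
  + apply: cvg_at_left_filter; exact: (continuous_ln (pos b (ltW ab))).
- move=> x; rewrite in_itv/= => /andP[xa _].
  by rewrite derive1E; have [_ ->] := is_derive1_ln (pos x (ltW xa)).
rewrite -EFinB lee_fin -ln_div ?posrE ?pos ?(ltW ab)//.
rewrite -[leRHS]expRK ler_ln ?posrE ?divr_gt0 ?expR_gt0 ?pos ?(ltW ab)//.
by rewrite ler_pdivrMr// mulrC.
Qed.

Lemma expR_ge_pow (R : realType) (k : nat) : (11 / 10) ^+ k <= expR (k%:R / 10) :> R.
Proof.
have : (11 / 10 : R) <= expR (1 / 10) by apply: le_trans (expR_ge1Dx _); lra.
have e : expR (k%:R / 10) = expR (1 / 10) ^+ k :> R.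
  by rewrite -expRM_natl; congr expR; field.
by rewrite e => h; apply: lerXn2r; rewrite ?nnegrE ?expR_ge0 ?divr_ge0.
Qed.

Lemma expR2_ge4 (R : realType) : 4 <= expR 2 :> R.
Proof.
have -> : 2 = 20%:R / 10 :> R by lra.
by apply: le_trans (expR_ge_pow _ 20); lra.
Qed.

Lemma expR15_ge4 (R : realType) : 4 <= expR (3 / 2) :> R.
Proof.
have -> : 3 / 2 = 15%:R / 10 :> R by lra.
by apply: le_trans (expR_ge_pow _ 15); lra.
Qed.

Lemma expR17_ge (R : realType) : 44 / 9 <= expR (17 / 10) :> R.
Proof. by apply: le_trans (expR_ge_pow _ 17); lra. Qed.

Lemma expR4_ge16 (R : realType) : 16 <= expR 4 :> R.
Proof.
have -> : 4 = 40%:R / 10 :> R by lra.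
by apply: le_trans (expR_ge_pow _ 40); lra.
Qed.

Lemma expR1_ge2 (R : realType) : 2 <= expR 1 :> R.
Proof. by apply: le_trans (expR_ge1Dx _); lra. Qed.

(** * Means under Hellinger-close densities *)

Section hellinger_mean.
Context d (T : measurableType d) (R : realType) (mu : {measure set T -> \bar R}).
Variables (k a b F : T -> R).
Hypotheses (mk : mfunT k) (ma : mfunT a) (mb : mfunT b) (mF : mfunT F) (k0 : forall x, 0 <= k x)
  (F01 : forall x, 0 <= F x <= 1).
Variables (Za Zb ga gb W D : R).
Hypotheses (gb01 : 0 <= gb <= 1) (Ia : (\int[mu]_x (k x * a x ^+ 2)%:E = Za%:E)%E)
  (Ib : (\int[mu]_x (k x * b x ^+ 2)%:E = Zb%:E)%E)
  (IFa : (\int[mu]_x (k x * (F x * a x ^+ 2))%:E = (ga * Za)%:E)%E)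
  (IFb : (\int[mu]_x (k x * (F x * b x ^+ 2))%:E = (gb * Zb)%:E)%E)
  (IW : (\int[mu]_x (k x * ((F x - gb) ^+ 2 * b x ^+ 2))%:E <= (W ^+ 2)%:E)%E)
  (ID : (\int[mu]_x (k x * (a x - b x) ^+ 2)%:E <= (D ^+ 2)%:E)%E) (W0 : 0 <= W).
Hypothesis D0 : 0 < D.

Let M (f : T -> R) := mfunT (fun x => (k x * f x)%:E).

Let mM f : mfunT f -> M f.
Proof. by move=> mf; apply/measurable_EFinP; exact: measurable_funM. Qed.

Let I2 (c1 c2 : R) (f g : T -> R) : 0 <= c1 -> 0 <= c2 ->
  mfunT f -> mfunT g ->
  (forall x, 0 <= f x) -> (forall x, 0 <= g x) ->
  (\int[mu]_x (k x * (c1 * f x + c2 * g x))%:E =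
   c1%:E * \int[mu]_x (k x * f x)%:E + c2%:E * \int[mu]_x (k x * g x)%:E)%E.
Proof.
move=> c10 c20 mf mg f0 g0; rewrite -ge0_integral_linear//.
- by apply: eq_integral => x _; rewrite -!EFinM -EFinD; congr EFin; ring.
- exact: mM.
- exact: mM.
- by nneg.
- by nneg.
Qed.

Let ma2 : mfunT (fun x => a x ^+ 2). Proof. by meas. Qed.
Let mb2 : mfunT (fun x => b x ^+ 2). Proof. by meas. Qed.
Let mFa : mfunT (fun x => F x * a x ^+ 2). Proof. by meas. Qed.
Let mFb : mfunT (fun x => F x * b x ^+ 2). Proof. by meas. Qed.
Let mW : mfunT (fun x => (F x - gb) ^+ 2 * b x ^+ 2).
Proof.
by meas.
Qed.
Let mD : mfunT (fun x => (a x - b x) ^+ 2).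
Proof. by meas. Qed.

Let Fa0 x : 0 <= F x * a x ^+ 2.
Proof. by have /andP[? ?] := F01 x; rewrite mulr_ge0// sqr_ge0. Qed.
Let Fb0 x : 0 <= F x * b x ^+ 2.
Proof. by have /andP[? ?] := F01 x; rewrite mulr_ge0// sqr_ge0. Qed.
Let W20 x : 0 <= (F x - gb) ^+ 2 * b x ^+ 2. Proof. by nneg. Qed.

(** The integral of k (F - gb) b^2 vanishes, so the difference of means is that of k (F - gb) (a^2 -
    b^2), where a^2 - b^2 = 2 b (a - b) + (a - b)^2. Cauchy-Schwarz pairs (F - gb) b, of norm at
    most W, with a - b, of norm at most D; it is used as an AM-GM inequality with weight D / (W +
    e), where e > 0 covers W = 0. The factor W, a standard deviation, is what later bounds a
    gradient by the local variance. *)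
Lemma hellinger_mean e : 0 < e -> `|ga - gb| * Za <= D * (2 * W + 2 * e + D).
Proof.
move=> e0; have /andP[gb0 gb1] := gb01.
have We : 0 < W + e by rewrite ltr_wpDl.
pose la := D / (W + e); have la0 : 0 < la by rewrite divr_gt0.
have lai : la^-1 = (W + e) / D by rewrite /la invf_div.
have mu1 : 0 <= 1 + la^-1 by nneg.
have Za0 : 0 <= Za.
  by rewrite -lee_fin -Ia; apply: integral_ge0 => x _; rewrite lee_fin mulr_ge0 ?sqr_ge0.
pose E x := la * ((F x - gb) ^+ 2 * b x ^+ 2) + (1 + la^-1) * (a x - b x) ^+ 2.
have mE : mfunT E.
  by apply: measurable_funD; apply: measurable_funM => //; exact: measurable_cst.
have E0 x : 0 <= E x.
  by nneg.
have ptw x : `|(F x - gb) * (a x ^+ 2 - b x ^+ 2)| <= E x.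
  have /andP[F0 F1] := F01 x.
  set u := F x - gb; set v := a x - b x.
  have u1 : `|u| <= 1 by rewrite ler_norml /u; apply/andP; split; lra.
  have -> : u * (a x ^+ 2 - b x ^+ 2) = u * v * (2 * b x) + u * v ^+ 2 by rewrite /v; ring.
  apply: le_trans (ler_normD _ _) _; rewrite /E -/u -/v.
  have A1 : `|u * v ^+ 2| <= v ^+ 2.
    by rewrite normrM [`|v ^+ 2|]ger0_norm ?sqr_ge0// ler_piMl// sqr_ge0.
  have A2 : `|u * v * (2 * b x)| <= la * (u ^+ 2 * b x ^+ 2) + la^-1 * v ^+ 2.
    have h1 : 0 <= la^-1 * (la * (u * b x) - v) ^+ 2 by nneg.
    have h2 : 0 <= la^-1 * (la * (u * b x) + v) ^+ 2 by nneg.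
    have e1 : la^-1 * (la * (u * b x) - v) ^+ 2 =
        la * (u ^+ 2 * b x ^+ 2) + la^-1 * v ^+ 2 - u * v * (2 * b x).
      by field; rewrite gt_eqF.
    have e2 : la^-1 * (la * (u * b x) + v) ^+ 2 =
        la * (u ^+ 2 * b x ^+ 2) + la^-1 * v ^+ 2 + u * v * (2 * b x).
      by field; rewrite gt_eqF.
    by rewrite ler_norml; apply/andP; split; lra.
  lra.
have IE : (\int[mu]_x (k x * E x)%:E <= (D * (2 * W + 2 * e + D))%:E)%E.
  rewrite I2 ?(ltW la0)//; last by move=> x; rewrite sqr_ge0.
  apply: (@le_trans _ _ (la%:E * (W ^+ 2)%:E + (1 + la^-1)%:E * (D ^+ 2)%:E)%E).
    by apply: leeD; apply: lee_wpmul2l => //; rewrite lee_fin// ltW.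
  rewrite -!EFinM -EFinD lee_fin.
  have h : la * W ^+ 2 <= D * W.
    rewrite /la mulrAC -mulrA ler_pM2l// ler_pdivrMr// expr2.
    by rewrite ler_wpM2l// lerDl ltW.
  have -> : (1 + la^-1) * D ^+ 2 = D * (W + e) + D ^+ 2.
    by rewrite lai; field; rewrite gt_eqF.
  have : 0 <= D * e by nneg.
  lra.
(* Terms with a minus sign are moved to the other side, so that only integrals of nonnegative
   functions occur. *)
have cmp (f g : T -> R) : mfunT f -> mfunT g ->
    (forall x, 0 <= f x) -> (forall x, 0 <= g x) -> (forall x, f x <= g x + E x) ->
    (\int[mu]_x (k x * f x)%:E <= \int[mu]_x (k x * g x)%:E + (D * (2 * W + 2 * e + D))%:E)%E.
  move=> mf mg f0 g0 fg.
  apply: (@le_trans _ _ (\int[mu]_x (k x * (1 * g x + 1 * E x))%:E)%E).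
    apply: ge0_le_integral => //.
    - by nneg.
    - exact: mM.
    - by meas.
    - by move=> x _; rewrite lee_fin !mul1r ler_wpM2l.
  by rewrite I2// !mul1e leeD2l.
have lin (c1 c2 : R) (f g : T -> R) p1 p2 : 0 <= c1 -> 0 <= c2 ->
    mfunT f -> mfunT g -> (forall x, 0 <= f x) -> (forall x, 0 <= g x) ->
    (\int[mu]_x (k x * f x)%:E = p1%:E)%E -> (\int[mu]_x (k x * g x)%:E = p2%:E)%E ->
    (\int[mu]_x (k x * (c1 * f x + c2 * g x))%:E = (c1 * p1 + c2 * p2)%:E)%E.
  by move=> c10 c20 mf mg f0 g0 e1 e2; rewrite I2// e1 e2 -!EFinM -EFinD.
have a20 x : 0 <= a x ^+ 2 by nneg.
have b20 x : 0 <= b x ^+ 2 by nneg.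
have L1 := lin 1 gb _ _ _ _ ler01 gb0 mFa mb2 Fa0 b20 IFa Ib.
have L2 := lin 1 gb _ _ _ _ ler01 gb0 mFb ma2 Fb0 a20 IFb Ia.
have mc (f g : T -> R) : mfunT f -> mfunT g ->
    mfunT (fun x => 1 * f x + gb * g x).
  by move=> mf mg; apply: measurable_funD; apply: measurable_funM => //; exact: measurable_cst.
have pc (f g : T -> R) : (forall x, 0 <= f x) -> (forall x, 0 <= g x) ->
    forall x, 0 <= 1 * f x + gb * g x.
  by nneg.
have C1 := cmp _ _ (mc _ _ mFa mb2) (mc _ _ mFb ma2) (pc _ _ Fa0 b20) (pc _ _ Fb0 a20).
have C2 := cmp _ _ (mc _ _ mFb ma2) (mc _ _ mFa mb2) (pc _ _ Fb0 a20) (pc _ _ Fa0 b20).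
have {}C1 : 1 * (ga * Za) + gb * Zb <= 1 * (gb * Zb) + gb * Za + D * (2 * W + 2 * e + D).
  rewrite -lee_fin [leRHS]EFinD -[leLHS]L1 -[X in (_ <= X + _)%E]L2; apply: C1 => x.
  have := ptw x; rewrite ler_norml => /andP[_]; lra.
have {}C2 : 1 * (gb * Zb) + gb * Za <= 1 * (ga * Za) + gb * Zb + D * (2 * W + 2 * e + D).
  rewrite -lee_fin [leRHS]EFinD -[leLHS]L2 -[X in (_ <= X + _)%E]L1; apply: C2 => x.
  have := ptw x; rewrite ler_norml => /andP[+ _]; lra.
rewrite -{1}(ger0_norm Za0) -normrM ler_norml mulrBl; apply/andP; split; lra.
Qed.

(** Steiner's identity: the second moment about c exceeds the variance by the squared distance of c
    from the mean. *)
Lemma mean_min_variance c : 0 <= c <= 1 -> 0 < Zb ->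
  (\int[mu]_x (k x * ((F x - gb) ^+ 2 * b x ^+ 2))%:E + ((gb - c) ^+ 2 * Zb)%:E <=
   \int[mu]_x (k x * ((F x - c) ^+ 2 * b x ^+ 2))%:E)%E.
Proof.
move=> /andP[c0 c1] Zb0; have /andP[gb0 gb1] := gb01.
have mC : mfunT (fun x => (F x - c) ^+ 2 * b x ^+ 2).
  by meas.
have C0 x : 0 <= (F x - c) ^+ 2 * b x ^+ 2 by nneg.
have b20 x : 0 <= b x ^+ 2 by nneg.
have mL (p q : R) (f : T -> R) : mfunT f ->
    mfunT (fun x => 1 * f x + 1 * (p * (F x * b x ^+ 2) + q * b x ^+ 2)).
  move=> mf; apply: measurable_funD; apply: measurable_funM => //; try exact: measurable_cst.
  by meas.
have I3 (p q : R) (f : T -> R) : 0 <= p -> 0 <= q -> mfunT f ->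
    (forall x, 0 <= f x) ->
    (\int[mu]_x (k x * (1 * f x + 1 * (p * (F x * b x ^+ 2) + q * b x ^+ 2)))%:E =
     \int[mu]_x (k x * f x)%:E + (p * (gb * Zb) + q * Zb)%:E)%E.
  move=> p0 q0 mf f0; rewrite I2//.
  - by rewrite !mul1e; congr (_ + _)%E; rewrite I2// IFb Ib -!EFinM -EFinD.
  - by meas.
  - by nneg.
have g2 : 0 <= 2 * gb by nneg.
have c2 : 0 <= 2 * c by nneg.
have E := I3 (2 * gb) (c ^+ 2) _ g2 (sqr_ge0 _) mW W20.
have E' := I3 (2 * c) (gb ^+ 2) _ c2 (sqr_ge0 _) mC C0.
have EE : (\int[mu]_x (k x * ((F x - gb) ^+ 2 * b x ^+ 2))%:E +
    (2 * gb * (gb * Zb) + c ^+ 2 * Zb)%:E =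
    \int[mu]_x (k x * ((F x - c) ^+ 2 * b x ^+ 2))%:E +
    (2 * c * (gb * Zb) + gb ^+ 2 * Zb)%:E)%E.
  rewrite -E -E'; apply: eq_integral => x _; congr EFin; ring.
move: EE; have W1 : (0 <= \int[mu]_x (k x * ((F x - gb) ^+ 2 * b x ^+ 2))%:E)%E.
  by apply: integral_ge0 => x _; rewrite lee_fin mulr_ge0.
have W2 : (0 <= \int[mu]_x (k x * ((F x - c) ^+ 2 * b x ^+ 2))%:E)%E.
  by apply: integral_ge0 => x _; rewrite lee_fin mulr_ge0.
move: W1 W2; set X := (\int[mu]_x _)%E; set Y := (\int[mu]_x _)%E.
case: X => [x| |]//; case: Y => [y| |]//= _ _; rewrite -?EFinD => -[h]//.
by rewrite lee_fin; move: h; lra.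
Qed.

End hellinger_mean.

(** * The smoothing kernel *)

Section window.
Context {R : realType}.

(** A trapezoid on [1, 4]. With u = 8 t / s x it selects the ranges between s x / 8 and s x / 2. *)
Definition window (u : R) : R := Num.max 0 (Num.min 1 (Num.min (u - 1) (4 - u))).

Lemma window_ge0 u : 0 <= window u. Proof. by rewrite /window le_max lexx. Qed.

Lemma window_le1 u : window u <= 1.
Proof. by rewrite /window ge_max ler01/= ge_min lexx. Qed.

Lemma window_out u : ~ (1 < u < 4) -> window u = 0.
Proof.
move=> h; rewrite /window max_l// !ge_min; apply/orP; right.
have [u1|u1] := leP u 1; first by lra.
apply/orP; right; rewrite subr_le0 leNgt; apply/negP => u4.
by lra.
Qed.

Lemma window_mid u : 2 <= u <= 3 -> window u = 1.
Proof.
move=> /andP[u2 u3]; rewrite /window min_l.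
  by rewrite max_r.
by rewrite le_min; apply/andP; split; lra.
Qed.

Lemma window_lipschitz u v : `|window u - window v| <= `|u - v|.
Proof.
have H a b : window a <= window b + `|a - b|.
  have := ler_norm (a - b); have := ler_norm (- (a - b)); rewrite normrN => h1 h2.
  rewrite /window ge_max; apply/andP; split.
    by rewrite addr_ge0// le_max lexx.
  rewrite -lerBlDr le_max; apply/orP; right.
  rewrite !le_min; apply/and3P; split; rewrite lerBlDr.
  - by rewrite ge_min; apply/orP; left; rewrite lerDl.
  - by rewrite !ge_min; apply/orP; right; apply/orP; left; lra.
  - by rewrite !ge_min; apply/orP; right; apply/orP; right; lra.
have := H u v; have := H v u; rewrite [`|v - u|]distrC => h1 h2.
by rewrite ler_norml; apply/andP; split; lra.
Qed.

Lemma measurable_window : mfunT window.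
Proof.
apply: measurable_maxr; first exact: measurable_cst.
apply: measurable_minr; first exact: measurable_cst.
by apply: measurable_minr; apply: measurable_funB.
Qed.

End window.

Section kernel.
Context {R : realType} (n : nat).
Local Notation V := 'rV[R]_n.
Local Notation leb := (@lebesgue_measure R).
Variables (U : set V) (s : V -> R).
Hypotheses (n0 : (0 < n)%N) (mU : measurable U) (ms : mfunT s) (s0 : forall x, 0 <= s x).
Hypothesis spos : forall x, U x -> 0 < s x.

Variable kp : R.
Hypotheses (kp0 : 0 < kp) (kpE : kp ^+ 2 = 34 ^+ 2 * n%:R)
  (slip : forall x y, `|s x - s y| <= kp * enorm (x - y)) (cU : econvex U)
  (sconc : forall x y t, U x -> U y -> 0 <= t <= 1 ->
  (1 - t) * s x + t * s y <= s ((1 - t) *: x + t *: y)).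
Hypothesis inside : forall x t, U x -> 0 <= t < s x ->
  ((bumpvol n / 4)%:E <= \int[vol n]_w (\1_U (x + t *: w)%R * bump w ^+ 2)%:E)%E.

Let c0 := bumpvol n : R.
Let c00 : 0 < c0 := bumpvol_gt0 n0.

(** Smoothing at x averages over y = x + t w with w distributed by bump^2 and t by window^2 dt / t,
    a scale-invariant choice. In the coordinates z = (t, y) the density is [wgt] times the square of
    [root x]: everything that depends on x sits in the root, as Hellinger estimates require, and
    t^-n is the Jacobian. The cutoff t <= s y limits the kernel as seen from y. *)
Definition wgt (z : R * V) : R :=
  `|z.1|^-1 * `|z.1|^-1 ^+ n * (\1_U z.2 * \1_[set z : R * V | z.1 <= s z.2] z).

Definition root x (z : R * V) : R :=
  window (8 * z.1 / s x) * bump (`|z.1|^-1 *: (z.2 - x)).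

Lemma measurable_invn d (T : measurableType d) (f : T -> R) : mfunT f ->
  mfunT (fun x => `|f x|^-1).
Proof.
move=> mf; apply: measurable_inv_ge0 => // .
by meas.
Qed.

Lemma wgt_ge0 z : 0 <= wgt z.
Proof. by nneg. Qed.

Lemma measurable_wgt : mfunT wgt.
Proof.
have mi : mfunT (fun z : R * V => `|z.1|^-1).
  by meas.
apply: measurable_funM.
  by meas.
apply: measurable_funM.
  exact: (measurableT_comp (measurable_indic mU) measurable_snd).
apply: measurable_indic.
have m1 : mfunT (fun z : R * V => s z.2 - z.1).
  by meas.
rewrite (_ : [set z | _] = (fun z : R * V => s z.2 - z.1) @^-1` `[0, +oo[).
  by rewrite -[_ @^-1` _]setTI; exact: m1.
by apply/seteqP; split => z /=; rewrite in_itv/= andbT subr_ge0.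
Qed.

(* jointly in the base point x and z = (t, y) *)
Lemma measurable_root : mfunT (fun q : V * (R * V) => root q.1 q.2).
Proof.
have m1 : mfunT (fun q : V * (R * V) => q.2.1).
  by meas.
have m2 : mfunT (fun q : V * (R * V) => q.2.2).
  by meas.
apply: measurable_funM.
  apply: (measurableT_comp measurable_window).
  by meas.
by meas.
Qed.

Lemma measurable_root1 x : mfunT (root x).
Proof. exact: (measurableT_comp measurable_root (measurable_pair1 x)). Qed.

Lemma polar_change (x : V) (t : R) (F : V -> \bar R) : t != 0 ->
  mfunT F -> (forall y, 0 <= F y)%E ->
  (\int[vol n]_y ((`|t|%R^-1 ^+ n)%:E * F y) = \int[vol n]_w F (x + `|t|%R *: w)%R)%E.
Proof.
move=> t0 mF F0; rewrite ge0_integralZl_EFin ?exprn_ge0 ?invr_ge0//.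
have mG : mfunT (fun v : V => F (x + v)).
  apply: (measurableT_comp mF).
  by apply: measurable_rowD; [exact: measurable_cst|exact: measurable_id].
have nt : `|t| != 0 by rewrite normr_eq0.
rewrite (ge0_integral_scale nt mG)// normr_id; congr (_ * _)%E.
rewrite -(ge0_integral_translate x mF)//.
by apply: eq_integral => y _; rewrite addrC.
Qed.

Lemma window_range x t : 0 < s x -> window (8 * t / s x) != 0 -> s x / 8 < t < s x / 2.
Proof.
move=> sx; have [h _|h] := pselect (1 < 8 * t / s x < 4); last first.
  by rewrite window_out// eqxx.
move: h => /andP[]; rewrite ltr_pdivlMr// ltr_pdivrMr// => h1 h2.
by lra.
Qed.

Let prodint (F : R * V -> R) : mfunT F -> (forall z, 0 <= F z) ->
  (\int[(leb \x vol n)%E]_z (F z)%:E = \int[leb]_t \int[vol n]_y (F (t, y))%:E)%E.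
Proof.
move=> mF F0; rewrite fubini_tonelli1//.
by meas.
Qed.

Let wgt_le t y : wgt (t, y) <= `|t|^-1 * `|t|^-1 ^+ n.
Proof.
by rewrite /wgt/= ler_piMr ?mulr_ge0 ?exprn_ge0 ?invr_ge0// !indicE -natrM lern1;
  case: (_ \in _); case: (_ \in _).
Qed.

(** For upper bounds the cutoffs in [wgt] are replaced by 1. What remains factors into t^-1 and
    t^-n, and the y-integral at fixed range t is estimated by [C t]. *)
Lemma slice_le (h : R -> R) (B : R -> V -> R) (C : R -> R) : mfunT h ->
  (forall t, 0 <= h t) -> (forall t, h t != 0 -> 0 < t) ->
  mfunT (fun z : R * V => B z.1 z.2) -> (forall t y, 0 <= B t y) ->
  mfunT C -> (forall t, 0 <= C t) ->
  (forall t, 0 < t -> (\int[vol n]_y ((`|t|%R^-1 ^+ n)%:E * (B t y)%:E) <= (C t)%:E)%E) ->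
  (\int[(leb \x vol n)%E]_z (wgt z * (h z.1 * B z.1 z.2))%:E <=
   \int[leb]_t (h t * (`|t|^-1 * C t))%:E)%E.
Proof.
move=> mh h0 ht mB B0 mC C0 BC.
have mF : mfunT (fun z : R * V => wgt z * (h z.1 * B z.1 z.2)).
  apply: measurable_funM; first exact: measurable_wgt.
  by meas.
have F0 z : 0 <= wgt z * (h z.1 * B z.1 z.2) by nneg.
rewrite (prodint mF F0).
have mEF : mfunT (fun z : R * V => (wgt z * (h z.1 * B z.1 z.2))%:E).
  by meas.
apply: ge0_le_integral => //.
- by move=> t _; apply: integral_ge0 => y _; rewrite lee_fin F0.
- apply: (measurable_partial_integral (vol n)
    (f := fun t y => (wgt (t, y) * (h t * B t y))%:E)); last by move=> t y; rewrite lee_fin; exact: (F0 (t, y)).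
  by meas.
- by meas.
move=> t _; have [->|htn] := eqVneq (h t) 0.
  by rewrite mul0r integral0_eq// => y _; rewrite mul0r mulr0.
have t0 := ht t htn.
have mBt : mfunT (fun y : V => (`|t|^-1 ^+ n)%:E * (B t y)%:E)%E.
  apply: measurable_funeM; apply/measurable_EFinP.
  exact: (measurableT_comp mB (measurable_pair1 t)).
apply: (@le_trans _ _ (\int[vol n]_y ((h t * `|t|%R^-1)%:E * ((`|t|%R^-1 ^+ n)%:E * (B t y)%:E)))%E).
  apply: ge0_le_integral => //.
  - by nneg.
  - by apply: (measurableT_comp mEF); exact: measurable_pair1.
  - by meas.
  move=> y _; rewrite -!EFinM lee_fin.
  have := ler_wpM2r (mulr_ge0 (h0 t) (B0 t y)) (wgt_le t y).
  by move=> /le_trans; apply; apply: eqW; ring.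
rewrite ge0_integralZl_EFin ?mulr_ge0 ?invr_ge0//; last first.
  by nneg.
rewrite [h t * (_ * _)]mulrA [leRHS]EFinM; apply: lee_wpmul2l; last exact: BC.
by nneg.
Qed.

Let mbumpx (x : V) (t : R) : mfunT (fun y : V => bump (`|t|^-1 *: (y - x))).
Proof.
by meas.
Qed.

Lemma slice_bump x t : 0 < t ->
  (\int[vol n]_y ((`|t|%R^-1 ^+ n)%:E * (bump (`|t|%R^-1 *: (y - x)%R) ^+ 2)%:E) = c0%:E)%E.
Proof.
move=> t0; have tn : t != 0 by rewrite gt_eqF.
have m1 : mfunT (fun y : V => (bump (`|t|^-1 *: (y - x)) ^+ 2)%:E).
  by meas.
rewrite (polar_change x tn m1); last by move=> y; rewrite lee_fin sqr_ge0.
rewrite -[RHS](@integral_bump R n); apply: eq_integral => w _.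
by rewrite addrAC subrr add0r scalerA mulVf ?normr_eq0// scale1r.
Qed.

Lemma slice_bump_diff x z t : 0 < t ->
  (\int[vol n]_y ((`|t|%R^-1 ^+ n)%:E *
     ((bump (`|t|%R^-1 *: (y - x)%R) - bump (`|t|%R^-1 *: (y - z)%R)) ^+ 2)%:E) <=
   (72 * n%:R * c0 * (enorm (x - z) ^+ 2 * `|t|^-1 ^+ 2))%:E)%E.
Proof.
move=> t0; have tn : t != 0 by rewrite gt_eqF.
have m1 : mfunT (fun y : V =>
    ((bump (`|t|^-1 *: (y - x)) - bump (`|t|^-1 *: (y - z))) ^+ 2)%:E).
  by meas.
rewrite (polar_change z tn m1); last by move=> y; rewrite lee_fin sqr_ge0.
pose h := `|t|^-1 *: (z - x).
have := bump_shift_sq h n0.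
have -> : 72 * n%:R * dot h h * bumpvol n = 72 * n%:R * c0 * (enorm (x - z) ^+ 2 * `|t|^-1 ^+ 2).
  by rewrite -sqr_enorm /h enormZ normfV normr_id enormBC /c0; ring.
apply: le_trans; apply: eqW.
apply: eq_integral => w _.
have -> : `|t|^-1 *: (z + `|t| *: w - x) = w + h.
  by rewrite /h addrAC [LHS]scalerDr scalerA mulVf ?normr_eq0// scale1r [LHS]addrC.
suff -> : `|t|^-1 *: (z + `|t| *: w - z) = w by [].
by rewrite addrAC subrr add0r scalerA mulVf ?normr_eq0// scale1r.
Qed.

Let mu := (leb \x vol n)%E.

Let tint_le (h : R -> R) (a b M c K : R) : mfunT h ->
  0 < a -> 0 <= c -> 0 <= M -> 0 <= K -> b <= a * expR c ->
  (forall t, 0 <= h t) -> (forall t, h t != 0 -> a <= t <= b) -> (forall t, h t <= M) ->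
  (\int[leb]_t (h t * (`|t|^-1 * K))%:E <= (M * K * c)%:E)%E.
Proof.
move=> mh a0 c00' M0 K0 bc h0 hab hM.
have MK : 0 <= M * K by nneg.
have mI : mfunT (fun t : R => (\1_(`[a, b]%classic : set R) t * `|t|^-1)%:E : \bar R).
  by meas.
apply: (@le_trans _ _ ((M * K)%:E * \int[leb]_t (\1_(`[a, b]%classic : set R) t * `|t|^-1)%:E)%E).
  rewrite -ge0_integralZl_EFin//.
  apply: ge0_le_integral => //.
  - by nneg.
  - by meas.
  - by meas.
  move=> t _; rewrite -EFinM lee_fin; have [->|ht] := eqVneq (h t) 0.
    by rewrite mul0r mulr_ge0// mulr_ge0// invr_ge0.
  have tI : (`[a, b]%classic : set R) t by rewrite /= in_itv/= hab.
  rewrite indicE mem_set// mul1r -[M * K * _]mulrA [K * _]mulrC.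
  by rewrite ler_wpM2r// mulr_ge0// invr_ge0.
rewrite [leRHS]EFinM; apply: lee_wpmul2l; first by rewrite lee_fin.
exact: integral_inv_le.
Qed.

Let mwin x : mfunT (fun t : R => window (8 * t / s x)).
Proof.
apply: (measurableT_comp measurable_window).
by apply: measurable_funM => //; apply: measurable_funM => //.
Qed.

Let mbump2 (x : V) : mfunT (fun z : R * V => bump (`|z.1|^-1 *: (z.2 - x))).
Proof.
by meas.
Qed.

Let win_pos x t : 0 < s x -> window (8 * t / s x) != 0 -> 0 < t.
Proof.
move=> sx /(window_range sx)/andP[+ _]; apply: lt_trans.
by lra.
Qed.

Let root_s0 x : ~~ (0 < s x) -> forall z, root x z = 0.
Proof.
rewrite -leNgt => sx z; have s00 : s x = 0 by apply/eqP; rewrite eq_le sx s0.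
rewrite /root s00 invr0 mulr0 window_out ?mul0r//.
by lra.
Qed.

Let mroot2 x : mfunT (fun z => (wgt z * root x z ^+ 2)%:E).
Proof.
apply/measurable_EFinP; apply: measurable_funM; first exact: measurable_wgt.
by apply: measurable_funX; exact: measurable_root1.
Qed.

Lemma mass_le x : (\int[mu]_z (wgt z * root x z ^+ 2)%:E <= (2 * c0)%:E)%E.
Proof.
have [sx|sx] := boolP (0 < s x); last first.
  rewrite integral0_eq ?lee_fin ?mulr_ge0 ?(ltW c00)// => z _.
  by rewrite root_s0// expr0n/= mulr0.
have := @slice_le (fun t => window (8 * t / s x) ^+ 2)
  (fun t y => bump (`|t|^-1 *: (y - x)) ^+ 2) (fun=> c0).
have mw2 : mfunT (fun t : R => window (8 * t / s x) ^+ 2).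
  by meas.
have wn0 t : window (8 * t / s x) ^+ 2 != 0 -> window (8 * t / s x) != 0.
  by apply: contra_neq => ->; rewrite expr0n.
move=> /(_ mw2 (fun t => sqr_ge0 _)) H.
apply: (@le_trans _ _ (\int[leb]_t (window (8 * t / s x) ^+ 2 * (`|t|^-1 * c0))%:E)%E).
  rewrite (_ : (fun z => _) = (fun z : R * V => (wgt z * (window (8 * z.1 / s x) ^+ 2 *
    bump (`|z.1|^-1 *: (z.2 - x)) ^+ 2))%:E)); last first.
    by apply/funext => z; rewrite /root exprMn.
  apply: H => //.
  - by move=> t /wn0; exact: win_pos.
  - by meas.
  - by nneg.
  - by nneg.
  - by move=> t t0; rewrite slice_bump.
have -> : 2 * c0 = 1 * c0 * 2 by ring.
apply: (@tint_le _ (s x / 8) (s x / 2)) => //.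
- by rewrite divr_gt0.
- by nneg.
- have -> : s x / 2 = s x / 8 * 4 by field.
  by rewrite ler_wpM2l ?expR2_ge4// divr_ge0// ltW.
- by nneg.
- by move=> t /wn0 /(window_range sx) /andP[h1 h2]; rewrite !ltW.
- by move=> t; rewrite expr_le1 ?window_le1 ?window_ge0.
Qed.

Definition mass x : R := fine (\int[mu]_z (wgt z * root x z ^+ 2)%:E)%E.

Lemma massE x : (\int[mu]_z (wgt z * root x z ^+ 2)%:E = (mass x)%:E)%E.
Proof.
rewrite fineK// ge0_fin_numE; first exact: le_lt_trans (mass_le x) (ltry _).
by apply: integral_ge0 => z _; rewrite lee_fin mulr_ge0 ?wgt_ge0 ?sqr_ge0.
Qed.

(** Only t between s x / 4 and 3 s x / 8 is used, where the window is 1 and 2 t < s x. If x + 2 t w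
    lies in U, so does the midpoint x + t w, and by concavity its scale is at least s x / 2 >= t, so
    it passes the cutoff; [inside] at range 2 t provides a quarter of the bump mass. *)
Lemma mass_ge x : U x -> c0 / 12 <= mass x.
Proof.
move=> Ux; have sx := spos Ux; rewrite -lee_fin -massE.
have F0 z : 0 <= wgt z * root x z ^+ 2 by nneg.
have mF : mfunT (fun z => wgt z * root x z ^+ 2).
  by have /measurable_EFinP := mroot2 x.
rewrite (prodint mF F0).
pose J := `[s x / 4, 3 / 8 * s x]%classic : set R.
have mJ : measurable J by exact: measurable_itv.
have lJ : leb J = (s x / 8)%:E.
  apply: etrans (lebesgue_measure_itv `[s x / 4, 3 / 8 * s x]) _ => /=.
  by rewrite lte_fin ifT ?lra -?EFinB; [congr EFin; field|lra].
pose K := 8 / 3 / s x * (c0 / 4).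
have K0 : 0 <= K by nneg.
apply: (@le_trans _ _ (\int[leb]_t (K%:E * (\1_J t)%:E))%E).
  rewrite ge0_integralZl_EFin//; last by meas; exact: measurable_indic.
  rewrite integral_indic// setIT.
  have -> : (K%:E * leb J = (K * (s x / 8))%:E)%E by rewrite lJ.
  by rewrite lee_fin le_eqVlt; apply/orP; left; apply/eqP; rewrite /K; field; rewrite gt_eqF.
apply: ge0_le_integral => //.
- by nneg.
- by meas.
- apply: (measurable_partial_integral (vol n)
    (f := fun t y => (wgt (t, y) * root x (t, y) ^+ 2)%:E)).
    by meas.
  by nneg.
move=> t _; rewrite -EFinM indicE; case: (boolP (t \in J)) => [|_]; last first.
  by rewrite mulr0; apply: integral_ge0 => y _; rewrite lee_fin; exact: F0.
rewrite inE /J/= in_itv/= => /andP[t1 t2]; rewrite mulr1.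
have t0 : 0 < t by lra.
have tn : t != 0 by rewrite gt_eqF.
have w1 : window (8 * t / s x) = 1.
  apply: window_mid; rewrite ler_pdivlMr// ler_pdivrMr//; apply/andP; split; lra.
pose chi (y : V) : R := \1_U y * \1_[set z : R * V | z.1 <= s z.2] (t, y).
pose G (y : V) : \bar R := (chi y * bump (`|t|^-1 *: (y - x)) ^+ 2)%:E.
have chi0 y : 0 <= chi y by nneg.
have mchi : mfunT chi.
  apply: measurable_funM; first exact: measurable_indic.
  rewrite (_ : (fun y : V => _) = \1_[set y : V | t <= s y]); last first.
    by nneg.
  apply: measurable_indic; rewrite (_ : [set y | _] = s @^-1` `[t, +oo[).
    by rewrite -[_ @^-1` _]setTI; exact: ms.
  by apply/seteqP; split => y /=; rewrite in_itv/= andbT.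
have mG : mfunT G.
  apply/measurable_EFinP; apply: measurable_funM => //.
  by meas.
have G0 y : (0 <= G y)%E by nneg.
have nt : `|t|^-1 = t^-1 by rewrite gtr0_norm.
have ti0 : 0 <= t^-1 by nneg.
have -> : (\int[vol n]_y (wgt (t, y) * root x (t, y) ^+ 2)%:E =
    (t^-1)%:E * \int[vol n]_y ((`|t|%R^-1 ^+ n)%:E * G y))%E.
  rewrite -ge0_integralZl_EFin//; last 2 first.
  - by nneg.
  - by meas.
  apply: eq_integral => y _; rewrite /G -!EFinM; congr EFin.
  by rewrite /wgt /root /= w1 -/(chi y) nt; ring.
rewrite (polar_change x tn mG G0).
have mtr c : mfunT (fun w : V => \1_U (x + c *: w) : R).
  exact: (measurableT_comp (measurable_indic mU) (@measurable_row_affine R n x c)).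
have t2s : 0 <= 2 * t < s x by lra.
have Hin := inside Ux t2s.
apply: (@le_trans _ _ ((t^-1)%:E * (c0 / 4)%:E)%E).
  rewrite -EFinM lee_fin /K ler_wpM2r ?divr_ge0 ?(ltW c00)//.
  have -> : 8 / 3 / s x = (3 / 8 * s x)^-1 by field; rewrite gt_eqF.
  by rewrite lef_pV2 ?posrE// mulr_gt0.
apply: lee_wpmul2l; first by rewrite lee_fin.
apply: (le_trans Hin); apply: ge0_le_integral => //.
- by nneg.
- by apply/measurable_EFinP; apply: measurable_funM => //; exact: measurable_bump_sqr.
- by apply: (measurableT_comp mG); exact: measurable_row_affine.
move=> w _; rewrite /G lee_fin gtr0_norm//.
rewrite addrAC subrr add0r scalerA mulVf// scale1r ler_wpM2r ?sqr_ge0//.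
rewrite indicE; case: (boolP (_ \in U)) => [|_]; last exact: chi0.
rewrite inE => Uw.
have h01 : 0 <= (2^-1 : R) <= 1 by apply/andP; split; lra.
have mid : (1 - 2^-1) *: x + 2^-1 *: (x + (2 * t) *: w) = x + t *: w.
  rewrite scalerDr scalerA addrA -scalerDl (_ : 1 - 2^-1 + 2^-1 = 1 :> R) ?scale1r; last by field.
  by congr (_ + _ *: _); field.
have := sconc Ux Uw h01; have Ut := cU Ux Uw h01; rewrite mid in Ut *.
move=> hs; have st : t <= s (x + t *: w).
  by apply: le_trans hs; have := s0 (x + (2 * t) *: w); lra.
by rewrite /chi !indicE !mem_set// mulr1.
Qed.

Let Cd : R := 340 ^+ 2.

(** The increment of the product splits into the change of the window, controlled by the Lipschitz
    bound on s, and the change of the bump, controlled by [bump_shift_sq] at ranges comparable with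
    s z. Both are of order n |x - z|^2 / s z^2, and 340^2 dominates 2 * (44/9)^2 * 34^2 * 17/10 + 2
    * 72 * 64 * 3/2. *)
Lemma root_diff x z : U x -> U z -> enorm (x - z) <= s z / (10 * kp) ->
  (\int[mu]_q (wgt q * (root x q - root z q) ^+ 2)%:E <=
   (Cd * n%:R * c0 * enorm (x - z) ^+ 2 / s z ^+ 2)%:E)%E.
Proof.
move=> Ux Uz; set S := s z; set dl := enorm (x - z) => xz.
have S0 : 0 < S by exact: spos.
have dl0 : 0 <= dl by nneg.
have kd : kp * dl <= S / 10.
  move: xz; rewrite ler_pdivlMr ?mulr_gt0// => h.
  by lra.
have := slip x z; rewrite -/S -/dl ler_norml => /andP[l1 l2].
have sx1 : 9 / 10 * S <= s x by lra.
have sx2 : s x <= 11 / 10 * S by lra.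
have sx0 : 0 < s x by exact: spos.
pose h1 t := (window (8 * t / s x) - window (8 * t / S)) ^+ 2.
pose h2 t := window (8 * t / S) ^+ 2.
pose B1 (t : R) (y : V) := bump (`|t|^-1 *: (y - x)) ^+ 2.
pose B2 (t : R) (y : V) := (bump (`|t|^-1 *: (y - x)) - bump (`|t|^-1 *: (y - z))) ^+ 2.
have mh1 : mfunT h1 by apply: measurable_funX; apply: measurable_funB; exact: mwin.
have mh2 : mfunT h2 by apply: measurable_funX; exact: mwin.
have h1n t : h1 t != 0 -> 9 / 10 * S / 8 <= t <= 11 / 10 * S / 2.
  move=> h; have [h'|] := eqVneq (window (8 * t / s x)) 0.
    have : window (8 * t / S) != 0.
      by apply: contra_neq h => h''; rewrite /h1 h' h'' subrr expr0n.
    by move=> /(window_range S0); rewrite -/S => /andP[? ?]; apply/andP; split; lra.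
  by move=> /(window_range sx0) /andP[? ?]; apply/andP; split; lra.
have h2n t : h2 t != 0 -> S / 8 <= t <= S / 2.
  move=> h; have : window (8 * t / S) != 0 by apply: contra_neq h => h''; rewrite /h2 h'' expr0n.
  by move=> /(window_range S0) /andP[? ?]; rewrite !ltW.
have pos_of (a t b : R) : 0 < a -> a <= t <= b -> 0 < t by move=> a0 /andP[+ _]; exact: lt_le_trans.
have a1 : 0 < 9 / 10 * S / 8 by lra.
have a2 : 0 < S / 8 by lra.
have I1 : (\int[mu]_q (wgt q * (h1 q.1 * B1 q.1 q.2))%:E <=
    ((44 / 9 * (kp * dl / S)) ^+ 2 * c0 * (17 / 10))%:E)%E.
  apply: (@le_trans _ _ (\int[leb]_t (h1 t * (`|t|^-1 * c0))%:E)%E).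
    apply: slice_le => //.
    - by nneg.
    - by move=> t /h1n /(pos_of _ _ _ a1).
    - by apply: measurable_funX; exact: mbump2.
    - by nneg.
    - by nneg.
    - by move=> t t0; rewrite slice_bump.
  apply: (@tint_le _ (9 / 10 * S / 8) (11 / 10 * S / 2)) => //.
  - by nneg.
  - by nneg.
  - have -> : 11 / 10 * S / 2 = 9 / 10 * S / 8 * (44 / 9) by field.
    by rewrite ler_wpM2l ?expR17_ge// ltW.
  - by nneg.
  move=> t; have [->|/h1n] := eqVneq (h1 t) 0; first by rewrite sqr_ge0.
  move=> /andP[t1 t2]; have t0 : 0 < t by exact: lt_le_trans t1.
  rewrite /h1 -[leLHS]real_normK ?num_real//.
  have e1 : `|8 * t / s x - 8 * t / S| <= 44 / 9 * (kp * dl / S).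
    have -> : 8 * t / s x - 8 * t / S = 8 * t * (S - s x) / (s x * S).
      by field; rewrite !gt_eqF.
    rewrite normrM normfV [`|s x * S|]gtr0_norm ?mulr_gt0// ler_pdivrMr ?mulr_gt0//.
    rewrite normrM gtr0_norm ?mulr_gt0// distrC.
    apply: (@le_trans _ _ (8 * (11 / 10 * S / 2) * (kp * dl))).
      by apply: ler_pM => //; [rewrite mulr_ge0// ltW|rewrite ler_pM2l|exact: slip].
    have -> : 44 / 9 * (kp * dl / S) * (s x * S) = 44 / 9 * s x * (kp * dl).
      by field; rewrite gt_eqF.
    by rewrite ler_wpM2r ?mulr_ge0 ?(ltW kp0)//; lra.
  have e2 := le_trans (window_lipschitz (8 * t / s x) (8 * t / S)) e1.
  by rewrite ler_pXn2r// nnegrE// (le_trans _ e2).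
have I2 : (\int[mu]_q (wgt q * (h2 q.1 * B2 q.1 q.2))%:E <=
    (1 * (72 * n%:R * c0 * (dl ^+ 2 * (64 / S ^+ 2))) * (3 / 2))%:E)%E.
  set K := 72 * n%:R * c0 * (dl ^+ 2 * (64 / S ^+ 2)).
  have K0 : 0 <= K.
    by rewrite !mulr_ge0 ?sqr_ge0 ?invr_ge0 ?sqr_ge0 ?(ltW c00).
  apply: (@le_trans _ _ (\int[leb]_t (h2 t * (`|t|^-1 * (72 * n%:R * c0 * (dl ^+ 2 * `|t|^-1 ^+ 2))))%:E)%E).
    apply: (@slice_le h2 B2 (fun t => 72 * n%:R * c0 * (dl ^+ 2 * `|t|^-1 ^+ 2))) => //.
    - by nneg.
    - by move=> t /h2n /(pos_of _ _ _ a2).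
    - by apply: measurable_funX; apply: measurable_funB; exact: mbump2.
    - by nneg.
    - by meas.
    - by move=> t; rewrite !mulr_ge0 ?sqr_ge0 ?(ltW c00).
    - by move=> t t0; exact: slice_bump_diff.
  apply: (@le_trans _ _ (\int[leb]_t (h2 t * (`|t|^-1 * K))%:E)%E).
    have minv : mfunT (fun t : R => `|t|^-1) by meas.
    apply: ge0_le_integral => //.
    - move=> t _; rewrite lee_fin mulr_ge0 ?sqr_ge0// mulr_ge0 ?invr_ge0//.
      by rewrite mulr_ge0 ?mulr_ge0 ?sqr_ge0 ?(ltW c00).
    - by meas.
    - by meas.
    move=> t _; rewrite lee_fin; have [->|/h2n] := eqVneq (h2 t) 0; first by rewrite !mul0r.
    move=> /andP[t1 t2]; have t0 : 0 < t by exact: lt_le_trans t1.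
    rewrite ler_wpM2l ?sqr_ge0// ler_wpM2l ?invr_ge0// /K.
    rewrite ler_wpM2l ?mulr_ge0 ?(ltW c00)// ler_wpM2l ?sqr_ge0// gtr0_norm//.
    have -> : 64 / S ^+ 2 = (S / 8)^-1 ^+ 2 by field; rewrite gt_eqF.
    rewrite ler_pXn2r ?nnegrE ?invr_ge0 ?(ltW t0) ?(ltW a2)//.
    by rewrite lef_pV2 ?posrE.
  apply: (@tint_le _ (S / 8) (S / 2)) => //.
  - have -> : S / 2 = S / 8 * 4 by field.
    by rewrite ler_wpM2l ?expR15_ge4// ltW.
  - by nneg.
  - by move=> t; rewrite expr_le1 ?window_le1 ?window_ge0.
have mF1 : mfunT (fun q : R * V => (wgt q * (h1 q.1 * B1 q.1 q.2))%:E).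
  apply/measurable_EFinP; apply: measurable_funM; first exact: measurable_wgt.
  apply: measurable_funM; first exact: (measurableT_comp mh1 measurable_fst).
  by apply: measurable_funX; exact: mbump2.
have mF2 : mfunT (fun q : R * V => (wgt q * (h2 q.1 * B2 q.1 q.2))%:E).
  apply/measurable_EFinP; apply: measurable_funM; first exact: measurable_wgt.
  apply: measurable_funM; first exact: (measurableT_comp mh2 measurable_fst).
  by apply: measurable_funX; apply: measurable_funB; exact: mbump2.
have F10 (q : R * V) : (0 <= (wgt q * (h1 q.1 * B1 q.1 q.2))%:E)%E.
  by nneg.
have F20 (q : R * V) : (0 <= (wgt q * (h2 q.1 * B2 q.1 q.2))%:E)%E.
  by nneg.
apply: (@le_trans _ _ (\int[mu]_q (2%:E * (wgt q * (h1 q.1 * B1 q.1 q.2))%:E +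
    2%:E * (wgt q * (h2 q.1 * B2 q.1 q.2))%:E))%E).
  apply: ge0_le_integral => //.
  - by nneg.
  - apply/measurable_EFinP; apply: measurable_funM; first exact: measurable_wgt.
    by apply: measurable_funX; apply: measurable_funB; exact: measurable_root1.
  - by apply: emeasurable_funD; exact: measurable_funeM.
  move=> q _; rewrite -!EFinM -EFinD lee_fin.
  have -> : 2 * (wgt q * (h1 q.1 * B1 q.1 q.2)) + 2 * (wgt q * (h2 q.1 * B2 q.1 q.2)) =
      wgt q * (2 * (h1 q.1 * B1 q.1 q.2) + 2 * (h2 q.1 * B2 q.1 q.2)) by ring.
  rewrite ler_wpM2l ?wgt_ge0// /root /h1 /h2 /B1 /B2 -/S.
  set wx := window _; set wz := window _; set bx := bump _; set bz := bump _.
  have := sqr_ge0 ((wx - wz) * bx - wz * (bx - bz)).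
  by rewrite -subr_ge0 => h; apply: le_trans h _; apply: eqW; ring.
rewrite ge0_integral_linear//.
apply: (le_trans (leeD (lee_wpmul2l _ I1) (lee_wpmul2l _ I2))) => //.
rewrite -!EFinM -EFinD lee_fin.
set X := n%:R * c0 * dl ^+ 2 / S ^+ 2.
have X0 : 0 <= X by nneg.
have -> : Cd * n%:R * c0 * dl ^+ 2 / S ^+ 2 = Cd * X by rewrite /X; ring.
have -> : (44 / 9 * (kp * dl / S)) ^+ 2 * c0 * (17 / 10) = (44 / 9) ^+ 2 * 34 ^+ 2 * (17 / 10) * X.
  have -> : (44 / 9 * (kp * dl / S)) ^+ 2 = (44 / 9) ^+ 2 * kp ^+ 2 * (dl ^+ 2 / S ^+ 2).
    by field; rewrite gt_eqF.
  by rewrite kpE /X; ring.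
have -> : 1 * (72 * n%:R * c0 * (dl ^+ 2 * (64 / S ^+ 2))) * (3 / 2) = 72 * 64 * (3 / 2) * X.
  by rewrite /X; ring.
by rewrite /Cd; lra.
Qed.

End kernel.

(** Arithmetic of [smoothing_gap]: 24 + 2 * 64 * 1600 * 24^2 * 340^2 < 14 * 10^12. *)
Lemma smoothing_constant (R : realType) (i X Y : R) : i <= X -> 0 <= X ->
  Y <= 64 * 1600 * (24 ^+ 2 * 340 ^+ 2) * X ->
  2 * (12 * i) + 2 * Y <= 14 * 10 ^+ 12 * X.
Proof. by move=> *; lra. Qed.

(** * Gradient of the smoothed function *)

Section smoothing.
Context {R : realType} (n : nat).
Local Notation V := 'rV[R]_n.
Local Notation leb := (@lebesgue_measure R).
Variables (U : set V) (r : R).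
Hypotheses (n0 : (0 < n)%N) (oU : eopen U) (cU : econvex U) (BU : oball 1 `<=` U)
  (Ur : U `<=` eball r) (r1 : 1 <= r).
Variable f : V -> R.
Hypothesis mf : mfunT f.
Hypothesis f01 : forall x, 0 <= f x <= 1.

Variable s : V -> R.
Variables c0 q kp C : R.
Hypotheses (c00 : 0 < c0) (q0 : 0 < q) (qq : q ^+ 2 = n%:R) (kp0 : 0 < kp) (C0 : 0 < C)
  (C2 : C ^+ 2 = 340 ^+ 2 * (n%:R * c0)).
Let mU : measurable U. Proof. exact: measurable_eopen. Qed.
Let U_0 : U 0. Proof. by apply: BU; rewrite /oball/= enorm0. Qed.

Hypotheses (ms : mfunT s) (s0 : forall x, 0 <= s x) (spos : forall x, U x -> 0 < s x)
  (slip : forall x y, `|s x - s y| <= kp * enorm (x - y))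
  (sconc : forall x y t, U x -> U y -> 0 <= t <= 1 ->
  (1 - t) * s x + t * s y <= s ((1 - t) *: x + t *: y)).
Hypothesis smean : ((fine (vol n U) / (40 * q))%:E <=
  \int[vol n]_x (\1_U x * s x)%:E)%E.

(* An abstract averaging kernel: y = pr z is distributed with density w (a x)^2
   with respect to mu, and a x depends on x in a Lipschitz way in L^2. *)
Context d (T : measurableType d) (mu : {sigma_finite_measure set T -> \bar R}).
Variables (w : T -> R) (a : V -> T -> R) (pr : T -> V) (M : V -> R).
Hypotheses (mw : mfunT w) (w0 : forall z, 0 <= w z)
  (maj : mfunT (fun xz : V * T => a xz.1 xz.2)) (mpr : mfunT pr)
  (ME : forall x, (\int[mu]_z (w z * a x z ^+ 2)%:E = (M x)%:E)%E)
  (M2 : forall x, M x <= 2 * c0) (Mge : forall x, U x -> c0 / 12 <= M x).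
Hypothesis adiff : forall x z, U x -> U z ->
  enorm (x - z) <= s z / (10 * kp) ->
  (\int[mu]_y (w y * (a x y - a z y) ^+ 2)%:E <=
   ((C / s z * enorm (x - z)) ^+ 2)%:E)%E.

Let M0 x : 0 <= M x.
Proof.
rewrite -lee_fin -ME; apply: integral_ge0 => z _.
by nneg.
Qed.

Let ma x : mfunT (a x).
Proof. exact: (measurableT_comp maj (measurable_pair1 x)). Qed.
Let ma2 x : mfunT (fun z => a x z ^+ 2).
Proof. by meas. Qed.
Let mF : mfunT (fun z : T => f (pr z)).
Proof. by meas. Qed.
Let mwM (h : T -> R) : mfunT h -> mfunT (fun z => (w z * h z)%:E).
Proof. by move=> mh; apply/measurable_EFinP; exact: measurable_funM. Qed.
Let a20 x z : 0 <= a x z ^+ 2. Proof. by nneg. Qed.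

Let num x := fine (\int[mu]_z (w z * (f (pr z) * a x z ^+ 2))%:E)%E.
(** The smoothed function: mean of f under the normalized density at x. *)
Let g x := num x / M x.

Let mnumi x : mfunT (fun z => (w z * (f (pr z) * a x z ^+ 2))%:E).
Proof.
by meas.
Qed.

Let numi0 x z : (0 <= (w z * (f (pr z) * a x z ^+ 2))%:E)%E.
Proof. by have /andP[? ?] := f01 (pr z); rewrite lee_fin mulr_ge0// mulr_ge0. Qed.

Let num_le x : (\int[mu]_z (w z * (f (pr z) * a x z ^+ 2))%:E <= (M x)%:E)%E.
Proof.
rewrite -ME; apply: ge0_le_integral => //; first exact: mwM.
move=> z _; rewrite lee_fin ler_wpM2l// ler_piMl ?sqr_ge0//.
by have /andP[] := f01 (pr z).
Qed.

Let numE x : (\int[mu]_z (w z * (f (pr z) * a x z ^+ 2))%:E = (num x)%:E)%E.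
Proof.
rewrite fineK// ge0_fin_numE; first exact: le_lt_trans (num_le x) (ltry _).
by apply: integral_ge0.
Qed.

Let num01 x : 0 <= num x <= M x.
Proof.
rewrite -!lee_fin -numE num_le andbT; by apply: integral_ge0.
Qed.

Let g01 x : 0 <= g x <= 1.
Proof.
have /andP[h1 h2] := num01 x; rewrite /g.
have [->|h] := eqVneq (M x) 0; first by lra.
have Mp : 0 < M x by lra.
by rewrite divr_ge0 ?M0//= ler_pdivrMr// mul1r.
Qed.

Let gE x : (\int[mu]_z (w z * (f (pr z) * a x z ^+ 2))%:E = (g x * M x)%:E)%E.
Proof.
rewrite numE /g; have [h|h] := eqVneq (M x) 0; last by rewrite divfK.
by have := num01 x; rewrite h mulr0 => h2; congr EFin; lra.
Qed.

Let mjoint (F : V -> V -> R) : mfunT (fun z : V * V => F z.1 z.2) ->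
  (forall x y, 0 <= F x y) ->
  mfunT (fun x => \int[mu]_z (w z * (F x (pr z) * a x z ^+ 2))%:E)%E.
Proof.
move=> mFF F0.
apply: (measurable_partial_integral mu (f := fun x z => (w z * (F x (pr z) * a x z ^+ 2))%:E)); last first.
  by nneg.
by meas.
Qed.

Let mfine : measurable_fun [set: \bar R] (@fine R). Proof. exact: fine_measurable. Qed.

Let mM : mfunT M.
Proof.
have m1 := mjoint (F := fun _ _ => 1) (measurable_cst _) (fun _ _ => ler01).
rewrite (_ : M = fun x => fine (\int[mu]_z (w z * (1 * a x z ^+ 2))%:E)%E).
  exact: (measurableT_comp mfine m1).
by apply/funext => x; under eq_integral do rewrite mul1r; rewrite ME.
Qed.

Let mg : mfunT g.
Proof.
apply: measurable_funM; last exact: measurable_inv_ge0.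
have m1 : mfunT (fun x => \int[mu]_z (w z * (f (pr z) * a x z ^+ 2))%:E)%E.
  apply: (mjoint (F := fun _ y => f y)); first exact: (measurableT_comp mf measurable_snd).
  by move=> x y; have /andP[] := f01 y.
exact: (measurableT_comp mfine m1).
Qed.

Definition local_var x : R := fine (\int[mu]_z (w z * ((f (pr z) - f x) ^+ 2 * a x z ^+ 2))%:E)%E.

Let lvi0 x z : (0 <= (w z * ((f (pr z) - f x) ^+ 2 * a x z ^+ 2))%:E)%E.
Proof. by nneg. Qed.

Let lv_le x : (\int[mu]_z (w z * ((f (pr z) - f x) ^+ 2 * a x z ^+ 2))%:E <= (M x)%:E)%E.
Proof.
rewrite -ME; apply: ge0_le_integral => //.
- by meas.
- exact: mwM.
- move=> z _; rewrite lee_fin ler_wpM2l// ler_piMl ?sqr_ge0//.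
  by have := f01 (pr z); have := f01 x => /andP[? ?] /andP[? ?]; nra.
Qed.

Lemma local_varE x : (\int[mu]_z (w z * ((f (pr z) - f x) ^+ 2 * a x z ^+ 2))%:E =
  (local_var x)%:E)%E.
Proof.
rewrite fineK// ge0_fin_numE; first exact: le_lt_trans (lv_le x) (ltry _).
by apply: integral_ge0.
Qed.

Lemma local_var_ge0 x : 0 <= local_var x.
Proof. by rewrite -lee_fin -local_varE; apply: integral_ge0. Qed.

Let lv2 x : local_var x <= 2 * c0.
Proof. by apply: le_trans (M2 x); rewrite -lee_fin -local_varE. Qed.

Lemma measurable_local_var : mfunT local_var.
Proof.
have m1 : mfunT
    (fun x => \int[mu]_z (w z * ((f (pr z) - f x) ^+ 2 * a x z ^+ 2))%:E)%E.
  apply: (mjoint (F := fun x y => (f y - f x) ^+ 2)) => [|x y]; last by rewrite sqr_ge0.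
  by meas.
exact: (measurableT_comp mfine m1).
Qed.

Let W x := Num.sqrt (local_var x).
Let W2 x : W x ^+ 2 = local_var x. Proof. by rewrite sqr_sqrtr// local_var_ge0. Qed.
Let W0 x : 0 <= W x. Proof. exact: sqrtr_ge0. Qed.

Let Mp x : U x -> 0 < M x.
Proof. by move=> Ux; apply: lt_le_trans (Mge Ux); rewrite divr_gt0. Qed.

Let var_split x : U x ->
  (\int[mu]_z (w z * ((f (pr z) - g x) ^+ 2 * a x z ^+ 2))%:E + ((g x - f x) ^+ 2 * M x)%:E <=
   (local_var x)%:E)%E.
Proof.
move=> Ux; rewrite -local_varE.
exact: (mean_min_variance mw (ma x) mF w0 (fun z => f01 (pr z)) (g01 x) (ME x) (gE x) (f01 x) (Mp Ux)).
Qed.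

Let f_minus_g x : U x -> (f x - g x) ^+ 2 * (c0 / 12) <= local_var x.
Proof.
move=> Ux; apply: (@le_trans _ _ ((g x - f x) ^+ 2 * M x)).
  have -> : (f x - g x) ^+ 2 = (g x - f x) ^+ 2 by ring.
  by rewrite ler_wpM2l ?sqr_ge0// Mge.
rewrite -lee_fin; apply: le_trans (var_split Ux); rewrite leeDr//.
by apply: integral_ge0 => z _; rewrite lee_fin mulr_ge0// mulr_ge0// sqr_ge0.
Qed.

(** [hellinger_mean] with W the root of the local variance at z; division by M x >= c0 / 12 gives
    the factor 12 / c0. The slope is proportional to W z / s z up to terms that vanish as x tends to
    z. *)
Let slope x z e : U x -> U z -> enorm (x - z) <= s z / (10 * kp) -> 0 < e ->
  `|g x - g z| <= 12 / c0 * (C / s z) * (2 * W z + 2 * e + C / s z * enorm (x - z)) * enorm (x - z).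
Proof.
move=> Ux Uz xz e0; have sz := spos Uz.
set D := C / s z; set dl := enorm (x - z).
have D0 : 0 < D by rewrite divr_gt0.
have dl0 : 0 <= dl by nneg.
have [dlE|dlN] := eqVneq dl 0.
  have -> : x = z by apply/eqP; rewrite -subr_eq0; apply/eqP; exact: enorm_eq0.
  by rewrite subrr normr0 dlE mulr0.
have dlp : 0 < dl by lra.
have Ddl : 0 < D * dl by rewrite mulr_gt0.
have IW : (\int[mu]_y (w y * ((f (pr y) - g z) ^+ 2 * a z y ^+ 2))%:E <= (W z ^+ 2)%:E)%E.
  rewrite W2; apply: le_trans (var_split Uz); rewrite leeDl// lee_fin.
  by nneg.
have ID : (\int[mu]_y (w y * (a x y - a z y) ^+ 2)%:E <= ((D * dl) ^+ 2)%:E)%E.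
  exact: adiff.
have H := hellinger_mean mw (ma x) (ma z) mF w0 (fun z => f01 (pr z)) (g01 z)
  (ME x) (ME z) (gE x) (gE z) IW ID (W0 z) Ddl e0.
have K0 : 0 <= 2 * W z + 2 * e + D * dl by nneg.
rewrite -(ler_pM2r (Mp Ux)); apply: (le_trans H).
apply: (@le_trans _ _ (12 / c0 * D * (2 * W z + 2 * e + D * dl) * dl * (c0 / 12))).
  by apply: eqW; field; rewrite gt_eqF.
rewrite ler_wpM2l ?Mge// mulr_ge0// mulr_ge0// mulr_ge0 ?(ltW D0)//.
by nneg.
Qed.

Let l x := 24 / c0 * (C / s x) * W x.

Let l0 x : 0 <= l x.
Proof. by nneg. Qed.

Let ml : mfunT l.
Proof.
apply: measurable_funM.
  by meas.
apply: measurableT_comp measurable_local_var.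
exact: (continuous_measurable_fun (@sqrt_continuous R)).
Qed.

Let gl z e : U z -> 0 < e -> exists2 dl : R, 0 < dl &
  forall x, U x -> enorm (x - z) < dl -> `|g x - g z| <= (l z + e) * enorm (x - z).
Proof.
move=> Uz e0; have sz := spos Uz; set D := C / s z.
have D0 : 0 < D by rewrite divr_gt0.
pose A := 12 / c0 * D; have A0 : 0 < A by rewrite mulr_gt0// divr_gt0.
(* Within the first radius [slope] applies; the second one keeps the term A D |x - z| below e /
   2. *)
exists (Num.min (s z / (10 * kp)) (e / (2 * A * D))).
  by rewrite lt_min; apply/andP; split; rewrite divr_gt0// mulr_gt0// mulr_gt0.
move=> x Ux; rewrite lt_min => /andP[h1 h2].
have e'0 : 0 < e / (4 * A) by rewrite divr_gt0// mulr_gt0.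
have := slope Ux Uz (ltW h1) e'0; rewrite -/D -/A => /le_trans; apply.
rewrite ler_wpM2r ?enorm_ge0//.
have h3 : A * (D * enorm (x - z)) <= e / 2.
  have AD : 0 < 2 * A * D by rewrite mulr_gt0// mulr_gt0.
  move: h2; rewrite ltr_pdivlMr// => /ltW h.
  by lra.
have -> : l z = A * (2 * W z) by rewrite /l /A /D; field; rewrite !gt_eqF.
have -> : A * (2 * W z + 2 * (e / (4 * A)) + D * enorm (x - z)) =
   A * (2 * W z) + e / 2 + A * (D * enorm (x - z)) by field; rewrite gt_eqF.
lra.
Qed.

(** Crude global constant that serves the dominated convergence in [weighted_cheeger]: its first
    summand covers points close to z relative to s z, and 10 [kp] covers the others through |g x - g
    z| <= 1. *)
Let L := 12 / c0 * C * (2 * Num.sqrt (2 * c0) + 2 + C / (10 * kp)) + 10 * kp.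

Let gL x z : U x -> U z -> s z * `|g x - g z| <= L * enorm (x - z).
Proof.
move=> Ux Uz; have sz := spos Uz; have d0 := enorm_ge0 (x - z).
have L1 : 0 <= 12 / c0 * C * (2 * Num.sqrt (2 * c0) + 2 + C / (10 * kp)).
  rewrite mulr_ge0//; first by nneg.
  by nneg.
have [h|h] := leP (enorm (x - z)) (s z / (10 * kp)); last first.
  have g1 : `|g x - g z| <= 1.
    have := g01 x; have := g01 z => /andP[? ?] /andP[? ?].
    by rewrite ler_norml; apply/andP; split; lra.
  move: h; rewrite ltr_pdivrMr ?mulr_gt0// => h.
  apply: (@le_trans _ _ (s z)); first by rewrite ler_piMr// ltW.
  rewrite /L mulrDl; have := mulr_ge0 L1 d0; lra.
have := slope Ux Uz h ltr01 => H.
have := ler_wpM2l (ltW sz) H => /le_trans; apply.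
have -> : s z * (12 / c0 * (C / s z) * (2 * W z + 2 * 1 + C / s z * enorm (x - z)) * enorm (x - z)) =
   12 / c0 * C * (2 * W z + 2 + C / s z * enorm (x - z)) * enorm (x - z).
  by field; rewrite !gt_eqF.
rewrite ler_wpM2r// /L.
apply: (@le_trans _ _ (12 / c0 * C * (2 * Num.sqrt (2 * c0) + 2 + C / (10 * kp)))); last first.
  by rewrite lerDl mulr_ge0// ltW.
rewrite ler_wpM2l ?mulr_ge0 ?divr_ge0 ?invr_ge0 ?(ltW c00) ?(ltW C0)//.
have wl : W z <= Num.sqrt (2 * c0) by rewrite ler_sqrt ?lv2// mulr_ge0// ltW.
have : C / s z * enorm (x - z) <= C / s z * (s z / (10 * kp)).
  by rewrite ler_wpM2l// divr_ge0 ?(ltW C0)// ltW.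
have -> : C / s z * (s z / (10 * kp)) = C / (10 * kp) by field; rewrite !gt_eqF.
lra.
Qed.

Definition total_var : \bar R := (\int[vol n]_x (\1_U x * local_var x)%:E)%E.

(** f - m is split at the smoothed g. The square of f - g is at most 12 / c0 times the local
    variance; g - m falls under [weighted_poincare], where in s l the scale cancels and leaves (24 C
    / c0) W. The factor (n r)^2 combines the squared diameter 4 r^2, the bound 1600 n on (vU / nU)^2
    and the n in C^2. *)
Lemma smoothing_gap : exists2 m, 0 <= m <= 1 &
  (\int[vol n]_x (\1_U x * (f x - m) ^+ 2)%:E <=
   (14 * 10 ^+ 12 * (n%:R * r) ^+ 2 / c0)%:E * total_var)%E.
Proof.
have r0 : 0 < r by apply: lt_le_trans r1.
have Uoo : (vol n U < +oo)%E by exact: (convex_vol_fin oU Ur).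
have UE : vol n U = (fine (vol n U))%:E by rewrite fineK// ge0_fin_numE.
set vU := fine (vol n U) in UE.
have vU0 : 0 < vU by have := vol_eopen_gt0 oU (ex_intro _ 0 U_0); rewrite UE lte_fin.
have mI : mfunT (\1_U : V -> R) by meas.
have nuoo : (\int[vol n]_x (\1_U x * s x)%:E < +oo)%E.
  pose B := s 0 + kp * r.
  have B0 : 0 <= B by nneg.
  apply: (@le_lt_trans _ _ (\int[vol n]_x (B%:E * (\1_U x)%:E))%E).
    apply: ge0_le_integral => //.
    - by nneg.
    - by meas.
    - by meas.
    move=> x _; rewrite -EFinM lee_fin indicE; case: (boolP (x \in U)); rewrite ?mul0r ?mulr0//.
    rewrite inE => Ux; rewrite mul1r mulr1 /B.
    have := slip x 0; rewrite subr0 ler_norml => /andP[_].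
    have := Ur Ux; rewrite /eball/= => h.
    have : kp * enorm x <= kp * r by rewrite ler_wpM2l// ltW.
    lra.
  rewrite ge0_integralZl_EFin//; last exact/measurable_EFinP.
  by rewrite integral_indic ?setIT// lte_mul_pinfty// lee_fin.
pose N := (Num.truncn r).+1.
have rN : r < N%:R by exact: truncnS_gt.
have UM : U `<=` pbox (fun=> `]- N%:R, N%:R[%classic).
  move=> x /Ur; rewrite /eball/= => h i; rewrite /= in_itv/= -ltr_norml.
  exact: le_lt_trans (ler_coord_enorm x i) (le_lt_trans h rN).
have UD x y : U x -> U y -> enorm (x - y) <= 2 * r.
  move=> /Ur h1 /Ur h2; apply: le_trans (ler_enormB _ _) _.
  by move: h1 h2; rewrite /eball/=; lra.
have sm := smean; rewrite -/vU in sm.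
have nuE : (\int[vol n]_x (\1_U x * s x)%:E = (fine (\int[vol n]_x (\1_U x * s x)%:E))%:E)%E.
  by rewrite fineK// ge0_fin_numE//; apply: integral_ge0 => x _; rewrite lee_fin mulr_ge0.
rewrite nuE lee_fin in sm; set nU := fine _ in sm nuE.
have nU0 : 0 < nU by apply: lt_le_trans sm; rewrite divr_gt0// mulr_gt0.
have r20 : 0 < 2 * r by lra.
have [m m01 Hm] := weighted_poincare UM oU cU (ex_intro _ 0 U_0) ms s0 spos
  sconc nuoo UD r20 nU0 mg ml g01 l0 gL gl.
exists m => //; move: Hm; rewrite -/vU -/nU.
have mlv : mfunT (fun x => (\1_U x * local_var x)%:E).
  by apply/measurable_EFinP; apply: measurable_funM => //; exact: measurable_local_var.
have lvx x : (0 <= (\1_U x * local_var x)%:E)%E by rewrite lee_fin mulr_ge0 ?local_var_ge0.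
pose Kl := 24 / c0 * C.
have -> : (\int[vol n]_x (\1_U x * (s x * l x) ^+ 2)%:E = (Kl ^+ 2)%:E * total_var)%E.
  rewrite /total_var -ge0_integralZl_EFin ?sqr_ge0//.
  apply: eq_integral => x _; rewrite -EFinM; congr EFin.
  rewrite indicE; case: (boolP (x \in U)); rewrite ?mul0r ?mulr0// inE => Ux.
  rewrite !mul1r -W2.
  have -> : s x * l x = Kl * W x by rewrite /l /Kl; field; rewrite !gt_eqF ?spos.
  by rewrite exprMn.
set cP := 16 * _ * _ => Hm.
have cP0 : 0 <= cP by nneg.
have cPle : cP <= 64 * r ^+ 2 * (1600 * n%:R).
  have : vU / nU <= 40 * q.
    by move: sm; rewrite !ler_pdivrMr ?mulr_gt0//; lra.
  have v0 : 0 <= vU / nU by nneg.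
  move=> h; have : (vU / nU) ^+ 2 <= (40 * q) ^+ 2.
    by rewrite ler_pXn2r// nnegrE mulr_ge0// ltW.
  have -> : (40 * q) ^+ 2 = 1600 * n%:R by rewrite exprMn qq; ring.
  move=> h2; rewrite /cP exprMn.
  have := ler_wpM2l (_ : 0 <= 64 * r ^+ 2) h2.
  rewrite mulr_ge0 ?sqr_ge0// => /(_ isT); lra.
have EP0 : (0 <= total_var)%E by apply: integral_ge0.
have If : (\int[vol n]_x (\1_U x * (f x - g x) ^+ 2)%:E <= (12 / c0)%:E * total_var)%E.
  rewrite /total_var -ge0_integralZl_EFin ?divr_ge0 ?(ltW c00)//.
  apply: ge0_le_integral => //.
  - by nneg.
  - by meas.
  - by meas.
  move=> x _; rewrite -EFinM lee_fin indicE; case: (boolP (x \in U)); rewrite ?mul0r ?mulr0// inE => Ux.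
  rewrite !mul1r; have := f_minus_g Ux; rewrite -ler_pdivlMr ?divr_gt0// => /le_trans; apply.
  by apply: eqW; field; rewrite gt_eqF.
have mfg : mfunT (fun x => (\1_U x * (f x - g x) ^+ 2)%:E).
  by meas.
have mgm : mfunT (fun x => (\1_U x * (g x - m) ^+ 2)%:E).
  by meas.
apply: (@le_trans _ _ (\int[vol n]_x (2%:E * (\1_U x * (f x - g x) ^+ 2)%:E +
   2%:E * (\1_U x * (g x - m) ^+ 2)%:E))%E).
  apply: ge0_le_integral => //.
  - by nneg.
  - by meas.
  - by apply: emeasurable_funD; exact: measurable_funeM.
  move=> x _; rewrite -!EFinM -EFinD lee_fin.
  have : 0 <= \1_U x * ((f x - g x) - (g x - m)) ^+ 2 by nneg.
  by rewrite -subr_ge0 => h; apply: le_trans h _; apply: eqW; ring.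
rewrite ge0_integral_linear//; last 2 first.
- by nneg.
- by nneg.
apply: (le_trans (leeD (lee_wpmul2l _ If) (lee_wpmul2l _ Hm))) => //.
rewrite !muleA -!EFinM -ge0_muleDl; last 2 first.
- by nneg.
- by nneg.
apply: lee_wpmul2r => //; rewrite -EFinD lee_fin.
have nr : 1 <= (n%:R * r) ^+ 2.
  by rewrite exprn_ege1// -[leLHS]mulr1; apply: ler_pM => //; rewrite ler1n.
have ci : 0 < c0^-1 by rewrite invr_gt0.
have KlE : Kl ^+ 2 = 24 ^+ 2 * 340 ^+ 2 * n%:R / c0.
  by rewrite /Kl !exprMn C2; field; rewrite gt_eqF.
have := ler_wpM2r (sqr_ge0 Kl) cPle; rewrite KlE => h2.
have := ler_wpM2r (ltW ci) nr; rewrite mul1r => h1.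
set X := (n%:R * r) ^+ 2 / c0 in h1 *.
have X0 : 0 <= X by nneg.
have e1 : 64 * r ^+ 2 * (1600 * n%:R) * (24 ^+ 2 * 340 ^+ 2 * n%:R / c0) =
   64 * 1600 * (24 ^+ 2 * 340 ^+ 2) * X by rewrite /X; ring.
rewrite e1 in h2.
have -> : 14 * 10 ^+ 12 * (n%:R * r) ^+ 2 / c0 = 14 * 10 ^+ 12 * X by rewrite /X; ring.
rewrite -[2 * cP * _]mulrA; exact: smoothing_constant.
Qed.

End smoothing.

Section sigma_finite_product.
Context d1 d2 (T1 : measurableType d1) (T2 : measurableType d2) (R : realType).
Variables (m1 : {sigma_finite_measure set T1 -> \bar R}).
Variables (m2 : {sigma_finite_measure set T2 -> \bar R}).

(** Alias of the product measure that carries the sigma-finite structure used by the Tonelli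
    exchanges. *)
Definition prod_measure : set (T1 * T2)%type -> \bar R := (m1 \x m2)%E.

HB.instance Definition _ := Measure.on prod_measure.

Let prod_sigma_finite : sigma_finite setT prod_measure.
Proof.
have /sigma_finiteP[F [TF ndF Foo]] := sigma_finiteT m1.
have /sigma_finiteP[G [TG ndG Goo]] := sigma_finiteT m2.
exists (fun k => F k `*` G k).
  apply/seteqP; split => // -[x y] _.
  have [k _ Fx] : (\bigcup_k F k) x by rewrite -TF.
  have [l _ Gy] : (\bigcup_l G l) y by rewrite -TG.
  exists (maxn k l) => //; split => /=.
  - by move: x Fx; exact/subsetPset/ndF/leq_maxl.
  - by move: y Gy; exact/subsetPset/ndG/leq_maxr.
move=> k; have [mF Fk] := Foo k; have [mG Gk] := Goo k.
split; first exact: measurableX.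
by rewrite /prod_measure product_measure1E// lte_mul_pinfty// ge0_fin_numE.
Qed.

HB.instance Definition _ := Measure_isSigmaFinite.Build _ _ _ prod_measure
  prod_sigma_finite.

Definition sigma_finite_product : {sigma_finite_measure set (T1 * T2)%type -> \bar R} :=
  prod_measure.

End sigma_finite_product.

(** * From local variance to chord energy *)

Section local_to_chord.
Context {R : realType} (n : nat).
Local Notation V := 'rV[R]_n.
Local Notation leb := (@lebesgue_measure R).
Variables (U : set V) (s : V -> R).
Hypotheses (n0 : (0 < n)%N) (mU : measurable U) (cU : econvex U) (ms : mfunT s)
  (s0 : forall x, 0 <= s x) (spos : forall x, U x -> 0 < s x)
  (sconc : forall x y t, U x -> U y -> 0 <= t <= 1 ->
  (1 - t) * s x + t * s y <= s ((1 - t) *: x + t *: y)).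
Variable f : V -> R.
Hypotheses (mf : mfunT f) (f01 : forall x, 0 <= f x <= 1).
Variable Q : V -> V -> R.
Hypotheses (mQ : mfunT (fun wx : V * V => Q wx.1 wx.2)) (Q01 : forall w x, 0 <= Q w x <= 1).
Hypothesis Qinv : forall w x t, U x -> U (x + t *: w) -> Q w (x + t *: w) = Q w x.

Let mu := sigma_finite_product leb (vol n).
Let mI : mfunT (\1_U : V -> R). Proof. by meas. Qed.

Let K x (t : R) : R := `|t|^-1 * window (8 * t / s x) ^+ 2.

Let K0 x t : 0 <= K x t. Proof. by nneg. Qed.

Let K_le x t : K x t <= `|t|^-1.
Proof. by rewrite ler_piMr ?invr_ge0// expr_le1 ?window_le1 ?window_ge0. Qed.

Let K_out x t : K x t != 0 -> U x -> s x / 8 < t < s x / 2.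
Proof.
move=> h Ux; apply: (window_range (spos Ux)).
by apply: contra_neq h => h; rewrite /K h expr0n/= mulr0.
Qed.

Let mK d (T : measurableType d) (X : T -> V) (t : T -> R) :
  mfunT X -> mfunT t ->
  mfunT (fun z => K (X z) (t z)).
Proof.
move=> mX mt; apply: measurable_funM; first exact: measurable_invn.
apply: measurable_funX; apply: (measurableT_comp measurable_window).
by meas.
Qed.

Let low (t : R) (y : V) : R := \1_[set z : R * V | z.1 <= s z.2] (t, y).

Let mlow d (T : measurableType d) (X : T -> V) (t : T -> R) :
  mfunT X -> mfunT t ->
  mfunT (fun z => low (t z) (X z)).
Proof.
move=> mX mt; have mS : measurable [set z : R * V | z.1 <= s z.2].
  have m1 : mfunT (fun z : R * V => s z.2 - z.1).
    by meas.
  rewrite (_ : [set z | _] = (fun z : R * V => s z.2 - z.1) @^-1` `[0, +oo[).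
    by rewrite -[_ @^-1` _]setTI; exact: m1.
  by apply/seteqP; split => z /=; rewrite in_itv/= andbT subr_ge0.
have m2 : mfunT (fun z => (t z, X z)) by meas.
have m3 : mfunT (\1_[set z : R * V | z.1 <= s z.2] : R * V -> R).
  by meas.
exact: (measurableT_comp m3 m2).
Qed.

Let low_le1 t y : low t y <= 1.
Proof. by rewrite /low indicE lern1 leq_b1. Qed.

Let res (w y : V) : R := bump w ^+ 2 * (\1_U y * (f y - Q w y) ^+ 2).

Let res0 w y : 0 <= res w y. Proof. by nneg. Qed.

Let res_le w y : res w y <= bump w ^+ 2.
Proof.
rewrite ler_piMr ?sqr_ge0// -[leRHS]mulr1; apply: ler_pM => //; rewrite ?sqr_ge0//.
by have /andP[? ?] := f01 y; have /andP[? ?] := Q01 w y; nra.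
Qed.

Let mres d (T : measurableType d) (X Y : T -> V) :
  mfunT X -> mfunT Y ->
  mfunT (fun z => res (X z) (Y z)).
Proof.
move=> mX mY; apply: measurable_funM; first exact: (measurableT_comp (@measurable_bump_sqr R n) mX).
by meas.
Qed.

Let shift (x : V) (z : R * V) : V := x + `|z.1| *: z.2.

Let mshift d (T : measurableType d) (X : T -> V) (Z : T -> R * V) :
  mfunT X -> mfunT Z ->
  mfunT (fun z => shift (X z) (Z z)).
Proof.
move=> mX mZ; apply: measurable_rowD => //; apply: measurable_rowZ.
  by meas.
by meas.
Qed.

Let pairE (F : R * V -> \bar R) : mfunT F -> (forall z, 0 <= F z)%E ->
  (\int[mu]_z F z = \int[leb]_t \int[vol n]_y F (t, y))%E.
Proof. by move=> mF F0; exact: fubini_tonelli1. Qed.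

Let H x (z : R * V) : R :=
  K x z.1 * (bump z.2 ^+ 2 * (\1_U (shift x z) * low z.1 (shift x z)) *
             (f (shift x z) - f x) ^+ 2).

Let mH x : mfunT (fun z => (H x z)%:E).
Proof.
apply/measurable_EFinP.
have msh : mfunT (fun z => shift x z).
  by meas.
apply: measurable_funM; first by apply: mK; [exact: measurable_cst|exact: measurable_fst].
by meas.
Qed.

Let local_polar x : U x ->
  (\int[mu]_z (wgt U s z * ((f z.2 - f x) ^+ 2 * root s x z ^+ 2))%:E =
   \int[mu]_z (H x z)%:E)%E.
Proof.
move=> Ux; have mL : mfunT
    (fun z => (wgt U s z * ((f z.2 - f x) ^+ 2 * root s x z ^+ 2))%:E).
  apply/measurable_EFinP; apply: measurable_funM; first exact: measurable_wgt.
  apply: measurable_funM.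
    by meas.
  by apply: measurable_funX; exact: measurable_root1.
have L0 z : (0 <= (wgt U s z * ((f z.2 - f x) ^+ 2 * root s x z ^+ 2))%:E)%E.
  by nneg.
have H0 z : (0 <= (H x z)%:E)%E.
  by nneg.
rewrite (pairE mL L0) (pairE (mH x) H0); apply: eq_integral => t _.
have [wz|wn] := eqVneq (window (8 * t / s x)) 0.
  rewrite !integral0_eq// => y _; rewrite /H /K /root /= wz ?mul0r ?expr0n/= ?mulr0 ?mul0r//.
have /andP[t1 _] := window_range (spos Ux) wn.
have t0 : 0 < t by apply: lt_trans t1; rewrite divr_gt0// spos.
have tn : t != 0 by rewrite gt_eqF.
pose F (y : V) : \bar R := (K x t * (bump (`|t|^-1 *: (y - x)) ^+ 2 * (\1_U y * low t y) * (f y - f x) ^+ 2))%:E.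
have mF : mfunT F.
  apply/measurable_EFinP; apply: measurable_funM; first exact: measurable_cst.
  by meas.
have F0 y : (0 <= F y)%E.
  by nneg.
transitivity (\int[vol n]_y ((`|t|%R^-1 ^+ n)%:E * F y))%E.
  apply: eq_integral => y _; rewrite /F -EFinM; congr EFin.
  by rewrite /wgt /root /K /low /=; ring.
rewrite (polar_change x tn mF F0); apply: eq_integral => w _.
rewrite /F /H /shift /=; congr (_ * (bump _ ^+ 2 * _ * _))%:E.
by rewrite addrAC subrr add0r scalerA mulVf ?normr_eq0// scale1r.
Qed.

(** Both values of f are compared with Q, which by [Qinv] is the same at the two ends of the
    displacement. The difference splits into a residual at x and one at the shifted point. *)
Let split_le x z : U x ->
  H x z <= 2 * (K x z.1 * res z.2 x) + 2 * (K x z.1 * low z.1 (shift x z) * res z.2 (shift x z)).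
Proof.
move=> Ux; rewrite /H /res.
set y := shift x z; set lo := low z.1 y; have lo0 : 0 <= lo by [].
have -> : \1_U x = 1 :> R by rewrite indicE mem_set.
rewrite (@indicE _ _ U y); case: (boolP (y \in U)) => [|_]; last first.
  by rewrite !(mul0r, mulr0) addr0 mulr_ge0// mulr_ge0// mulr_ge0 ?sqr_ge0// mulr_ge0 ?sqr_ge0.
rewrite inE => Uy; rewrite !mul1r.
have <- : Q z.2 y = Q z.2 x by apply: Qinv.
set k := K x z.1; set b := bump z.2 ^+ 2; set q := Q z.2 y.
have k0 : 0 <= k by nneg.
have b0 : 0 <= b by nneg.
have e1 : (f y - f x) ^+ 2 <= 2 * (f x - q) ^+ 2 + 2 * (f y - q) ^+ 2.
  by have := sqr_ge0 ((f y - q) + (f x - q)); lra.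
have kb : 0 <= k * b by nneg.
have lo1 : lo <= 1 by exact: low_le1.
have := ler_wpM2l (mulr_ge0 kb lo0) e1.
have : k * b * lo * (f x - q) ^+ 2 <= k * b * (f x - q) ^+ 2.
  by rewrite ler_wpM2r ?sqr_ge0// ler_piMr.
lra.
Qed.

(** Mass that y receives along direction w from the base points y - |t| w: the kernel seen from its
    target. *)
Let colmass y w (t : R) : R := \1_U (y - `|t| *: w) * K (y - `|t| *: w) t * low t y.

Let col_ge0 y w t : 0 <= colmass y w t. Proof. by nneg. Qed.

Let col_neq0 y w t : colmass y w t != 0 ->
  [/\ 0 < t, t <= s y, U (y - t *: w) & s (y - t *: w) / 8 < t].
Proof.
rewrite /colmass mulf_eq0 negb_or => /andP[]; rewrite mulf_eq0 negb_or => /andP[h1 h2] h3.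
have Ux : U (y - `|t| *: w).
  by move: h1; rewrite indicE; case: (boolP (_ \in U)); rewrite ?inE// eqxx.
have /andP[t1 _] := K_out h2 Ux.
have t0 : 0 < t by apply: lt_trans t1; rewrite divr_gt0// spos.
rewrite gtr0_norm// in Ux t1; split => //.
by move: h3; rewrite /low indicE; case: (boolP (_ \in _)); rewrite ?inE//= eqxx.
Qed.

(* The chord leaves U soon after s falls below half of its value at y, by concavity:
   the admissible t below s y / 16 lie within a factor 2 of each other. *)
Let column_le y w : U y -> (\int[leb]_t (colmass y w t)%:E <= 5%:E)%E.
Proof.
move=> Uy; set S := s y; have S0 : 0 < S by exact: spos.
pose A := [set t | colmass y w t != 0 /\ t < S / 16].
have Apos t : A t -> 0 < t by move=> [/col_neq0[]].
have A2 t1 t2 : A t1 -> A t2 -> t1 <= 2 * t2.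
  move=> [h1 l1] [h2 l2]; rewrite leNgt; apply/negP => h.
  have [p1 _ U1 _] := col_neq0 h1; have [p2 _ U2 b2] := col_neq0 h2.
  have h01 : 0 <= t2 / t1 <= 1.
    by rewrite divr_ge0 ?(ltW p1) ?(ltW p2)//= ler_pdivrMr// mul1r; lra.
  have := sconc Uy U1 h01.
  have -> : (1 - t2 / t1) *: y + (t2 / t1) *: (y - t1 *: w) = y - t2 *: w.
    rewrite scalerBr scalerA divfK ?gt_eqF// addrA -scalerDl.
    by rewrite subrK scale1r.
  have := s0 (y - t1 *: w) => sx.
  have d2 : t2 / t1 < 1 / 2 by rewrite ltr_pdivrMr//; lra.
  have t20 : 0 <= t2 / t1 * s (y - t1 *: w) by nneg.
  have : (1 / 2) * S <= (1 - t2 / t1) * S by rewrite ler_wpM2r ?(ltW S0)//; lra.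
  by move: l2 b2; rewrite -/S; lra.
have mi (a b : R) : mfunT (fun t : R => (\1_(`[a, b]%classic : set R) t * `|t|^-1)%:E : \bar R).
  by meas.
have i0 (a b t : R) : (0 <= (\1_(`[a, b]%classic : set R) t * `|t|^-1)%:E :> \bar R)%E.
  by nneg.
have [u [u0 Au]] : exists u, 0 < u /\ forall t, A t -> u / 2 <= t <= u.
  have [[t0 At0]|nA] := pselect (A !=set0); last first.
    by exists 1; split => // t At; exfalso; apply: nA; exists t.
  have hA : has_sup A by split; [exists t0|exists (S / 16) => t [_ /ltW]].
  have uA t : A t -> t <= sup A by exact: (ub_le_sup (proj2 hA)).
  exists (sup A); split; first exact: lt_le_trans (Apos _ At0) (uA _ At0).
  move=> t At; rewrite uA// andbT; have : sup A <= 2 * t.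
    by apply: ge_sup; [exists t0|move=> t' At'; exact: A2].
  lra.
apply: (@le_trans _ _ (\int[leb]_t (1%:E * (\1_(`[S / 16, S]%classic : set R) t * `|t|^-1)%:E +
    1%:E * (\1_(`[u / 2, u]%classic : set R) t * `|t|^-1)%:E))%E).
  apply: ge0_le_integral => //.
  - by nneg.
  - apply/measurable_EFinP; apply: measurable_funM; last first.
      by meas.
    by meas.
  - by apply: emeasurable_funD; apply: measurable_funeM; exact: mi.
  move=> t _; rewrite !mul1e -EFinD lee_fin -mulrDl.
  have [->|h] := eqVneq (colmass y w t) 0.
    by nneg.
  have [t0 tS _ _] := col_neq0 h.
  apply: (@le_trans _ _ (1 * `|t|^-1)).
    rewrite mul1r; apply: le_trans (K_le (y - `|t| *: w) t).
    rewrite /colmass mulrAC -[leRHS]mul1r ler_wpM2r// mulr_ile1//.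
  rewrite ler_wpM2r ?invr_ge0//.
  have [tS'|tS'] := leP (S / 16) t.
    rewrite [X in X + _]indicE mem_set/= ?lerDl// in_itv/= tS'; exact: tS.
  rewrite [X in _ + X]indicE mem_set/= ?lerDr// in_itv/=; exact: Au.
rewrite (ge0_integral_linear leb ler01 ler01 (mi _ _) (mi _ _) (i0 _ _) (i0 _ _)) !mul1e.
have S16 : 0 < S / 16 by lra.
have u2 : 0 < u / 2 by lra.
(* 4 comes from [S / 16, S], since 16 <= e^4, and 1 from the short ranges in [u / 2, u], since 2 <=
   e. *)
have -> : 5%:E = (4%:E + 1%:E :> \bar R)%E by rewrite -EFinD; congr EFin; lra.
apply: leeD; apply: integral_inv_le => //.
  have -> : S = S / 16 * 16 :> R by field.
  by rewrite (_ : S / 16 * 16 / 16 = S / 16) ?ler_wpM2l ?expR4_ge16 ?(ltW S16)//; field.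
rewrite -[leLHS](_ : u / 2 * 2 = u); last by field.
by rewrite ler_wpM2l ?expR1_ge2// ltW.
Qed.

Definition chord_energy : \bar R := (\int[vol n]_x \int[vol n]_w (res w x)%:E)%E.

Let mres1 x : mfunT (fun w => (res w x)%:E).
Proof.
by meas.
Qed.

Let Ires_fin x : (\int[vol n]_w (res w x)%:E = (fine (\int[vol n]_w (res w x)%:E))%:E)%E.
Proof.
rewrite fineK// ge0_fin_numE; last by apply: integral_ge0 => w _; rewrite lee_fin.
apply: (@le_lt_trans _ _ (bumpvol n)%:E); last exact: ltry.
rewrite -integral_bump; apply: ge0_le_integral => //.
- by nneg.
- by apply/measurable_EFinP; exact: measurable_bump_sqr.
- by nneg.
Qed.

Let mIres : mfunT (fun x => \int[vol n]_w (res w x)%:E)%E.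
Proof.
apply: (measurable_partial_integral (vol n) (f := fun x w => (res w x)%:E)).
  by meas.
by nneg.
Qed.

Let Ires0 x : (0 <= \int[vol n]_w (res w x)%:E)%E.
Proof. by apply: integral_ge0 => w _; rewrite lee_fin. Qed.

Let T1 x (z : R * V) := K x z.1 * res z.2 x.
Let T2 x (z : R * V) := \1_U x * (K x z.1 * low z.1 (shift x z) * res z.2 (shift x z)).

Let T10 x z : (0 <= (T1 x z)%:E)%E. Proof. by nneg. Qed.
Let T20 x z : (0 <= (T2 x z)%:E)%E.
Proof. by nneg. Qed.

Let mT1 : mfunT (fun q : V * (R * V) => (T1 q.1 q.2)%:E).
Proof.
have m1 : mfunT (fun q : V * (R * V) => q.2.1).
  by meas.
have m2 : mfunT (fun q : V * (R * V) => q.2.2).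
  by meas.
apply/measurable_EFinP; apply: measurable_funM.
  by meas.
by meas.
Qed.

Let mT2 : mfunT (fun q : V * (R * V) => (T2 q.1 q.2)%:E).
Proof.
have m1 : mfunT (fun q : V * (R * V) => q.2.1).
  by meas.
have m2 : mfunT (fun q : V * (R * V) => q.2.2).
  by meas.
have msh : mfunT (fun q : V * (R * V) => shift q.1 q.2).
  by meas.
apply/measurable_EFinP; apply: measurable_funM.
  by meas.
by meas.
Qed.

Let K_mass x : U x -> (\int[leb]_t (K x t)%:E <= 2%:E)%E.
Proof.
move=> Ux; have sx := spos Ux.
apply: (@le_trans _ _ (\int[leb]_t (\1_(`[s x / 8, s x / 2]%classic : set R) t * `|t|^-1)%:E)%E).
  apply: ge0_le_integral => //.
  - by nneg.
  - by meas.
  - by meas.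
  move=> t _; rewrite lee_fin; have [->|h] := eqVneq (K x t) 0.
    by nneg.
  have /andP[t1 t2] := K_out h Ux.
  by rewrite indicE mem_set/= ?mul1r ?K_le// in_itv/= !ltW.
apply: integral_inv_le => //; first by lra.
have -> : s x / 2 = s x / 8 * 4 by field.
by rewrite ler_wpM2l ?expR2_ge4// divr_ge0// ltW.
Qed.

Let T1_le x : (\int[mu]_z (T1 x z)%:E <= 2%:E * \int[vol n]_w (res w x)%:E)%E.
Proof.
have m1 : mfunT (fun z => (T1 x z)%:E).
  exact: (measurableT_comp mT1 (measurable_pair1 x)).
rewrite (pairE m1 (T10 x)).
have [Ux|nU] := pselect (U x); last first.
  rewrite integral0_eq ?mule_ge0// => t _; rewrite integral0_eq// => w _.
  by rewrite /T1 /res indicE memNset// mul0r !mulr0.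
have mKx : mfunT (fun t => (K x t)%:E).
  by meas.
under eq_integral => t _.
  rewrite /T1 /=; under eq_integral do rewrite EFinM.
  rewrite ge0_integralZl_EFin//; last by move=> w _; rewrite lee_fin.
  rewrite Ires_fin muleC.
  over.
have I0 : 0 <= fine (\int[vol n]_w (res w x)%:E)%E by exact: fine_ge0.
rewrite ge0_integralZl_EFin//; last by move=> t _; rewrite lee_fin.
rewrite [in leRHS]Ires_fin [leRHS]muleC; apply: lee_wpmul2l; first by rewrite lee_fin.
exact: K_mass.
Qed.

(** Exchanging the integrals and translating by |t| w turns the residual at the target into a
    residual at the base point weighted by [colmass], to which [column_le] applies. *)
Let T2_le : (\int[vol n]_x \int[mu]_z (T2 x z)%:E <= 5%:E * chord_energy)%E.
Proof.
rewrite (tonelli_swap (vol n) mu mT2)//.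
pose G (y : V) (z : R * V) := colmass y z.2 z.1 * res z.2 y.
have G0 y z : (0 <= (G y z)%:E)%E by nneg.
have GE y (z : R * V) : G y z = T2 (y - `|z.1| *: z.2) z.
  by rewrite /G /T2 /shift subrK /colmass; ring.
have mG : mfunT (fun q : V * (R * V) => (G q.1 q.2)%:E).
  rewrite (_ : (fun q : V * (R * V) => _) = (fun q : V * (R * V) => (T2 (q.1 - `|q.2.1| *: q.2.2) q.2)%:E)).
    have m1 : mfunT (fun q : V * (R * V) => (q.1 - `|q.2.1| *: q.2.2, q.2)).
      by meas.
    exact: (measurableT_comp mT2 m1).
  by apply/funext => q; rewrite GE.
have -> : (\int[mu]_z \int[vol n]_x (T2 x z)%:E = \int[mu]_z \int[vol n]_y (G y z)%:E)%E.
  apply: eq_integral => z _.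
  have m2 : mfunT (fun x => (T2 x z)%:E).
    exact: (measurableT_comp mT2 (measurable_pair2 z)).
  rewrite -(ge0_integral_translate (- (`|z.1| *: z.2)) m2)//.
  by apply: eq_integral => y _; rewrite GE.
rewrite -(tonelli_swap (vol n) mu mG)//.
rewrite /chord_energy -ge0_integralZl_EFin//.
have mGy y : mfunT (fun z => (G y z)%:E).
  exact: (measurableT_comp mG (measurable_pair1 y)).
apply: ge0_le_integral => //.
- by move=> y _; apply: integral_ge0.
- by apply: (measurable_partial_integral mu (f := fun y z => (G y z)%:E) mG).
- by meas.
move=> y _; rewrite (pairE (mGy y) (G0 y)).
have mG' : mfunT (fun z : R * V => (G y (z.1, z.2))%:E).
  by meas.
rewrite (tonelli_swap leb (vol n) (f := fun t w => (G y (t, w))%:E) mG')//.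
rewrite -ge0_integralZl_EFin//; last by move=> w _; rewrite lee_fin.
apply: ge0_le_integral => //.
- by move=> w _; apply: integral_ge0.
- apply: (measurable_partial_integral leb (f := fun w t => (G y (t, w))%:E)) => //.
  have msw : mfunT (fun z : V * R => (z.2, z.1)).
    by meas.
  exact: (measurableT_comp (mGy y) msw).
- by meas.
move=> w _; have [Uy|nU] := pselect (U y); last first.
  rewrite integral0_eq ?mule_ge0 ?lee_fin// => t _.
  by rewrite /G /res (@indicE _ _ U y) memNset// mul0r !mulr0.
have mc : mfunT (fun t => (colmass y w t)%:E).
  have m1 : mfunT (fun t : R => y - `|t| *: w).
    by meas.
  apply/measurable_EFinP; apply: measurable_funM; last first.
    by meas.
  by meas.
under eq_integral do rewrite /G /= mulrC EFinM.
rewrite ge0_integralZl_EFin//; last by move=> t _; rewrite lee_fin.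
rewrite muleC; apply: lee_wpmul2r; first by rewrite lee_fin.
exact: column_le.
Qed.

Theorem total_var_le :
  (total_var U f mu (wgt U s) (root s) snd <= 14%:E * chord_energy)%E.
Proof.
have mT1x x : mfunT (fun z => (T1 x z)%:E).
  exact: (measurableT_comp mT1 (measurable_pair1 x)).
have mT2x x : mfunT (fun z => (T2 x z)%:E).
  exact: (measurableT_comp mT2 (measurable_pair1 x)).
have mI1 := measurable_partial_integral mu (f := fun x z => (T1 x z)%:E) mT1 T10.
have mI2 := measurable_partial_integral mu (f := fun x z => (T2 x z)%:E) mT2 T20.
have I10 x : (0 <= \int[mu]_z (T1 x z)%:E)%E by apply: integral_ge0.
have I20 x : (0 <= \int[mu]_z (T2 x z)%:E)%E by apply: integral_ge0.
have c10 : (0 <= chord_energy)%E by apply: integral_ge0.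
have key x : ((\1_U x * local_var f mu (wgt U s) (root s) snd x)%:E <=
    2%:E * \int[mu]_z (T1 x z)%:E + 2%:E * \int[mu]_z (T2 x z)%:E)%E.
  have [Ux|nU] := pselect (U x); last first.
    by rewrite indicE memNset// mul0r adde_ge0// mule_ge0.
  rewrite indicE mem_set// mul1r.
  rewrite -(ge0_integral_linear mu _ _ (mT1x x) (mT2x x) (T10 x) (T20 x))//.
  set I := (\int[mu]_z _)%E.
  have II : (\int[mu]_z (H x z)%:E <= I)%E.
    apply: ge0_le_integral => //.
    - by nneg.
    - exact: mH.
    - by apply: emeasurable_funD; apply: measurable_funeM; [exact: mT1x|exact: mT2x].
    move=> z _; rewrite -!EFinM -EFinD lee_fin.
    by have := split_le z Ux; rewrite /T1 /T2 (@indicE _ _ U x) mem_set// mul1r.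
  rewrite /local_var (local_polar Ux); apply: le_trans II.
  have : (0 <= \int[mu]_z (H x z)%:E)%E.
    apply: integral_ge0 => z _; rewrite lee_fin mulr_ge0// mulr_ge0 ?sqr_ge0//.
    by nneg.
  by case: (\int[mu]_z (H x z)%:E)%E => //= _; rewrite leey.
apply: (@le_trans _ _ (\int[vol n]_x (2%:E * \int[mu]_z (T1 x z)%:E + 2%:E * \int[mu]_z (T2 x z)%:E))%E).
  apply: ge0_le_integral => //.
  - by move=> x _; rewrite lee_fin mulr_ge0// fine_ge0//; apply: integral_ge0 => z _;
      rewrite lee_fin mulr_ge0 ?wgt_ge0// mulr_ge0 ?sqr_ge0.
  - apply/measurable_EFinP; apply: measurable_funM => //.
    have mJ : mfunT (fun q : V * (R * V) =>
        (wgt U s q.2 * ((f q.2.2 - f q.1) ^+ 2 * root s q.1 q.2 ^+ 2))%:E).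
      apply/measurable_EFinP; apply: measurable_funM.
        by apply: (measurableT_comp _ measurable_snd); exact: measurable_wgt.
      apply: measurable_funM.
        by meas.
      by apply: measurable_funX; exact: measurable_root.
    have J0 x z : (0 <= (wgt U s z * ((f z.2 - f x) ^+ 2 * root s x z ^+ 2))%:E)%E.
      by nneg.
    have m1 := measurable_partial_integral mu
      (f := fun x z => (wgt U s z * ((f z.2 - f x) ^+ 2 * root s x z ^+ 2))%:E) mJ J0.
    have m2 : measurable_fun [set: \bar R] (@fine R) by [].
    exact: (measurableT_comp m2 m1).
  - by apply: emeasurable_funD; exact: measurable_funeM.
rewrite ge0_integral_linear//.
(* [T1_le] contributes 2 * 2 and [T2_le] contributes 2 * 5. *)
apply: (@le_trans _ _ (2%:E * (2%:E * chord_energy) + 2%:E * (5%:E * chord_energy))%E).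
  apply: leeD; apply: lee_wpmul2l => //.
  rewrite /chord_energy -ge0_integralZl_EFin//.
  apply: ge0_le_integral => //; first exact: measurable_funeM.
rewrite !muleA -ge0_muleDl ?mule_ge0//; apply: lee_wpmul2r => //.
by rewrite -!EFinM -EFinD lee_fin; lra.
Qed.

End local_to_chord.

Section real_line.
Context {R : realType}.
Local Notation leb := (@lebesgue_measure R).

Lemma ge0_integral_affine1 (c e : R) (F : R -> \bar R) : c != 0 ->
  mfunT F -> (forall t, 0 <= F t)%E ->
  (\int[leb]_t F (c * t + e)%R = (`|c|%R^-1)%:E * \int[leb]_t F t)%E.
Proof.
move=> c0 mF F0.
apply: (@ge0_integral_comp _ _ _ _ R leb leb (fun t => c * t + e)) => //.
- exact: measurable_affine.
- by move=> A mA; exact: lebesgue_measure_affine.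
Qed.

End real_line.

(** * Hit-and-run steps along chords *)

Section chord.
Context {R : realType} (n : nat).
Local Notation V := 'rV[R]_n.
Local Notation leb := (@lebesgue_measure R).
Variables (U : set V) (r : R).
Hypotheses (n0 : (0 < n)%N) (oU : eopen U) (cU : econvex U) (BU : oball 1 `<=` U).
Hypothesis Ur : U `<=` eball r.

Let mu := sigma_finite_product leb (vol n).
Let mU : measurable U. Proof. exact: measurable_eopen. Qed.
Let mI : mfunT (\1_U : V -> R). Proof. by meas. Qed.
Let b0 := @ballvol_gt0 R n.

Lemma measurable_line d (T : measurableType d) (X W : T -> V) (t : T -> R) :
  mfunT X -> mfunT W -> mfunT t ->
  mfunT (fun z => X z + t z *: W z).
Proof. by move=> mX mW mt; apply: measurable_rowD => //; exact: measurable_rowZ. Qed.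

Let mline1 (x w : V) : mfunT (fun t : R => x + t *: w).
Proof.
by meas.
Qed.

(** Length in the parameter t of x + t w, hence in units of |w|. For w = 0 the integral is 0 or
    infinite and [fine] returns 0. *)
Definition chord_length w x : R := fine (\int[leb]_t (\1_U (x + t *: w)%R)%:E)%E.

Lemma chord_length_fin w x : w != 0 ->
  (\int[leb]_t (\1_U (x + t *: w)%R)%:E = (chord_length w x)%:E :> \bar R)%E.
Proof.
move=> w0; have ew : 0 < enorm w.
  by rewrite lt_neqAle enorm_ge0 andbT eq_sym; apply: contra_neq w0; exact: enorm_eq0.
rewrite fineK// ge0_fin_numE; last by apply: integral_ge0 => t _; rewrite lee_fin.
pose a := (r + enorm x) / enorm w.
have mJ : measurable (`[- a, a]%classic : set R) by [].
apply: (@le_lt_trans _ _ (\int[leb]_t (\1_(`[- a, a]%classic : set R) t)%:E)%E); last first.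
  rewrite integral_indic// setIT.
  have E : leb (`[- a, a]%classic : set R) =
      (if ((- a)%:E < a%:E)%E then (a%:E - (- a)%:E)%E else 0%E).
    exact: (lebesgue_measure_itv `[- a, a]).
  suff L : (leb (`[(- a)%R, a]%classic : set R) < +oo)%E by exact: L.
  by rewrite E; case: ifP => _; rewrite ?ltry.
apply: ge0_le_integral => //.
- by meas.
- by meas.
move=> t _; rewrite lee_fin !indicE ler_nat.
case: (boolP ((x + t *: w) \in U)) => //; rewrite inE => /Ur; rewrite /eball/= => h.
rewrite mem_set//= in_itv/= -ler_norml /a ler_pdivlMr// -enormZ.
have -> : t *: w = (x + t *: w) - x by rewrite addrC addKr.
by apply: le_trans (ler_enormB _ _) _; rewrite lerD2r.
Qed.

Lemma chord_length_gt0 w x : w != 0 -> U x -> 0 < chord_length w x.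
Proof.
move=> w0 Ux; have ew : 0 < enorm w.
  by rewrite lt_neqAle enorm_ge0 andbT eq_sym; apply: contra_neq w0; exact: enorm_eq0.
rewrite -lte_fin -chord_length_fin//.
have [e e0 He] := oU Ux; pose a := e / enorm w; have a0 : 0 < a by rewrite divr_gt0.
have mJ : measurable (`[0, a[%classic : set R) by [].
apply: (@lt_le_trans _ _ (\int[leb]_t (\1_(`[0%R, a[%classic : set R) t)%:E)%E).
  rewrite integral_indic// setIT.
  have E : leb (`[0, a[%classic : set R) = a%:E.
    by apply: etrans (lebesgue_measure_itv `[0, a[) _ => /=; rewrite lte_fin a0 oppr0 adde0.
  suff L : (0 < leb (`[0%R, a[%classic : set R))%E by exact: L.
  by rewrite E lte_fin.
apply: ge0_le_integral => //.
- by meas.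
- by meas.
move=> t _; rewrite lee_fin !indicE ler_nat.
case: (boolP (t \in _)) => //; rewrite inE/= in_itv/= => /andP[t0 ta].
rewrite mem_set//; apply: He; rewrite addrAC subrr add0r enormZ ger0_norm//.
by rewrite -ltr_pdivlMr.
Qed.

Lemma chord_length0 x : chord_length 0 x = 0.
Proof.
rewrite /chord_length; under eq_integral do rewrite scaler0 addr0.
rewrite integral_cst//= indicE; case: (x \in U); rewrite ?mul0e ?mul1e//=.
by have := @lebesgue_measure_itv R `]-oo, +oo[; rewrite set_itvNyy => ->.
Qed.

Lemma chord_length_ge0 w x : 0 <= chord_length w x.
Proof. by apply: fine_ge0; apply: integral_ge0 => t _; rewrite lee_fin. Qed.

Let slide (F : V -> R) w x t0 : mfunT F -> (forall y, 0 <= F y) ->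
  (\int[leb]_t (F (x + t0 *: w + t *: w)%R)%:E = \int[leb]_t (F (x + t *: w)%R)%:E)%E.
Proof.
move=> mF F0.
have mG : mfunT (fun t : R => (F (x + t *: w))%:E).
  by meas.
have := ge0_integral_affine1 t0 (oner_neq0 R) mG (fun t => F0 _).
rewrite normr1 invr1 mul1e => <-; apply: eq_integral => t _.
by rewrite mul1r -addrA -scalerDl addrC [t0 + t]addrC addrC.
Qed.

Lemma chord_length_slide w x t0 : chord_length w (x + t0 *: w) = chord_length w x.
Proof. by rewrite /chord_length slide. Qed.

Let mlen d (T : measurableType d) (X W : T -> V) :
  mfunT X -> mfunT W ->
  mfunT (fun z => chord_length (W z) (X z)).
Proof.
move=> mX mW; pose f (wx : V * V) (t : R) : \bar R := (\1_U (wx.2 + t *: wx.1))%:E.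
have mf : mfunT (fun z : (V * V) * R => f z.1 z.2).
  apply/measurable_EFinP; apply: (measurableT_comp mI).
  by meas.
have m1 := measurable_partial_integral leb mf (fun _ _ => (_ : 0 <= _)%E).
have m2 : measurable_fun [set: \bar R] (@fine R) by [].
have m3 : mfunT (fun z => (W z, X z)) by meas.
have f0 x y : (0 <= f x y)%E by nneg.
exact: (measurableT_comp (measurableT_comp m2 (m1 f0)) m3).
Qed.

(** The direction is a uniform point w of the ball instead of the sphere. The uniform point of a
    chord depends on the line only, and [chord_length] absorbs the norm of w, so no surface measure
    is needed. *)
Definition step_density x (z : R * V) : R :=
  \1_(@oball R n 1) z.2 * \1_U (x + z.1 *: z.2) * (chord_length z.2 x * ballvol n)^-1.

Definition move_to (x : V) (z : R * V) : V := x + z.1 *: z.2.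

Lemma step_density_ge0 x z : 0 <= step_density x z.
Proof.
by rewrite mulr_ge0 ?invr_ge0 ?mulr_ge0 ?chord_length_ge0 ?(ltW b0).
Qed.

Lemma measurable_move d (T : measurableType d) (X : T -> V) (Z : T -> R * V) :
  mfunT X -> mfunT Z ->
  mfunT (fun z => move_to (X z) (Z z)).
Proof.
move=> mX mZ; apply: measurable_line => //.
  by meas.
by meas.
Qed.

Lemma measurable_step_density d (T : measurableType d) (X : T -> V) (Z : T -> R * V) :
  mfunT X -> mfunT Z ->
  mfunT (fun z => step_density (X z) (Z z)).
Proof.
move=> mX mZ; have mZ2 : mfunT (fun z => (Z z).2).
  by meas.
apply: measurable_funM.
  by meas.
apply: measurable_inv_ge0; last by move=> z; rewrite mulr_ge0 ?chord_length_ge0 ?(ltW b0).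
by meas.
Qed.

Let pairE (F : R * V -> \bar R) : mfunT F -> (forall z, 0 <= F z)%E ->
  (\int[mu]_z F z = \int[vol n]_w \int[leb]_t F (t, w))%E.
Proof.
move=> mF F0; rewrite (tonelli_swap (vol n) leb (f := fun w t => F (t, w)))//.
  exact: fubini_tonelli1.
by meas.
Qed.

Lemma measurable_zero : measurable [set (0 : V)].
Proof.
rewrite (_ : [set (0 : V)] = pbox (fun=> [set 0])).
  by apply: measurable_pbox => i; exact: measurable_set1.
apply/seteqP; split => x /=; first by move=> -> i; rewrite /= mxE.
by move=> h; apply/rowP => i; rewrite h mxE.
Qed.

Lemma vol_set0 : vol n [set (0 : V)] = 0%E.
Proof.
apply/eqP; rewrite eq_le measure_ge0 andbT; apply/lee_addgt0Pr => e e0.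
rewrite add0e; pose k := Num.min 1 (e / ballvol n).
have k0 : 0 < k by rewrite lt_min ltr01/= divr_gt0.
apply: (@le_trans _ _ (vol n (@oball R n k))).
  apply: le_measure; rewrite ?inE; [exact: measurable_zero|exact: measurable_oball|].
  by move=> _ ->; rewrite /oball/= enorm0.
rewrite vol_oball// lee_fin.
have k1 : k <= 1 by rewrite ge_min lexx.
have : k ^+ n <= k.
  by case: (n) n0 => // m _; rewrite exprS ler_piMr ?(ltW k0)// exprn_ile1 ?(ltW k0).
move=> /(ler_wpM2r (ltW b0)) /le_trans; apply.
by rewrite -ler_pdivlMr// ge_min lexx orbT.
Qed.

(** The direction w = 0 is exceptional in all chord formulas; for n > 0 it is a null set. *)
Lemma ge0_integral_off0 (F G : V -> \bar R) :
  mfunT F -> mfunT G ->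
  (forall w, 0 <= F w)%E -> (forall w, 0 <= G w)%E ->
  (forall w, w != 0 -> F w = G w) -> (\int[vol n]_w F w = \int[vol n]_w G w)%E.
Proof.
move=> mF mG F0 G0 FG; apply: ge0_ae_eq_integral => //.
exists [set (0 : V)]; split; [exact: measurable_zero|exact: vol_set0|].
by move=> w /= h; apply: contrapT => /eqP w0; apply: h => _; exact: FG.
Qed.

Let integral_oball : (\int[vol n]_w (\1_(@oball R n 1) w)%:E = (ballvol n)%:E)%E.
Proof. by rewrite -vol_oball1 integral_indic ?setIT//; exact: measurable_oball. Qed.

Lemma step_density_mass x : U x -> (\int[mu]_z (step_density x z)%:E = 1)%E.
Proof.
move=> Ux; have m1 : mfunT (fun z : R * V => (step_density x z)%:E).
  apply/measurable_EFinP; apply: measurable_step_density; last exact: measurable_id.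
  by meas.
rewrite pairE//; last by move=> z; rewrite lee_fin step_density_ge0.
have E (w : V) : w != 0 -> (\int[leb]_t (step_density x (t, w))%:E =
    (\1_(@oball R n 1) w * (ballvol n)^-1)%:E)%E.
  move=> w0; have l0 := chord_length_gt0 w0 Ux.
  under eq_integral => t _ do rewrite /step_density/= -mulrA mulrCA mulrC EFinM.
  rewrite ge0_integralZl_EFin//.
  - rewrite chord_length_fin// -EFinM; congr (_ %:E).
    by rewrite invfM; field; rewrite !gt_eqF.
  - by meas.
  - by nneg.
rewrite (@ge0_integral_off0 _ (fun w => (\1_(@oball R n 1) w * (ballvol n)^-1)%:E))//.
- under eq_integral do rewrite mulrC EFinM.
  rewrite ge0_integralZl_EFin ?invr_ge0 ?(ltW b0)//; last first.
    by meas.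
  by rewrite integral_oball -EFinM mulVf// gt_eqF.
- apply: (measurable_partial_integral leb (f := fun w t => (step_density x (t, w))%:E)).
    have m2 : mfunT (fun z : V * R => (z.2, z.1)).
      by meas.
    exact: (measurableT_comp m1 m2).
  by move=> w t; rewrite lee_fin step_density_ge0.
- by meas.
- by move=> w; apply: integral_ge0 => t _; rewrite lee_fin step_density_ge0.
- by nneg.
Qed.

(** The chord length is constant along the line, so the step (t, w) from x and the step (-t, w) back
    from x + t w have the same density, while translations and t |-> -t preserve the measures. *)
Lemma step_reversible (F : V -> V -> R) :
  mfunT (fun z : V * V => F z.1 z.2) -> (forall x y, 0 <= F x y) ->
  (\int[vol n]_x \int[mu]_z (\1_U x * step_density x z * F x (move_to x z))%:E =
   \int[vol n]_x \int[mu]_z (\1_U x * step_density x z * F (move_to x z) x)%:E)%E.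
Proof.
move=> mF F0.
have mG (G : V -> V -> R) : mfunT (fun z : V * V => G z.1 z.2) ->
    mfunT (fun q : V * (R * V) =>
      (\1_U q.1 * step_density q.1 q.2 * G q.1 (move_to q.1 q.2))%:E).
  move=> mG; apply/measurable_EFinP; apply: measurable_funM.
    apply: measurable_funM; first exact: (measurableT_comp mI measurable_fst).
    by apply: measurable_step_density; [exact: measurable_fst|exact: measurable_snd].
  have m1 : mfunT (fun q : V * (R * V) => (q.1, move_to q.1 q.2)).
    apply: measurable_fun_pair; first exact: measurable_fst.
    by apply: measurable_move; [exact: measurable_fst|exact: measurable_snd].
  exact: (measurableT_comp mG m1).
have mF' : mfunT (fun z : V * V => F z.2 z.1).
  by meas.
have p0 (G : V -> V -> R) x z : (forall x y, 0 <= G x y) ->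
    (0 <= (\1_U x * step_density x z * G x (move_to x z))%:E)%E.
  by move=> G0; rewrite lee_fin mulr_ge0// mulr_ge0// step_density_ge0.
pose flip (z : R * V) : R * V := (- z.1, z.2).
have mflip : mfunT flip.
  apply: measurable_fun_pair; last exact: measurable_snd.
  by meas.
have shift z : (\int[vol n]_x (\1_U x * step_density x z * F x (move_to x z))%:E =
    \int[vol n]_x (\1_U x * step_density x (flip z) * F (move_to x (flip z)) x)%:E)%E.
  rewrite -(ge0_integral_translate (- (z.1 *: z.2))
    (F := fun x => (\1_U x * step_density x z * F x (move_to x z))%:E)); last 2 first.
  - exact: (measurableT_comp (mG F mF) (measurable_pair2 z)).
  - by move=> x; exact: p0.
  apply: eq_integral => x _; rewrite /move_to /flip/= scaleNr subrK; congr (_ %:E).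
  rewrite /step_density/= subrK scaleNr.
  have -> : chord_length z.2 (x - z.1 *: z.2) = chord_length z.2 x.
    by rewrite -scaleNr chord_length_slide.
  by ring.
rewrite (tonelli_swap (vol n) mu
  (f := fun x z => (\1_U x * step_density x z * F x (move_to x z))%:E)); last 2 first.
- exact: mG.
- by move=> x z; exact: p0.
under eq_integral do rewrite shift.
rewrite -(tonelli_swap (vol n) mu
  (f := fun x z => (\1_U x * step_density x (flip z) * F (move_to x (flip z)) x)%:E)); last 2 first.
- have m1 : mfunT (fun q : V * (R * V) => (q.1, flip q.2)).
    by meas.
  exact: (measurableT_comp (mG (fun x y => F y x) mF') m1).
- by move=> x z; exact: (@p0 (fun x y => F y x)).
apply: eq_integral => x _.
have mx : mfunT (fun z => (\1_U x * step_density x z * F (move_to x z) x)%:E).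
  exact: (measurableT_comp (mG (fun x y => F y x) mF') (measurable_pair1 x)).
have mx' : mfunT (fun z =>
    (\1_U x * step_density x (flip z) * F (move_to x (flip z)) x)%:E).
  exact: (measurableT_comp mx mflip).
have px z : (0 <= (\1_U x * step_density x z * F (move_to x z) x)%:E)%E.
  exact: (@p0 (fun x y => F y x)).
apply: (etrans (pairE mx' (fun z => px (flip z)))).
apply: (etrans _ (esym (pairE mx px))).
apply: eq_integral => w _.
have mt : mfunT (fun t : R =>
    (\1_U x * step_density x (t, w) * F (move_to x (t, w)) x)%:E).
  exact: (measurableT_comp mx (measurable_pair2 w)).
have N0 : (-1 : R) != 0 by nneg.
have := ge0_integral_affine1 0 N0 mt (fun t => px (t, w)).
rewrite normrN normr1 invr1 mul1e => <-; apply: eq_integral => t _.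
by rewrite addr0 mulN1r.
Qed.

Section average.
Variable f : V -> R.
Hypothesis mf : mfunT f.
Hypothesis f01 : forall x, 0 <= f x <= 1.

Let f0 x : 0 <= f x. Proof. by have /andP[] := f01 x. Qed.
Let f1 x : f x <= 1. Proof. by have /andP[] := f01 x. Qed.

Let g y := \1_U y * f y.
Let g0 y : 0 <= g y. Proof. by nneg. Qed.
Let mg : mfunT g. Proof. exact: measurable_funM. Qed.

Let chord_sum w x : R := fine (\int[leb]_t (g (x + t *: w)%R)%:E)%E.

Let chord_sum_le w x : w != 0 ->
  (\int[leb]_t (g (x + t *: w)%R)%:E = (chord_sum w x)%:E)%E /\
  0 <= chord_sum w x <= chord_length w x.
Proof.
move=> w0.
have p0 : (0 <= \int[leb]_t (g (x + t *: w)%R)%:E)%E.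
  by apply: integral_ge0 => t _; rewrite lee_fin.
have le : (\int[leb]_t (g (x + t *: w)%R)%:E <= (chord_length w x)%:E)%E.
  rewrite -chord_length_fin//; apply: ge0_le_integral => //.
  - by nneg.
  - by meas.
  - by meas.
  - by move=> t _; rewrite lee_fin /g ler_piMr.
have E : (\int[leb]_t (g (x + t *: w)%R)%:E = (chord_sum w x)%:E)%E.
  by rewrite fineK// ge0_fin_numE//; exact: le_lt_trans le (ltry _).
by split => //; rewrite -!lee_fin -E p0 le.
Qed.

(** Mean of f over the chord in direction w. The indicator sets the value f x at w = 0, in agreement
    with the point mass convention of [uniform]. *)
Definition chord_avg w x : R := chord_sum w x / chord_length w x + \1_[set (0 : V)] w * f x.

Lemma chord_avg0 x : chord_avg 0 x = f x.
Proof. by rewrite /chord_avg chord_length0 invr0 mulr0 add0r indicE mem_set// mul1r. Qed.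

Lemma chord_avgN0 w x : w != 0 -> chord_avg w x = chord_sum w x / chord_length w x.
Proof.
by move=> w0; rewrite /chord_avg indicE memNset ?mul0r ?addr0//; apply/eqP.
Qed.

Lemma chord_avg01 w x : 0 <= chord_avg w x <= 1.
Proof.
have [->|w0] := eqVneq w 0; first by rewrite chord_avg0.
have [_ /andP[h0 h1]] := chord_sum_le x w0.
rewrite chord_avgN0// divr_ge0 ?chord_length_ge0//=.
have [->|l0] := eqVneq (chord_length w x) 0; first by lra.
by rewrite ler_pdivrMr ?mul1r// lt_neqAle eq_sym l0 chord_length_ge0.
Qed.

Let chord_avg_inv w x t : U x -> U (x + t *: w) -> chord_avg w (x + t *: w) = chord_avg w x.
Proof.
move=> _ _; have [->|w0] := eqVneq w 0; first by rewrite scaler0 addr0.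
by rewrite !chord_avgN0// chord_length_slide /chord_sum slide.
Qed.

Let rescale (h : V -> R) c w x : c != 0 -> mfunT h -> (forall y, 0 <= h y) ->
  fine (\int[leb]_t (h (x + t *: (c *: w))%R)%:E)%E =
  `|c|^-1 * fine (\int[leb]_t (h (x + t *: w)%R)%:E)%E.
Proof.
move=> c0 mh h0; have mt : mfunT (fun t : R => (h (x + t *: w))%:E).
  by meas.
have := ge0_integral_affine1 0 c0 mt (fun t => h0 _).
under eq_integral do rewrite addr0 mulrC -scalerA.
have ci : 0 < `|c|^-1 by rewrite invr_gt0 normr_gt0.
move=> ->; case: (\int[leb]_t _)%E => [z| |] //=.
  by rewrite gt0_muley ?lte_fin// mulr0.
by rewrite gt0_muleNy ?lte_fin// mulr0.
Qed.

Lemma chord_avg_scale c w x : c != 0 -> chord_avg (c *: w) x = chord_avg w x.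
Proof.
move=> c0; have [->|w0] := eqVneq w 0; first by rewrite scaler0.
have cw : c *: w != 0 by rewrite scaler_eq0 negb_or c0.
rewrite chord_avgN0// chord_avgN0//.
rewrite /chord_sum /chord_length !rescale// -mulf_div divff ?mul1r//.
by rewrite invr_eq0 normr_eq0.
Qed.

Lemma measurable_chord_avg : mfunT (fun wx : V * V => chord_avg wx.1 wx.2).
Proof.
apply: measurable_funD; apply: measurable_funM.
- have mh : mfunT (fun z : (V * V) * R => (g (z.1.2 + z.2 *: z.1.1))%:E).
    by meas.
  have m2 : measurable_fun [set: \bar R] (@fine R) by [].
  have h0 (wx : V * V) t : (0 <= (g (wx.2 + t *: wx.1))%:E)%E by nneg.
  exact: (measurableT_comp m2 (measurable_partial_integral leb
    (f := fun (wx : V * V) t => (g (wx.2 + t *: wx.1))%:E) mh h0)).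
- apply: measurable_inv_ge0; last by move=> z; exact: chord_length_ge0.
  by meas.
- apply: (measurableT_comp _ measurable_fst).
  by apply: measurable_indic; exact: measurable_zero.
- by meas.
Qed.

Lemma step_chord_avg x : U x ->
  (\int[mu]_z (step_density x z * f (move_to x z))%:E =
   \int[vol n]_w (\1_(@oball R n 1) w / ballvol n * chord_avg w x)%:E)%E.
Proof.
move=> Ux; have m1 : mfunT (fun z : R * V => step_density x z * f (move_to x z)).
  apply: measurable_funM.
    by apply: measurable_step_density; [exact: measurable_cst|exact: measurable_id].
  by apply: (measurableT_comp mf); apply: measurable_move; [exact: measurable_cst|exact: measurable_id].
have p0 z : 0 <= step_density x z * f (move_to x z) by rewrite mulr_ge0 ?step_density_ge0.
have m1' : mfunT (fun z : R * V => (step_density x z * f (move_to x z))%:E).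
  by meas.
rewrite pairE//.
have E (w : V) : w != 0 -> (\int[leb]_t (step_density x (t, w) * f (move_to x (t, w)))%:E =
    (\1_(@oball R n 1) w / ballvol n * chord_avg w x)%:E)%E.
  move=> w0; have l0 := chord_length_gt0 w0 Ux; have [Es _] := chord_sum_le x w0.
  rewrite (_ : (\1_(@oball R n 1) w / ballvol n * chord_avg w x)%:E =
    ((\1_(@oball R n 1) w / (chord_length w x * ballvol n))%:E * (chord_sum w x)%:E)%E); last first.
    by rewrite chord_avgN0// -EFinM; congr EFin; field; rewrite !gt_eqF.
  rewrite -Es -ge0_integralZl_EFin//.
  - by apply: eq_integral => t _; rewrite -EFinM; congr EFin; rewrite /step_density /g /move_to/=; ring.
  - by nneg.
  - by meas.
  - by nneg.
apply: ge0_integral_off0 => //.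
- apply: (measurable_partial_integral leb
    (f := fun w t => (step_density x (t, w) * f (move_to x (t, w)))%:E)).
    have m2 : mfunT (fun z : V * R => (z.2, z.1)).
      by meas.
    exact: (measurableT_comp m1' m2).
  by nneg.
- apply/measurable_EFinP; apply: measurable_funM.
    by meas.
  exact: (measurableT_comp measurable_chord_avg (measurable_pair2 x)).
- by move=> w; apply: integral_ge0 => t _; rewrite lee_fin.
- by move=> w; rewrite lee_fin mulr_ge0 ?divr_ge0 ?(ltW b0)//; have /andP[] := chord_avg01 w x.
Qed.

Definition jump_sqr x (z : R * V) : R := step_density x z * (f x - f (move_to x z)) ^+ 2.

Let jump0 x z : 0 <= jump_sqr x z.
Proof. by rewrite mulr_ge0 ?step_density_ge0// sqr_ge0. Qed.

Let mjump2 : mfunT (fun q : V * (R * V) => jump_sqr q.1 q.2).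
Proof.
apply: measurable_funM.
  by apply: measurable_step_density; [exact: measurable_fst|exact: measurable_snd].
apply: measurable_funX; apply: measurable_funB.
  by meas.
apply: (measurableT_comp mf).
by apply: measurable_move; [exact: measurable_fst|exact: measurable_snd].
Qed.

Let mjump x : mfunT (fun z => (jump_sqr x z)%:E).
Proof. by apply/measurable_EFinP; exact: (measurableT_comp mjump2 (measurable_pair1 x)). Qed.

Let line_variance w x : w != 0 -> U x -> (((chord_avg w x - f x) ^+ 2 * chord_length w x)%:E <=
  \int[leb]_t (\1_U (x + t *: w)%R * (f x - f (x + t *: w)%R) ^+ 2)%:E)%E.
Proof.
move=> w0 Ux; have l0 := chord_length_gt0 w0 Ux; have [Es _] := chord_sum_le x w0.
have m1 : mfunT (fun t : R => \1_U (x + t *: w) : R).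
  by meas.
have m2 : mfunT (fun t : R => f (x + t *: w)).
  by meas.
have h := @mean_min_variance _ _ R leb (fun t => \1_U (x + t *: w)) (fun=> 1)
  (fun t => f (x + t *: w)) m1 (measurable_cst _) m2 _ _ (chord_length w x) (chord_avg w x)
  (chord_avg01 w x) _ _ (f x) (f01 x) l0.
apply: (@le_trans _ _ (\int[leb]_t (\1_U (x + t *: w)%R * ((f (x + t *: w)%R - f x) ^+ 2 * 1 ^+ 2))%:E)%E).
  apply: le_trans (h _ _ _ _); last first.
  - under eq_integral do rewrite expr1n mulr1.
    by rewrite Es chord_avgN0// divfK// gt_eqF.
  - by under eq_integral do rewrite expr1n mulr1; exact: chord_length_fin.
  - by nneg.
  - by [].
  by rewrite leeDr//; apply: integral_ge0 => t _; rewrite lee_fin mulr_ge0// mulr_ge0 ?sqr_ge0.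
apply: eqW; apply: eq_integral => t _.
by congr EFin; ring.
Qed.

Let row_variance x : U x -> (\int[vol n]_w (\1_(@oball R n 1) w * (f x - chord_avg w x) ^+ 2)%:E <=
  (ballvol n)%:E * \int[mu]_z (jump_sqr x z)%:E)%E.
Proof.
move=> Ux; have jz z : (0 <= (jump_sqr x z)%:E)%E by nneg.
have m2 : mfunT (fun z : V * R => (jump_sqr x (z.2, z.1))%:E).
  by meas.
have mh := measurable_partial_integral leb (f := fun w t => (jump_sqr x (t, w))%:E)
  m2 (fun w t => jz (t, w)).
rewrite (pairE (mjump x) jz) -ge0_integralZl_EFin ?(ltW b0)//; last first.
  by move=> w _; apply: integral_ge0 => t _.
have mq : mfunT (fun w => chord_avg w x).
  exact: (measurableT_comp measurable_chord_avg (measurable_pair2 x)).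
apply: ge0_le_integral => //.
- by nneg.
- by meas.
- exact: measurable_funeM.
move=> w _; have [->|w0] := eqVneq w 0.
  rewrite chord_avg0 subrr expr0n/= mulr0 mule_ge0 ?lee_fin ?(ltW b0)//.
  by apply: integral_ge0.
have l0 := chord_length_gt0 w0 Ux.
have -> : (\int[leb]_t (jump_sqr x (t, w))%:E = (\1_(@oball R n 1) w / (chord_length w x * ballvol n))%:E *
   \int[leb]_t (\1_U (x + t *: w)%R * (f x - f (x + t *: w)%R) ^+ 2)%:E)%E.
  rewrite -ge0_integralZl_EFin//.
  - by apply: eq_integral => t _; rewrite -EFinM; congr EFin; rewrite /jump_sqr /step_density/=; ring.
  - by nneg.
  - by meas.
  - by nneg.
rewrite muleA -EFinM.
apply: le_trans (lee_wpmul2l _ (line_variance w0 Ux)); last first.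
  by nneg.
rewrite -EFinM lee_fin le_eqVlt; apply/orP; left; apply/eqP; field.
by rewrite !gt_eqF.
Qed.

(** [chord_avg] depends on w through its line only, so the squared deviation is constant along rays
    away from 0 and [bump_avg_le] passes from the bump density to the uniform one. *)
Let bump_variance x : U x -> (\int[vol n]_w (bump w ^+ 2 * (f x - chord_avg w x) ^+ 2)%:E <=
  (bumpvol n)%:E * \int[mu]_z (jump_sqr x z)%:E)%E.
Proof.
move=> Ux; pose Phi w := (f x - chord_avg w x) ^+ 2.
have mq : mfunT (fun w => chord_avg w x).
  exact: (measurableT_comp measurable_chord_avg (measurable_pair2 x)).
have mP : mfunT Phi by apply: measurable_funX; apply: measurable_funB.
have P0 w : 0 <= Phi w by nneg.
have P1 w : Phi w <= 1.
  rewrite /Phi; have := f01 x; have := chord_avg01 w x.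
  move=> /andP[a0 a1] /andP[d0 d1].
  rewrite -subr_ge0 (_ : 1 - _ = (1 - (f x - chord_avg w x)) * (1 + (f x - chord_avg w x))).
    by apply: mulr_ge0; lra.
  by ring.
pose I := fine (\int[vol n]_w (\1_(@oball R n 1) w * Phi w)%:E)%E.
have EI : (\int[vol n]_w (\1_(@oball R n 1) w * Phi w)%:E = I%:E)%E.
  rewrite fineK// ge0_fin_numE; last by apply: integral_ge0 => v _; rewrite lee_fin mulr_ge0.
  apply: (@le_lt_trans _ _ (\int[vol n]_w (\1_(@oball R n 1) w)%:E)%E).
    apply: ge0_le_integral => //.
    - by nneg.
    - by meas.
    - by meas.
    - by move=> w _; rewrite lee_fin ler_piMr.
  by rewrite integral_oball ltry.
have hr c w : 0 < c <= 1 -> oball 1 w -> Phi (c *: w) <= Phi w.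
  by move=> /andP[c0 _] _; rewrite /Phi chord_avg_scale// gt_eqF.
have := bump_avg_le mP P0 hr EI; rewrite -EI => h.
have h2 := lee_wpmul2r (_ : (0 <= (bumpvol n)%:E)%E) (row_variance Ux).
rewrite -(@lee_pmul2l _ (ballvol n)%:E) ?lte_fin//; apply: le_trans h _.
apply: le_trans (h2 _) _; first by rewrite lee_fin ltW// bumpvol_gt0.
by rewrite -muleA [X in (_ * X)%E]muleC.
Qed.

Definition step_energy : \bar R := (\int[vol n]_x \int[mu]_z (\1_U x * jump_sqr x z)%:E)%E.

Let energy_le : (chord_energy U f chord_avg <= (bumpvol n)%:E * step_energy)%E.
Proof.
have mE : mfunT (fun q : V * (R * V) => (\1_U q.1 * jump_sqr q.1 q.2)%:E).
  by meas.
have E0 x z : (0 <= (\1_U x * jump_sqr x z)%:E)%E by nneg.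
have mS := measurable_partial_integral mu (f := fun x z => (\1_U x * jump_sqr x z)%:E) mE E0.
have bv : 0 <= bumpvol n :> R by rewrite ltW// bumpvol_gt0.
rewrite /step_energy -ge0_integralZl_EFin//; last first.
  by move=> x _; apply: integral_ge0.
apply: ge0_le_integral => //.
- by move=> x _; apply: integral_ge0 => w _; rewrite lee_fin mulr_ge0 ?sqr_ge0// mulr_ge0 ?sqr_ge0.
- apply: (measurable_partial_integral (vol n) (f := fun x w =>
    (bump w ^+ 2 * (\1_U x * (f x - chord_avg w x) ^+ 2))%:E)).
    apply/measurable_EFinP; apply: measurable_funM.
      by meas.
    apply: measurable_funM; first exact: (measurableT_comp mI measurable_fst).
    apply: measurable_funX; apply: measurable_funB.
      by meas.
    have m3 : mfunT (fun q : V * V => (q.2, q.1)).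
      by meas.
    exact: (measurableT_comp measurable_chord_avg m3).
  by nneg.
- exact: measurable_funeM.
move=> x _; have [Ux|nUx] := pselect (U x).
  under eq_integral do rewrite indicE mem_set// mul1r.
  under [X in (_ <= _ * X)%E]eq_integral do rewrite indicE mem_set// mul1r.
  exact: bump_variance.
rewrite integral0_eq; last by move=> w _; rewrite indicE memNset// mul0r mulr0.
by rewrite mule_ge0//; apply: integral_ge0.
Qed.

(** Smoothing with weight [scale U] is combined with the chord comparison for Q = [chord_avg]. The
    constants multiply to 14 * 10^12 * 14, and [bumpvol] cancels. *)
Lemma step_gap : 1 <= r -> exists2 m, 0 <= m <= 1 &
  (\int[vol n]_x (\1_U x * (f x - m) ^+ 2)%:E <=
   (196 * 10 ^+ 12 * (n%:R * r) ^+ 2)%:E * step_energy)%E.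
Proof.
move=> r1; pose s := scale U; pose q := Num.sqrt n%:R : R.
have q0 : 0 < q by rewrite sqrtr_gt0 ltr0n.
have qq : q ^+ 2 = n%:R by rewrite sqr_sqrtr.
have c00 : 0 < bumpvol n :> R by exact: bumpvol_gt0.
have kp0 : 0 < 34 * q by lra.
have kpE : (34 * q) ^+ 2 = 34 ^+ 2 * n%:R by lra.
have nc0 : 0 < n%:R * bumpvol n :> R by rewrite mulr_gt0// ltr0n.
have [C C0 C2] : exists2 C : R, 0 < C & C ^+ 2 = 340 ^+ 2 * (n%:R * bumpvol n).
  exists (340 * Num.sqrt (n%:R * bumpvol n)); last by rewrite exprMn sqr_sqrtr// ltW.
  by apply: mulr_gt0; rewrite ?sqrtr_gt0 ?ltr0n.
have ms : mfunT s by exact: (measurable_scale n0 oU BU Ur).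
have s0 x : 0 <= s x by exact: scale_ge0.
have spos x : U x -> 0 < s x by exact: (scale_gt0 n0 oU BU Ur).
have slip := scale_lipschitz n0 oU BU Ur : forall x y, `|s x - s y| <= 34 * q * enorm (x - y).
have sconc := scale_concave n0 oU cU BU Ur.
have inside := scale_inside n0 oU cU BU Ur.
have adiff x z : U x -> U z -> enorm (x - z) <= s z / (10 * (34 * q)) ->
    (\int[mu]_y (wgt U s y * (root s x y - root s z y) ^+ 2)%:E <=
     ((C / s z * enorm (x - z)) ^+ 2)%:E)%E.
  move=> Ux Uz xz; have := root_diff n0 mU ms s0 spos kp0 kpE slip Ux Uz xz.
  by move=> h; apply: le_trans h _; rewrite lee_fin !exprMn C2 exprVn le_eqVlt; apply/orP; left; apply/eqP; ring.
have ME x : (\int[mu]_z (wgt U s z * root s x z ^+ 2)%:E = (mass U s x)%:E)%E.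
  exact: massE.
have M2 x : mass U s x <= 2 * bumpvol n by rewrite -lee_fin -ME; exact: mass_le.
have Mge x (Ux : U x) : bumpvol n / 12 <= mass U s x.
  exact: (mass_ge n0 mU ms s0 spos cU sconc inside Ux).
have smean := scale_mean n0 oU cU BU Ur.
have [m m01 hm] := @smoothing_gap R n U r n0 oU cU BU Ur r1 f mf f01 s _ _ _ _ c00 q0 qq kp0
  C0 C2 ms s0 spos slip sconc smean _ _ mu _ _ _ _ (measurable_wgt mU ms) (wgt_ge0 U s)
  (measurable_root ms s0) measurable_snd ME M2 Mge adiff.
exists m => //; apply: le_trans hm _.
have h1 := total_var_le mU ms s0 spos sconc mf f01 measurable_chord_avg chord_avg01 chord_avg_inv.
apply: le_trans (lee_wpmul2l _ (le_trans h1 (lee_wpmul2l _ energy_le))) _ => //.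
  by nneg.
rewrite !muleA -!EFinM; apply: lee_wpmul2r.
  by apply: integral_ge0 => x _; apply: integral_ge0 => z _; rewrite lee_fin mulr_ge0.
rewrite lee_fin le_eqVlt; apply/orP; left; apply/eqP; field; by rewrite gt_eqF.
Qed.

End average.
End chord.

(** * Positive normalized functionals on bounded functions *)

Section bounded_measurable.
Context {R : realType} d (T : measurableType d).

Definition bmeas (f : T -> R) :=
  mfunT f /\ exists M, forall x, `|f x| <= M.

Lemma bmeas_cst c : bmeas (fun=> c).
Proof. by split; [exact: measurable_cst|exists `|c|]. Qed.

Lemma bmeasD f g : bmeas f -> bmeas g -> bmeas (fun x => f x + g x).
Proof.
move=> [mf [M fM]] [mg [N gN]]; split; first exact: measurable_funD.
by exists (M + N) => x; apply: le_trans (ler_normD _ _) _; exact: lerD.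
Qed.

Lemma bmeasM f g : bmeas f -> bmeas g -> bmeas (fun x => f x * g x).
Proof.
move=> [mf [M fM]] [mg [N gN]]; split; first exact: measurable_funM.
by exists (M * N) => x; rewrite normrM ler_pM.
Qed.

Lemma bmeasZ c f : bmeas f -> bmeas (fun x => c * f x).
Proof. by move=> bf; apply: bmeasM => //; exact: bmeas_cst. Qed.

Lemma bmeasN f : bmeas f -> bmeas (fun x => - f x).
Proof.
move=> bf; have := bmeasZ (-1) bf.
by under [X in bmeas X -> _]eq_fun do rewrite mulN1r.
Qed.

Lemma bmeasB f g : bmeas f -> bmeas g -> bmeas (fun x => f x - g x).
Proof. by move=> bf bg; apply: bmeasD => //; exact: bmeasN. Qed.

Lemma bmeasX k f : bmeas f -> bmeas (fun x => f x ^+ k).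
Proof.
move=> [mf [M fM]]; split; first exact: measurable_funX.
by exists (M ^+ k) => x; rewrite normrX lerXn2r ?nnegrE// (le_trans _ (fM x)).
Qed.

Lemma bmeas_norm f : bmeas f -> bmeas (fun x => `|f x|).
Proof.
move=> [mf [M fM]]; split; last by exists M => x; rewrite normr_id.
exact: (measurableT_comp (@normr_measurable R setT) mf).
Qed.

Lemma bmeas_powR f c : 0 <= c -> (forall x, 0 <= f x) -> bmeas f ->
  bmeas (fun x => f x `^ c).
Proof.
move=> c0 f0 [mf [M fM]]; split; first exact: (measurableT_comp (measurable_powR c) mf).
exists (M `^ c) => x; rewrite ger0_norm ?powR_ge0// ge0_ler_powR ?nnegrE//.
  exact: le_trans (normr_ge0 _) (fM x).
exact: le_trans (ler_norm _) (fM x).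
Qed.

Lemma bmeas_sum N (F : 'I_N -> T -> R) : (forall i, bmeas (F i)) ->
  bmeas (fun x => \sum_(i < N) F i x).
Proof.
elim: N F => [|N IH] F bF.
  by under eq_fun do rewrite big_ord0; exact: bmeas_cst.
by under eq_fun do rewrite big_ord_recl; apply: bmeasD => //; apply: IH.
Qed.

(* Expectations, restricted to bounded measurable functions. *)
Record state (I : (T -> R) -> R) : Prop := {
  stateD : forall f g, bmeas f -> bmeas g -> I (fun x => f x + g x) = I f + I g;
  stateZ : forall c f, bmeas f -> I (fun x => c * f x) = c * I f;
  state_ge0 : forall f, bmeas f -> (forall x, 0 <= f x) -> 0 <= I f;
  state1 : I (fun=> 1) = 1 }.

Section state.
Variable I : (T -> R) -> R.
Hypothesis sI : state I.

Lemma state_lin a b c f g : bmeas f -> bmeas g ->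
  I (fun x => a * f x + b * g x + c) = a * I f + b * I g + c.
Proof.
move=> bf bg; have b1 := bmeas_cst 1.
have e1 := stateD sI (bmeasD (bmeasZ a bf) (bmeasZ b bg)) (bmeasZ c b1).
have e2 := stateD sI (bmeasZ a bf) (bmeasZ b bg).
rewrite e2 !(stateZ sI)// (state1 sI) mulr1 in e1.
by nneg.
Qed.

Lemma state_cst c : I (fun=> c) = c.
Proof.
have := state_lin 0 0 c (bmeas_cst 0) (bmeas_cst 0); rewrite !mul0r !add0r => h.
by nneg.
Qed.

Lemma stateB f g : bmeas f -> bmeas g -> I (fun x => f x - g x) = I f - I g.
Proof.
move=> bf bg; have := state_lin 1 (-1) 0 bf bg; rewrite mul1r mulN1r addr0 => <-.
by congr I; apply/funext => x; rewrite mul1r mulN1r addr0.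
Qed.

Lemma state_sum N (F : 'I_N -> T -> R) : (forall i, bmeas (F i)) ->
  I (fun x => \sum_(i < N) F i x) = \sum_(i < N) I (F i).
Proof.
elim: N F => [|N IH] F bF.
  by under eq_fun do rewrite big_ord0; rewrite big_ord0 state_cst.
under eq_fun do rewrite big_ord_recl.
by rewrite big_ord_recl -IH// -(stateD sI)//; exact: bmeas_sum.
Qed.

Lemma state_le f g : bmeas f -> bmeas g -> (forall x, f x <= g x) -> I f <= I g.
Proof.
move=> bf bg fg; rewrite -subr_ge0 -stateB//; apply: (state_ge0 sI).
  exact: bmeasB.
by move=> x; rewrite subr_ge0.
Qed.

Lemma state_norm f : bmeas f -> `|I f| <= I (fun x => `|f x|).
Proof.
move=> bf; have bn := bmeas_norm bf; rewrite ler_norml; apply/andP; split.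
  rewrite -subr_ge0 opprK -(stateD sI)//; apply: (state_ge0 sI) => [|x]; first exact: bmeasD.
  by have := ler_norm (- f x); rewrite normrN; lra.
by apply: state_le => // x; exact: ler_norm.
Qed.

Lemma state_sqr f : bmeas f -> I f ^+ 2 <= I (fun x => f x ^+ 2).
Proof.
move=> bf; have b2 := bmeasX 2 bf; set c := I f.
have h : I (fun x => 1 * f x ^+ 2 + (- 2 * c) * f x + c ^+ 2) = I (fun x => f x ^+ 2) - c ^+ 2.
  by rewrite (state_lin 1 (- 2 * c) (c ^+ 2) b2 bf) -/c; ring.
rewrite -subr_ge0 -h; apply: (state_ge0 sI) => [|x].
  by apply: bmeasD; [apply: bmeasD; exact: bmeasZ|exact: bmeas_cst].
have := sqr_ge0 (f x - c); congr (0 <= _); ring.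
Qed.

(* AM-GM form of the Cauchy-Schwarz inequality. *)
Lemma state_mul_le e f g : 0 < e -> bmeas f -> bmeas g ->
  `|I (fun x => f x * g x)| <= (e * I (fun x => f x ^+ 2) + e^-1 * I (fun x => g x ^+ 2)) / 2.
Proof.
move=> e0 bf bg; have bf2 := bmeasX 2 bf; have bg2 := bmeasX 2 bg.
have bfg := bmeasM bf bg; apply: le_trans (state_norm bfg) _.
have -> : (e * I (fun x => f x ^+ 2) + e^-1 * I (fun x => g x ^+ 2)) / 2 =
    I (fun x => (e / 2) * f x ^+ 2 + (e^-1 / 2) * g x ^+ 2 + 0).
  by rewrite state_lin//; ring.
apply: state_le => [||x].
- exact: bmeas_norm.
- by apply: bmeasD; [apply: bmeasD; exact: bmeasZ|exact: bmeas_cst].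
rewrite addr0 normrM -(real_normK (num_real (f x))) -(real_normK (num_real (g x))).
set a := `|f x|; set b := `|g x|.
rewrite -subr_ge0 (_ : _ - _ = e / 2 * (a - e^-1 * b) ^+ 2).
  by nneg.
by field; rewrite gt_eqF.
Qed.

End state.
End bounded_measurable.

Lemma bmeas_comp {R : realType} d1 (T1 : measurableType d1) d2 (T2 : measurableType d2)
    (phi : T1 -> T2) (f : T2 -> R) :
  mfunT phi -> bmeas f -> bmeas (fun x => f (phi x)).
Proof.
by move=> mp [mf [M fM]]; split; [exact: (measurableT_comp mf mp)|exists M].
Qed.

Lemma sum_geometric_le {R : realFieldType} (x : R) N : 0 <= x < 1 ->
  \sum_(i < N) x ^+ i <= (1 - x)^-1.
Proof.
move=> /andP[x0 x1]; have h : 0 < 1 - x by lra.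
rewrite -[leRHS]mul1r ler_pdivlMr//.
have -> : (\sum_(i < N) x ^+ i) * (1 - x) = 1 - x ^+ N.
  by rewrite -[RHS]opprB subrX1; ring.
by rewrite gerBl exprn_ge0.
Qed.

(** * Contraction of a lazy reversible operator *)

Section reversible.
Context {R : realType} d (T : measurableType d).
Variables (I : (T -> R) -> R) (H : (T -> R) -> T -> R) (G : R).
Hypotheses (sI : state I) (sH : forall x, state (H^~ x)) (bH : forall f, bmeas f -> bmeas (H f))
  (symH : forall f g, bmeas f -> bmeas g ->
  I (fun x => f x * H g x) = I (fun x => g x * H f x)) (G1 : 1 <= G).
Hypothesis gap : forall f, bmeas f -> (forall x, 0 <= f x <= 1) ->
  exists m, I (fun x => (f x - m) ^+ 2) <= G * (I (fun x => f x ^+ 2) - I (fun x => f x * H f x)).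

Let G0 : 0 < G. Proof. exact: lt_le_trans G1. Qed.

Definition lazy f x : R := (f x + H f x) / 2.

Lemma lazy_state x : state (lazy^~ x).
Proof.
have sx := sH x; split; rewrite /lazy.
- by move=> f g bf bg; rewrite (stateD sx)//; ring.
- by move=> c f bf; rewrite (stateZ sx)//; ring.
- by move=> f bf f0; rewrite divr_ge0// addr_ge0// (state_ge0 sx).
- by rewrite (state1 sx); field.
Qed.

Lemma bmeas_lazy f : bmeas f -> bmeas (lazy f).
Proof.
move=> bf; have := bmeasZ 2^-1 (bmeasD bf (bH bf)); congr bmeas.
by apply/funext => x; rewrite /lazy mulrC.
Qed.

Lemma lazy_sym f g : bmeas f -> bmeas g ->
  I (fun x => f x * lazy g x) = I (fun x => g x * lazy f x).
Proof.
have E u v : bmeas u -> bmeas v -> I (fun x => u x * lazy v x) =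
    2^-1 * I (fun x => u x * v x) + 2^-1 * I (fun x => u x * H v x) + 0.
  move=> bu bv; rewrite -(state_lin sI)//; try exact: bmeasM; last exact: (bmeasM bu (bH bv)).
  by congr I; apply/funext => x; rewrite /lazy; field.
move=> bf bg; rewrite !E// (symH bf bg); congr (_ * I _ + _ + _).
by apply/funext => x; rewrite mulrC.
Qed.

Lemma state_lazy f : bmeas f -> I (lazy f) = I f.
Proof.
move=> bf; have := lazy_sym (bmeas_cst T 1) bf.
under [X in I X = _]eq_fun do rewrite mul1r.
move=> ->; congr I; apply/funext => x.
by rewrite (state1 (lazy_state x)) mulr1.
Qed.

Lemma lazy_sqr f x : bmeas f -> lazy f x ^+ 2 <= lazy (fun y => f y ^+ 2) x.
Proof. by move=> bf; exact: (state_sqr (lazy_state x)). Qed.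

Lemma lazy_norm2_le f : bmeas f -> I (fun x => lazy f x ^+ 2) <= I (fun x => f x ^+ 2).
Proof.
move=> bf; have b2 := bmeasX 2 bf; rewrite -[leRHS]state_lazy//.
apply: (state_le sI); [exact/bmeasX/bmeas_lazy|exact: bmeas_lazy|].
by move=> x; exact: lazy_sqr.
Qed.

(** Jensen's inequality and invariance give |I (f H f)| <= I (f^2), which the lazy half of the form
    compensates. *)
Lemma lazy_form_ge0 f : bmeas f -> 0 <= I (fun x => f x * lazy f x).
Proof.
move=> bf; have bh := bH bf; have b2 := bmeasX 2 bf; have bfh := bmeasM bf bh.
have h1 : I (fun x => H f x ^+ 2) <= I (fun x => f x ^+ 2).
  have IH : I (H (fun y => f y ^+ 2)) = I (fun y => f y ^+ 2).
    have := symH (bmeas_cst T 1) b2.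
    under [X in I X = _]eq_fun do rewrite mul1r.
    move=> ->; congr I; apply/funext => x.
    by rewrite (state1 (sH x)) mulr1.
  rewrite -IH; apply: (state_le sI); [exact: bmeasX|exact: bH|].
  by move=> x; exact: (state_sqr (sH x)).
have h2 := state_mul_le sI (ltr01 : 0 < 1 :> R) bf bh.
have -> : I (fun x => f x * lazy f x) =
    2^-1 * I (fun x => f x ^+ 2) + 2^-1 * I (fun x => f x * H f x) + 0.
  by rewrite -(state_lin sI)//; congr I; apply/funext => x; rewrite /lazy; field.
move: h2; rewrite invr1 !mul1r ler_norml => /andP[h2 _].
lra.
Qed.

(** The gap is given for values in [0, 1]; g = f / (2 M) + 1/2 brings f there. The unknown m
    disappears because the second moment is smallest about the mean. *)
Lemma gap_centered f : bmeas f -> I f = 0 ->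
  I (fun x => f x ^+ 2) <= G * (I (fun x => f x ^+ 2) - I (fun x => f x * H f x)).
Proof.
move=> bf f0; have [mf [M0 fM0]] := bf; pose M := Num.max M0 1.
have Mp : 0 < M by rewrite lt_max ltr01 orbT.
have fM x : `|f x| <= M by rewrite le_max fM0.
have bh := bH bf; have b2 := bmeasX 2 bf; have bfh := bmeasM bf bh.
pose c := (2 * M)^-1; have c0 : 0 < c by rewrite invr_gt0 mulr_gt0.
have cM : c * M = 2^-1 by rewrite /c; field; rewrite gt_eqF.
pose g x := c * f x + 2^-1.
have bg : bmeas g by apply: bmeasD; [exact: bmeasZ|exact: bmeas_cst].
have g01 x : 0 <= g x <= 1.
  have := fM x; rewrite ler_norml => /andP[l1 l2].
  have := ler_wpM2l (ltW c0) l1; have := ler_wpM2l (ltW c0) l2.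
  by rewrite /g mulrN cM => h1 h2; apply/andP; split; lra.
have [m hm] := gap bg g01.
have Hg x : H g x = c * H f x + 2^-1.
  have := state_lin (sH x) c 0 2^-1 bf bf; rewrite mul0r addr0 => <-.
  by congr H; apply/funext => y; rewrite mul0r addr0.
have e1 : I (fun x => (g x - m) ^+ 2) = c ^+ 2 * I (fun x => f x ^+ 2) + (2^-1 - m) ^+ 2.
  rewrite (_ : (fun x => _) = (fun x => c ^+ 2 * f x ^+ 2 + (2 * c * (2^-1 - m)) * f x + (2^-1 - m) ^+ 2)).
    by rewrite (state_lin sI)// f0 mulr0 addr0.
  by apply/funext => x; rewrite /g; ring.
have e2 : I (fun x => g x ^+ 2) = c ^+ 2 * I (fun x => f x ^+ 2) + 4^-1.
  rewrite (_ : (fun x => _) = (fun x => c ^+ 2 * f x ^+ 2 + c * f x + 4^-1)).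
    by rewrite (state_lin sI)// f0 mulr0 addr0.
  by apply/funext => x; rewrite /g; field.
have bs : bmeas (fun x => f x + H f x) by exact: bmeasD.
have IH0 : I (fun x => f x + H f x) = 0.
  have := state_lazy bf; rewrite f0 => h.
  rewrite (_ : (fun x => _) = (fun x => 2 * lazy f x)).
    by rewrite (stateZ sI) ?h ?mulr0//; exact: bmeas_lazy.
  by apply/funext => x; rewrite /lazy; field.
have e3 : I (fun x => g x * H g x) = c ^+ 2 * I (fun x => f x * H f x) + 4^-1.
  rewrite (_ : (fun x => _) = (fun x => c ^+ 2 * (f x * H f x) + (c / 2) * (f x + H f x) + 4^-1)).
    by rewrite (state_lin sI)// IH0 mulr0 addr0.
  by apply/funext => x; rewrite Hg /g; field.
have c2 : 0 < c ^+ 2 by exact: exprn_gt0.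
rewrite -(ler_pM2l c2); move: hm; rewrite e1 e2 e3 => hm.
have := sqr_ge0 (2^-1 - m) => hm0.
have -> : c ^+ 2 * (G * (I (fun x => f x ^+ 2) - I (fun x => f x * H f x))) =
  G * (c ^+ 2 * I (fun x => f x ^+ 2) + 4^-1 - (c ^+ 2 * I (fun x => f x * H f x) + 4^-1)) by ring.
by apply: le_trans hm; rewrite lerDl.
Qed.

(** Laziness halves the gap 1 / G. *)
Definition rate : R := 1 - (2 * G)^-1.

Lemma rate_gt0 : 0 < rate.
Proof.
rewrite /rate subr_gt0 invf_lt1 ?mulr_gt0//.
by apply: (@lt_le_trans _ _ 2); rewrite ?ltr1n// ler_peMr.
Qed.

Lemma rate_lt1 : rate < 1.
Proof. by rewrite /rate ltrBlDr ltrDl invr_gt0 mulr_gt0. Qed.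

Lemma lazy_form_le f : bmeas f -> I f = 0 ->
  I (fun x => f x * lazy f x) <= rate * I (fun x => f x ^+ 2).
Proof.
move=> bf f0; have h := gap_centered bf f0.
have bh := bH bf; have b2 := bmeasX 2 bf; have bfh := bmeasM bf bh.
have -> : I (fun x => f x * lazy f x) =
    2^-1 * I (fun x => f x ^+ 2) + 2^-1 * I (fun x => f x * H f x) + 0.
  by rewrite -(state_lin sI)//; congr I; apply/funext => x; rewrite /lazy; field.
have Gi : 0 < (2 * G)^-1 by rewrite invr_gt0 mulr_gt0.
have := ler_wpM2l (ltW Gi) h.
have -> : (2 * G)^-1 * (G * (I (fun x => f x ^+ 2) - I (fun x => f x * H f x))) =
  (I (fun x => f x ^+ 2) - I (fun x => f x * H f x)) / 2 by field; rewrite gt_eqF.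
by move=> hh; rewrite /rate mulrBl mul1r; lra.
Qed.

(* Apply positivity of the form [f, g |-> I (f * lazy g)] to
   [f - rate^-1 * lazy f]. *)
Lemma lazy_contract f : bmeas f -> I f = 0 ->
  I (fun x => lazy f x ^+ 2) <= rate ^+ 2 * I (fun x => f x ^+ 2).
Proof.
move=> bf f0; have bt := bmeas_lazy bf; have btt := bmeas_lazy bt.
have t0 : I (lazy f) = 0 by rewrite state_lazy.
pose g x := 1 * f x + (- rate^-1) * lazy f x + 0.
have bg : bmeas g by apply: bmeasD; [apply: bmeasD; exact: bmeasZ|exact: bmeas_cst].
have Tg x : lazy g x = lazy f x - rate^-1 * lazy (lazy f) x.
  by rewrite /g (state_lin (lazy_state x))//; ring.
have := lazy_form_ge0 bg.
have bff : bmeas (fun x => f x * lazy f x) by exact: bmeasM.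
have bft : bmeas (fun x => f x * lazy (lazy f) x) by exact: bmeasM.
have btft : bmeas (fun x => lazy f x * lazy (lazy f) x) by exact: bmeasM.
have b2 : bmeas (fun x => lazy f x ^+ 2) by exact: bmeasX.
have sy : I (fun x => f x * lazy (lazy f) x) = I (fun x => lazy f x ^+ 2).
  by rewrite lazy_sym//.
have -> : I (fun x => g x * lazy g x) = I (fun x => f x * lazy f x)
   - 2 * rate^-1 * I (fun x => lazy f x ^+ 2)
   + rate^-1 ^+ 2 * I (fun x => lazy f x * lazy (lazy f) x).
  rewrite (_ : (fun x => _) = (fun x => 1 * (1 * (f x * lazy f x) + (- rate^-1) * (f x * lazy (lazy f) x) + 0) +
    1 * ((- rate^-1) * (lazy f x ^+ 2) + rate^-1 ^+ 2 * (lazy f x * lazy (lazy f) x) + 0) + 0)).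
    rewrite !(state_lin sI)//; try by apply: bmeasD; [apply: bmeasD; exact: bmeasZ|exact: bmeas_cst].
    by rewrite sy; ring.
  by apply/funext => x; rewrite Tg /g; ring.
have h1 := lazy_form_le bf f0; have h2 := lazy_form_le bt t0.
have r0 := rate_gt0; have ri : 0 < rate^-1 by rewrite invr_gt0.
have h3 := ler_wpM2l (sqr_ge0 rate^-1) h2.
have h4 : rate^-1 ^+ 2 * (rate * I (fun x => lazy f x ^+ 2)) = rate^-1 * I (fun x => lazy f x ^+ 2).
  by field; rewrite gt_eqF.
rewrite h4 in h3 => h5.
have h6 : rate^-1 * I (fun x => lazy f x ^+ 2) <= rate * I (fun x => f x ^+ 2).
  have := le_trans h5 (lerD (lerD h1 (lexx _)) h3); lra.
have := ler_wpM2l (ltW r0) h6; rewrite mulrA mulfV ?gt_eqF// mul1r; congr (_ <= _); ring.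
Qed.

Definition lazy_iter k f := iter k lazy f.

Lemma bmeas_iter k f : bmeas f -> bmeas (lazy_iter k f).
Proof. by move=> bf; elim: k => //= k; exact: bmeas_lazy. Qed.

Lemma state_iter k f : bmeas f -> I (lazy_iter k f) = I f.
Proof.
by move=> bf; elim: k => //= k IH; rewrite state_lazy//; exact: bmeas_iter.
Qed.

Lemma lazy_iterSr k f : lazy_iter k.+1 f = lazy_iter k (lazy f).
Proof. exact: iterSr. Qed.

Lemma lazy_iter_sym k f g : bmeas f -> bmeas g ->
  I (fun x => f x * lazy_iter k g x) = I (fun x => g x * lazy_iter k f x).
Proof.
move=> bf; elim: k f bf g => [|k IH] f bf g bg.
  by congr I; apply/funext => x /=; rewrite mulrC.
rewrite [lazy_iter _ g]/= lazy_sym//; last exact: bmeas_iter.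
under [X in I X = _]eq_fun do rewrite mulrC.
rewrite IH//; last exact: bmeas_lazy.
by rewrite -lazy_iterSr.
Qed.

Lemma lazy_iter_state k x : state (lazy_iter k ^~ x).
Proof.
elim: k x => [|k IH] x; first by split.
have sx := lazy_state x; split => /=.
- move=> f g bf bg; rewrite -(stateD sx) ?(bmeas_iter _ bf) ?(bmeas_iter _ bg)//; try exact: bmeas_iter.
  by congr lazy; apply/funext => y; rewrite (stateD (IH y)).
- move=> c f bf; rewrite -(stateZ sx); last exact: bmeas_iter.
  by congr lazy; apply/funext => y; rewrite (stateZ (IH y)).
- move=> f bf f0; apply: (state_ge0 sx) => [|y]; first exact: bmeas_iter.
  exact: (state_ge0 (IH y)).
- rewrite -[RHS](state1 sx); congr lazy; apply/funext => y; exact: (state1 (IH y)).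
Qed.

Lemma lazy_iter_contract k f : bmeas f -> I f = 0 ->
  I (fun x => lazy_iter k f x ^+ 2) <= (rate ^+ k) ^+ 2 * I (fun x => f x ^+ 2).
Proof.
move=> bf f0; elim: k => [|k IH]; first by lra.
have h := lazy_contract (bmeas_iter k bf) (etrans (state_iter k bf) f0).
apply: le_trans h _; apply: le_trans (ler_wpM2l (sqr_ge0 _) IH) _.
by rewrite mulrA -exprMn -exprS.
Qed.

Lemma lazy_iter_norm2_le k f : bmeas f ->
  I (fun x => lazy_iter k f x ^+ 2) <= I (fun x => f x ^+ 2).
Proof.
move=> bf; elim: k => //= k IH.
by apply: le_trans (lazy_norm2_le _) IH; exact: bmeas_iter.
Qed.

Lemma stationary_cov k f : bmeas f -> I f = 0 ->
  `|I (fun x => f x * lazy_iter k f x)| <= rate ^+ k * I (fun x => f x ^+ 2).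
Proof.
move=> bf f0; have rk : 0 < rate ^+ k by rewrite exprn_gt0// rate_gt0.
have h1 := state_mul_le sI rk bf (bmeas_iter k bf).
have h2 := lazy_iter_contract k bf f0.
have rki : 0 <= (rate ^+ k)^-1 by nneg.
have := ler_wpM2l rki h2.
have -> : (rate ^+ k)^-1 * ((rate ^+ k) ^+ 2 * I (fun x => f x ^+ 2)) =
  rate ^+ k * I (fun x => f x ^+ 2) by field; rewrite gt_eqF.
lra.
Qed.

(** * Covariances under a warm start *)

Section integrability_gain.
Variables (p q : R).
Hypotheses (p2 : 2 < p) (q2 : 2 <= q).
Hypothesis pq : q * (p - 2) = p.

Let q0 : 0 < q. Proof. exact: lt_le_trans q2. Qed.

(* Young's inequality with the conjugate exponents q and p/2; since g <= M the
   q-th moment of g is controlled by its second moment. *)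
Lemma young_mean M b g f : 1 <= M -> 0 < b -> bmeas g -> bmeas f ->
  (forall x, 0 <= g x <= M) -> I (fun x => g x ^+ 2) <= b * M ->
  I (fun x => (`|f x| / 2) `^ p) <= 1 ->
  I (fun x => g x * f x ^+ 2) <= 4 * M * b `^ q^-1.
Proof.
move=> M1 b0 bg bf g01 Ig If; have M0 : 0 < M by lra.
have p0 : 0 < p by exact: lt_trans p2.
set t := b `^ q^-1; have t0 : 0 < t by rewrite powR_gt0.
have tq : t `^ q = b by rewrite -powRrM mulVf ?gt_eqF// powRr1// ltW.
have cj : q^-1 + (p / 2)^-1 = 1.
  have pn : p - 2 != 0 by rewrite subr_eq0 gt_eqF.
  have e1 : q = p / (p - 2) by apply: (mulIf pn); rewrite pq divfK.
  by rewrite e1; field; rewrite gt_eqF//= subr_eq0 gt_eqF.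
have p20 : 0 < p / 2 by lra.
have g0 x : 0 <= g x by have /andP[] := g01 x.
have bn : bmeas (fun x => `|f x| / 2).
  by have := bmeasM (bmeas_norm bf) (bmeas_cst T 2^-1).
have bp : bmeas (fun x => (`|f x| / 2) `^ p).
  by apply: bmeas_powR => //; exact: ltW.
have b2 := bmeasX 2 bg; have bf2 := bmeasX 2 bf.
pose c1 := 4 * M * t / (q * b * M ^+ 2); pose c2 := 4 * M * t / (p / 2).
have point x : g x * f x ^+ 2 <= c1 * g x ^+ 2 + c2 * (`|f x| / 2) `^ p + 0.
  (* t^q = b normalizes u: its q-th moment is at most I (g^2) / (b M^2), hence at most 1 / M. *)
  pose u := g x / M / t; pose v := (`|f x| / 2) ^+ 2.
  have u0 : 0 <= u by nneg.
  have v0 : 0 <= v by nneg.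
  have vp : v `^ (p / 2) = (`|f x| / 2) `^ p.
    by rewrite /v -powR_mulrn ?divr_ge0// -powRrM; congr powR; field.
  have y1 : g x / M <= 1 by rewrite ler_pdivrMr// mul1r; have /andP[] := g01 x.
  have y0 : 0 <= g x / M by nneg.
  have uq : u `^ q <= g x ^+ 2 / (b * M ^+ 2).
    have : u `^ q * b = (g x / M) `^ q.
      by rewrite -tq -powRM ?(ltW t0)//; congr powR; rewrite /u divfK// gt_eqF.
    have : (g x / M) `^ q <= (g x / M) ^+ 2.
      have [->|yn] := eqVneq (g x / M) 0; first by rewrite powR0 ?expr0n ?gt_eqF.
      have yp : 0 < g x / M by lra.
      rewrite (_ : q = 2 * (q / 2)); last by field.
      rewrite powRrM powR_mulrn//; apply: ge1r_powR; last by rewrite ler_pdivlMr// mul1r.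
      by rewrite exprn_gt0//= expr_le1.
    move=> h1 h2; rewrite -(ler_pM2r b0) h2; apply: le_trans h1 _.
    apply: eqW; rewrite expr_div_n; field.
    by rewrite !gt_eqF.
  have yo := conjugate_powR u0 v0 q0 p20 cj.
  have e : g x * f x ^+ 2 = 4 * M * t * (u * v).
    rewrite /u /v -(real_normK (num_real (f x))); field; by rewrite !gt_eqF.
  have c0 : 0 <= 4 * M * t by nneg.
  rewrite e; apply: le_trans (ler_wpM2l c0 yo) _; rewrite vp addr0 mulrDr.
  apply: lerD; last by rewrite /c2 le_eqVlt; apply/orP; left; apply/eqP; ring.
  have := ler_wpM2r (_ : 0 <= q^-1) uq; rewrite invr_ge0 (ltW q0) => /(_ isT) h.
  apply: le_trans (ler_wpM2l c0 h) _; rewrite /c1 le_eqVlt; apply/orP; left; apply/eqP.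
  by field; rewrite !gt_eqF.
have := state_le sI (bmeasM bg bf2) (bmeasD (bmeasD (bmeasZ c1 b2) (bmeasZ c2 bp)) (bmeas_cst T 0)) point.
rewrite (state_lin sI)// addr0 => h; apply: le_trans h _.
have c10 : 0 <= c1 by nneg.
have c20 : 0 <= c2 by nneg.
apply: le_trans (lerD (ler_wpM2l c10 Ig) (ler_wpM2l c20 If)) _.
have -> : c1 * (b * M) + c2 * 1 = 4 * M * t * (q^-1 * M^-1 + (p / 2)^-1).
  by rewrite /c1 /c2; field; rewrite !gt_eqF.
have le1 : q^-1 * M^-1 + (p / 2)^-1 <= 1.
  by rewrite -[leRHS]cj lerD2r ler_piMr ?invr_ge0 ?(ltW q0)// invf_le1.
by apply: ler_piMr => //; rewrite !mulr_ge0// ltW.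
Qed.

(** After a steps the density differs from 1 by D, with |D| <= M and second moment at most rate^(2
    a) M. The product of f with its k-th iterate is split by AM-GM into two squares; Jensen's
    inequality and symmetry move the iterate from the second square onto |D|, so that both terms are
    instances of [young_mean]. *)
Lemma nonstationary_cov M rho f a k : 1 <= M -> bmeas rho -> (forall x, 0 <= rho x <= M) ->
  I rho = 1 -> bmeas f -> I (fun x => (`|f x| / 2) `^ p) <= 1 ->
  `|I (fun x => lazy_iter a rho x * (f x * lazy_iter k f x)) - I (fun x => f x * lazy_iter k f x)|
  <= 4 * M * ((rate ^+ a) ^+ 2) `^ q^-1.
Proof.
move=> M1 br r01 r1 bf If; have M0 : 0 < M by lra.
have bT := bmeas_iter; have ra : 0 < (rate ^+ a) ^+ 2 by rewrite !exprn_gt0// rate_gt0.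
pose D x := lazy_iter a rho x - 1.
have bD : bmeas D by apply: bmeasB; [exact: bT|exact: bmeas_cst].
have D1 x : `|D x| <= M.
  have sx := lazy_iter_state a x.
  have h0 : 0 <= lazy_iter a rho x.
    by apply: (state_ge0 sx) => // y; have /andP[] := r01 y.
  have h1 : lazy_iter a rho x <= M.
    rewrite -(state_cst sx M); apply: (state_le sx) => //; first exact: bmeas_cst.
    by move=> y; have /andP[] := r01 y.
  by rewrite /D ler_norml; apply/andP; split; lra.
have ID : I (fun x => D x ^+ 2) <= (rate ^+ a) ^+ 2 * M.
  pose r' x := rho x - 1; have br' : bmeas r' by apply: bmeasB => //; exact: bmeas_cst.
  have r0 : I r' = 0 by rewrite (stateB sI) ?r1 ?(state1 sI) ?subrr//; exact: bmeas_cst.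
  have -> : (fun x => D x ^+ 2) = (fun x => lazy_iter a r' x ^+ 2).
    apply/funext => x; have sx := lazy_iter_state a x.
    by rewrite /r' (stateB sx) ?(state1 sx)//; exact: bmeas_cst.
  apply: le_trans (lazy_iter_contract a br' r0) _; apply: ler_wpM2l; first exact: ltW.
  have br2 := bmeasX 2 br'.
  (* Since rho^2 <= M rho, (rho - 1)^2 is at most (M - 2) rho + 1, whose mean is M - 1. *)
  have h : I (fun x => r' x ^+ 2) <= I (fun x => (M - 2) * rho x + 0 * rho x + 1).
    apply: (state_le sI) => // [|x].
      by apply: bmeasD; [apply: bmeasD; exact: bmeasZ|exact: bmeas_cst].
    have /andP[h0 h1] := r01 x; rewrite /r' mul0r addr0.
    have := mulr_ge0 h0 (_ : 0 <= M - rho x); rewrite subr_ge0 h1 => /(_ isT); lra.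
  by apply: le_trans h _; rewrite (state_lin sI)// r1; lra.
set b := (rate ^+ a) ^+ 2 in ra ID *.
have bk := bT k f bf.
have bfk : bmeas (fun x => f x * lazy_iter k f x) by exact: bmeasM.
rewrite -(stateB sI)//; last by apply: bmeasM => //; exact: bT.
have -> : (fun x => lazy_iter a rho x * (f x * lazy_iter k f x) - f x * lazy_iter k f x) =
    (fun x => D x * (f x * lazy_iter k f x)).
  by apply/funext => x; rewrite /D; ring.
pose g x := `|D x|; have bg : bmeas g by exact: bmeas_norm.
have g01 x : 0 <= g x <= M by rewrite normr_ge0 D1.
have g2 : I (fun x => g x ^+ 2) <= b * M.
  rewrite (_ : (fun x => g x ^+ 2) = fun x => D x ^+ 2)//.
  by apply/funext => x; rewrite /g real_normK ?num_real.
have h1 : I (fun x => g x * f x ^+ 2) <= 4 * M * b `^ q^-1 by exact: young_mean.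
pose g' := lazy_iter k g; have bg' : bmeas g' by exact: bT.
have h2 : I (fun x => g' x * f x ^+ 2) <= 4 * M * b `^ q^-1.
  apply: young_mean => //; last first.
    by apply: le_trans g2; exact: lazy_iter_norm2_le.
  move=> x; have sx := lazy_iter_state k x; apply/andP; split.
    by apply: (state_ge0 sx) => // y; have /andP[] := g01 y.
  by rewrite -(state_cst sx M); apply: (state_le sx) => //; exact: bmeas_cst.
have bf2 := bmeasX 2 bf; have bk2 := bmeasX 2 bk.
have h3 : I (fun x => g x * lazy_iter k f x ^+ 2) <= I (fun x => g' x * f x ^+ 2).
  have -> : I (fun x => g' x * f x ^+ 2) = I (fun x => g x * lazy_iter k (fun y => f y ^+ 2) x).
    by rewrite lazy_iter_sym//; congr I; apply/funext => x; rewrite mulrC.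
  apply: (state_le sI) => [||x]; [exact: bmeasM|by apply: bmeasM => //; exact: bT|].
  by rewrite ler_wpM2l ?normr_ge0//; exact: (state_sqr (lazy_iter_state k x)).
apply: le_trans (state_norm sI (bmeasM bD bfk)) _.
have h4 : I (fun x => `|D x * (f x * lazy_iter k f x)|) <=
    I (fun x => 2^-1 * (g x * f x ^+ 2) + 2^-1 * (g x * lazy_iter k f x ^+ 2) + 0).
  apply: (state_le sI) => [||x]; first by apply: bmeas_norm; exact: bmeasM.
    by apply: bmeasD; [apply: bmeasD; apply: bmeasZ; exact: bmeasM|exact: bmeas_cst].
  rewrite !normrM -/(g x) -(real_normK (num_real (f x))) -(real_normK (num_real (lazy_iter k f x))).
  have := mulr_ge0 (normr_ge0 (D x)) (sqr_ge0 (`|f x| - `|lazy_iter k f x|)).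
  rewrite -/(g x); lra.
apply: le_trans h4 _; rewrite (state_lin sI); [|exact: bmeasM|exact: bmeasM].
lra.
Qed.

(** * Mean square error of the ergodic average *)

Section chain.
Context dO (Om : measurableType dO) (E : (Om -> R) -> R) (X : nat -> Om -> T).
Hypotheses (sE : state E) (mX : forall k, mfunT (X k))
  (markov : forall i k g h, (0 < i <= k)%N -> bmeas g -> bmeas h ->
  E (fun w => g (X i w) * h (X k.+1 w)) = E (fun w => g (X i w) * lazy h (X k w))).
Variables (rho : T -> R) (M : R).
Hypotheses (M1 : 1 <= M) (brho : bmeas rho) (rho01 : forall x, 0 <= rho x <= M).
Hypothesis init : forall h, bmeas h -> E (fun w => h (X 1%N w)) = I (fun x => rho x * h x).

Let I_rho : I rho = 1.
Proof.
have := init (bmeas_cst T 1); rewrite (state1 sE) => ->.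
by congr I; apply/funext => x; rewrite mulr1.
Qed.

Lemma chain_shift i k g h : (0 < i)%N -> bmeas g -> bmeas h ->
  E (fun w => g (X i w) * h (X (i + k)%N w)) = E (fun w => g (X i w) * lazy_iter k h (X i w)).
Proof.
move=> i0 bg; elim: k h => [|k IH] h bh; first by rewrite addn0.
rewrite addnS markov ?i0 ?leq_addr// IH; last exact: bmeas_lazy.
by rewrite -lazy_iterSr.
Qed.

(** The chain starts at index 1, so X (a + 1) is a transitions away from the initial law; symmetry
    moves these transitions from the test function onto the initial density. *)
Lemma chain_cov a k f : bmeas f -> E (fun w => f (X a.+1 w) * f (X (a.+1 + k)%N w)) =
  I (fun x => lazy_iter a rho x * (f x * lazy_iter k f x)).
Proof.
move=> bf; rewrite chain_shift//.
pose h x := f x * lazy_iter k f x; have bh : bmeas h by apply: bmeasM => //; exact: bmeas_iter.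
have := chain_shift a (ltn0Sn 0) (bmeas_cst T 1) bh.
under [X in E X = _]eq_fun do rewrite mul1r add1n.
move=> ->; under [X in E X = _]eq_fun do rewrite mul1r.
rewrite init; last exact: bmeas_iter.
by rewrite lazy_iter_sym//; congr I; apply/funext => x; rewrite mulrC.
Qed.

Variable f : T -> R.
Hypotheses (bf : bmeas f) (f_mean : I f = 0) (f_var : I (fun x => f x ^+ 2) <= 1).
Hypothesis f_mom : I (fun x => (`|f x| / 2) `^ p) <= 1.

Let tau := (rate ^+ 2) `^ q^-1.

Let chain_cov_le a k : E (fun w => f (X a.+1 w) * f (X (a.+1 + k)%N w)) <=
  rate ^+ k + 4 * M * tau ^+ a.
Proof.
have h1 := nonstationary_cov a k M1 brho rho01 I_rho bf f_mom.
have h2 := stationary_cov k bf f_mean.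
have rk : 0 <= rate ^+ k by rewrite exprn_ge0// ltW// rate_gt0.
have h3 := ler_wpM2l rk f_var.
have e : ((rate ^+ a) ^+ 2) `^ q^-1 = tau ^+ a.
  rewrite exprAC -powR_mulrn ?sqr_ge0// -powRrM mulrC powRrM powR_mulrn ?powR_ge0//.
rewrite chain_cov// -e; move: h1 h2; rewrite !ler_norml => /andP[_ h1] /andP[_ h2].
lra.
Qed.

Let eta := (2 * G)^-1.
Let eta0 : 0 < eta. Proof. by rewrite invr_gt0 mulr_gt0. Qed.
Let eta1 : eta <= 1.
Proof. by rewrite invf_le1 ?mulr_gt0// (le_trans G1)// ler_peMl ?(ltW G0)// ler1n. Qed.
Let x0 := 2 / q * eta.

Let tau_le : 0 < tau <= expR (- x0).
Proof.
have r0 := rate_gt0; rewrite powR_gt0 ?exprn_gt0//=.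
have re : rate <= expR (- eta) by rewrite /rate -/eta; exact: expR_ge1Dx.
have -> : expR (- x0) = (expR (- eta) ^+ 2) `^ q^-1.
  rewrite /powR gt_eqF ?exprn_gt0 ?expR_gt0// -expRM_natl expRK; congr expR.
  by rewrite /x0; field; rewrite gt_eqF.
apply: ge0_ler_powR; rewrite ?nnegrE ?sqr_ge0 ?invr_ge0 ?(ltW q0)//.
by rewrite lerXn2r// nnegrE ltW// expR_gt0.
Qed.

(** x0 = 2 eta / q is at most 1, hence tau <= e^(- x0) <= 1 / (1 + x0) <= 1 - x0 / 2, and x0 / 2 =
    eta / q. *)
Let tau_gap : tau < 1 /\ (1 - tau)^-1 <= q / eta.
Proof.
have /andP[t0 tl] := tau_le.
have xp : 0 < x0 by rewrite mulr_gt0// divr_gt0.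
have x1 : x0 <= 1.
  rewrite /x0 -[leRHS]mul1r; apply: ler_pM => //; [by rewrite divr_ge0// ltW|exact: ltW|].
  by rewrite ler_pdivrMr ?mul1r.
have h : tau <= (1 + x0)^-1.
  apply: le_trans tl _; rewrite expRN lef_pV2 ?posrE ?expR_gt0 ?addr_gt0//.
  exact: expR_ge1Dx.
have h2 : (1 + x0)^-1 <= 1 - x0 / 2.
  rewrite -[leLHS]mul1r ler_pdivrMr ?addr_gt0//.
  have -> : (1 - x0 / 2) * (1 + x0) = 1 + x0 * (1 - x0) / 2 by field.
  by rewrite lerDl divr_ge0// mulr_ge0 ?(ltW xp)// subr_ge0.
have h3 : x0 / 2 <= 1 - tau by lra.
have x2 : 0 < x0 / 2 by lra.
split; first by lra.
have -> : q / eta = (x0 / 2)^-1 by rewrite /x0; field; rewrite !gt_eqF.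
by rewrite lef_pV2// posrE//; apply: lt_le_trans h3.
Qed.

Variable n0 : nat.

Let W := 4 * M * tau ^+ n0 / (1 - tau).

(** Induction on N: the new square together with twice its covariances with earlier terms is at most
    twice one row of geometric sums, that is 2 (1 / eta + W). *)
Let chain_sum N : E (fun w => (\sum_(i < N) f (X (n0 + i).+1 w)) ^+ 2) <=
  N%:R * (2 / eta + 2 * W).
Proof.
have bY i : bmeas (fun w => f (X (n0 + i).+1 w)) by exact: bmeas_comp.
elim: N => [|N IH].
  by under [X in E X <= _]eq_fun do rewrite big_ord0 expr0n/=; rewrite (state_cst sE) mul0r.
pose S w := \sum_(i < N) f (X (n0 + i).+1 w); pose Y w := f (X (n0 + N).+1 w).
have bS : bmeas S by exact: bmeas_sum.
have bSY : bmeas (fun w => S w * Y w) by exact: (bmeasM bS (bY N)).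
have bS2 := bmeasX 2 bS; have bY2 := bmeasX 2 (bY N).
have -> : E (fun w => (\sum_(i < N.+1) f (X (n0 + i).+1 w)) ^+ 2) =
    E (fun w => S w ^+ 2) + (2 * E (fun w => S w * Y w) + E (fun w => Y w ^+ 2)).
  rewrite (_ : (fun w => _) = fun w => S w ^+ 2 + (2 * (S w * Y w) + 1 * Y w ^+ 2 + 0)).
    rewrite (stateD sE)//; last first.
      by apply: bmeasD; [apply: bmeasD; exact: bmeasZ|exact: bmeas_cst].
    by rewrite (state_lin sE)// mul1r addr0.
  by apply/funext => w; rewrite big_ord_recr/= -/(S w) -/(Y w); ring.
set K := 2 / eta + 2 * W in IH *.
have -> : N.+1%:R * K = N%:R * K + K by lra.
apply: lerD; first exact: IH.
rewrite /K.
have cSY : E (fun w => S w * Y w) <= \sum_(i < N) (rate ^+ (N - i) + 4 * M * tau ^+ (n0 + i)).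
  rewrite (_ : (fun w => _) = fun w => \sum_(i < N) f (X (n0 + i).+1 w) * Y w); last first.
    by apply/funext => w; rewrite mulr_suml.
  rewrite (state_sum sE); last by move=> i; exact: (bmeasM (bY _) (bY N)).
  apply: ler_sum => i _; have := chain_cov_le (n0 + i) (N - i).
  by rewrite addSn -addnA subnKC// ltnW.
have cY : E (fun w => Y w ^+ 2) <= rate ^+ (N - N) + 4 * M * tau ^+ (n0 + N).
  have := chain_cov_le (n0 + N) 0; rewrite addn0 subnn; apply: le_trans.
  by nneg.
have [t1 _] := tau_gap; have /andP[t0 _] := tau_le.
have M0 : 0 < M by exact: lt_le_trans M1.
have cY0 : 0 <= rate ^+ (N - N) + 4 * M * tau ^+ (n0 + N).
  by rewrite addr_ge0 ?exprn_ge0 ?mulr_ge0 ?exprn_ge0// ltW// rate_gt0.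
have A : \sum_(i < N.+1) (rate ^+ (N - i) + 4 * M * tau ^+ (n0 + i)) <= eta^-1 + W.
  rewrite big_split/=; apply: lerD.
    have r01 : 0 <= rate < 1 by rewrite rate_lt1 ltW// rate_gt0.
    have := sum_geometric_le N.+1 r01; rewrite {2}/rate opprB addrCA subrr addr0 -/eta.
    apply: le_trans; rewrite (reindex_inj rev_ord_inj)/=.
    by apply: ler_sum => i _; rewrite subSS subKn// -ltnS.
  have -> : \sum_(i < N.+1) 4 * M * tau ^+ (n0 + i) = 4 * M * tau ^+ n0 * \sum_(i < N.+1) tau ^+ i.
    by rewrite mulr_sumr; apply: eq_bigr => i _; rewrite exprD; ring.
  rewrite /W; apply: ler_wpM2l; first by nneg.
  by apply: sum_geometric_le; rewrite t1 ltW.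
have := A; rewrite big_ord_recr/= => A'.
lra.
Qed.

(** The burn-in makes W at most 1 / (8 eta), so 2 / eta + 2 W <= 9 / (4 eta) = 9 G / 2. *)
Lemma chain_mse N : M * q * expR (- (n0%:R * x0)) <= 32^-1 ->
  E (fun w => (\sum_(i < N) f (X (n0 + i).+1 w)) ^+ 2) <= N%:R * (9 / 2 * G).
Proof.
move=> hM; apply: le_trans (chain_sum N) _; apply: ler_wpM2l => //.
have [t1 hg] := tau_gap; have /andP[t0 tl] := tau_le.
have M0 : 0 < M by exact: lt_le_trans M1.
have tn : tau ^+ n0 <= expR (- (n0%:R * x0)).
  by rewrite -mulrN expRM_natl lerXn2r// nnegrE ltW// expR_gt0.
have W1 : W <= 4 * M * expR (- (n0%:R * x0)) * (q / eta).
  apply: ler_pM => //; rewrite ?mulr_ge0 ?exprn_ge0 ?invr_ge0 ?subr_ge0 ?(ltW t0) ?(ltW t1) ?(ltW M0)//.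
  by apply: ler_wpM2l => //; rewrite mulr_ge0// ltW.
have W2 : 4 * M * expR (- (n0%:R * x0)) * (q / eta) <= 8^-1 * eta^-1.
  have -> : 4 * M * expR (- (n0%:R * x0)) * (q / eta) = 4 * (M * q * expR (- (n0%:R * x0))) / eta by ring.
  apply: ler_wpM2r; first by nneg.
  by lra.
have -> : 9 / 2 * G = (2 + 4^-1) * eta^-1 by rewrite /eta invrK; field.
rewrite mulrDl; lra.
Qed.

End chain.
End integrability_gain.

End reversible.

(** * Functionals determined by indicators *)

Section approximation.
Context {R : realType}.

(** The sum is the integer part of y; it makes step functions with levels j / N uniformly 1 / N
    close. *)
Lemma level_count (y : R) N : 0 <= y <= N%:R ->
  y - 1 <= \sum_(j < N) (((j.+1)%:R <= y)%R : nat)%:R <= y.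
Proof.
elim: N => [|N IH] /andP[y0 yN]; first by rewrite big_ord0 y0 andbT; lra.
rewrite big_ord_recr/=; have [h|h] := leP y N%:R.
  have /andP[h1 h2] := IH (introT andP (conj y0 h)).
  have -> : (N.+1%:R <= y) = false.
    by apply/negbTE; rewrite -ltNge; apply: le_lt_trans h _; rewrite ltr_nat.
  by rewrite addr0 h1.
have -> : \sum_(i < N) ((((i.+1)%:R <= y)%R : nat)%:R : R) = N%:R.
  rewrite (eq_bigr (fun=> 1)); last first.
    by move=> i _; rewrite (le_trans _ (ltW h))// ler_nat.
  by rewrite sumr_const card_ord.
rewrite -natr1 in yN *; case: (leP (N%:R + 1) y) => /= h2; apply/andP; split; lra.
Qed.

Context d (T : measurableType d).

Record bounded_linear (L : (T -> R) -> R) : Prop := {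
  blinD : forall f g, bmeas f -> bmeas g -> L (fun x => f x + g x) = L f + L g;
  blinZ : forall c f, bmeas f -> L (fun x => c * f x) = c * L f;
  blin_bound : exists2 K, 0 <= K &
    forall f e, bmeas f -> (forall x, `|f x| <= e) -> `|L f| <= K * e }.

Lemma bmeas_indic (C : set T) : measurable C -> bmeas (\1_C : T -> R).
Proof.
move=> mC; split; first exact: measurable_indic.
by exists 1 => x; rewrite indicE ger0_norm// lern1 leq_b1.
Qed.

Lemma state_bounded_linear (I : (T -> R) -> R) : state I -> bounded_linear I.
Proof.
move=> sI; split; [exact: (stateD sI)|exact: (stateZ sI)|exists 1 => // f e bf fe].
rewrite mul1r; apply: le_trans (state_norm sI bf) _; rewrite -(state_cst sI e).
by apply: (state_le sI) => //; [exact: bmeas_norm|exact: bmeas_cst].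
Qed.

Let blin_sum (L : (T -> R) -> R) N (F : 'I_N -> T -> R) : bounded_linear L ->
  (forall i, bmeas (F i)) -> L (fun x => \sum_(i < N) F i x) = \sum_(i < N) L (F i).
Proof.
move=> bL; elim: N F => [|N IH] F bF.
  rewrite big_ord0 -[RHS](mul0r (L (fun=> 0))) -(blinZ bL); last exact: bmeas_cst.
  by congr L; apply/funext => x; rewrite big_ord0 mul0r.
under [X in L X]eq_fun do rewrite big_ord_recl.
by rewrite big_ord_recl -IH// -(blinD bL)//; exact: bmeas_sum.
Qed.

(** After rescaling to [0, 1], f is a uniform limit of step functions on its superlevel sets.
    Identities given on sets, such as the Markov property and the initial law, reach bounded
    functions in this way. *)
Lemma bounded_linear_eq (L1 L2 : (T -> R) -> R) : bounded_linear L1 -> bounded_linear L2 ->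
  (forall C, measurable C -> L1 \1_C = L2 \1_C) -> forall f, bmeas f -> L1 f = L2 f.
Proof.
move=> b1 b2 L12.
suff H f : bmeas f -> (forall x, 0 <= f x <= 1) -> L1 f = L2 f.
  move=> f bf; have [mf [M0 fM0]] := bf; pose M := Num.max M0 1.
  have Mp : 0 < M by rewrite lt_max ltr01 orbT.
  have fM x : `|f x| <= M by rewrite le_max fM0.
  have bc : bmeas (fun=> M : R) := bmeas_cst T M.
  have bg : bmeas (fun x => (2 * M)^-1 * (f x + M)) by apply: bmeasZ; exact: bmeasD.
  have E L : bounded_linear L -> L (fun x => (2 * M)^-1 * (f x + M)) = (2 * M)^-1 * (L f + M * L \1_setT).
    move=> bL; rewrite (blinZ bL); last exact: bmeasD.
    rewrite (blinD bL)// -(blinZ bL); last exact: bmeas_indic.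
    by congr (_ * (_ + L _)); apply/funext => x; rewrite indicT mulr1.
  have h : L1 (fun x => (2 * M)^-1 * (f x + M)) = L2 (fun x => (2 * M)^-1 * (f x + M)).
    apply: H => // x; have := fM x; rewrite ler_norml => /andP[h1 h2].
    rewrite mulr_ge0 ?invr_ge0 ?mulr_ge0 ?(ltW Mp)//=; last by lra.
    by rewrite mulrC ler_pdivrMr ?mulr_gt0// mul1r; lra.
  move: h; rewrite !E// (L12 _ measurableT) => /mulfI.
  by rewrite invr_eq0 mulf_neq0 ?gt_eqF// => /(_ isT) /addIr.
move=> bf f01; have [K1 K10 h1] := blin_bound b1; have [K2 K20 h2] := blin_bound b2.
suff le N : `|L1 f - L2 f| <= (K1 + K2) / N.+1%:R.
  apply/eqP; rewrite -subr_eq0 -normr_eq0 eq_le normr_ge0 andbT.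
  apply/ler_addgt0Pr => e e0; rewrite add0r.
  have Ke : 0 <= (K1 + K2) / e by nneg.
  apply: le_trans (le (Num.bound ((K1 + K2) / e))) _.
  rewrite ler_pdivrMr ?ltr0n// mulrC -ler_pdivrMr// ltW//.
  by apply: lt_trans (archi_boundP Ke) _; rewrite ltr_nat.
pose s x := \sum_(j < N.+1) N.+1%:R^-1 * \1_[set x | (j.+1)%:R <= N.+1%:R * f x] x : R.
have mC (j : 'I_N.+1) : measurable [set x | (j.+1)%:R <= N.+1%:R * f x].
  rewrite -[X in measurable X]setTI.
  apply: (@measurable_fun_le _ _ _ _ (fun=> (j.+1)%:R) (fun x => N.+1%:R * f x)) => //.
  by have [] := bmeasZ N.+1%:R bf.
have bi (j : 'I_N.+1) : bmeas (\1_[set x | (j.+1)%:R <= N.+1%:R * f x] : T -> R).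
  exact: bmeas_indic.
have bs : bmeas s by apply: bmeas_sum => j; exact: bmeasZ.
have N0 : 0 < N.+1%:R :> R by rewrite ltr0n.
have sE x : s x = N.+1%:R^-1 * \sum_(j < N.+1) (((j.+1)%:R <= N.+1%:R * f x)%R : nat)%:R.
  rewrite mulr_sumr; apply: eq_bigr => j _; congr (_ * _); rewrite indicE.
  by congr (nat_of_bool _)%:R; apply/idP/idP; rewrite inE.
have fs x : `|f x - s x| <= N.+1%:R^-1.
  have /andP[f0 f1] := f01 x.
  have := @level_count (N.+1%:R * f x) N.+1; rewrite mulr_ge0//= -[leRHS]mulr1 ler_pM2l// f1.
  move=> /(_ isT) /andP[l1 l2].
  rewrite -(ler_pM2l N0) mulfV ?gt_eqF// -[X in X * _]gtr0_norm// -normrM mulrBr sE mulrA.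
  by rewrite mulfV ?gt_eqF// mul1r ler_norml; apply/andP; split; lra.
have bfs : bmeas (fun x => f x - s x) by exact: bmeasB.
have dec L : bounded_linear L -> L f = L (fun x => f x - s x) + L s.
  by move=> bL; rewrite -(blinD bL)//; congr L; apply/funext => x; rewrite subrK.
have Ls : L1 s = L2 s.
  rewrite /s !blin_sum//; try by move=> j; exact: bmeasZ.
  by apply: eq_bigr => j _; rewrite (blinZ b1)// (blinZ b2)// L12.
rewrite (dec L1)// (dec L2)// Ls opprD addrACA subrr addr0; apply: le_trans (ler_normB _ _) _.
by rewrite mulrDl; apply: lerD; [exact: h1|exact: h2].
Qed.

End approximation.

(** * Means with respect to a probability density *)

Section density_mean.
Context d (T : measurableType d) (R : realType) (m : {measure set T -> \bar R}).
Variable k : T -> R.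
Hypotheses (mk : mfunT k) (k0 : forall x, 0 <= k x).
Hypothesis k1 : (\int[m]_x (k x)%:E = 1)%E.

Definition density_mean (f : T -> R) : R := fine (\int[m]_x (k x * f x)%:E)%E.

Lemma density_integrable f : bmeas f -> m.-integrable setT (fun x => (k x * f x)%:E).
Proof.
move=> [mf [M fM]]; apply/integrableP; split.
  by apply/measurable_EFinP; exact: measurable_funM.
have M0 (x : T) : 0 <= M by apply: le_trans (fM x).
apply: (@le_lt_trans _ _ (\int[m]_x (`|M|%:E * (k x)%:E))%E).
  apply: ge0_le_integral => //.
  - apply/measurable_EFinP; apply: (measurableT_comp (@normr_measurable R setT)).
    exact: measurable_funM.
  - by apply: measurable_funeM; exact/measurable_EFinP.
  - move=> x _ /=; rewrite lee_fin normrM (ger0_norm (k0 x)) mulrC.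
    by apply: ler_wpM2r => //; rewrite (ger0_norm (M0 x)).
rewrite ge0_integralZl_EFin ?k1 ?mule1 ?ltry//; first by move=> x _; rewrite lee_fin.
exact/measurable_EFinP.
Qed.

Lemma density_meanE f : bmeas f -> (\int[m]_x (k x * f x)%:E = (density_mean f)%:E)%E.
Proof. by move=> bf; rewrite fineK//; apply: integrable_fin_num => //; exact: density_integrable. Qed.

Lemma density_state : state density_mean.
Proof.
split.
- move=> f g bf bg; apply: EFin_inj; rewrite EFinD -!density_meanE//; last exact: bmeasD.
  rewrite -integralD_EFin//; try exact: density_integrable.
  by apply: eq_integral => x _; rewrite mulrDr.
- move=> c f bf; apply: EFin_inj; rewrite EFinM -!density_meanE//; last exact: bmeasZ.
  rewrite -integralZl//; last exact: density_integrable.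
  by apply: eq_integral => x _; rewrite -EFinM mulrCA.
- by move=> f bf f0; apply: fine_ge0; apply: integral_ge0 => x _; rewrite lee_fin mulr_ge0.
- by rewrite /density_mean; under eq_integral do rewrite mulr1; rewrite k1.
Qed.

End density_mean.

(** * The hit-and-run operator on an open convex body *)

Section hit_and_run_operator.
Context {R : realType} (n : nat).
Local Notation V := 'rV[R]_n.
Local Notation leb := (@lebesgue_measure R).
Variables (U : set V) (r : R).
Hypotheses (n0 : (0 < n)%N) (oU : eopen U) (cU : econvex U) (BU : oball 1 `<=` U)
  (Ur : U `<=` eball r).
Hypothesis r1 : 1 <= r.

Let mu := sigma_finite_product leb (vol n).
Let mU : measurable U. Proof. exact: measurable_eopen. Qed.
Let mI : mfunT (\1_U : V -> R). Proof. exact: measurable_indic. Qed.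
Let b0 := @ballvol_gt0 R n.
Let kk := step_density U.

Definition bodyvol : R := fine (vol n U).

Lemma bodyvolE : vol n U = bodyvol%:E.
Proof. by rewrite fineK// ge0_fin_numE//; exact: (convex_vol_fin oU Ur). Qed.

Lemma bodyvol_gt0 : 0 < bodyvol.
Proof.
rewrite -lte_fin -bodyvolE; apply: vol_eopen_gt0 => //; exists 0; apply: BU.
by rewrite /oball/= enorm0.
Qed.

Definition body_weight (x : V) : R := \1_U x / bodyvol.

Let mbw : mfunT body_weight.
Proof. by apply: measurable_funM => //; exact: measurable_cst. Qed.
Let bw0 x : 0 <= body_weight x. Proof. by rewrite divr_ge0// ltW// bodyvol_gt0. Qed.

Let bw1 : (\int[vol n]_x (body_weight x)%:E = 1)%E.
Proof.
under eq_integral do rewrite /body_weight mulrC EFinM.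
rewrite ge0_integralZl_EFin ?invr_ge0 ?(ltW bodyvol_gt0)//; last by meas.
rewrite integral_indic// setIT.
rewrite [X in (_ * X)%E](_ : _ = bodyvol%:E); last exact: bodyvolE.
by rewrite -EFinM mulVf// gt_eqF// bodyvol_gt0.
Qed.

Definition body_mean : (V -> R) -> R := density_mean (vol n) body_weight.

Lemma body_state : state body_mean.
Proof. by apply: density_state; [exact: mbw|exact: bw0|exact: bw1]. Qed.

Lemma body_meanE g : bmeas g -> (\int[vol n]_x (\1_U x * g x)%:E = (bodyvol * body_mean g)%:E)%E.
Proof.
move=> bg; rewrite EFinM -(density_meanE mbw bw0 bw1 bg) -integralZl//; last first.
  exact: (density_integrable mbw bw0 bw1 bg).
apply: eq_integral => x _; rewrite -EFinM /body_weight; congr EFin; field.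
by rewrite gt_eqF// bodyvol_gt0.
Qed.

(** Off U the operator is the identity, so that evaluation of [har] is a state at every point. *)
Definition har (f : V -> R) (x : V) : R :=
  if x \in U then density_mean mu (kk x) (fun z => f (move_to x z)) else f x.

Let mk x : mfunT (kk x).
Proof. by apply: measurable_step_density => //; exact: measurable_cst. Qed.
Let kk0 x z : 0 <= kk x z. Proof. exact: step_density_ge0. Qed.
Let kk1 x : U x -> (\int[mu]_z (kk x z)%:E = 1)%E.
Proof. exact: (step_density_mass n0 oU Ur). Qed.

Let mmove x : mfunT (@move_to R n x).
Proof. by apply: measurable_move => //; exact: measurable_cst. Qed.

Let step_state x : U x -> state (density_mean mu (kk x)).
Proof. by move=> Ux; apply: density_state; [exact: mk|exact: kk0|exact: kk1]. Qed.

Let step_meanE x f : U x -> bmeas f ->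
  (\int[mu]_z (kk x z * f z)%:E = (density_mean mu (kk x) f)%:E)%E.
Proof.
by move=> Ux bf; apply: (density_meanE (m := mu)) bf; [exact: mk|exact: kk0|exact: kk1].
Qed.

Lemma har_state x : state (har^~ x).
Proof.
rewrite /har; case: (boolP (x \in U)) => [|_]; last by split.
rewrite inE => Ux; have sx := step_state Ux.
have bm f : bmeas f -> bmeas (fun z => f (move_to x z)) by exact: bmeas_comp.
split.
- by move=> f g /bm bf /bm bg; rewrite (stateD sx).
- by move=> c f /bm bf; rewrite (stateZ sx).
- by move=> f /bm bf f0; apply: (state_ge0 sx).
- exact: (state1 sx).
Qed.

Lemma harE (F : V -> V -> R) x : bmeas (F x) ->
  (\int[mu]_z (\1_U x * kk x z * F x (move_to x z))%:E = (\1_U x * har (F x) x)%:E)%E.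
Proof.
move=> bF; rewrite /har indicE; case: (boolP (x \in U)) => [|_]; last first.
  by rewrite mul0r; apply: integral0_eq => z _; rewrite !mul0r.
rewrite inE mul1r => Ux; under eq_integral do rewrite mul1r.
exact: (step_meanE Ux (bmeas_comp (mmove x) bF)).
Qed.

Let mkkF (F : V -> V -> R) : mfunT (fun z : V * V => F z.1 z.2) ->
  mfunT (fun q : V * (R * V) =>
    (\1_U q.1 * kk q.1 q.2 * F q.1 (move_to q.1 q.2))%:E).
Proof.
move=> mF; apply/measurable_EFinP; apply: measurable_funM.
  apply: measurable_funM; first exact: (measurableT_comp mI measurable_fst).
  by apply: measurable_step_density; [|exact: measurable_fst|exact: measurable_snd].
have m1 : mfunT (fun q : V * (R * V) => (q.1, move_to q.1 q.2)).
  apply: measurable_fun_pair; first exact: measurable_fst.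
  by apply: measurable_move; [exact: measurable_fst|exact: measurable_snd].
exact: (measurableT_comp mF m1).
Qed.

Lemma bmeas_har f : bmeas f -> bmeas (har f).
Proof.
move=> bf; have [mf [M fM]] := bf; have bc := bmeas_cst V M.
have f0 x : 0 <= f x + M by have := fM x; rewrite ler_norml => /andP[]; lra.
have bh : bmeas (fun x => f x + M) by exact: bmeasD.
split; last first.
  exists M => x; have sx := har_state x; rewrite ler_norml; apply/andP; split.
    rewrite -(state_cst sx (- M)); apply: (state_le sx) => //; first exact: bmeas_cst.
    by move=> y; have := fM y; rewrite ler_norml => /andP[].
  rewrite -(state_cst sx M); apply: (state_le sx) => // y.
  by have := fM y; rewrite ler_norml => /andP[].
pose F (x y : V) := f y + M.
have mF : mfunT (fun z : V * V => F z.1 z.2).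
  exact: (measurableT_comp (proj1 bh) measurable_snd).
have E x : har f x = fine (\int[mu]_z (\1_U x * kk x z * F x (move_to x z))%:E)%E
    - \1_U x * M + (1 - \1_U x) * f x.
  rewrite harE//= (stateD (har_state x))// (state_cst (har_state x)) indicE.
  case: (boolP (x \in U)) => h /=; first by ring.
  by rewrite {1}/har (negbTE h); ring.
rewrite (funext E).
have F0 x z : (0 <= (\1_U x * kk x z * F x (move_to x z))%:E)%E.
  rewrite lee_fin; apply: mulr_ge0; last exact: f0.
  by nneg.
have m2 : measurable_fun [set: \bar R] (@fine R) by [].
have m1 := measurable_partial_integral mu
  (f := fun x z => (\1_U x * kk x z * F x (move_to x z))%:E) (mkkF mF) F0.
apply: measurable_funD; last first.
  by meas.
apply: measurable_funB; first exact: (measurableT_comp m2 m1).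
by meas.
Qed.

Let bmeas_pair1 (F : V -> V -> R) x : mfunT (fun z : V * V => F z.1 z.2) ->
  (forall x y, `|F x y| <= 1) -> bmeas (F x).
Proof.
move=> mF F1; split; last by exists 1.
exact: (measurableT_comp mF (measurable_pair1 x)).
Qed.

Let bmeas_mul f g : bmeas f -> bmeas g -> bmeas (fun x => f x * har g x).
Proof. by move=> bf bg; apply: bmeasM => //; exact: bmeas_har. Qed.

Let sym0 f g : bmeas f -> bmeas g -> (forall x, 0 <= f x) -> (forall x, 0 <= g x) ->
  body_mean (fun x => f x * har g x) = body_mean (fun x => g x * har f x).
Proof.
move=> bf bg f0 g0.
have E u v : bmeas u -> bmeas v -> (bodyvol * body_mean (fun x => u x * har v x))%:E =
    (\int[vol n]_x \int[mu]_z (\1_U x * kk x z * (u x * v (move_to x z)))%:E)%E.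
  move=> bu bv; rewrite -body_meanE; last exact: bmeas_mul.
  apply: eq_integral => x _; rewrite (@harE (fun x y => u x * v y)); last exact: bmeasZ.
  by rewrite (stateZ (har_state x)).
have V0 : bodyvol != 0 by rewrite gt_eqF// bodyvol_gt0.
have mfg : mfunT (fun z : V * V => f z.1 * g z.2).
  apply: measurable_funM; first exact: (measurableT_comp (proj1 bf) measurable_fst).
  exact: (measurableT_comp (proj1 bg) measurable_snd).
have fg0 x y : 0 <= f x * g y by nneg.
apply: (mulfI V0); apply: EFin_inj; rewrite (E f g bf bg) (E g f bg bf).
apply: (etrans (step_reversible oU (F := fun x y => f x * g y) mfg fg0)).
by apply: eq_integral => x _; apply: eq_integral => z _; rewrite [f _ * _]mulrC.
Qed.

(** Reversibility is available for nonnegative functions. Constants are added to f and g, and the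
    expanded identity uses that [har] preserves the mean, itself the case of the constant function
    1. *)
Lemma har_sym f g : bmeas f -> bmeas g ->
  body_mean (fun x => f x * har g x) = body_mean (fun x => g x * har f x).
Proof.
move=> bf bg; have [_ [M fM]] := bf; have [_ [N gN]] := bg.
have bM := bmeas_cst V M; have bN := bmeas_cst V N; have bo := bmeas_cst V (1 : R).
have f0 x : 0 <= f x + M by have := fM x; rewrite ler_norml => /andP[]; lra.
have g0 x : 0 <= g x + N by have := gN x; rewrite ler_norml => /andP[]; lra.
have bf' : bmeas (fun x => f x + M) by exact: bmeasD.
have bg' : bmeas (fun x => g x + N) by exact: bmeasD.
have sI := body_state.
have M1 u C : bmeas u -> (forall x, 0 <= u x + C) -> body_mean (har u) = body_mean u.
  move=> bu u0; have bC := bmeas_cst V C; have bu' : bmeas (fun x => u x + C) by exact: bmeasD.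
  have := sym0 bo bu' (fun _ => ler01) u0.
  rewrite (_ : (fun x => 1 * har (fun y => u y + C) x) = fun x => har u x + C); last first.
    by apply/funext => x; rewrite mul1r (stateD (har_state x))// (state_cst (har_state x)).
  rewrite (_ : (fun x => (u x + C) * har (fun=> 1) x) = fun x => u x + C); last first.
    by apply/funext => x; rewrite (state1 (har_state x)) mulr1.
  by rewrite !(stateD sI)//; [move=> /addIr|exact: bmeas_har].
have E u v C D : bmeas u -> bmeas v -> (forall x, 0 <= v x + D) ->
    body_mean (fun x => (u x + C) * har (fun y => v y + D) x) =
    body_mean (fun x => u x * har v x) + (C * body_mean v + D * body_mean u + C * D).
  move=> bu bv v0; have bD := bmeas_cst V D; rewrite -(M1 v D)//.
  rewrite -(state_lin sI C D (C * D) (bmeas_har bv) bu) -(stateD sI).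
  - congr body_mean; apply/funext => x.
    by rewrite (stateD (har_state x))// (state_cst (har_state x)); ring.
  - exact: bmeas_mul.
  - apply: bmeasD; last exact: bmeas_cst.
    by apply: bmeasD; apply: bmeasZ => //; exact: bmeas_har.
have := sym0 bf' bg' f0 g0; rewrite !E// => h.
by apply: (addIr (M * body_mean g + N * body_mean f + M * N)); rewrite h; ring.
Qed.

(** [step_energy] integrates (f x - f y)^2, which is twice the Dirichlet form; hence 392 = 2 *
    196. *)
Lemma har_gap f : bmeas f -> (forall x, 0 <= f x <= 1) ->
  exists m, body_mean (fun x => (f x - m) ^+ 2) <=
    392 * 10 ^+ 12 * (n%:R * r) ^+ 2 *
    (body_mean (fun x => f x ^+ 2) - body_mean (fun x => f x * har f x)).
Proof.
move=> bf f01; have [m m01 h] := step_gap n0 oU cU BU Ur (proj1 bf) f01 r1.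
exists m; have sI := body_state; have bo := bmeas_cst V (1 : R).
have bm : bmeas (fun x => (f x - m) ^+ 2) by apply: bmeasX; apply: bmeasB => //; exact: bmeas_cst.
have b2 := bmeasX 2 bf; have bfh := bmeas_mul bf bf; have bh2 := bmeas_har b2.
have E : step_energy U f = (bodyvol * (2 * (body_mean (fun x => f x ^+ 2) - body_mean (fun x => f x * har f x))))%:E.
  have M2 : body_mean (har (fun x => f x ^+ 2)) = body_mean (fun x => f x ^+ 2).
    have := har_sym bo b2.
    under [X in body_mean X = _]eq_fun do rewrite mul1r.
    move=> ->; congr body_mean; apply/funext => x.
    by rewrite (state1 (har_state x)) mulr1.
  have -> : 2 * (body_mean (fun x => f x ^+ 2) - body_mean (fun x => f x * har f x)) =
      body_mean (fun x => (1 * f x ^+ 2 + (- 2) * (f x * har f x) + 0) + har (fun x => f x ^+ 2) x).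
    rewrite (stateD sI)//; last first.
      by apply: bmeasD; [apply: bmeasD; exact: bmeasZ|exact: bmeas_cst].
    by rewrite (state_lin sI)// M2; ring.
  rewrite -body_meanE; last first.
    by apply: bmeasD => //; apply: bmeasD; [apply: bmeasD; exact: bmeasZ|exact: bmeas_cst].
  apply: eq_integral => x _; have sx := har_state x.
  under eq_integral do rewrite /jump_sqr mulrA.
  rewrite (@harE (fun x y => (f x - f y) ^+ 2)); last first.
    by apply: bmeasX; apply: bmeasB => //; exact: bmeas_cst.
  congr (_ * _)%:E.
  rewrite (_ : (fun y => (f x - f y) ^+ 2) = fun y => 1 * f y ^+ 2 + (- 2 * f x) * f y + f x ^+ 2).
    by rewrite (state_lin sx)//; ring.
  by apply/funext => y; ring.
move: h; rewrite body_meanE// E -EFinM lee_fin => h.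
rewrite -(ler_pM2l bodyvol_gt0); apply: le_trans h _; apply: eqW.
by ring.
Qed.

End hit_and_run_operator.

(** * Bodies and their interiors up to null sets *)

Lemma mnormalizeE d (T : measurableType d) (R : realType) (m : {measure set T -> \bar R})
    (P : probability T R) (u : R) C : 0 < u -> m setT = u%:E ->
  mnormalize m P C = (m C * (u^-1)%:E)%E.
Proof. by move=> u0 E; rewrite /mnormalize E eqe gt_eqF. Qed.

Lemma mnormalize_infty d (T : measurableType d) (R : realType) (m : {measure set T -> \bar R})
    (P : probability T R) C : m setT = +oo%E -> mnormalize m P C = P C.
Proof. by move=> E; rewrite /mnormalize E eqxx orbT. Qed.

Section thin_boundary.
Context d (T : measurableType d) (R : realType) (m : {measure set T -> \bar R}).
Variables (A U : set T) (u : R).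
Hypotheses (mU : measurable U) (UA : U `<=` A) (Uu : m U = u%:E).
Hypothesis hull : forall e, 0 < e ->
  exists K, [/\ measurable K, A `<=` K & (m K <= (u + e)%:E)%E].

(** A itself may fail to be measurable. The outer measure of its intersection with C lies between
    the measures of C [&] U and C [&] K, for measurable K around A of nearly the same measure as
    U. *)
Lemma mtrace_hull C : measurable C -> mtrace m A C = m (C `&` U).
Proof.
move=> mC; have mCU : measurable (C `&` U) by exact: measurableI.
apply/eqP; rewrite eq_le; apply/andP; split; last first.
  rewrite -(measurable_mu_extE m mCU) /mtrace; apply: le_outer_measure.
  by move=> x [Cx Ux]; split => //; exact: UA.
apply/lee_addgt0Pr => e e0; have [K [mK AK Ku]] := hull e0.
have mCK : measurable (C `&` K) by exact: measurableI.
have mKU : measurable (K `\` U) by exact: measurableD.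
apply: (@le_trans _ _ (m (C `&` K))).
  rewrite -(measurable_mu_extE m mCK) /mtrace; apply: le_outer_measure.
  by move=> x [Cx Ax]; split => //; exact: AK.
apply: (@le_trans _ _ (m ((C `&` U) `|` (K `\` U)))).
  apply: le_measure; rewrite ?inE//; first exact: measurableU.
  by move=> x [Cx Kx]; have [Ux|nUx] := pselect (U x); [left|right].
apply: le_trans (measureU2 m mCU mKU) _; rewrite leeD2l//.
have KU : K `&` U = U by apply/setIidPr => x /UA; exact: AK.
have D : m (K `\` U) = (m K - m (K `&` U))%E.
  by apply: measureD => //; exact: le_lt_trans Ku (ltry _).
apply: (@le_trans _ _ (m K - m (K `&` U))%E); first by rewrite -D.
by rewrite KU Uu leeBlDr// -EFinD addrC.
Qed.

Hypothesis u0 : 0 < u.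

Lemma uniform_hull x0 C : measurable C -> uniform m x0 A C = (m (C `&` U) * (u^-1)%:E)%E.
Proof.
move=> mC; have E : mtrace m A [set: T] = u%:E by rewrite mtrace_hull// setTI.
by apply: (etrans (mnormalizeE _ _ u0 E)); congr (_ * _)%E; exact: mtrace_hull.
Qed.

End thin_boundary.

Section body.
Context {R : realType} (n : nat).
Local Notation V := 'rV[R]_n.
Local Notation leb := (@lebesgue_measure R).
Variables (U : set V) (r : R).
Hypotheses (n0 : (0 < n)%N) (oU : eopen U) (BU : oball 1 `<=` U).
Hypothesis Ur : U `<=` eball r.

Let mU : measurable U. Proof. exact: measurable_eopen. Qed.
Let b0 := @ballvol_gt0 R n.
Let u := bodyvol U.
Let u0 : 0 < u. Proof. exact: (bodyvol_gt0 oU BU Ur). Qed.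

Section star.
Variable A : set V.
Hypothesis UA : U `<=` A.
Hypothesis star : forall y c, A y -> 0 < c < 1 -> U (c *: y).

Let vol_hull e : 0 < e ->
  exists K, [/\ measurable K, A `<=` K & (vol n K <= (u + e)%:E)%E].
Proof.
(* By Bernoulli's inequality this shrinking factor c = 1 - dl satisfies u <= (u + e) c^n, so the
   dilate of U by 1 / c has volume at most u + e. *)
move=> e0; pose dl := e / ((n.+1)%:R * (u + e)); pose c := 1 - dl.
have ue : 0 < u + e by exact: addr_gt0.
have dp : 0 < dl by rewrite divr_gt0// mulr_gt0.
have n1 : 1 <= n.+1%:R :> R by rewrite ler1n.
have d1 : dl < 1.
  rewrite /dl ltr_pdivrMr ?mulr_gt0// mul1r; apply: (@lt_le_trans _ _ (u + e)); first by rewrite ltrDr.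
  by rewrite ler_peMl// ltW.
have c01 : 0 < c < 1 by rewrite /c; apply/andP; split; lra.
have /andP[c0 c1] := c01.
exists [set y | U (c *: y)]; split.
- apply: measurable_eopen => y Uy; have [e' e'0 He] := oU Uy.
  exists e' => // z zy; apply: He; rewrite -scalerBr enormZ gtr0_norm//.
  by apply: le_lt_trans zy; rewrite ler_piMl ?enorm_ge0// ltW.
- by move=> y Ay; exact: star.
rewrite vol_scale ?gt_eqF//.
have Eu : vol n U = u%:E by exact: (bodyvolE oU Ur).
rewrite [X in (_ * X <= _)%E](_ : _ = u%:E)// -EFinM lee_fin gtr0_norm// exprVn mulrC ler_pdivrMr ?exprn_gt0//.
have bern : 1 - n%:R * dl <= c ^+ n by apply: bernoulli_le; rewrite !ltW.
apply: le_trans (ler_wpM2l (ltW ue) bern).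
have nd : n%:R * dl * (u + e) <= e.
  have -> : n%:R * dl * (u + e) = e * (n%:R / n.+1%:R) by rewrite /dl; field; rewrite ?gt_eqF.
  by rewrite ler_piMr ?(ltW e0)// ler_pdivrMr// mul1r ler_nat.
by lra.
Qed.

Lemma vol_trace C : measurable C -> mtrace (vol n) A C = vol n (C `&` U).
Proof.
by move=> mC; exact: (mtrace_hull (m := vol n) mU UA (bodyvolE oU Ur) vol_hull mC).
Qed.

Lemma vol_traceT : mtrace (vol n) A setT = u%:E.
Proof. by rewrite vol_trace// setTI; exact: (bodyvolE oU Ur). Qed.

Lemma vol_uniform C : measurable C ->
  uniform (vol n) 0 A C = (vol n (C `&` U) * (u^-1)%:E)%E.
Proof.
by move=> mC; exact: (uniform_hull (m := vol n) mU UA (bodyvolE oU Ur) vol_hull u0 0 mC).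
Qed.

Let body_indic C : measurable C -> body_mean U \1_C = fine (vol n (C `&` U)) / u.
Proof.
move=> mC; have mCU : measurable (C `&` U) by exact: measurableI.
have := body_meanE oU BU Ur (bmeas_indic mC).
rewrite (eq_integral (fun x => (\1_(C `&` U) x)%:E)); last first.
  by move=> x _; rewrite indicI mulrC.
rewrite integral_indic// setIT => h.
have -> : fine (vol n (C `&` U)) = u * body_mean U \1_C by rewrite -[RHS]/(fine (_%:E)) -h.
by rewrite mulrC mulKf// gt_eqF.
Qed.

(* The boundary of a convex body is negligible, so that averages over the body
   and over its interior agree. *)
Lemma uniform_body_mean f : bmeas f ->
  density_mean (uniform (vol n) 0 A) (fun=> 1) f = body_mean U f.
Proof.
move=> bf; apply: bounded_linear_eq => //.
- apply: state_bounded_linear; apply: density_state => //.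
  by rewrite integral_cst//= mul1e; exact: probability_setT.
- by apply: state_bounded_linear; exact: (body_state oU BU Ur).
move=> C mC; rewrite body_indic// /density_mean; under eq_integral do rewrite mul1r.
rewrite integral_indic// setIT.
rewrite [X in fine X](_ : _ = (vol n (C `&` U) * (u^-1)%:E)%E); last exact: vol_uniform.
have mCU : measurable (C `&` U) by exact: measurableI.
rewrite fineM// ge0_fin_numE//; apply: (@le_lt_trans _ _ (vol n U)).
  by apply: le_measure; rewrite ?inE//; exact: subIsetr.
by rewrite [X in (X < _)%E](_ : _ = u%:E) ?ltry//; exact: (bodyvolE oU Ur).
Qed.

Lemma trace_body_mean f : bmeas f ->
  density_mean (mtrace (vol n) A) (fun=> u^-1) f = body_mean U f.
Proof.
move=> bf; have ui : 0 <= u^-1 by nneg.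
apply: bounded_linear_eq => //.
- apply: state_bounded_linear; apply: density_state => //.
  rewrite integral_cst//= [X in (_ * X)%E](_ : _ = u%:E); last exact: vol_traceT.
  by rewrite -EFinM mulVf// gt_eqF.
- by apply: state_bounded_linear; exact: (body_state oU BU Ur).
move=> C mC; rewrite body_indic// /density_mean; under eq_integral do rewrite EFinM.
rewrite ge0_integralZl_EFin//; last by meas; exact: measurable_indic.
rewrite integral_indic// setIT.
rewrite [X in fine (_ * X)](_ : _ = vol n (C `&` U)); last exact: vol_trace.
have mCU : measurable (C `&` U) by exact: measurableI.
rewrite fineM// 1?mulrC// ge0_fin_numE//; apply: (@le_lt_trans _ _ (vol n U)).
  by apply: le_measure; rewrite ?inE//; exact: subIsetr.
by rewrite [X in (X < _)%E](_ : _ = u%:E) ?ltry//; exact: (bodyvolE oU Ur).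
Qed.

End star.
End body.

(** * The hit-and-run kernel of a convex body *)

Section through.
Context {R : realType} (n : nat).
Local Notation V := 'rV[R]_n.
Local Notation leb := (@lebesgue_measure R).
Variables (U : set V) (r : R).
Hypotheses (n0 : (0 < n)%N) (oU : eopen U) (Ur : U `<=` eball r).
Let mU : measurable U. Proof. exact: measurable_eopen. Qed.
Let b0 := @ballvol_gt0 R n.
Variables (A : set V) (x : V).
Hypotheses (UA : U `<=` A) (Ux : U x).
Hypothesis star : forall y c, A (x + y) -> 0 < c < 1 -> U (x + c *: y).

Let mline (w : V) : mfunT (fun t : R => x + t *: w).
Proof.
by meas.
Qed.

Let mpre (w : V) (C : set V) : measurable C -> measurable [set t : R | C (x + t *: w)].
Proof. by move=> mC; rewrite -[X in measurable X]setTI; exact: (mline w). Qed.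

Let lenE (w : V) : w != 0 -> leb [set t : R | U (x + t *: w)] = (chord_length U w x)%:E.
Proof.
move=> w0; rewrite -(chord_length_fin oU Ur x w0).
have h : (\int[leb]_t (\1_U (x + t *: w)%R)%:E =
    \int[leb]_t (\1_[set t : R | U (x + t *: w)%R] t)%:E)%E.
  by nneg.
by rewrite h integral_indic ?setIT//; exact: mpre.
Qed.

(** Shrinking towards x by a factor below 1 carries the chord of A into that of U, so a slightly
    dilated chord of U covers the chord of A. *)
Let line_hull (w : V) e : w != 0 -> 0 < e -> exists K, [/\ measurable K,
  [set t : R | A (x + t *: w)] `<=` K & (leb K <= (chord_length U w x + e)%:E)%E].
Proof.
move=> w0 e0; set l := chord_length U w x.
have l0 : 0 < l by exact: (chord_length_gt0 oU Ur w0 Ux).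
have le : 0 < l + e by exact: addr_gt0.
pose c := l / (l + e); have c0 : 0 < c by rewrite divr_gt0.
have c1 : c < 1 by rewrite ltr_pdivrMr// mul1r ltrDl.
exists ((fun t => c * t + 0) @^-1` [set t : R | U (x + t *: w)]); split.
- by rewrite -[X in measurable X]setTI; apply: (measurable_affine c 0) => //; exact: mpre.
- move=> t /= At; rewrite addr0 -scalerA; apply: star => //; exact/andP.
have E := lebesgue_measure_affine 0 (lt0r_neq0 c0) (mpre w mU).
suff L : (leb ((fun t => c * t + 0)%R @^-1` [set t : R | U (x + t *: w)%R]) <= (l + e)%:E)%E.
  exact: L.
rewrite E.
rewrite [X in (_ * X <= _)%E](_ : _ = l%:E); last exact: lenE.
rewrite -EFinM lee_fin gtr0_norm// /c le_eqVlt; apply/orP; left; apply/eqP; field.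
by rewrite !gt_eqF.
Qed.

Lemma line_uniform (w : V) C : measurable C ->
  uniform leb 0 [set t : R | A (x + t *: w)] [set t : R | C (x + t *: w)] =
  (chord_avg U (\1_C) w x)%:E.
Proof.
move=> mC; have mP := mpre w mC; have [->|w0] := eqVneq w 0.
  (* For w = 0 the parameter set is the whole line, of infinite measure; [uniform] falls back on the
     point mass at t = 0 and the next state is x. *)
  rewrite chord_avg0.
  rewrite (_ : [set t : R | A (x + t *: (0 : V))] = setT); last first.
    by apply/seteqP; split => // t _ /=; rewrite scaler0 addr0; exact: UA.
  have E : mtrace leb setT setT = +oo%E.
    rewrite mtraceE// setTI.
    by have := @lebesgue_measure_itv R `]-oo, +oo[; rewrite set_itvNyy => h; exact: h.
  have D : (\d_(0%R : R) [set t : R | C (x + t *: (0%R : V))%R] = (\1_C x)%:E :> \bar R)%E.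
    by rewrite diracE indicE; congr (nat_of_bool _)%:R%:E; apply/idP/idP; rewrite !inE/= scaler0 addr0.
  by apply: (etrans (mnormalize_infty _ _ E)); exact: D.
have l0 := chord_length_gt0 oU Ur w0 Ux.
rewrite (@uniform_hull _ _ _ leb _ [set t : R | U (x + t *: w)] (chord_length U w x))//.
- rewrite chord_avgN0// EFinM; congr (_ * _)%E.
  have mCU : measurable (C `&` U) by exact: measurableI.
  have fin : (leb [set t : R | (C `&` U) (x + t *: w)%R] < +oo)%E.
    apply: (@le_lt_trans _ _ (leb [set t : R | U (x + t *: w)%R])); last first.
      by rewrite [X in (X < _)%E](_ : _ = (chord_length U w x)%:E) ?ltry//; exact: lenE.
    by apply: le_measure; rewrite ?inE; [exact: mpre|exact: mpre|move=> t []].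
  have h : (\int[leb]_t (\1_U (x + t *: w)%R * \1_C (x + t *: w)%R)%:E =
      \int[leb]_t (\1_[set t : R | (C `&` U) (x + t *: w)%R] t)%:E)%E.
    apply: eq_integral => t _; rewrite mulrC !indicE -natrM mulnb; congr (nat_of_bool _)%:R%:E.
    rewrite -in_setI; apply/idP/idP; by rewrite !inE.
  by rewrite h integral_indic ?setIT ?fineK ?ge0_fin_numE//; exact: mpre.
- exact: mpre.
- by move=> t; exact: UA.
- exact: lenE.
- by move=> e; exact: line_hull.
Qed.

(** Chord means are unchanged when w is rescaled, so [direction w] may be replaced by w, uniform on
    the closed ball. This law agrees with that of the open ball, and [step_chord_avg] identifies the
    result with the step density. *)
Lemma har_kernelE C : measurable C -> har_kernel A x C = (har U \1_C x)%:E.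
Proof.
move=> mC; rewrite /har_kernel; under eq_integral do rewrite line_uniform//.
pose q w := chord_avg U (\1_C : V -> R) w x.
have mf : mfunT (\1_C : V -> R) by meas.
have f01 y : 0 <= (\1_C y : R) <= 1 by rewrite indicE ler0n lern1 leq_b1.
have mq : mfunT q.
  exact: (measurableT_comp (measurable_chord_avg oU mf f01) (measurable_pair2 x)).
have q01 w : 0 <= q w <= 1 by exact: (chord_avg01 oU Ur mf f01).
have bq : bmeas q.
  by split => //; exists 1 => w; have /andP[h1 h2] := q01 w; rewrite ger0_norm.
have mqe : mfunT (fun w => (q w)%:E) by meas.
have qe0 : {in [set: V], forall w, (0 <= (q w)%:E)%E}.
  by move=> w _; rewrite lee_fin; have /andP[] := q01 w.
apply: (etrans (ge0_integral_pushforward (@measurable_direction R n) _ measurableT mqe qe0)).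
rewrite preimage_setT.
have qd w : q (direction w) = q w.
  have [->|w0] := eqVneq w 0; first by rewrite /direction scaler0.
  rewrite /q /direction; apply: (chord_avg_scale oU mf f01) => //.
  by rewrite invr_eq0; apply: contra_neq w0; exact: enorm_eq0.
have oB : eopen (@oball R n 1).
  move=> y; rewrite /oball/= => y1; exists (1 - enorm y); first by lra.
  move=> z zy; have := ler_enormD (z - y) y; rewrite subrK => h; apply: le_lt_trans h _; lra.
have bB : @oball R n 1 `<=` eball 1 by move=> y; rewrite /oball/eball/=; exact: ltW.
have sB y c : @eball R n 1 y -> 0 < c < 1 -> @oball R n 1 (c *: y).
  rewrite /eball/oball/= => y1 /andP[c0 c1]; rewrite enormZ gtr0_norm//.
  by apply: le_lt_trans c1; rewrite ler_piMr// ltW.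
have EB : bodyvol (@oball R n 1) = ballvol n by nneg.
have bm : bmeas (fun z : R * V => (\1_C : V -> R) (move_to x z)).
  apply: bmeas_comp; last exact: bmeas_indic.
  by apply: measurable_move; [exact: measurable_cst|exact: measurable_id].
have hE : (density_mean (uniform (vol n) 0%R (eball 1)) (fun=> 1) q)%:E =
    (\int[uniform (vol n) 0%R (eball 1)]_w (q w)%:E)%E.
  rewrite -density_meanE//; first by apply: eq_integral => w _; rewrite mul1r.
  by rewrite integral_cst//= mul1e; exact: probability_setT.
apply: (etrans (y := (\int[uniform (vol n) 0%R (eball 1)]_w (q w)%:E)%E)).
  by apply: eq_integral => w _ /=; rewrite qd.
rewrite -hE (uniform_body_mean oB (@subset_refl _ _) bB bB sB)//.
have := body_meanE oB (@subset_refl _ _) bB bq; rewrite EB => hb.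
have hs := step_chord_avg n0 oU Ur mf f01 Ux.
rewrite /har mem_set//; congr EFin.
have e1 : (\int[vol n]_w (\1_(@oball R n 1) w / ballvol n * q w)%:E =
    (body_mean (@oball R n 1) q)%:E)%E.
  under eq_integral do rewrite mulrAC mulrC EFinM.
  rewrite ge0_integralZl_EFin ?invr_ge0 ?(ltW b0)//.
  - by rewrite hb -EFinM mulKf// gt_eqF.
  - by move=> w _; rewrite lee_fin mulr_ge0//; have /andP[] := q01 w.
  - by meas.
by rewrite /density_mean hs e1.
Qed.

End through.

(** The integral of a nonnegative function is a supremum over simple functions below it, so
    monotonicity holds without measurability. *)
Lemma ge0_integral_mono d (T : measurableType d) (R : realType)
    (m : {measure set T -> \bar R}) (f g : T -> \bar R) :
  (forall x, 0 <= f x)%E -> (forall x, f x <= g x)%E -> (\int[m]_x f x <= \int[m]_x g x)%E.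
Proof.
move=> f0 fg; have g0 x : (0 <= g x)%E by exact: le_trans (fg x).
rewrite !ge0_integralTE//; apply: le_ereal_sup => _ [h hf <-]; exists h => //.
by move=> x; exact: le_trans (fg x).
Qed.

(* No measurability of f is required off the null set N. *)
Lemma ge0_integral_null_eq d (T : measurableType d) (R : realType)
    (m : {measure set T -> \bar R}) (f g : T -> \bar R) (N : set T) :
  measurable N -> m N = 0%E -> mfunT g ->
  (forall x, 0 <= f x)%E -> (forall x, 0 <= g x)%E -> (forall x, ~ N x -> f x = g x) ->
  (\int[m]_x f x = \int[m]_x g x)%E.
Proof.
move=> mN N0 mg f0 g0 fg.
(* f lies between the versions of g changed on N to 0 and to infinity, both of which have the
   integral of g. *)
pose h (c : \bar R) x := if x \in N then c else g x.
have mh c : mfunT (h c).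
  apply: measurable_fun_ifT; [|exact: measurable_cst|exact: mg].
  apply: (@measurable_fun_bool _ _ _ _ true); rewrite setTI.
  rewrite (_ : _ @^-1` _ = N)//; apply/seteqP; split => x /=.
    by move=> xN; exact: (set_mem xN).
  by move=> xN; exact: (mem_set xN).
have h0 c x : (0 <= c)%E -> (0 <= h c x)%E by rewrite /h; case: ifP.
have hE c : (0 <= c)%E -> (\int[m]_x h c x = \int[m]_x g x)%E.
  move=> c0; apply: ge0_ae_eq_integral => //; first by move=> x _; exact: h0.
  exists N; split => // x /= H; apply: contrapT => nN; apply: H => _.
  by rewrite /h memNset.
apply/eqP; rewrite eq_le; apply/andP; split.
  rewrite -(hE +oo%E)//; apply: ge0_integral_mono => // x; rewrite /h.
  by case: ifPn => [_|]; [rewrite leey|rewrite notin_setE => nN; rewrite fg].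
rewrite -(hE 0%E)//; apply: ge0_integral_mono => x; first exact: h0.
by rewrite /h; case: ifPn => // ; rewrite notin_setE => nN; rewrite fg.
Qed.

(** Both sides of the Markov identity, as functionals of one of the two functions, have this shape,
    so [bounded_linear_eq] reduces them to indicators. *)
Lemma weighted_bounded_linear (R : realType) d1 (T : measurableType d1) d2 (W : measurableType d2)
    (E : (W -> R) -> R) (g : W -> R) (S : (T -> R) -> W -> R) :
  state E -> bmeas g -> (forall f, bmeas f -> bmeas (S f)) ->
  (forall f h w, bmeas f -> bmeas h -> S (fun x => f x + h x) w = S f w + S h w) ->
  (forall c f w, bmeas f -> S (fun x => c * f x) w = c * S f w) ->
  (forall f e w, bmeas f -> (forall x, `|f x| <= e) -> `|S f w| <= e) ->
  bounded_linear (fun f => E (fun w => g w * S f w)).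
Proof.
move=> sE bg bS SD SZ Sb; split.
- move=> f h bf bh; rewrite -(stateD sE); [|exact: (bmeasM bg (bS _ bf))|exact: (bmeasM bg (bS _ bh))].
  by congr E; apply/funext => w; rewrite SD// mulrDr.
- move=> c f bf; rewrite -(stateZ sE); last exact: (bmeasM bg (bS _ bf)).
  by congr E; apply/funext => w; rewrite SZ// mulrCA.
have [mg [M gM]] := bg; exists `|M| => // f e bf fe.
have bgS := bmeasM bg (bS _ bf); apply: le_trans (state_norm sE bgS) _.
rewrite -(state_cst sE (`|M| * e)); apply: (state_le sE) => [||w].
- exact: bmeas_norm.
- exact: bmeas_cst.
rewrite normrM; apply: ler_pM => //; last exact: Sb.
exact: le_trans (gM w) (ler_norm M).
Qed.

(** * The Euclidean interior of a body *)

Section interior.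
Context {R : realType} (n : nat).
Local Notation V := 'rV[R]_n.
Variables (A : set V) (r : R).
Hypothesis bA : bodies r A.

Definition einterior : set V :=
  [set x | exists2 e, 0 < e & forall y, enorm (y - x) < e -> A y].

Lemma body_convex x y c : A x -> A y -> 0 <= c <= 1 -> A ((1 - c) *: x + c *: y).
Proof.
move=> Ax Ay /andP[c0 c1]; have [cA _ _] := bA.
have := cA y x (Itv01 c0 c1); rewrite !inE => /(_ Ay Ax).
by congr A; rewrite addrC.
Qed.

Lemma einterior_sub : einterior `<=` A.
Proof. by move=> x [e e0]; apply; rewrite subrr enorm0. Qed.

Lemma eopen_einterior : eopen einterior.
Proof.
move=> x [e e0 He]; exists (e / 2); first by lra.
move=> y yx; exists (e / 2); first by lra.
move=> z zy; apply: He; have := ler_enormD (z - y) (y - x).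
by rewrite addrA subrK => h; apply: le_lt_trans h _; rewrite (splitr e) ltrD.
Qed.

Lemma oball_sub_einterior : oball 1 `<=` einterior.
Proof.
move=> x; rewrite /oball/= => x1; have [_ BA _] := bA.
exists (1 - enorm x); first by lra.
move=> y yx; apply: BA; rewrite /eball/=; have := ler_enormD (y - x) x.
by rewrite subrK => h; apply: le_trans h _; lra.
Qed.

Lemma einterior_sub_eball : einterior `<=` eball r.
Proof. by move=> x /einterior_sub; have [_ _] := bA; apply. Qed.

(** The homothety with centre x + y and ratio 1 - c carries the e-ball at x to the ball of radius (1
    - c) e at x + c y and stays in A by convexity. *)
Lemma einterior_star x y c : einterior x -> A (x + y) -> 0 < c < 1 -> einterior (x + c *: y).
Proof.
move=> [e e0 He] Ay /andP[c0 c1]; have c1' : 0 < 1 - c by lra.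
exists ((1 - c) * e); first exact: mulr_gt0.
move=> z zx; pose v := (1 - c)^-1 *: (z - (x + c *: y)).
have Av : A (x + v).
  apply: He; rewrite addrC addKr /v enormZ gtr0_norm ?invr_gt0//.
  by rewrite ltr_pdivrMl.
have := body_convex Av Ay (_ : 0 <= c <= 1); rewrite !ltW// => /(_ isT).
rewrite (_ : (1 - c) *: (x + v) + c *: (x + y) = z)//.
rewrite !scalerDr /v scalerA mulfV ?gt_eqF// scale1r scalerBl scale1r.
apply/rowP => i; rewrite !mxE; ring.
Qed.

Lemma econvex_einterior : econvex einterior.
Proof.
move=> x y c Ux Uy /andP[c0 c1].
have [->|cn1] := eqVneq c 1; first by rewrite subrr scale0r add0r scale1r.
have [->|cn0] := eqVneq c 0; first by rewrite subr0 scale0r addr0 scale1r.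
rewrite (_ : (1 - c) *: x + c *: y = x + c *: (y - x)).
  apply: einterior_star => //; first by rewrite addrC subrK; exact: einterior_sub.
  by lra.
by apply/rowP => i; rewrite !mxE; ring.
Qed.

Lemma einterior_star0 y c : A y -> 0 < c < 1 -> einterior (c *: y).
Proof.
move=> Ay c01; have U0 : einterior 0 by apply: oball_sub_einterior; rewrite /oball/= enorm0.
by have := @einterior_star 0 y c U0; rewrite !add0r; apply.
Qed.

Lemma bodyvol_le : (0 < n)%N -> 1 <= r -> bodyvol einterior <= r ^+ n * ballvol n.
Proof.
move=> n0 r1; have r0 : 0 < r by lra.
rewrite -lee_fin -(bodyvolE eopen_einterior einterior_sub_eball) -vol_oball//.
apply: le_measure; rewrite ?inE.
- by apply: measurable_eopen; exact: eopen_einterior.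
- exact: measurable_oball.
move=> x Ux; have [e e0 He] := eopen_einterior Ux.
have := einterior_sub_eball Ux; rewrite /eball/oball/= le_eqVlt => /orP[/eqP xr|//].
(* A point of the open interior on the sphere of radius r could be moved outward by s x without
   leaving the interior, hence out of the ball of radius r. *)
pose s := e / (2 * r); have s0 : 0 < s by rewrite divr_gt0// mulr_gt0.
have := He ((1 + s) *: x); rewrite (_ : (1 + s) *: x - x = s *: x); last first.
  by apply/rowP => i; rewrite !mxE; ring.
rewrite enormZ xr gtr0_norm// (_ : s * r = e / 2); last by rewrite /s; field; rewrite gt_eqF.
have -> : e / 2 < e by lra.
move=> /(_ isT) /einterior_sub_eball; rewrite /eball/= enormZ xr gtr0_norm ?addr_gt0// => h; exfalso; move: h; rewrite leNgt => /negP; apply.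
by rewrite mulrDl mul1r ltrDl mulr_gt0.
Qed.

End interior.

(** * The given chain on the interior *)

Section chain_of_body.
Context {R : realType} (n : nat).
Local Notation V := 'rV[R]_n.
Variables (A : set V) (r : R).
Hypotheses (n0 : (0 < n)%N) (r1 : 1 <= r) (bA : bodies r A).
Context dO (Om : measurableType dO) (P : probability Om R) (X : nat -> {RV P >-> V}).
Hypothesis X_chain : lazy_har_chain A (uniform (vol n) 0 (eball 1)) X.

Local Notation U := (einterior A).
Let oU : eopen U := @eopen_einterior R n A.
Let mU : measurable U. Proof. exact: measurable_eopen. Qed.
Let BU := oball_sub_einterior bA.
Let Ur := einterior_sub_eball bA.
Let b0 := @ballvol_gt0 R n.

Definition prob_mean : (Om -> R) -> R := density_mean P (fun=> 1).

Lemma prob_one : (\int[P]_w ((1 : R)%:E) = 1)%E.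
Proof. by rewrite integral_cst//= mul1e; exact: probability_setT. Qed.

Lemma prob_state : state prob_mean.
Proof. by apply: density_state => //; exact: prob_one. Qed.

Lemma prob_meanE f : bmeas f -> (\int[P]_w (f w)%:E = (prob_mean f)%:E)%E.
Proof.
move=> bf; rewrite -density_meanE//; last exact: prob_one.
by apply: eq_integral => w _; rewrite mul1r.
Qed.

Let mX k : mfunT (X k). Proof. exact: measurable_funPT. Qed.

Let mXC k C : measurable C -> measurable (X k @^-1` C).
Proof. by move=> mC; rewrite -[X in measurable X]setTI; exact: mX. Qed.

Lemma lazy_kernelE x C : U x -> measurable C ->
  lazy_har_kernel A x C = (lazy (har U) \1_C x)%:E.
Proof.
move=> Ux mC; rewrite /lazy_har_kernel.
rewrite (har_kernelE n0 oU Ur (@einterior_sub R n A) Ux)//; last first.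
  by move=> y c; exact: (einterior_star bA).
by rewrite -EFinD -EFinM /lazy mulrC.
Qed.

Let ball_uniform C : measurable C -> uniform (vol n) 0 (eball 1) C =
  (vol n (C `&` @oball R n 1) * ((ballvol n)^-1)%:E)%E.
Proof.
move=> mC; have -> : ballvol n = bodyvol (@oball R n 1) by nneg.
apply: vol_uniform => //.
- move=> y; rewrite /oball/= => y1; exists (1 - enorm y); first by lra.
  move=> z zy; have := ler_enormD (z - y) y; rewrite subrK => h; apply: le_lt_trans h _; lra.
- by move=> y; rewrite /oball/eball/=; exact: ltW.
- by move=> y; rewrite /oball/eball/=; exact: ltW.
- move=> y c; rewrite /eball/oball/= => y1 /andP[c0 c1]; rewrite enormZ gtr0_norm//.
  by apply: le_lt_trans c1; rewrite ler_piMr// ltW.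
Qed.

Lemma lazy_kernel_ge0 x C : (0 <= lazy_har_kernel A x C)%E.
Proof.
rewrite /lazy_har_kernel mule_ge0// adde_ge0 ?lee_fin//.
by apply: integral_ge0 => t _; exact: measure_ge0.
Qed.

Let mlazy C : measurable C -> bmeas (lazy (har U) \1_C).
Proof.
move=> mC; apply: bmeas_lazy; last exact: bmeas_indic.
by move=> f bf; exact: (bmeas_har n0 oU Ur).
Qed.

Let history i k C : (0 < i <= k)%N -> measurable C ->
  g_sigma_preimage (fun (j : 'I_k) (w : Om) => X j.+1 w) (X i @^-1` C).
Proof.
case: i => // i /= ik mC; apply: sub_sigma_algebra => /=.
rewrite -bigcup_seq/=; exists (Ordinal ik) => /=; first by rewrite mem_index_enum.
by exists C => //; rewrite setTI.
Qed.

(** The chain starts in the open ball, and the kernel at a point of U gives no mass to the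
    complement of U. Almost surely the states lie in U, where [har_kernelE] describes the kernel. *)
Lemma chain_inside k : P (X k.+1 @^-1` (~` U)) = 0%E.
Proof.
have [_ X1 Xk] := X_chain; have mC : measurable (~` U) by exact: measurableC.
elim: k => [|k IH].
  rewrite X1// ball_uniform// (_ : _ `&` _ = set0) ?measure0 ?mul0e//.
  by apply/seteqP; split => // x [nU /BU].
have := Xk k.+1 setT (~` U) isT; rewrite setTI => ->//; last first.
  have := @history k.+1 k.+1 setT; rewrite preimage_setT; apply => //.
  by rewrite leqnn.
rewrite (@ge0_integral_null_eq _ _ _ _ _ (cst 0%E) (X k.+1 @^-1` (~` U)))//.
- by rewrite integral0.
- exact: mXC.
- by move=> w; exact: lazy_kernel_ge0.
move=> w /= /contrapT Uw; rewrite lazy_kernelE//; congr EFin.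
rewrite /lazy [X in X + _]indicE memNset; last by move=> /(_ Uw).
rewrite /har mem_set//= /density_mean integral0_eq ?addr0 ?mul0r//.
move=> z _; rewrite /step_density /move_to.
have [h|h] := pselect (U (X k.+1 w + z.1 *: z.2)).
  by rewrite [X in _ * X]indicE memNset ?mulr0//; move=> /(_ h).
by rewrite [X in _ * X * _ * _]indicE memNset// mulr0 !mul0r.
Qed.

Let markov_indic i k C' C : (0 < i <= k)%N -> measurable C' -> measurable C ->
  prob_mean (fun w => \1_C' (X i w) * \1_C (X k.+1 w)) =
  prob_mean (fun w => \1_C' (X i w) * lazy (har U) \1_C (X k w)).
Proof.
move=> ik mC' mC; have [_ _ Xk] := X_chain.
have k0 : (0 < k)%N by case/andP: ik => /leq_trans; apply.
have h := Xk k (X i @^-1` C') C k0 (history ik mC') mC.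
have b1 : bmeas (fun w => \1_C' (X i w) : R) by exact: (bmeas_comp (mX i) (bmeas_indic mC')).
have b2 : bmeas (fun w => \1_C (X k.+1 w) : R) by exact: (bmeas_comp (mX k.+1) (bmeas_indic mC)).
have b3 : bmeas (fun w => lazy (har U) \1_C (X k w)) by exact: (bmeas_comp (mX k) (mlazy mC)).
apply: EFin_inj; rewrite -!prob_meanE; [|exact: bmeasM|exact: bmeasM].
transitivity (P (X i @^-1` C' `&` X k.+1 @^-1` C)).
  have mF : measurable (X i @^-1` C' `&` X k.+1 @^-1` C) by apply: measurableI; exact: mXC.
  rewrite -[in RHS](setIT (_ `&` _)) -integral_indic//; apply: eq_integral => w _.
  by rewrite indicI.
rewrite h integral_mkcond.
(* The state with index 0 is unconstrained; [chain_inside] speaks of the indices from 1 on. *)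
have kk : k = k.-1.+1 by rewrite prednK.
apply: (@ge0_integral_null_eq _ _ _ _ _ _ (X k @^-1` (~` U))).
- exact/mXC/measurableC.
- by rewrite kk; exact: chain_inside.
- by have [m _] := bmeasM b1 b3; exact/measurable_EFinP.
- by move=> w; rewrite patchE; case: ifP => // _; exact: lazy_kernel_ge0.
- move=> w; rewrite lee_fin mulr_ge0//.
  apply: (state_ge0 (lazy_state (har_state n0 oU Ur) _)) => //; exact: bmeas_indic.
move=> w /= /contrapT Uw; rewrite patchE lazy_kernelE// indicE.
have -> : (X i w \in C') = (w \in X i @^-1` C') by nneg.
by case: (w \in _); rewrite /= ?mul1r ?mul0r.
Qed.

Let S1 k := fun (f : V -> R) (w : Om) => f (X k w).
Let S2 k := fun (f : V -> R) (w : Om) => lazy (har U) f (X k w).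

Let lin1 k (g : Om -> R) : bmeas g -> bounded_linear (fun f => prob_mean (fun w => g w * S1 k f w)).
Proof.
move=> bg; apply: weighted_bounded_linear => //; first exact: prob_state.
- by move=> f; exact: bmeas_comp.
- by move=> f e w _; apply.
Qed.

Let bT f : bmeas f -> bmeas (lazy (har U) f).
Proof. by apply: bmeas_lazy => h bh; exact: (bmeas_har n0 oU Ur). Qed.

Let lin2 k (g : Om -> R) : bmeas g -> bounded_linear (fun f => prob_mean (fun w => g w * S2 k f w)).
Proof.
move=> bg; have sT x := lazy_state (har_state n0 oU Ur) x.
apply: weighted_bounded_linear => //; first exact: prob_state.
- by move=> f bf; apply: bmeas_comp => //; exact: bT.
- by move=> f h w bf bh; exact: (stateD (sT _)).
- by move=> c f w bf; exact: (stateZ (sT _)).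
- move=> f e w bf fe; apply: le_trans (state_norm (sT _) bf) _.
  rewrite -(state_cst (sT (X k w)) e); apply: (state_le (sT _)) => //.
    exact: bmeas_norm.
  exact: bmeas_cst.
Qed.

(** The Markov property on sets is extended to functions one argument at a time, first in h and then
    in g. *)
Lemma chain_markov i k g h : (0 < i <= k)%N -> bmeas g -> bmeas h ->
  prob_mean (fun w => g (X i w) * h (X k.+1 w)) =
  prob_mean (fun w => g (X i w) * lazy (har U) h (X k w)).
Proof.
move=> ik bg bh; have bXi (f : V -> R) : bmeas f -> bmeas (fun w => f (X i w)) by exact: bmeas_comp.
refine (bounded_linear_eq (lin1 k.+1 (bXi _ bg)) (lin2 k (bXi _ bg)) _ bh) => C mC.
have b2 : bmeas (fun w => \1_C (X k.+1 w) : R) by exact: (bmeas_comp (mX k.+1) (bmeas_indic mC)).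
have b3 : bmeas (fun w => lazy (har U) \1_C (X k w)) by exact: (bmeas_comp (mX k) (mlazy mC)).
have sw (u v : Om -> R) : (fun w => u w * v w) = (fun w => v w * u w).
  by apply/funext => w; rewrite mulrC.
rewrite /S1 /S2 sw [in RHS]sw.
refine (bounded_linear_eq (lin1 i b2) (lin1 i b3) _ bg) => C' mC'.
by rewrite /S1 sw [in RHS]sw; exact: markov_indic.
Qed.

(** Density of the uniform law on the unit ball with respect to that on the interior; [bodyvol_le]
    bounds it by r^n, the warm-start constant. *)
Definition start_density (x : V) : R := bodyvol U / ballvol n * \1_(@oball R n 1) x.

Let V0 : 0 < bodyvol U. Proof. exact: (bodyvol_gt0 oU BU Ur). Qed.

Lemma bmeas_start : bmeas start_density.
Proof. by apply: bmeasZ; apply: bmeas_indic; exact: measurable_oball. Qed.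

Lemma start_density_range x : 0 <= start_density x <= r ^+ n.
Proof.
have h : bodyvol U / ballvol n <= r ^+ n by rewrite ler_pdivrMr//; exact: bodyvol_le.
have h0 : 0 <= bodyvol U / ballvol n by nneg.
rewrite /start_density mulr_ge0//=; apply: le_trans h.
by rewrite ler_piMr// indicE lern1 leq_b1.
Qed.

Lemma chain_init h : bmeas h ->
  prob_mean (fun w => h (X 1%N w)) = body_mean U (fun x => start_density x * h x).
Proof.
have sI := body_state oU BU Ur.
have mO : measurable (@oball R n 1) by exact: measurable_oball.
have L2 : bounded_linear (fun h => body_mean U (fun x => start_density x * h x)).
  by apply: (@weighted_bounded_linear _ _ _ _ _ _ _ (fun f => f)) => //; exact: bmeas_start.
have L1 : bounded_linear (fun h => prob_mean (fun w => h (X 1%N w))).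
  have := lin1 1 (bmeas_cst Om 1); congr bounded_linear.
  by apply/funext => f; congr prob_mean; apply/funext => w; rewrite mul1r.
apply: (bounded_linear_eq L1 L2) => C mC; have [_ X1 _] := X_chain.
have mCO : measurable (C `&` @oball R n 1) by exact: measurableI.
have b1 : bmeas (fun w => \1_C (X 1%N w) : R) by exact: (bmeas_comp (mX 1) (bmeas_indic mC)).
have bs : bmeas (fun x => start_density x * \1_C x) by apply: bmeasM; [exact: bmeas_start|exact: bmeas_indic].
apply: (mulfI (lt0r_neq0 V0)); apply: EFin_inj.
rewrite EFinM -prob_meanE// -(body_meanE oU BU Ur bs).
have -> : (\int[P]_w (\1_C (X 1%N w))%:E = P (X 1%N @^-1` C))%E.
  by rewrite -(setIT (X 1%N @^-1` C)) -integral_indic//; exact: mXC.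
rewrite X1// ball_uniform//.
have -> : (\int[vol n]_x (\1_U x * (start_density x * \1_C x))%:E =
    \int[vol n]_x ((bodyvol U / ballvol n)%:E * (\1_(C `&` @oball R n 1) x)%:E))%E.
  apply: eq_integral => x _; rewrite -EFinM; congr EFin; rewrite /start_density indicI/=.
  have [Ox|nO] := pselect (@oball R n 1 x).
    by rewrite !indicE (mem_set (BU Ox)) (mem_set Ox) mul1r !mulr1.
  by rewrite !indicE (memNset nO) !(mulr0, mul0r).
rewrite ge0_integralZl_EFin//.
- by rewrite integral_indic// setIT EFinM -muleA; congr (_ * _)%E; exact: muleC.
- by meas.
- by nneg.
Qed.

Lemma body_chain_mse (p q : R) f N0 N : 2 < p -> 2 <= q -> q * (p - 2) = p ->
  bmeas f -> body_mean U f = 0 -> body_mean U (fun x => f x ^+ 2) <= 1 ->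
  body_mean U (fun x => (`|f x| / 2) `^ p) <= 1 ->
  r ^+ n * q * expR (- (N0%:R * (2 / q / (2 * (392 * 10 ^+ 12 * (n%:R * r) ^+ 2))))) <= 32^-1 ->
  prob_mean (fun w => (\sum_(i < N) f (X (N0 + i).+1 w)) ^+ 2) <=
  N%:R * (9 / 2 * (392 * 10 ^+ 12 * (n%:R * r) ^+ 2)).
Proof.
move=> p2 q2 pq bf f0 f2 fp hN.
have cU := econvex_einterior bA.
have G1 : 1 <= 392 * 10 ^+ 12 * (n%:R * r) ^+ 2.
  have h1 : 1 <= (n%:R * r) ^+ 2.
    by rewrite exprn_ege1// -[leLHS]mulr1; apply: ler_pM => //; rewrite ler1n.
  have h2 : 1 <= 10 ^+ 12 :> R by lra.
  have := ler_pM (ler01 : 0 <= 1 :> R) ler01 h2 h1; rewrite mulr1.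
  by lra.
apply: (@chain_mse R _ V (body_mean U) (har U) _ (body_state oU BU Ur) (har_state n0 oU Ur)
  (bmeas_har n0 oU Ur) (@har_sym R n U r n0 oU BU Ur) G1 (har_gap n0 oU cU BU Ur r1)
  p q p2 q2 pq _ Om prob_mean (fun k => X k) prob_state mX chain_markov start_density
  (r ^+ n) _ bmeas_start start_density_range chain_init f bf f0 f2 fp N0 N hN).
by rewrite exprn_ege1.
Qed.

End chain_of_body.

(** * Powers and truncation *)

Section powers.
Context {R : realType}.
Implicit Types y a b p : R.

(* Young's inequality applied to y^a * 1. *)
Lemma powR_interp y a b : 0 <= y -> 0 < a < b -> y `^ a <= a / b * y `^ b + (1 - a / b).
Proof.
move=> y0 /andP[a0 ab]; have b0 : 0 < b by lra.
have ba : 0 < b - a by lra.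
have cj : (b / a)^-1 + (b / (b - a))^-1 = 1 by field; rewrite !gt_eqF.
have := @conjugate_powR _ (y `^ a) 1 (b / a) (b / (b - a)) (powR_ge0 _ _) ler01
  (divr_gt0 b0 a0) (divr_gt0 b0 ba) cj.
rewrite mulr1 powR1 -powRrM (_ : a * (b / a) = b); last by field; rewrite gt_eqF.
move=> h; apply: le_trans h _; apply: eqW.
by field; rewrite !gt_eqF.
Qed.

Lemma powR_half_le y a p : 1 <= p -> 0 <= y -> 0 <= a ->
  ((y + a) / 2) `^ p <= 2^-1 * y `^ p + 2^-1 * a `^ p.
Proof.
move=> p1 y0 a0; have h0 : 0 <= 2^-1 :> R by [].
have h1 : 2^-1 <= 1 :> R by lra.
have := @convex_powR _ p p1 (Itv01 h0 h1) y a.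
rewrite !inE/= !in_itv/= !andbT => /(_ y0 a0); rewrite convRE/= /unstable.onem.
have e : 1 - 2^-1 = 2^-1 :> R by field.
rewrite e (_ : (y + a) / 2 = 2^-1 * y + (1 - 2^-1) * a); first by move=> h; exact: h.
by rewrite e; ring.
Qed.

End powers.

Section truncation.
Context {R : realType} d (T : measurableType d).

Definition truncate (j : nat) (f : T -> R) (x : T) : R := Num.max (- j%:R) (Num.min j%:R (f x)).

Lemma bmeas_truncate j f : mfunT f -> bmeas (truncate j f).
Proof.
move=> mf; split.
  apply: measurable_maxr; first exact: measurable_cst.
  by apply: measurable_minr => //; exact: measurable_cst.
exists j%:R => x; rewrite ler_norml /truncate le_max lexx/= ge_max ge_min lexx/= andbT.
by apply: le_trans (ler0n R j); rewrite oppr_le0.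
Qed.

Lemma truncate_norm_le j f x : `|truncate j f x| <= `|f x|.
Proof.
have j0 := ler0n R j; rewrite /truncate ler_norml; apply/andP; split.
  rewrite le_max le_min; apply/orP.
  have h := ler_norm (- f x); rewrite normrN in h.
  by right; apply/andP; split; [have := normr_ge0 (f x)|]; lra.
rewrite ge_max ge_min ler_norm orbT andbT.
by apply: le_trans (normr_ge0 _); rewrite oppr_le0.
Qed.

Lemma truncate_id j f x : `|f x| <= j%:R -> truncate j f x = f x.
Proof. by rewrite ler_norml => /andP[h1 h2]; rewrite /truncate min_r// max_r. Qed.

Lemma truncate_near f x : \forall j \near \oo, truncate j f x = f x.
Proof.
near=> j; apply: truncate_id; apply: ltW; apply: lt_le_trans (archi_boundP (normr_ge0 _)) _.
by rewrite ler_nat; near: j; exact: nbhs_infty_ge.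
Unshelve. all: by end_near.
Qed.

End truncation.

Lemma limn_einf_le (R : realType) (u : (\bar R)^nat) (B : \bar R) :
  (forall j, u j <= B)%E -> (limn_einf u <= B)%E.
Proof.
move=> uB; rewrite limn_einf_lim; apply: lime_le; first exact: is_cvg_einfs.
apply: nearW => j; apply: le_trans (uB j); apply: ereal_inf_lbound.
by exists j => //=.
Qed.

(** * Mean square error for a general integrand *)

Section mean_square_error.
Context {R : realType} (n : nat).
Local Notation V := 'rV[R]_n.
Variables (A : set V) (r : R).
Hypotheses (n0 : (0 < n)%N) (r1 : 1 <= r) (bA : bodies r A).
Context dO (Om : measurableType dO) (P : probability Om R) (X : nat -> {RV P >-> V}).
Hypothesis X_chain : lazy_har_chain A (uniform (vol n) 0 (eball 1)) X.

Local Notation U := (einterior A).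
Local Notation G := (392 * 10 ^+ 12 * (n%:R * r) ^+ 2).
Let oU : eopen U := @eopen_einterior R n A.
Let BU := oball_sub_einterior bA.
Let Ur := einterior_sub_eball bA.
Let UA := @einterior_sub R n A.
Let star := einterior_star0 bA.
Let sI := body_state oU BU Ur.
Let V0 : 0 < bodyvol U. Proof. exact: (bodyvol_gt0 oU BU Ur). Qed.
Let mX k : mfunT (X k). Proof. exact: measurable_funPT. Qed.

Variable f : V -> R.
Hypothesis mf : mfunT f.
Variables p q : R.
Hypotheses (p2 : 2 < p) (q2 : 2 <= q) (pq : q * (p - 2) = p).
Hypothesis f_mom : (\int[uniform (vol n) 0%R A]_x (`|f x| `^ p)%:E <= 1)%E.

Let p0 : 0 < p. Proof. exact: lt_trans p2. Qed.

Let uniform_meanE g : bmeas g ->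
  (\int[uniform (vol n) 0%R A]_x (g x)%:E = (body_mean U g)%:E)%E.
Proof.
move=> bg; rewrite -(uniform_body_mean oU BU Ur UA star bg).
rewrite -density_meanE//; first by apply: eq_integral => w _; rewrite mul1r.
exact: prob_one.
Qed.

Let mpow : mfunT (fun x => `|f x| `^ p).
Proof.
apply: (measurableT_comp (measurable_powR p)).
exact: (measurableT_comp (@normr_measurable R setT) mf).
Qed.

Let ft j := truncate j f.
Let bft j : bmeas (ft j). Proof. exact: bmeas_truncate. Qed.

Let bpow (g : V -> R) : bmeas g -> bmeas (fun x => `|g x| `^ p).
Proof. by move=> bg; apply: bmeas_powR => //; [exact: ltW|exact: bmeas_norm]. Qed.

Let ft_mom j : body_mean U (fun x => `|ft j x| `^ p) <= 1.
Proof.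
have bp := bpow (bft j).
rewrite -lee_fin -(uniform_meanE bp); apply: le_trans f_mom.
have m1 : mfunT (fun x => (`|ft j x| `^ p)%:E).
  by apply/measurable_EFinP; have [] := bp.
have m2 : mfunT (fun x => (`|f x| `^ p)%:E) by meas.
apply: ge0_le_integral => // x _; rewrite lee_fin.
by apply: ge0_ler_powR; rewrite ?nnegrE ?(ltW p0)//; exact: truncate_norm_le.
Qed.

Let ft_var j : body_mean U (fun x => ft j x ^+ 2) <= 1.
Proof.
have bp := bpow (bft j); have b2 := bmeasX 2 (bft j).
apply: (@le_trans _ _ (body_mean U (fun x => 2 / p * `|ft j x| `^ p + 0 * ft j x + (1 - 2 / p)))).
  apply: (state_le sI) => // [|x].
    by apply: bmeasD; [apply: bmeasD; exact: bmeasZ|exact: bmeas_cst].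
  have := @powR_interp R `|ft j x| 2 p (normr_ge0 _); rewrite p2 andbT => /(_ (ltr0n _ 2)).
  by rewrite powR_mulrn// real_normK ?num_real// mul0r addr0.
rewrite (state_lin sI)// mul0r addr0.
have h : 0 <= 2 / p by nneg.
have := ler_wpM2l h (ft_mom j); lra.
Qed.

Let m j := body_mean U (ft j).

Let m_le1 j : `|m j| <= 1.
Proof.
have := le_trans (state_sqr sI (bft j)) (ft_var j).
by rewrite -/(m j) -[m j ^+ 2]real_normK ?num_real// expr_le1.
Qed.

Variables N0 N : nat.
Hypothesis N_gt0 : (0 < N)%N.
Hypothesis burn : r ^+ n * q * expR (- (N0%:R * (2 / q / (2 * G)))) <= 32^-1.

Let avg (g : V -> R) w := har_mean N N0 g X w.

Let avgE (g : V -> R) w : avg g w = N%:R^-1 * \sum_(i < N) g (X (N0 + i).+1 w).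
Proof.
rewrite /avg /har_mean big_add1 big_mkord; congr (_ * _); apply: eq_bigr => i _.
by rewrite addSn addnC.
Qed.

Let bound := 9 / 2 * G / N%:R.

Let truncated_mse j : (\int[P]_w (`|avg (ft j) w - m j| ^+ 2)%:E <= bound%:E)%E.
Proof.
(* Centering may double the size of the function: as |m j| <= 1, it is |F| / 2 that keeps a p-th
   moment of at most 1, which is the form of the moment hypothesis on the chain. *)
pose F x := ft j x - m j; have bF : bmeas F by apply: bmeasB => //; exact: bmeas_cst.
have F0 : body_mean U F = 0.
  by rewrite /F (stateB sI)//; [rewrite (state_cst sI) subrr|exact: bmeas_cst].
have b2 := bmeasX 2 (bft j).
have F2 : body_mean U (fun x => F x ^+ 2) <= 1.
  rewrite (_ : (fun x => F x ^+ 2) = fun x => 1 * ft j x ^+ 2 + (- 2 * m j) * ft j x + m j ^+ 2).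
    rewrite (state_lin sI)// -/(m j); have := ft_var j; have := sqr_ge0 (m j); lra.
  by apply/funext => x; rewrite /F; ring.
have bp := bpow (bft j).
have Fp : body_mean U (fun x => (`|F x| / 2) `^ p) <= 1.
  have bF2 : bmeas (fun x => `|F x| / 2).
    by have := bmeasM (bmeas_norm bF) (bmeas_cst V 2^-1).
  apply: (@le_trans _ _ (body_mean U (fun x => 2^-1 * `|ft j x| `^ p + 0 * ft j x + 2^-1))).
    apply: (state_le sI) => [||x].
    - by apply: bmeas_powR => //; exact: ltW.
    - by apply: bmeasD; [apply: bmeasD; exact: bmeasZ|exact: bmeas_cst].
    have p1 : 1 <= p by apply: ltW; apply: lt_trans p2; rewrite ltr1n.
    have := powR_half_le p1 (normr_ge0 (ft j x)) (normr_ge0 (m j)).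
    have : `|m j| `^ p <= 1.
      have one : (1 : R) `^ p = 1 by rewrite powR1.
      rewrite -[leRHS]one; apply: ge0_ler_powR; rewrite ?nnegrE ?(ltW p0)//; exact: m_le1.
    have : (`|F x| / 2) `^ p <= ((`|ft j x| + `|m j|) / 2) `^ p.
      apply: ge0_ler_powR; rewrite ?nnegrE ?(ltW p0) ?divr_ge0 ?addr_ge0//.
      by rewrite ler_pM2r ?invr_gt0//; exact: ler_normB.
    by lra.
  rewrite (state_lin sI)// mul0r; have := ft_mom j; lra.
have h := body_chain_mse n0 r1 bA X_chain N p2 q2 pq bF F0 F2 Fp burn.
have N1 : 0 < N%:R :> R by rewrite ltr0n.
pose S w := \sum_(i < N) F (X (N0 + i).+1 w).
have bS : bmeas S by apply: bmeas_sum => i; exact: (bmeas_comp (mX _) bF).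
have E w : `|avg (ft j) w - m j| ^+ 2 = (N%:R ^+ 2)^-1 * S w ^+ 2.
  rewrite real_normK ?num_real// avgE /S sumrB sumr_const card_ord.
  rewrite -[m j *+ N]mulr_natr; set z := \sum_(i < N) _.
  by field; rewrite gt_eqF.
under eq_integral do rewrite E.
rewrite (prob_meanE P) //; last by apply: bmeasZ; exact: bmeasX.
rewrite lee_fin (stateZ (prob_state P)); last exact: bmeasX.
apply: le_trans (ler_wpM2l _ h) _; first by nneg.
by rewrite /bound le_eqVlt; apply/orP; left; apply/eqP; field; rewrite gt_eqF.
Qed.

(** Dominated convergence with majorant 1 + |f|^p. The moment hypothesis concerns the normalized
    measure and [mean] the trace of the volume; [pushE] converts between the two. *)
Let mean_cvg : m j @[j --> \oo] --> mean f A.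
Proof.
pose rho := mtrace (vol n) A; pose u := bodyvol U.
have rhoT : rho setT = u%:E by exact: (vol_traceT oU BU Ur UA star).
have ui : 0 <= u^-1 by nneg.
have k1 : (\int[rho]_x (u^-1)%:E = 1)%E.
  rewrite integral_cst//= [X in (_ * X)%E](_ : _ = u%:E)// -EFinM mulVf// gt_eqF//.
have mE j : (m j)%:E = (\int[rho]_x (u^-1 * ft j x)%:E)%E.
  by rewrite /m -(trace_body_mean oU BU Ur UA star (bft j)) -density_meanE.
have pushE (g : V -> \bar R) : mfunT g -> (forall x, 0 <= g x)%E ->
    (\int[uniform (vol n) 0%R A]_x g x = (u^-1)%:E * \int[rho]_x g x)%E.
  apply: (@ge0_integral_comp _ _ _ _ _ _ rho id) => //.
  move=> C mC; rewrite preimage_id.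
  apply: etrans (vol_uniform oU BU Ur UA star mC) _.
  rewrite muleC; congr (_ * _)%E; apply: esym; exact: (vol_trace oU BU Ur UA star mC).
have powfin : (\int[rho]_x (`|f x| `^ p)%:E < +oo)%E.
  have me : mfunT (fun x => (`|f x| `^ p)%:E) by meas.
  have pe x : (0 <= (`|f x| `^ p)%:E)%E by nneg.
  have h := f_mom; rewrite (pushE _ me pe) in h.
  rewrite ltey; apply/eqP => E; move: h; rewrite E gt0_muley//.
  by rewrite lte_fin invr_gt0.
pose g x := (1 + `|f x| `^ p)%:E.
have mg : mfunT g.
  by apply/measurable_EFinP; apply: measurable_funD => //; exact: measurable_cst.
have g0 x : (0 <= g x)%E by nneg.
have ig : rho.-integrable setT g.
  apply/integrableP; split => //; under eq_integral do rewrite gee0_abs//.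
  have mp : mfunT (fun x => (`|f x| `^ p)%:E) by meas.
  have pp x : (0 <= (`|f x| `^ p)%:E)%E by nneg.
  have h := ge0_integral_linear rho (ler01 : 0 <= 1 :> R) ler01 (measurable_cst 1%E) mp (fun _ => lee01) pp.
  rewrite (eq_integral (fun x => (1%:E * cst 1%E x + 1%:E * (`|f x| `^ p)%:E)%E)); last first.
    by move=> x _; rewrite /= !mul1e.
  rewrite h !mul1e integral_cst// mul1e [X in (X + _)%E](_ : _ = u%:E)//.
  by rewrite lte_add_pinfty// ltry.
have nrm x : `|f x| <= 1 + `|f x| `^ p.
  have p1 : 1 < p by apply: lt_trans p2; rewrite ltr1n.
  have := @powR_interp R `|f x| 1 p (normr_ge0 _); rewrite p1 ltr01 => /(_ isT).
  rewrite powRr1//; have h := powR_ge0 `|f x| p.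
  have : 0 <= 1 / p <= 1 by rewrite divr_ge0 ?(ltW p0)//= ler_pdivrMr// mul1r ltW.
  move=> /andP[s0 s1]; have := ler_wpM2r h s1; rewrite mul1r; lra.
have if1 : rho.-integrable setT (fun x => (f x)%:E).
  apply: (@le_integrable _ _ _ _ _ measurableT _ g) => //; first exact/measurable_EFinP.
  by move=> x _; rewrite (gee0_abs (g0 x)) lee_fin.
have meanE : (mean f A)%:E = (\int[rho]_x (u^-1 * f x)%:E)%E.
  rewrite /mean /Rintegral.
  have -> : fine (mu_ext (vol n) A) = u.
    by have := rhoT; rewrite /rho /= /mtrace setTI => ->.
  rewrite EFinM fineK; last exact: integrable_fin_num.
  by rewrite -integralZl.
have H : (m j)%:E @[j --> \oo] --> (mean f A)%:E.
  rewrite meanE; under eq_fun do rewrite mE.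
  apply: (@dominated_cvg _ _ _ rho setT measurableT _ _ (fun x => (u^-1)%:E * g x)%E) => //.
  - move=> j; apply/measurable_EFinP; apply: measurable_funM; first exact: measurable_cst.
    by have [] := bft j.
  - move=> x _; apply: cvg_near_cst.
    by apply: filterS (truncate_near f x) => j; rewrite /ft => ->.
  - exact: integrableZl.
  - move=> j x _; rewrite EFinM abseM; apply: lee_pmul => //; last first.
      by rewrite lee_fin; apply: le_trans (truncate_norm_le j f x) _.
    by rewrite gee0_abs.
exact: (fine_cvg H).
Qed.

Lemma har_mse_le : (\int[P]_w (`|avg f w - mean f A| ^+ 2)%:E <= bound%:E)%E.
Proof.
pose h j w := (`|avg (ft j) w - m j| ^+ 2)%:E.
have mavg (g : V -> R) : mfunT g -> mfunT (avg g).
  move=> mg; rewrite (_ : avg g = fun w => N%:R^-1 * \sum_(i < N) g (X (N0 + i).+1 w)).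
    apply: measurable_funM; first exact: measurable_cst.
    by apply: measurable_sum => i; exact: (measurableT_comp mg (mX _)).
  by apply/funext => w; exact: avgE.
have mh j : mfunT (h j).
  apply/measurable_EFinP; apply: measurable_funX.
  apply: (measurableT_comp (@normr_measurable R setT)).
  apply: measurable_funB; last exact: measurable_cst.
  by apply: mavg; have [] := bft j.
(* At a fixed w only N values of f occur, so truncation is inactive once j exceeds the sum of their
   moduli. *)
have c1 w : avg (ft j) w @[j --> \oo] --> avg f w.
  apply: cvg_near_cst; near=> j; rewrite !avgE; congr (_ * _); apply: eq_bigr => i _.
  apply: truncate_id; apply: (@le_trans _ _ (\sum_(i < N) `|f (X (N0 + i).+1 w)|)).
    by rewrite (bigD1 i)//= lerDl sumr_ge0.
  have s0 : 0 <= \sum_(i < N) `|f (X (N0 + i).+1 w)| by nneg.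
  apply: ltW; apply: lt_le_trans (archi_boundP s0) _.
  by rewrite ler_nat; near: j; exact: nbhs_infty_ge.
have lim w : limn_einf (h ^~ w) = (`|avg f w - mean f A| ^+ 2)%:E.
  have c2 : `|avg (ft j) w - m j| @[j --> \oo] --> `|avg f w - mean f A|.
    by apply: cvg_norm; apply: cvgB; [exact: c1|exact: mean_cvg].
  have c3 : h j w @[j --> \oo] --> (`|avg f w - mean f A| ^+ 2)%:E.
    apply: cvg_EFin; first exact: nearW.
    by rewrite expr2; under eq_fun do rewrite /h /= expr2; exact: cvgM.
  by rewrite (cvg_limn_einf_sup c3).1.
have h0 j w : setT w -> (0 <= h j w)%E by nneg.
have := fatou P measurableT mh h0; under eq_integral do rewrite lim.
move=> hf; apply: le_trans hf _; apply: limn_einf_le => j; exact: truncated_mse.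
Unshelve. all: by end_near.
Qed.

End mean_square_error.

(** * Moments, burn-in and numerical constants *)

Section constants.
Context {R : realType}.

Lemma Lnorm_le1 d (T : measurableType d) (m : {measure set T -> \bar R}) (f : T -> R) (s : R) :
  0 < s -> ('N[m]_(s%:E)[EFin \o f] <= 1)%E -> (\int[m]_x (`|f x| `^ s)%:E <= 1)%E.
Proof.
move=> s0; rewrite unlock /=.
have -> : (\int[m]_x (`|(f x)%:E| `^ s) = \int[m]_x (`|f x| `^ s)%:E)%E.
  by nneg.
have : (0 <= \int[m]_x (`|f x| `^ s)%:E)%E by apply: integral_ge0 => x _; rewrite lee_fin powR_ge0.
move: (\int[m]_x (`|f x| `^ s)%:E)%E => [y|_|//].
  rewrite lee_fin poweR_EFin !lee_fin => y0 h.
  have := ge0_ler_powR (ltW s0) (_ : y `^ s^-1 \in Num.nneg) (_ : 1 \in Num.nneg) h.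
  rewrite !nnegrE powR_ge0 ler01 => /(_ isT isT).
  by rewrite -powRrM mulVf ?gt_eqF// powRr1// powR1.
by rewrite poweRyr// invr_neq0// gt_eqF.
Qed.

Lemma Lnorm_infty_le1 d (T : measurableType d) (m : probability T R) (f : T -> R) (s : R) :
  0 < s -> mfunT f -> ('N[m]_(+oo%E)[EFin \o f] <= 1)%E ->
  (\int[m]_x (`|f x| `^ s)%:E <= 1)%E.
Proof.
move=> s0 mf; rewrite unlock /= probability_setT lte01 => /ess_sup_inf.ess_supP h.
have mp : mfunT (fun x => (`|f x| `^ s)%:E).
  apply/measurable_EFinP; apply: (measurableT_comp (measurable_powR s)).
  by meas.
apply: (@le_trans _ _ (\int[m]_x (cst 1%E x))%E); last by rewrite integral_cst//= mul1e probability_setT.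
apply: ae_ge0_le_integral => //.
apply: filterS h => x /= h _; rewrite lee_fin in h; rewrite lee_fin.
have := ge0_ler_powR (ltW s0) (_ : `|f x| \in Num.nneg) (_ : 1 \in Num.nneg) h.
by rewrite !nnegrE normr_ge0 ler01 powR1 => /(_ isT isT).
Qed.

(* Lyapunov's inequality for the exponents 4 and s. *)
Lemma moment4_le d (T : measurableType d) (m : probability T R) (f : T -> R) (s : R) :
  4 <= s -> mfunT f -> (\int[m]_x (`|f x| `^ s)%:E <= 1)%E ->
  (\int[m]_x (`|f x| `^ 4)%:E <= 1)%E.
Proof.
rewrite le_eqVlt => /orP[/eqP<-//|s4] mf h; have s0 : 0 < s by lra.
have mp c : mfunT (fun x => (`|f x| `^ c)%:E).
  apply/measurable_EFinP; apply: (measurableT_comp (measurable_powR c)).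
  by meas.
have pp c x : (0 <= (`|f x| `^ c)%:E)%E by nneg.
have t0 : 0 <= 4 / s by nneg.
have t1 : 0 <= 1 - 4 / s by rewrite subr_ge0 ler_pdivrMr// mul1r ltW.
have e := ge0_integral_linear m t0 t1 (mp s) (measurable_cst 1%E) (pp s) (fun _ => lee01).
apply: (@le_trans _ _ ((4 / s)%:E * \int[m]_x (`|f x| `^ s)%:E + (1 - 4 / s)%:E * \int[m]_x (cst 1%E x))%E).
  rewrite -e; apply: ge0_le_integral => //.
  - by apply: emeasurable_funD; [apply: measurable_funeM; exact: mp|exact: measurable_cst].
  - move=> x _; rewrite mule1 -EFinM -EFinD lee_fin; apply: powR_interp => //.
    by lra.
have -> : (\int[m]_x (cst 1%E x) = 1 :> \bar R)%E by rewrite integral_cst//= mul1e probability_setT.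
apply: le_trans (leeD2r _ (lee_wpmul2l _ h)) _; rewrite ?lee_fin//.
by lra.
Qed.

Lemma burn_in_ge n (p : \bar R) (r : R) : burn_in_bound n p r <= (burn_in n p r)%:R.
Proof.
rewrite /burn_in; set b := burn_in_bound n p r.
by apply: le_trans (ceil_ge b) _; rewrite natr_absz ler_int ler_norm.
Qed.

Lemma burn_in_suffices n (r q K b : R) (N : nat) : (0 < n)%N -> 1 <= r -> 2 <= q -> 0 <= K ->
  b <= N%:R -> b = 451 / 100 * 10 ^+ 15 * n%:R ^+ 2 * r ^+ 2 * (q / 2 * K) ->
  r ^+ n * q * expR (- (5 * K)) <= 32^-1 ->
  r ^+ n * q * expR (- (N%:R * (2 / q / (2 * (392 * 10 ^+ 12 * (n%:R * r) ^+ 2))))) <= 32^-1.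
Proof.
move=> n0 r1 q2 K0 bN bE; apply: le_trans; apply: ler_wpM2l.
  by rewrite mulr_ge0 ?exprn_ge0 ?(le_trans _ q2)// (le_trans _ r1).
rewrite ler_expR lerN2.
have q0 : 0 < q by lra.
have r0 : 0 < r by lra.
have n0' : 0 < n%:R :> R by rewrite ltr0n.
have e15 : 10 ^+ 15 = 1000 * 10 ^+ 12 :> R.
  rewrite (exprD 10 3 12); congr (_ * _); rewrite !exprS expr0; lra.
have t0 : 0 < 10 ^+ 12 :> R by nneg.
move: bE t0; rewrite e15; set t := 10 ^+ 12 => bE t0.
set Y := 2 / q / _; have Y0 : 0 <= Y.
  apply: divr_ge0; first by apply: divr_ge0; [exact: ler0n|exact: ltW].
  apply: mulr_ge0; first exact: ler0n.
  apply: mulr_ge0; last exact: sqr_ge0.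
  by apply: mulr_ge0; [exact: ler0n|exact: ltW].
apply: le_trans (ler_wpM2r Y0 bN).
(* 4.51 * 10^15 divided by 2 * 392 * 10^12 leaves 4510 / 784, which exceeds 5. *)
have -> : b * Y = 4510 / 784 * K by rewrite bE /Y; field; rewrite !gt_eqF.
lra.
Qed.

Lemma expR_ln_power n (r : R) : 0 < r -> expR (n%:R * ln r) = r ^+ n.
Proof. by move=> r0; rewrite expRM_natl lnK. Qed.

(** The exponential of - (n ln r + ln (32 q)) is exactly 1 / (32 q r^n), and the factor 5 only makes
    the exponential smaller. *)
Lemma burn_in_small n (r q : R) : 1 <= r -> 2 <= q ->
  r ^+ n * q * expR (- (5 * (n%:R * ln r + ln (32 * q)))) <= 32^-1.
Proof.
move=> r1 q2; have r0 : 0 < r by lra.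
have q0 : 0 < q by lra.
have l0 : 0 <= ln r by exact: ln_ge0.
have q1 : 1 <= 32 * q by lra.
have l1 : 0 <= ln (32 * q) by exact: ln_ge0.
have nl : 0 <= n%:R * ln r by exact: mulr_ge0.
have h : expR (- (5 * (n%:R * ln r + ln (32 * q)))) <= (r ^+ n * (32 * q))^-1.
  rewrite -(@expR_ln_power n r r0) -[in leRHS](lnK (_ : 32 * q \in Num.pos)) ?posrE ?mulr_gt0//.
  by rewrite -expRD -expRN ler_expR; lra.
have rn : 0 < r ^+ n by exact: exprn_gt0.
apply: le_trans (ler_wpM2l _ h) _; first by nneg.
by apply: eqW; field; rewrite !gt_eqF.
Qed.

(** Here q = 2. As 5 * 4.16 >= 20 and e^20 >= 11^2 = 121, the left side is at most 2 / 121. *)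
Lemma burn_in_small4 n (r : R) : 1 <= r ->
  r ^+ n * 2 * expR (- (5 * (n%:R * ln r + 416 / 100))) <= 32^-1.
Proof.
move=> r1; have r0 : 0 < r by lra.
have l0 : 0 <= ln r by exact: ln_ge0.
have nl : 0 <= n%:R * ln r by exact: mulr_ge0.
have e20 : 121 <= expR (20 : R).
  have h : 11 <= expR (10 : R) by have := expR_ge1Dx (10 : R); lra.
  have -> : (20 : R) = 10 + 10 by lra.
  by rewrite expRD; have := ler_pM (ler0n R 11) (ler0n R 11) h h; lra.
have rn : 0 < r ^+ n by exact: exprn_gt0.
have h : expR (- (5 * (n%:R * ln r + 416 / 100))) <= (r ^+ n * 121)^-1.
  apply: (@le_trans _ _ (expR (- (n%:R * ln r + 20)))); first by rewrite ler_expR; lra.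
  rewrite expRN expRD (@expR_ln_power n r r0) lef_pV2 ?posrE ?mulr_gt0 ?expR_gt0//.
  by rewrite ler_pM2l.
apply: le_trans (ler_wpM2l _ h) _; first by nneg.
have -> : r ^+ n * 2 * (r ^+ n * 121)^-1 = 2 / 121 by field; rewrite gt_eqF.
lra.
Qed.

(* The exponent p' = min (p, 4) and q = p' / (p' - 2). *)
Lemma moment_and_burn_in n (r : R) (p : \bar R) (m : probability 'rV[R]_n R) (f : 'rV[R]_n -> R) :
  (0 < n)%N -> 1 <= r -> (2%:E < p)%E -> mfunT f ->
  ('N[m]_p[EFin \o f] <= 1)%E ->
  exists s q, [/\ 2 < s, 2 <= q, q * (s - 2) = s, (\int[m]_x (`|f x| `^ s)%:E <= 1)%E &
    r ^+ n * q * expR (- ((burn_in n p r)%:R * (2 / q / (2 * (392 * 10 ^+ 12 * (n%:R * r) ^+ 2))))) <= 32^-1].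
Proof.
move=> n0 r1 p2 mf Nf; have bN := burn_in_ge n p r.
have l0 : 0 <= ln r by exact: ln_ge0.
have nl : 0 <= n%:R * ln r by exact: mulr_ge0.
have case4 : ~~ (p < 4%:E)%E -> (\int[m]_x (`|f x| `^ 4)%:E <= 1)%E ->
    exists s q, [/\ 2 < s, 2 <= q, q * (s - 2) = s, (\int[m]_x (`|f x| `^ s)%:E <= 1)%E &
      r ^+ n * q * expR (- ((burn_in n p r)%:R * (2 / q / (2 * (392 * 10 ^+ 12 * (n%:R * r) ^+ 2))))) <= 32^-1].
  move=> p4 f4; exists 4, 2; split => //; [lra|lra|].
  apply: (@burn_in_suffices n r 2 (n%:R * ln r + 416 / 100) _ _ n0 r1 (lexx 2) _ bN).
  - lra.
  - by rewrite /burn_in_bound (negbTE p4) divff ?mul1r.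
  - exact: burn_in_small4.
case: p p2 Nf bN case4 => [s| |//] p2 Nf bN case4.
  rewrite lte_fin in p2; have s0 : 0 < s by lra.
  have fs := Lnorm_le1 s0 Nf.
  have [s4|s4] := boolP (s%:E < 4%:E)%E; last first.
    by apply: (case4 s4); apply: (moment4_le _ mf fs); move: s4; rewrite lte_fin -leNgt.
  rewrite lte_fin in s4; have s2 : 0 < s - 2 by lra.
  exists s, (s / (s - 2)); split => //.
  - by rewrite ler_pdivlMr//; lra.
  - by rewrite divfK// gt_eqF.
  have q2 : 2 <= s / (s - 2) by rewrite ler_pdivlMr//; lra.
  apply: (@burn_in_suffices n r _ (n%:R * ln r + ln (32 * (s / (s - 2)))) _ _ n0 r1 q2 _ bN).
  - by rewrite addr_ge0// ln_ge0//; lra.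
  - rewrite /burn_in_bound lte_fin s4/= [32 * (s / (s - 2))]mulrA; congr (_ * (_ * _)).
    by field; rewrite gt_eqF.
  - exact: burn_in_small.
apply: case4; first by nneg.
by apply: Lnorm_infty_le1.
Qed.

(** 9/2 * 392 = 42^2, so the left side is 42 * 10^6 x / sqrt y. *)
Lemma error_constant (x y : R) : 0 <= x -> 0 < y ->
  Num.sqrt (9 / 2 * (392 * 10 ^+ 12 * x ^+ 2) / y) <=
  95 / 10 * 10 ^+ 7 * (x / Num.sqrt y).
Proof.
move=> x0 y0; have s0 : 0 < Num.sqrt y by rewrite sqrtr_gt0.
have t0 : 0 < 10 ^+ 6 :> R by nneg.
have e12 : 10 ^+ 12 = (10 ^+ 6) ^+ 2 :> R by rewrite -exprM.
have e7 : 10 ^+ 7 = 10 * 10 ^+ 6 :> R by rewrite exprS.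
rewrite e12 e7; move: t0; set t := 10 ^+ 6 => t0.
have xs : 0 <= x / Num.sqrt y by nneg.
have -> : 9 / 2 * (392 * t ^+ 2 * x ^+ 2) / y = 1764 * (t * (x / Num.sqrt y)) ^+ 2.
  rewrite -{1}(sqr_sqrtr (ltW y0)); field; by rewrite gt_eqF.
have tx : 0 <= t * (x / Num.sqrt y) by nneg.
rewrite (_ : 1764 * _ = (42 * (t * (x / Num.sqrt y))) ^+ 2); last by ring.
rewrite sqrtr_sqr ger0_norm ?mulr_ge0//.
move: tx; set z := t * _ => tx.
have -> : 95 / 10 * (10 * t) * (x / Num.sqrt y) = 95 * z by rewrite /z; field; rewrite gt_eqF.
lra.
Qed.

End constants.

Theorem theorem4p12 (R : realType) (d : nat) (d_gt0 : (0 < d)%N)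
    (r : R) (r_ge1 : 1 <= r) (p : \bar R) (p_gt2 : (2%:E < p)%E)
    (dO : measure_display) (Om : set 'rV[R]_d -> measurableType dO)
    (P : forall A, probability (Om A) R)
    (X : forall A, nat -> {RV (P A) >-> 'rV[R]_d})
    (X_chain : forall A, bodies r A ->
      lazy_har_chain A (uniform (vol d) 0 (eball 1)) (X A))
    (n : nat) (n_gt0 : (0 < n)%N) :
  (ereal_sup [set har_error (P fA.2) (X fA.2) n (burn_in d p r) fA.1 fA.2
             | fA in integrands p r]
   <= (95 / 10 * 10 ^+ 7 * (d%:R * r / Num.sqrt n%:R)
       + 64 / 10 * 10 ^+ 15 * (d%:R ^+ 2 * r ^+ 2 / n%:R))%:E)%E.
Proof.
apply: ge_ereal_sup => _ [[f A] [/= mf bA Nf] <-].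
have [s [q [s2 q2 sq fs burn]]] := moment_and_burn_in d_gt0 r_ge1 p_gt2 mf Nf.
have h := har_mse_le d_gt0 r_ge1 bA (X_chain A bA) mf s2 q2 sq fs n_gt0 burn.
set b := 9 / 2 * _ / _ in h.
have x0 : 0 <= d%:R * r by rewrite mulr_ge0// (le_trans _ r_ge1).
have n0 : 0 < n%:R :> R by rewrite ltr0n.
have hc := error_constant x0 n0.
have b0 : 0 <= b.
  apply: divr_ge0; last exact: ler0n.
  apply: mulr_ge0; first by apply: divr_ge0; exact: ler0n.
  apply: mulr_ge0; last exact: sqr_ge0.
  by apply: mulr_ge0; [exact: ler0n|apply: exprn_ge0; exact: ler0n].
apply: (@le_trans _ _ (Num.sqrt b)%:E).
  rewrite /har_error unlock -powR12_sqrt// -poweR_EFin.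
  have h0 : (0 <= \int[P A]_w (`|har_mean n (burn_in d p r) f (X A) w - mean f A| ^+ 2)%:E)%E.
    by apply: integral_ge0 => w _; rewrite lee_fin sqr_ge0.
  apply: gt0_ler_poweR; last exact: h.
  - by rewrite invr_ge0 ler0n.
  - by rewrite in_itv/= h0 leey.
  - by rewrite in_itv/= lee_fin b0 leey.
(* The root mean square error lies below the first summand, and the second one is nonnegative. *)
rewrite lee_fin; apply: le_trans hc _; rewrite lerDl.
apply: mulr_ge0.
  by apply: mulr_ge0; [apply: divr_ge0; exact: ler0n|apply: exprn_ge0; exact: ler0n].
by rewrite divr_ge0// mulr_ge0 ?sqr_ge0.
Qed.
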